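(* Let $\mu>0$ and suppose $\varphi_0\in C^\infty([0,1])$ satisfies $\varphi_0(0)=0$ and $|\varphi_0(r)|\le\pi$ for all $r\in[0,1]$. Then there is a unique global smooth solution $(v,w,\varphi)$ (together with pressures $Q,R$) on $[0,\infty)$ of the system $$\begin{cases} v_t+vv_r-\mu\big(v_{rr}+\frac{v_r}{r}-\frac{v}{r^2}\big)+Q_r=-\big(\varphi_{rr}+\frac{\varphi_r}{r}-\frac{\sin(2\varphi)}{2r^2}\big)\varphi_r, & r\in[0,1],\\ w_t+ww_z-\mu w_{zz}+R_z=0, & z\in[0,1],\\ \frac1r(rv)_r+w_z=0, & (r,z)\in[0,1]\times[0,1],\\ \varphi_t+v\varphi_r=\varphi_{rr}+\frac{\varphi_r}{r}-\frac{\sin(2\varphi)}{2r^2}, & r\in[0,1], \end{cases}$$ for unknowns $v=v(r,t)$, $w=w(z,t)$, $\varphi=\varphi(r,t)$, $Q=Q(r,t)$, $R=R(z,t)$, with initial conditions $v(r,0)=r$, $w(z,0)=-2z$, $\varphi(r,0)=\varphi_0(r)$ and boundary conditions $v(0,t)=0$, $v(1,t)=1$, $w(0,t)=0$, $w(1,t)=-2$, $\varphi(0,t)=0$, $\varphi(1,t)=\varphi_0(1)$. *)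

(* Defs.v *)
From Stdlib Require Import Reals List.
From Coquelicot Require Import Coquelicot.
Open Scope R_scope.

Definition dx (f : R -> R -> R) : R -> R -> R :=
  fun x y => Derive (fun a => f a y) x.
Definition dy (f : R -> R -> R) : R -> R -> R :=
  fun x y => Derive (fun b => f x b) y.

Fixpoint pder (l : list bool) (f : R -> R -> R) : R -> R -> R :=
  match l with
  | nil => f
  | b :: l' => if b then dx (pder l' f) else dy (pder l' f)
  end.

Definition smooth2_on (U : R -> R -> Prop) (f : R -> R -> R) : Prop :=
  forall (l : list bool) (x y : R), U x y ->
    continuous (fun p : R * R => pder l f (fst p) (snd p)) (x, y) /\
    ex_derive (fun a => pder l f a y) x /\
    ex_derive (fun b => pder l f x b) y.

(* f is smooth on [0,1] x (0,oo), up to the spatial boundary x = 0, x = 1: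
   it is the restriction of a function smooth on the open strip R x (0,oo). *)
Definition smooth_pos (f : R -> R -> R) : Prop :=
  exists g : R -> R -> R,
    smooth2_on (fun _ t => 0 < t) g /\
    forall x t, 0 <= x <= 1 -> 0 < t -> f x t = g x t.

Definition cont_closed (f : R -> R -> R) : Prop :=
  forall x t, 0 <= x <= 1 -> 0 <= t ->
    filterlim (fun p : R * R => f (fst p) (snd p))
      (within (fun p : R * R => 0 <= fst p <= 1 /\ 0 <= snd p) (locally (x, t)))
      (locally (f x t)).

Definition smooth_01 (f : R -> R) : Prop :=
  exists g : R -> R, (forall (n : nat) (x : R), ex_derive_n g n x) /\
    forall x, 0 <= x <= 1 -> f x = g x.

Definition is_solution (mu : R) (phi0 : R -> R)
  (v w phi Q Rp : R -> R -> R) : Prop :=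
  smooth_pos v /\ smooth_pos w /\ smooth_pos phi /\ smooth_pos Q /\ smooth_pos Rp /\
  cont_closed v /\ cont_closed w /\ cont_closed phi /\
  (forall r t, 0 < r < 1 -> 0 < t ->
     dy v r t + v r t * dx v r t
     - mu * (dx (dx v) r t + dx v r t / r - v r t / r ^ 2) + dx Q r t
     = - (dx (dx phi) r t + dx phi r t / r - sin (2 * phi r t) / (2 * r ^ 2))
         * dx phi r t) /\
  (forall z t, 0 < z < 1 -> 0 < t ->
     dy w z t + w z t * dx w z t - mu * dx (dx w) z t + dx Rp z t = 0) /\
  (forall r z t, 0 < r < 1 -> 0 < z < 1 -> 0 < t ->
     / r * dx (fun r' t' => r' * v r' t') r t + dx w z t = 0) /\
  (forall r t, 0 < r < 1 -> 0 < t ->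
     dy phi r t + v r t * dx phi r t
     = dx (dx phi) r t + dx phi r t / r - sin (2 * phi r t) / (2 * r ^ 2)) /\
  (forall r, 0 <= r <= 1 -> v r 0 = r /\ phi r 0 = phi0 r) /\
  (forall z, 0 <= z <= 1 -> w z 0 = - 2 * z) /\
  (forall t, 0 <= t ->
     v 0 t = 0 /\ v 1 t = 1 /\ w 0 t = 0 /\ w 1 t = -2 /\
     phi 0 t = 0 /\ phi 1 t = phi0 1).

(* Main.v *)
From Stdlib Require Import Reals ZArith Lra Lia List ClassicalEpsilon.
From Coquelicot Require Import Coquelicot.
Require Import Defs.
Open Scope R_scope.

(* The divergence condition separates the variables, so w is linear and the boundary values force v = r, w = -2z;
   the first two equations then merely define Q and R. With phi = r u, the last equation becomes the heat-type equation
   u_t = u_rr + (3/r - r) u_r - u + G(r,u) with G smooth. A Liouville substitution turns its linear part into the zonal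
   Laplacian of the sphere S^4, plus a bounded potential, with Dirichlet data on the equator; that semigroup is built
   from odd polynomial eigenfunctions, with smoothing bounds by Bernstein's method, and the nonlinear problem is solved
   by Picard iteration. A perturbed stationary harmonic map is a supersolution for data bounded by PI and excludes
   blow-up. Time derivatives come from scaling t in Duhamel's formula, space derivatives from integrating the equation
   in r, and the solution is continued smoothly past r = 1 by Seeley's series. Uniqueness of phi is the maximum
   principle, the singular term being monotone near the axis, where phi is small. *)

(** * Calculus preliminaries *)

(** Writing [phi = r u] turns the equivariant operator of dimension 2 into the radial Laplacian of
    dimension 4. Conjugating its 3/r into 3 k cot(kr), k = PI/2, replaces Bessel functions by
    polynomials in x = cos(kr): r = 0 is the pole, r = 1 the equator x = 0, and the Dirichlet
    condition becomes oddness in x. All estimates on the semigroup are proved in the sup norm for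
    finite sums of eigenfunctions, with constants that do not see the sum, and reach continuous data
    by density. The datum and the boundary value are compatible only to order zero, so time
    derivatives may blow up as t -> 0. The operator t d/dt does not see this, which is why time is
    scaled: y(lt) is expanded at l = 1, uniformly down to t = 0. Two requirements pull the barrier
    apart. It must equal PI away from the axis, where the datum may reach PI, and it must be linear
    in r at the axis, uniformly in time. The logarithm pushes the harmonic map up to PI at a finite
    radius; the errors that this causes are absorbed by the gain from the outward drift v = r. *)

Section Continuity.
Context {U : UniformSpace}.
Implicit Types (f g : U -> R) (u : U).

Lemma cR_plus f g u : continuous f u -> continuous g u -> continuous (fun x => f x + g x) u.
Proof. intros A B. exact (continuous_plus (V:=R_NormedModule) f g u A B). Qed.

Lemma cR_minus f g u : continuous f u -> continuous g u -> continuous (fun x => f x - g x) u.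
Proof. intros A B. exact (continuous_minus (V:=R_NormedModule) f g u A B). Qed.

Lemma cR_opp f u : continuous f u -> continuous (fun x => - f x) u.
Proof. intros A. exact (continuous_opp (V:=R_NormedModule) f u A). Qed.

Lemma cR_mult f g u : continuous f u -> continuous g u -> continuous (fun x => f x * g x) u.
Proof. intros A B. exact (continuous_mult (K:=R_AbsRing) f g u A B). Qed.

Lemma cR_pow f n u : continuous f u -> continuous (fun x => f x ^ n) u.
Proof.
intros A; induction n as [|n IH]; simpl.
- apply continuous_const.
- apply cR_mult; auto.
Qed.

Lemma cR_comp (h : R -> R) f u : continuous f u -> continuous h (f u) -> continuous (fun x => h (f x)) u.
Proof. intros A B. apply (continuous_comp f h u A B). Qed.

Lemma cR_comp_pt (h : R -> R) f u : continuous f u -> continuity_pt h (f u) -> continuous (fun x => h (f x)) u.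
Proof. intros A B. apply cR_comp; auto. apply continuity_pt_filterlim. exact B. Qed.

Lemma cR_inv f u : continuous f u -> f u <> 0 -> continuous (fun x => / f x) u.
Proof. intros A B. apply cR_comp; auto. apply continuous_Rinv; auto. Qed.

Lemma cR_div f g u : continuous f u -> continuous g u -> g u <> 0 -> continuous (fun x => f x / g x) u.
Proof. intros A B C. unfold Rdiv. apply cR_mult; auto. apply cR_inv; auto. Qed.

Lemma cR_cos f u : continuous f u -> continuous (fun x => cos (f x)) u.
Proof. intros A. apply cR_comp_pt; auto. apply continuity_cos. Qed.

Lemma cR_sin f u : continuous f u -> continuous (fun x => sin (f x)) u.
Proof. intros A. apply cR_comp_pt; auto. apply continuity_sin. Qed.

Lemma cR_exp f u : continuous f u -> continuous (fun x => exp (f x)) u.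
Proof. intros A. apply cR_comp_pt; auto. apply derivable_continuous_pt, derivable_pt_exp. Qed.

Lemma cR_abs f u : continuous f u -> continuous (fun x => Rabs (f x)) u.
Proof. intros A. apply cR_comp_pt; auto. apply Rcontinuity_abs. Qed.

Lemma cR_max c f u : continuous f u -> continuous (fun x => Rmax c (f x)) u.
Proof.
intros A. apply continuous_ext with (fun x => (c + f x + Rabs (c - f x)) / 2).
- intros x. unfold Rmax, Rabs. destruct (Rle_dec c (f x)), (Rcase_abs (c - f x)); lra.
- unfold Rdiv. apply cR_mult; [|apply continuous_const].
  apply cR_plus; [apply cR_plus; auto; apply continuous_const|].
  apply cR_abs, cR_minus; auto; apply continuous_const.
Qed.

Lemma cR_min c f u : continuous f u -> continuous (fun x => Rmin c (f x)) u.
Proof.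
intros A. apply continuous_ext with (fun x => - Rmax (-c) (- f x)).
- intros x. unfold Rmax, Rmin. destruct (Rle_dec c (f x)), (Rle_dec (-c) (-f x)); lra.
- apply cR_opp, cR_max, cR_opp, A.
Qed.

End Continuity.

Lemma c_fst (A B : UniformSpace) (p : prod_UniformSpace A B) : continuous (fun q : prod_UniformSpace A B => fst q) p.
Proof. destruct p. apply continuous_fst. Qed.
Lemma c_snd (A B : UniformSpace) (p : prod_UniformSpace A B) : continuous (fun q : prod_UniformSpace A B => snd q) p.
Proof. destruct p. apply continuous_snd. Qed.

Lemma c_fst' (U A B : UniformSpace) (h : U -> prod_UniformSpace A B) u : continuous h u -> continuous (fun q => fst (h q)) u.
Proof. intros H. apply (continuous_comp h (fun q => fst q) u H). apply c_fst. Qed.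
Lemma c_snd' (U A B : UniformSpace) (h : U -> prod_UniformSpace A B) u : continuous h u -> continuous (fun q => snd (h q)) u.
Proof. intros H. apply (continuous_comp h (fun q => snd q) u H). apply c_snd. Qed.

Lemma exp_le x y : x <= y -> exp x <= exp y.
Proof. intros [H| ->]; [left; apply exp_increasing; auto|right; auto]. Qed.

(** * Continuity in several variables and compactness of rectangles *)

Definition cont1 (f : R -> R) := forall x, continuous f x.
Definition cont2 (f : R -> R -> R) :=
  forall p : R * R, continuous (fun q : R * R => f (fst q) (snd q)) p.
Definition cont3 (f : R -> R -> R -> R) :=
  forall p : (R * R) * R, continuous (fun q : (R * R) * R => f (fst (fst q)) (snd (fst q)) (snd q)) p.

Lemma cont1_at {U : UniformSpace} f (a : U -> R) u :
  cont1 f -> continuous a u -> continuous (fun x => f (a x)) u.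
Proof. intros H A. apply cR_comp; auto. Qed.

Lemma cont2_at {U : UniformSpace} f (a b : U -> R) u :
  cont2 f -> continuous a u -> continuous b u -> continuous (fun x => f (a x) (b x)) u.
Proof. intros H A B. apply (continuous_comp_2 a b f u A B). apply (H (a u, b u)). Qed.

Lemma cont3_at {U : UniformSpace} f (a b c : U -> R) u :
  cont3 f -> continuous a u -> continuous b u -> continuous c u ->
  continuous (fun x => f (a x) (b x) (c x)) u.
Proof.
intros H A B C.
apply (continuous_comp_2 (fun x => (a x, b x)) c (fun p s => f (fst p) (snd p) s) u); auto.
apply filterlim_locally. intros eps.
  apply filterlim_locally with (eps := eps) in A. apply filterlim_locally with (eps := eps) in B.
  generalize (filter_and _ _ A B). apply filter_imp. intros x [P Q]. split; assumption.
Qed.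

(** Proves continuity by the shape of the body; the continuity of a named function is read off a
    [cont1], [cont2] or [cont3] hypothesis in the context. *)
Ltac ct1 := lazymatch goal with
  | |- continuous (fun _ => ?c) _ => apply continuous_const
  | |- continuous (fun x => x) _ => apply continuous_id
  | |- continuous (fun x => @?a x + @?b x) _ => apply (cR_plus a b)
  | |- continuous (fun x => @?a x - @?b x) _ => apply (cR_minus a b)
  | |- continuous (fun x => @?a x * @?b x) _ => apply (cR_mult a b)
  | |- continuous (fun x => - @?a x) _ => apply (cR_opp a)
  | |- continuous (fun x => @?a x ^ ?n) _ => apply (cR_pow a n)
  | |- continuous (fun x => cos (@?a x)) _ => apply (cR_cos a)
  | |- continuous (fun x => sin (@?a x)) _ => apply (cR_sin a)
  | |- continuous (fun x => exp (@?a x)) _ => apply (cR_exp a)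
  | |- continuous (fun x => Rabs (@?a x)) _ => apply (cR_abs a)
  | |- continuous (fun x => Rmax ?c (@?a x)) _ => apply (cR_max c a)
  | |- continuous (fun x => Rmin ?c (@?a x)) _ => apply (cR_min c a)
  | |- continuous (fun x => fst x) _ => apply c_fst
  | |- continuous (fun x => snd x) _ => apply c_snd
  | |- continuous (fun x => fst (@?a x)) _ => apply (c_fst' _ _ _ a)
  | |- continuous (fun x => snd (@?a x)) _ => apply (c_snd' _ _ _ a)
  | H : cont3 ?f |- continuous (fun x => ?f (@?a x) (@?b x) (@?c x)) _ => apply (cont3_at f a b c _ H)
  | H : cont2 ?f |- continuous (fun x => ?f (@?a x) (@?b x)) _ => apply (cont2_at f a b _ H)
  | H : cont1 ?f |- continuous (fun x => ?f (@?a x)) _ => apply (cont1_at f a _ H)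
  | H : cont1 ?f |- continuous ?f _ => apply H
  end.
Ltac ct := intros; repeat ct1; auto.

Lemma continuous_eps (f : R -> R) x : continuous f x <->
  forall eps, 0 < eps -> exists d, 0 < d /\ forall y, Rabs (y - x) < d -> Rabs (f y - f x) < eps.
Proof.
split.
- intros H eps He. apply filterlim_locally with (eps := mkposreal eps He) in H.
  destruct H as [d Hd]. exists d; split; [apply d|]. intros y Hy. apply (Hd y). exact Hy.
- intros H. apply filterlim_locally. intros eps. destruct (H eps (cond_pos eps)) as [d [Hd H1]].
  exists (mkposreal d Hd). intros y Hy. apply H1. exact Hy.
Qed.

Lemma cont2_eps f : cont2 f <->
  forall r t eps, 0 < eps -> exists d, 0 < d /\
    forall r' t', Rabs (r' - r) < d -> Rabs (t' - t) < d -> Rabs (f r' t' - f r t) < eps.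
Proof.
split.
- intros H r t eps He. specialize (H (r, t)).
  apply filterlim_locally with (eps := mkposreal eps He) in H.
  destruct H as [d Hd]. exists d; split; [apply d|]. intros r' t' A B.
  apply (Hd (r', t')). split; assumption.
- intros H [r t]. apply filterlim_locally. intros eps.
  destruct (H r t eps (cond_pos eps)) as [d [Hd H1]].
  exists (mkposreal d Hd). intros [r' t'] [A B]. apply H1; assumption.
Qed.

Lemma cont2_pt f r t : cont2 f -> continuity_2d_pt f r t.
Proof. intros H. apply continuity_2d_pt_filterlim. apply (H (r, t)). Qed.

Lemma cont2_unif f a b c d eps : cont2 f -> 0 < eps ->
  exists dl, 0 < dl /\ forall x y u v, a <= x <= b -> c <= y <= d -> a <= u <= b -> c <= v <= d ->
   Rabs (u - x) < dl -> Rabs (v - y) < dl -> Rabs (f u v - f x y) < eps.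
Proof.
intros H He.
destruct (uniform_continuity_2d f a b c d (fun x y _ _ => cont2_pt f x y H) (mkposreal eps He)) as [dl Hd].
exists dl. split; [apply dl|]. exact Hd.
Qed.

(* Walking from a corner in n steps shorter than the modulus for [eps = 1]. *)
Lemma cont2_bounded f a b c d : cont2 f ->
  exists M, 0 < M /\ forall x y, a <= x <= b -> c <= y <= d -> Rabs (f x y) <= M.
Proof.
intros H. destruct (cont2_unif f a b c d 1 H Rlt_0_1) as [dl [Hd Hu]].
set (n := Z.to_nat (up ((Rabs (b - a) + Rabs (d - c)) / dl))).
assert (Hn : (Rabs (b - a) + Rabs (d - c)) < INR n * dl).
{ assert (P : 0 <= (Rabs (b - a) + Rabs (d - c)) / dl).
  { apply Rdiv_le_0_compat; auto. apply Rplus_le_le_0_compat; apply Rabs_pos. }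
  destruct (archimed ((Rabs (b - a) + Rabs (d - c)) / dl)) as [A _].
  unfold n. rewrite INR_IZR_INZ, Z2Nat.id.
  - apply Rmult_lt_compat_r with (r := dl) in A; auto.
    unfold Rdiv in A. rewrite Rmult_assoc, Rinv_l, Rmult_1_r in A; lra.
  - apply le_IZR. apply Rlt_le in A. lra. }
exists (Rabs (f a c) + INR n + 1). split.
{ pose proof (Rabs_pos (f a c)). pose proof (pos_INR n). lra. }
intros x y Hx Hy.
assert (K : forall k : nat, (k <= n)%nat ->
  Rabs (f (a + INR k / INR n * (x - a)) (c + INR k / INR n * (y - c))) <= Rabs (f a c) + INR k).
{ assert (Hn0 : 0 < INR n).
  { destruct (Rle_lt_dec (INR n) 0); auto.
    pose proof (Rabs_pos (b - a)). pose proof (Rabs_pos (d - c)). nra. }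
  assert (Q : forall z lo hi k, (k <= n)%nat -> lo <= z <= hi -> lo <= lo + INR k / INR n * (z - lo) <= hi).
  { intros z lo hi k Hk Hz. assert (0 <= INR k / INR n <= 1).
    { split. apply Rdiv_le_0_compat; auto. apply pos_INR.
      apply Rmult_le_reg_r with (INR n); auto. unfold Rdiv. rewrite Rmult_assoc, Rinv_l by lra.
      apply le_INR in Hk. lra. }
    nra. }
  assert (St : forall z lo hi k, lo <= z <= hi -> Rabs (hi - lo) < INR n * dl ->
     Rabs ((lo + INR (S k) / INR n * (z - lo)) - (lo + INR k / INR n * (z - lo))) < dl).
  { intros z lo hi k Hz Hh. rewrite S_INR.
    replace (_ - _) with ((z - lo) / INR n) by (field; lra).
    rewrite Rabs_pos_eq by (apply Rdiv_le_0_compat; lra).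
    apply Rmult_lt_reg_r with (INR n); auto. unfold Rdiv. rewrite Rmult_assoc, Rinv_l by lra.
    rewrite Rabs_pos_eq in Hh; lra. }
  pose proof (Rabs_pos (b - a)). pose proof (Rabs_pos (d - c)).
  intros k; induction k as [|k IH]; intros Hk.
  - replace (a + _) with a by (simpl; field; lra). replace (c + _) with c by (simpl; field; lra). simpl; lra.
  - rewrite S_INR at 3.
    assert (E : Rabs (f (a + INR (S k) / INR n * (x - a)) (c + INR (S k) / INR n * (y - c))
        - f (a + INR k / INR n * (x - a)) (c + INR k / INR n * (y - c))) < 1).
    { apply Hu; try (apply Q; auto; lia); try (apply St with b; auto; lra); apply St with d; auto; lra. }
    specialize (IH ltac:(lia)). revert E IH. unfold Rabs. repeat destruct Rcase_abs; lra. }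
destruct n as [|n'].
- simpl in Hn. pose proof (Rabs_pos (b - a)). pose proof (Rabs_pos (d - c)). lra.
- specialize (K (S n') (le_n _)).
  assert (INR (S n') <> 0) by (apply not_0_INR; lia).
  replace (a + _) with x in K by (field; auto). replace (c + _) with y in K by (field; auto). lra.
Qed.

(** If the supremum m were not attained, 1/(m - f), made global by clamping into the rectangle,
    would be continuous and hence bounded, and m could be lowered. *)
Lemma cont2_max f a b c d : a <= b -> c <= d -> cont2 f ->
  exists x y, a <= x <= b /\ c <= y <= d /\ forall u v, a <= u <= b -> c <= v <= d -> f u v <= f x y.
Proof.
intros Hab Hcd H. destruct (cont2_bounded f a b c d H) as [M [HM HB]].
set (E := fun z => exists x y, a <= x <= b /\ c <= y <= d /\ z = f x y).
destruct (completeness E) as [m [Hm1 Hm2]].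
- exists M. intros z [x [y [Hx [Hy ->]]]]. specialize (HB x y Hx Hy). apply Rabs_le_between in HB. lra.
- exists (f a c). exists a, c. repeat split; lra.
- apply NNPP. intros N.
  assert (L : forall x y, a <= x <= b -> c <= y <= d -> f x y < m).
  { intros x y Hx Hy. destruct (Rle_lt_or_eq_dec (f x y) m) as [|e]; auto.
    - apply Hm1. exists x, y. auto.
    - exfalso. apply N. exists x, y. repeat split; try lra. intros u v Hu Hv.
      rewrite e. apply Hm1. exists u, v. auto. }
  set (pa := fun x => Rmax a (Rmin b x)). set (pc := fun x => Rmax c (Rmin d x)).
  assert (Pa : forall x, a <= pa x <= b) by (intros x; unfold pa, Rmax, Rmin; repeat destruct Rle_dec; lra).
  assert (Pc : forall x, c <= pc x <= d) by (intros x; unfold pc, Rmax, Rmin; repeat destruct Rle_dec; lra).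
  assert (C : cont2 (fun x y => / (m - f (pa x) (pc y)))).
  { intros p. apply cR_inv.
    - unfold pa, pc. ct.
    - specialize (L (pa (fst p)) (pc (snd p)) (Pa _) (Pc _)). lra. }
  destruct (cont2_bounded _ a b c d C) as [K [HK KB]].
  assert (m <= m - / K).
  { apply Hm2. intros z [x [y [Hx [Hy ->]]]]. specialize (KB x y Hx Hy).
    replace (pa x) with x in KB by (unfold pa, Rmax, Rmin; repeat destruct Rle_dec; lra).
    replace (pc y) with y in KB by (unfold pc, Rmax, Rmin; repeat destruct Rle_dec; lra).
    specialize (L x y Hx Hy). rewrite Rabs_pos_eq in KB.
    - assert (/ K <= m - f x y); [|lra]. rewrite <- (Rinv_inv (m - f x y)).
      apply Rinv_le_contravar; auto. apply Rinv_0_lt_compat; lra.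
    - apply Rlt_le, Rinv_0_lt_compat; lra. }
  pose proof (Rinv_0_lt_compat K HK). lra.
Qed.

(** Compactness of the segment in s: a finite cover of [0,1] gives one radius around (r,t) for all
    s. This is what continuity of integrals in a parameter rests on. *)
Lemma cont3_unif H r t eps : cont3 H -> 0 < eps -> exists d, 0 < d /\
  forall r' t' s, Rabs (r' - r) < d -> Rabs (t' - t) < d -> 0 <= s <= 1 -> Rabs (H r' t' s - H r t s) < eps.
Proof.
intros C He.
assert (P : forall s, exists d : posreal, forall r' t' s', Rabs (r' - r) < d -> Rabs (t' - t) < d -> Rabs (s' - s) < d ->
    Rabs (H r' t' s' - H r t s) < eps / 2).
{ intros s. specialize (C ((r, t), s)).
  apply filterlim_locally with (eps := mkposreal (eps/2) ltac:(lra)) in C.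
  destruct C as [d Hd]. exists d. intros r' t' s' A B D. apply (Hd ((r', t'), s')). repeat split; assumption. }
set (dl := fun s => proj1_sig (constructive_indefinite_description _ (P s))).
destruct (compactness_value_1d 0 1 dl) as [d Hd].
exists d. split; [apply d|]. intros r' t' s A B Hs. apply NNPP. intros N.
apply (Hd s Hs). intros [s0 [_ [D Hle]]]. apply N.
assert (Q : forall r' t' s', Rabs (r' - r) < dl s0 -> Rabs (t' - t) < dl s0 -> Rabs (s' - s0) < dl s0 ->
    Rabs (H r' t' s' - H r t s0) < eps / 2)
  by exact (proj2_sig (constructive_indefinite_description _ (P s0))).
pose proof (Q r' t' s ltac:(lra) ltac:(lra) D).
assert (Z : forall x, Rabs (x - x) < dl s0) by (intros x; rewrite Rminus_diag, Rabs_R0; apply (dl s0)).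
pose proof (Q r t s (Z r) (Z t) D).
replace (H r' t' s - H r t s) with ((H r' t' s - H r t s0) - (H r t s - H r t s0)) by ring.
eapply Rle_lt_trans; [apply Rabs_triang|]. rewrite Rabs_Ropp. lra.
Qed.

Lemma cont3_sec H r t : cont3 H -> cont1 (H r t).
Proof. intros C s. apply (cont3_at H (fun _ => r) (fun _ => t) (fun s => s) s C); ct. Qed.
Lemma cont2_sec_r f t : cont2 f -> cont1 (fun r => f r t).
Proof. intros C s. ct. Qed.
Lemma cont2_sec_t f r : cont2 f -> cont1 (f r).
Proof. intros C s. apply (cont2_at f (fun _ => r) (fun s => s) s C); ct. Qed.

(** * Integrals with parameters, and clamping of arguments *)

Lemma cont1_RInt f a b : cont1 f -> ex_RInt f a b.
Proof. intros C. apply (ex_RInt_continuous (V:=R_CompleteNormedModule)). intros; apply C. Qed.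

Lemma RInt_bound f a b M : a <= b -> ex_RInt f a b -> (forall s, a <= s <= b -> Rabs (f s) <= M) ->
  Rabs (RInt f a b) <= (b - a) * M.
Proof. intros. apply abs_RInt_le_const; auto. Qed.

Lemma RInt_sub f g a b : ex_RInt f a b -> ex_RInt g a b -> RInt f a b - RInt g a b = RInt (fun s => f s - g s) a b.
Proof. intros A B. symmetry. exact (RInt_minus (V:=R_CompleteNormedModule) f g a b A B). Qed.
Lemma RInt_add f g a b : ex_RInt f a b -> ex_RInt g a b -> RInt f a b + RInt g a b = RInt (fun s => f s + g s) a b.
Proof. intros A B. symmetry. exact (RInt_plus (V:=R_CompleteNormedModule) f g a b A B). Qed.
Lemma RInt_mul f c a b : ex_RInt f a b -> c * RInt f a b = RInt (fun s => c * f s) a b.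
Proof. intros A. symmetry. exact (RInt_scal (V:=R_CompleteNormedModule) f a b c A). Qed.

Lemma ex_RInt_mul f c a b : ex_RInt f a b -> ex_RInt (fun s => c * f s) a b.
Proof. intros A. exact (ex_RInt_scal (V:=R_NormedModule) f a b c A). Qed.

Lemma RInt_cont2 H : cont3 H -> cont2 (fun r t => RInt (H r t) 0 1).
Proof.
intros C. apply cont2_eps. intros r t eps He.
destruct (cont3_unif H r t (eps/2) C ltac:(lra)) as [d [Hd Q]].
exists d. split; auto. intros r' t' A B.
rewrite RInt_sub by (apply cont1_RInt, cont3_sec, C).
eapply Rle_lt_trans; [apply (RInt_bound _ 0 1 (eps/2))|]; try lra.
- apply cont1_RInt. intros s. apply cR_minus; apply cont3_sec; auto.
- intros s Hs. left. apply Q; auto.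
Qed.

(** Clamping to [0,1] and to [0,oo). Composition with these makes a function given on the closed
    space-time domain continuous on the whole plane, so that [cont2] can do without a domain. *)
Definition cl x := Rmax 0 (Rmin 1 x).
Definition tp t := Rmax 0 t.
Lemma cl_in x : 0 <= cl x <= 1.
Proof. unfold cl, Rmax, Rmin; repeat destruct Rle_dec; lra. Qed.
Lemma cl_id x : 0 <= x <= 1 -> cl x = x.
Proof. unfold cl, Rmax, Rmin; repeat destruct Rle_dec; lra. Qed.
Lemma tp_pos t : 0 <= tp t.
Proof. apply Rmax_l. Qed.
Lemma tp_id t : 0 <= t -> tp t = t.
Proof. intros; apply Rmax_right; auto. Qed.
Lemma cl_cont : cont1 cl.
Proof. intros x. unfold cl. ct. Qed.
Lemma tp_cont : cont1 tp.
Proof. intros x. unfold tp. ct. Qed.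
#[export] Hint Resolve cl_in tp_pos cl_cont tp_cont : core.

Lemma c_cl {U : UniformSpace} (f : U -> R) u : continuous f u -> continuous (fun x => cl (f x)) u.
Proof. intros. apply cont1_at; auto. Qed.
Lemma c_tp {U : UniformSpace} (f : U -> R) u : continuous f u -> continuous (fun x => tp (f x)) u.
Proof. intros. apply cont1_at; auto. Qed.

Ltac ct1 ::= lazymatch goal with
  | |- continuous (fun _ => ?c) _ => apply continuous_const
  | |- continuous (fun x => x) _ => apply continuous_id
  | |- continuous (fun x => @?a x + @?b x) _ => apply (cR_plus a b)
  | |- continuous (fun x => @?a x - @?b x) _ => apply (cR_minus a b)
  | |- continuous (fun x => @?a x * @?b x) _ => apply (cR_mult a b)
  | |- continuous (fun x => - @?a x) _ => apply (cR_opp a)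
  | |- continuous (fun x => @?a x ^ ?n) _ => apply (cR_pow a n)
  | |- continuous (fun x => cos (@?a x)) _ => apply (cR_cos a)
  | |- continuous (fun x => sin (@?a x)) _ => apply (cR_sin a)
  | |- continuous (fun x => exp (@?a x)) _ => apply (cR_exp a)
  | |- continuous (fun x => Rabs (@?a x)) _ => apply (cR_abs a)
  | |- continuous (fun x => Rmax ?c (@?a x)) _ => apply (cR_max c a)
  | |- continuous (fun x => Rmin ?c (@?a x)) _ => apply (cR_min c a)
  | |- continuous (fun x => fst x) _ => apply c_fst
  | |- continuous (fun x => snd x) _ => apply c_snd
  | |- continuous (fun x => fst (@?a x)) _ => apply (c_fst' _ _ _ a)
  | |- continuous (fun x => snd (@?a x)) _ => apply (c_snd' _ _ _ a)
  | |- continuous (fun x => cl (@?a x)) _ => apply (c_cl a)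
  | |- continuous (fun x => tp (@?a x)) _ => apply (c_tp a)
  | H : cont3 ?f |- continuous (fun x => ?f (@?a x) (@?b x) (@?c x)) _ => apply (cont3_at f a b c _ H)
  | H : cont2 ?f |- continuous (fun x => ?f (@?a x) (@?b x)) _ => apply (cont2_at f a b _ H)
  | H : cont1 ?f |- continuous (fun x => ?f (@?a x)) _ => apply (cont1_at f a _ H)
  | H : cont1 ?f |- continuous ?f _ => apply H
  end.

(* Contraction in a norm of which only finiteness is known. *)
Lemma contraction_bound {T : Type} (D : T -> Prop) (F : T -> R) eps B0 :
  (forall x, D x -> F x <= B0) ->
  (forall B, 0 <= B -> (forall x, D x -> F x <= B) -> forall x, D x -> F x <= eps + B / 2) ->
  0 <= eps -> forall x, D x -> F x <= 2 * eps.
Proof.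
intros H0 HS He x Dx. apply Rnot_lt_le. intros N.
assert (H0' : forall x, D x -> F x <= Rmax 0 B0) by (intros; apply Rle_trans with B0; auto; apply Rmax_r).
destruct (completeness (fun z => exists x, D x /\ z = F x)) as [m [Hm1 Hm2]].
- exists B0. intros z [y [Dy ->]]. auto.
- exists (F x), x. auto.
- assert (F x <= m) by (apply Hm1; exists x; auto).
  assert (m <= eps + m / 2); [|lra].
  apply Hm2. intros z [y [Dy ->]]. apply HS; auto; try lra.
  intros w Dw. apply Hm1. exists w; auto.
Qed.

(** * Mean value estimates and derivative tests at a maximum *)

Lemma MVT_abs f df a b : (forall x, Rmin a b <= x <= Rmax a b -> is_derive f x (df x)) ->
  exists c, Rmin a b <= c <= Rmax a b /\ f b - f a = df c * (b - a).
Proof.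
intros H. apply MVT_gen.
- intros x Hx. apply H. lra.
- intros x Hx. apply derivable_continuous_pt. exists (df x). apply is_derive_Reals. apply H. auto.
Qed.

Lemma taylor2 f f1 f2 a b B :
  (forall x, Rmin a b <= x <= Rmax a b -> is_derive f x (f1 x) /\ is_derive f1 x (f2 x) /\ Rabs (f2 x) <= B) ->
  Rabs (f b - f a - (b - a) * f1 a) <= B * (b - a) ^ 2.
Proof.
intros H.
destruct (MVT_abs f f1 a b) as [c [Hc E]]; [intros; apply H; auto|].
assert (Q : forall x, Rmin a c <= x <= Rmax a c -> Rmin a b <= x <= Rmax a b).
{ intros x. revert Hc. unfold Rmin, Rmax. repeat destruct Rle_dec; lra. }
destruct (MVT_abs f1 f2 a c) as [d [Hd E2]]; [intros; apply H; auto|].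
replace (f b - f a - (b - a) * f1 a) with (f2 d * ((c - a) * (b - a))) by (rewrite E; replace (f1 c) with (f1 a + f2 d * (c - a)) by lra; ring).
rewrite Rabs_mult. destruct (H d (Q d Hd)) as [_ [_ Hb]].
apply Rmult_le_compat; auto; try apply Rabs_pos.
rewrite Rabs_mult. rewrite <- (pow2_abs (b - a)).
replace (Rabs (b - a) ^ 2) with (Rabs (b - a) * Rabs (b - a)) by ring.
apply Rmult_le_compat_r; [apply Rabs_pos|].
revert Hc. unfold Rmin, Rmax. destruct Rle_dec; intros; unfold Rabs; repeat destruct Rcase_abs; lra.
Qed.

(** One-sided tests, because a maximum over a space-time rectangle may sit at the final time or at
    an endpoint of the interval. *)
Lemma is_derive_max_left f x l d : 0 < d -> is_derive f x l -> (forall y, x - d < y <= x -> f y <= f x) -> 0 <= l.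
Proof.
intros Hd D H. apply Rnot_lt_le. intros N. apply is_derive_Reals in D.
destruct (D (-l) ltac:(lra)) as [e He].
set (h := - Rmin (e/2) (d/2)).
assert (Hh : 0 < -h /\ -h < e /\ -h < d).
{ unfold h. pose proof (cond_pos e). unfold Rmin; destruct Rle_dec; lra. }
specialize (He h ltac:(lra) ltac:(unfold Rabs; destruct Rcase_abs; lra)).
specialize (H (x + h) ltac:(lra)).
assert (0 <= (f (x + h) - f x) / h).
{ replace ((f (x + h) - f x) / h) with ((f x - f (x + h)) / (-h)) by (field; lra).
  apply Rdiv_le_0_compat; lra. }
revert He. unfold Rabs; destruct Rcase_abs; lra.
Qed.

Lemma is_derive_max_right f x l d : 0 < d -> is_derive f x l -> (forall y, x <= y < x + d -> f y <= f x) -> l <= 0.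
Proof.
intros Hd D H.
assert (0 <= - l); [|lra].
apply (is_derive_max_left (fun y => f (- y)) (- x) (-l) d); auto.
- replace (-l) with (scal (-1) l) by (unfold scal; simpl; unfold mult; simpl; ring).
  apply (is_derive_comp f (fun y => - y) (-x)); [rewrite Ropp_involutive; auto|auto_derive; auto; ring].
- intros y Hy. rewrite Ropp_involutive. apply H. lra.
Qed.

(** The derivative [f1] is assumed differentiable at x only. If l2 > 0, then [f1] is positive just
    to the right of x and f increases there. *)
Lemma is_derive_max_int f f1 x l2 d : 0 < d ->
  (forall y, Rabs (y - x) < d -> is_derive f y (f1 y)) -> is_derive f1 x l2 ->
  (forall y, Rabs (y - x) < d -> f y <= f x) -> f1 x = 0 /\ l2 <= 0.
Proof.
intros Hd D D2 H.
assert (Dx : is_derive f x (f1 x)) by (apply D; rewrite Rminus_diag, Rabs_R0; auto).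
assert (Z : f1 x = 0).
{ apply Rle_antisym.
  - apply (is_derive_max_right f x _ d); auto. intros y Hy. apply H. unfold Rabs; destruct Rcase_abs; lra.
  - apply (is_derive_max_left f x _ d); auto. intros y Hy. apply H. unfold Rabs; destruct Rcase_abs; lra. }
split; auto. apply Rnot_lt_le. intros N.
apply is_derive_Reals in D2. destruct (D2 l2 N) as [e He].
set (h := Rmin (e/2) (d/2)).
assert (Hh : 0 < h /\ h < e /\ h < d) by (unfold h; pose proof (cond_pos e); unfold Rmin; destruct Rle_dec; lra).
assert (P : forall z, x < z <= x + h -> 0 < f1 z).
{ intros z Hz. specialize (He (z - x) ltac:(lra) ltac:(unfold Rabs; destruct Rcase_abs; lra)).
  replace (x + (z - x)) with z in He by ring. rewrite Z in He.
  assert (0 < (f1 z - 0) / (z - x)) by (revert He; unfold Rabs; destruct Rcase_abs; lra).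
  replace (f1 z) with ((f1 z - 0) / (z - x) * (z - x)) by (field; lra). apply Rmult_lt_0_compat; lra. }
destruct (MVT_gen f x (x + h) f1) as [c [Hc E]].
- intros y. rewrite Rmin_left, Rmax_right by lra. intros. apply D. unfold Rabs; destruct Rcase_abs; lra.
- intros y. rewrite Rmin_left, Rmax_right by lra. intros. apply derivable_continuous_pt. exists (f1 y).
  apply is_derive_Reals, D. unfold Rabs; destruct Rcase_abs; lra.
- rewrite Rmin_left, Rmax_right in Hc by lra.
  assert (L : f (x + h) <= f x) by (apply H; unfold Rabs; destruct Rcase_abs; lra).
  (* The interval is halved because the intermediate point of [x, x + h] could be x itself, where
     [f1] vanishes; on the right half [f1] is strictly positive. *)
  destruct (MVT_gen f (x + h/2) (x + h) f1) as [c' [Hc' E']].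
  + intros y. rewrite Rmin_left, Rmax_right by lra. intros. apply D. unfold Rabs; destruct Rcase_abs; lra.
  + intros y. rewrite Rmin_left, Rmax_right by lra. intros. apply derivable_continuous_pt. exists (f1 y).
    apply is_derive_Reals, D. unfold Rabs; destruct Rcase_abs; lra.
  + rewrite Rmin_left, Rmax_right in Hc' by lra.
    destruct (MVT_gen f x (x + h/2) f1) as [c2 [Hc2 E2]].
    * intros y. rewrite Rmin_left, Rmax_right by lra. intros. apply D. unfold Rabs; destruct Rcase_abs; lra.
    * intros y. rewrite Rmin_left, Rmax_right by lra. intros. apply derivable_continuous_pt. exists (f1 y).
      apply is_derive_Reals, D. unfold Rabs; destruct Rcase_abs; lra.
    * rewrite Rmin_left, Rmax_right in Hc2 by lra.
      assert (0 < f1 c') by (apply P; lra).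
      assert (0 <= f1 c2).
      { destruct (Req_dec c2 x) as [->|]; [rewrite Z; lra|]. left. apply P; lra. }
      nra.
Qed.

(** [auto_derive] leaves derivatives of abstract functions as [Derive] terms; this rewrites them to
    the value known from [D]. *)
Ltac der D := match type of D with is_derive ?f ?x ?l =>
  let H := fresh in
  assert (H : Derive (fun y : R => f y) x = l) by exact (is_derive_unique _ _ _ D);
  cbv beta in H; rewrite ?H; clear H end.

(** * Zonal eigenfunctions and gradient estimates *)

(* Odd eigenfunctions of [(1-x^2) d^2/dx^2 - 4 x d/dx], the zonal Laplacian of S^4, with their derivatives. *)
Record mode := Mode { lam : R; e0 : R -> R; e1 : R -> R; e2 : R -> R; e3 : R -> R }.

Record is_mode (m : mode) : Prop := IsMode {
  lam_ge : 0 <= lam m;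
  e0_der : forall x, is_derive (e0 m) x (e1 m x);
  e1_der : forall x, is_derive (e1 m) x (e2 m x);
  e2_der : forall x, is_derive (e2 m) x (e3 m x);
  e_ode : forall x, (1 - x ^ 2) * e2 m x - 4 * x * e1 m x = - lam m * e0 m x;
  e_odd : forall x, e0 m (- x) = - e0 m x }.

(** The type of coefficients varies: real numbers for a flow, functions of time for separated
    sources. *)
Definition ls {A} (F : A -> mode -> R) (fl : list (A * mode)) : R :=
  fold_right (fun cm a => F (fst cm) (snd cm) + a) 0 fl.
Definition valid {A} (fl : list (A * mode)) := List.Forall (fun cm => is_mode (snd cm)) fl.

Section Sums.
Context {A : Type}.
Implicit Types (F G : A -> mode -> R) (fl : list (A * mode)).

Lemma ls_ext F G fl : (forall c m, In (c, m) fl -> F c m = G c m) -> ls F fl = ls G fl.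
Proof.
induction fl as [|[c m] fl IH]; simpl; intros H; auto.
rewrite IH by (intros; apply H; auto). rewrite (H c m); auto.
Qed.

Lemma ls_plus F G fl : ls F fl + ls G fl = ls (fun c m => F c m + G c m) fl.
Proof. induction fl as [|[c m] fl IH]; simpl; [ring|]. rewrite <- IH. ring. Qed.

Lemma ls_scal k F fl : k * ls F fl = ls (fun c m => k * F c m) fl.
Proof. induction fl as [|[c m] fl IH]; simpl; [ring|]. rewrite <- IH. ring. Qed.

Lemma ls_minus F G fl : ls F fl - ls G fl = ls (fun c m => F c m - G c m) fl.
Proof. induction fl as [|[c m] fl IH]; simpl; [ring|]. rewrite <- IH. ring. Qed.

Lemma ls_app F fl fl' : ls F (fl ++ fl') = ls F fl + ls F fl'.
Proof. induction fl as [|[c m] fl IH]; simpl; [ring|]. rewrite IH. ring. Qed.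

Lemma ls_map {B} (g : A -> mode -> B) (F : B -> mode -> R) fl :
  ls F (map (fun cm => (g (fst cm) (snd cm), snd cm)) fl) = ls (fun c m => F (g c m) m) fl.
Proof. induction fl as [|[c m] fl IH]; simpl; auto. rewrite IH. auto. Qed.

Lemma valid_in fl c m : valid fl -> In (c, m) fl -> is_mode m.
Proof. intros V H. unfold valid in V. rewrite Forall_forall in V. apply (V _ H). Qed.

Lemma valid_map {B} (g : A -> mode -> B) fl : valid fl -> valid (map (fun cm => (g (fst cm) (snd cm), snd cm)) fl).
Proof. intros V. apply Forall_map. exact V. Qed.

Lemma valid_app fl fl' : valid fl -> valid fl' -> valid (fl ++ fl').
Proof. intros. apply Forall_app; auto. Qed.

Lemma ls_derive (F : A -> mode -> R -> R) F' fl x :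
  (forall c m, In (c, m) fl -> is_derive (F c m) x (F' c m)) ->
  is_derive (fun y => ls (fun c m => F c m y) fl) x (ls F' fl).
Proof.
induction fl as [|[c m] fl IH]; simpl; intros H.
- apply (is_derive_const (V:=R_NormedModule) 0).
- apply (is_derive_plus (V:=R_NormedModule)); auto.
Qed.

Lemma ls_cont {U : UniformSpace} (F : A -> mode -> U -> R) fl u :
  (forall c m, In (c, m) fl -> continuous (F c m) u) ->
  continuous (fun y => ls (fun c m => F c m y) fl) u.
Proof.
induction fl as [|[c m] fl IH]; simpl; intros H.
- apply continuous_const.
- apply cR_plus; auto.
Qed.
End Sums.

(** One term of the flow. The choice of [e] selects a space derivative; the multiplier [q] selects a
    time derivative, each of which contributes a factor -lam. *)
Definition E (e : mode -> R -> R) (q : R -> R) x t (c : R) (m : mode) := c * q (lam m) * exp (- lam m * t) * e m x.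
(** This is t^j (d/dt)^j of the flow. The power of t compensates the smoothing singularity, so that
    it is controlled by the sup norm of the initial value alone. *)
Definition W (fl : list (R * mode)) j x t := ls (fun c m => c * (- lam m * t) ^ j * exp (- lam m * t) * e0 m x) fl.

Lemma is_derive_cont1 f f' : (forall x, is_derive f x (f' x)) -> cont1 f.
Proof. intros H x. apply (ex_derive_continuous (V:=R_NormedModule)). exists (f' x). apply H. Qed.

Lemma E_cont e q fl : (forall c m, In (c, m) fl -> cont1 (e m)) -> cont2 (fun x t => ls (E e q x t) fl).
Proof.
intros H p. apply (ls_cont (fun c m p => E e q (fst p) (snd p) c m)). intros c m I. unfold E.
pose proof (H c m I). ct.
Qed.

Lemma E_dx e e' q fl x t : (forall c m, In (c, m) fl -> is_derive (e m) x (e' m x)) ->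
  is_derive (fun y => ls (E e q y t) fl) x (ls (E e' q x t) fl).
Proof.
intros H. apply (ls_derive (fun c m y => E e q y t c m)). intros c m I. unfold E.
apply is_derive_scal. exact (H c m I).
Qed.

Lemma E_dt e q fl x t : is_derive (fun s => ls (E e q x s) fl) t (ls (E e (fun l => - l * q l) x t) fl).
Proof.
apply (ls_derive (fun c m s => E e q x s c m)). intros c m I. unfold E.
auto_derive; auto. ring.
Qed.

Lemma E_ode q fl x t : valid fl ->
  ls (E e0 (fun l => - l * q l) x t) fl = (1 - x ^ 2) * ls (E e2 q x t) fl - 4 * x * ls (E e1 q x t) fl.
Proof.
intros V. rewrite !ls_scal, ls_minus. apply ls_ext.
intros c m I. destruct (valid_in _ _ _ V I) as [_ _ _ _ O _]. unfold E.
replace (c * (- lam m * q (lam m)) * exp (- lam m * t) * e0 m x) with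
  (c * q (lam m) * exp (- lam m * t) * (- lam m * e0 m x)) by ring.
rewrite <- O. ring.
Qed.

Lemma e_ode' m x : is_mode m -> (1 - x ^ 2) * e3 m x - 6 * x * e2 m x - 4 * e1 m x = - lam m * e1 m x.
Proof.
intros [_ D0 D1 D2 O _].
rewrite <- (is_derive_unique _ _ _ (is_derive_scal (e0 m) x (- lam m) _ (D0 x))).
symmetry. apply is_derive_unique.
apply is_derive_ext with (fun x => (1 - x ^ 2) * e2 m x - 4 * x * e1 m x); [intros; apply O|].
auto_derive.
- repeat split; eexists; eauto.
der (D2 x). der (D1 x). ring.
Qed.

Lemma E_ode' q fl x t : valid fl ->
  ls (E e1 (fun l => - l * q l) x t) fl =
  (1 - x ^ 2) * ls (E e3 q x t) fl - 6 * x * ls (E e2 q x t) fl - 4 * ls (E e1 q x t) fl.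
Proof.
intros V. rewrite !ls_scal, !ls_minus. apply ls_ext.
intros c m I. pose proof (e_ode' m x (valid_in _ _ _ V I)) as O. unfold E.
replace (c * (- lam m * q (lam m)) * exp (- lam m * t) * e1 m x) with
  (c * q (lam m) * exp (- lam m * t) * (- lam m * e1 m x)) by ring.
rewrite <- O. ring.
Qed.

(** The operator degenerates at x = 1 and x = -1 and its drift points inward, so a maximum at an
    endpoint is excluded by the sign of the one-sided derivative. Subtracting [eps * t] makes the
    inequality strict. *)
Lemma sphere_max_principle P Pt Px Pxx B :
  cont2 P ->
  (forall x t, 0 < t -> is_derive (P x) t (Pt x t)) ->
  (forall x t, 0 < t -> is_derive (fun y => P y t) x (Px x t)) ->
  (forall x t, 0 < t -> is_derive (fun y => Px y t) x (Pxx x t)) ->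
  (forall x t, -1 <= x <= 1 -> 0 < t -> Pt x t <= (1 - x ^ 2) * Pxx x t - 4 * x * Px x t) ->
  (forall x, -1 <= x <= 1 -> P x 0 <= B) ->
  forall x t, -1 <= x <= 1 -> 0 <= t -> P x t <= B.
Proof.
intros C Dt Dx Dxx Hineq H0.
assert (K : forall eps T, 0 < eps -> 0 <= T -> forall x t, -1 <= x <= 1 -> 0 <= t <= T -> P x t - eps * t <= B).
{ intros eps T He HT.
  destruct (cont2_max (fun x t => P x t - eps * t) (-1) 1 0 T) as [x0 [t0 [Hx [Ht Hm]]]]; try lra.
  { intros p. ct. }
  intros x t Hx' Ht'. eapply Rle_trans; [apply (Hm x t Hx' Ht')|].
  destruct (Rle_lt_or_eq_dec 0 t0 (proj1 Ht)) as [Hp|<-].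
  2:{ specialize (H0 x0 Hx). lra. }
  exfalso.
  assert (Ht0 : 0 <= Pt x0 t0 - eps).
  { apply (is_derive_max_left (fun t => P x0 t - eps * t) t0 _ t0); auto.
    - specialize (Dt x0 t0 Hp). auto_derive; [eexists; eauto|].
      der Dt. ring.
    - intros y Hy. apply Hm; lra. }
  specialize (Hineq x0 t0 Hx Hp).
  assert (S : forall y, -1 <= y <= 1 -> P y t0 <= P x0 t0) by (intros y Hy; specialize (Hm y t0 Hy Ht); lra).
  destruct (Rle_lt_or_eq_dec x0 1 (proj2 Hx)) as [H1|H1].
  - destruct (Rle_lt_or_eq_dec (-1) x0 (proj1 Hx)) as [H2|H2].
    + set (d := Rmin (1 - x0) (x0 + 1)). assert (Hd : 0 < d /\ d <= 1 - x0 /\ d <= x0 + 1) by (unfold d, Rmin; destruct Rle_dec; lra).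
      destruct (is_derive_max_int (fun y => P y t0) (fun y => Px y t0) x0 (Pxx x0 t0) d) as [Z1 Z2]; try tauto; auto.
      * intros y Hy. apply S. revert Hy. unfold Rabs; destruct Rcase_abs; lra.
      * rewrite Z1 in Hineq. assert (0 <= (1 - x0 ^ 2)) by nra. nra.
    + subst x0.
      assert (Px (-1) t0 <= 0).
      { apply (is_derive_max_right (fun y => P y t0) (-1) _ 1); auto; try lra. intros; apply S; lra. }
      nra.
  - subst x0.
    assert (0 <= Px 1 t0).
    { apply (is_derive_max_left (fun y => P y t0) 1 _ 1); auto; try lra. intros; apply S; lra. }
    nra. }
intros x t Hx Ht. apply Rnot_lt_le. intros N.
set (eps := (P x t - B) / (2 * (t + 1))).
assert (0 < eps) by (apply Rdiv_lt_0_compat; lra).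
specialize (K eps t ltac:(auto) Ht x t Hx ltac:(lra)).
assert (eps * t <= (P x t - B) / 2).
{ unfold eps. replace ((P x t - B) / 2) with ((P x t - B) / (2 * (t + 1)) * (t + 1)) by (field; lra).
  fold eps. nra. }
lra.
Qed.

Section Bernstein.
Variable fl : list (R * mode).
Hypothesis V : valid fl.
Let w x t := ls (E e0 (fun _ => 1) x t) fl.
Let wx x t := ls (E e1 (fun _ => 1) x t) fl.
Let wxx x t := ls (E e2 (fun _ => 1) x t) fl.
Let wxxx x t := ls (E e3 (fun _ => 1) x t) fl.
Let q1 := fun l : R => - l * 1.
Let v x t := ls (E e0 q1 x t) fl.
Let vx x t := ls (E e1 q1 x t) fl.
Let vxx x t := ls (E e2 q1 x t) fl.
Let vt x t := ls (E e0 (fun l => - l * q1 l) x t) fl.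

(** Bernstein's quantity t^2 w_t^2 + 4 t (1-x^2) w_x^2 + 2 w^2 is a subsolution. The time derivative
    of the first weight costs 2 t w_t^2, absorbed by the dissipation of the gradient term; that of
    the second costs 4 (1-x^2) w_x^2, which is exactly the dissipation of 2 w^2. What remains is
    minus a sum of squares. *)
Lemma bernstein_estimate B : (forall x, -1 <= x <= 1 -> Rabs (w x 0) <= B) ->
  forall x t, -1 <= x <= 1 -> 0 <= t -> Rabs (w x t) <= B /\ Rabs (t * v x t) <= 2 * B.
Proof.
intros H0.
assert (HB : 0 <= B) by (apply Rle_trans with (2 := H0 0 ltac:(lra)); apply Rabs_pos).
assert (I0 : forall x c m, In (c, m) fl -> is_derive (e0 m) x (e1 m x)) by (intros; apply (e0_der m (valid_in _ _ _ V H))).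
assert (I1 : forall x c m, In (c, m) fl -> is_derive (e1 m) x (e2 m x)) by (intros; apply (e1_der m (valid_in _ _ _ V H))).
assert (I2 : forall x c m, In (c, m) fl -> is_derive (e2 m) x (e3 m x)) by (intros; apply (e2_der m (valid_in _ _ _ V H))).
assert (C0 : forall c m, In (c, m) fl -> cont1 (e0 m)) by (intros; eapply is_derive_cont1; eauto).
assert (C1 : forall c m, In (c, m) fl -> cont1 (e1 m)) by (intros; eapply is_derive_cont1; eauto).
assert (K : forall x t, -1 <= x <= 1 -> 0 <= t ->
  t ^ 2 * v x t ^ 2 + 4 * t * (1 - x ^ 2) * wx x t ^ 2 + 2 * w x t ^ 2 <= 2 * B ^ 2).
{ apply sphere_max_principle with
   (Pt := fun x t => 2 * t * v x t ^ 2 + 2 * t ^ 2 * v x t * vt x t + 4 * (1 - x ^ 2) * wx x t ^ 2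
        + 8 * t * (1 - x ^ 2) * wx x t * vx x t + 4 * w x t * v x t)
   (Px := fun x t => 2 * t ^ 2 * v x t * vx x t + 4 * t * (- 2 * x * wx x t ^ 2 + 2 * (1 - x ^ 2) * wx x t * wxx x t)
        + 4 * w x t * wx x t)
   (Pxx := fun x t => 2 * t ^ 2 * (vx x t ^ 2 + v x t * vxx x t)
     + 4 * t * (- 2 * wx x t ^ 2 - 8 * x * wx x t * wxx x t + 2 * (1 - x ^ 2) * (wxx x t ^ 2 + wx x t * wxxx x t))
     + 4 * (wx x t ^ 2 + w x t * wxx x t)).
  - assert (Cw : cont2 w) by (apply E_cont; auto).
    assert (Cwx : cont2 wx) by (apply E_cont; auto).
    assert (Cv : cont2 v) by (apply E_cont; auto).
    intros p. ct.
  - intros x t _.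
    assert (D1 : is_derive (fun t => w x t) t (v x t)) by apply E_dt.
    assert (D2 : is_derive (fun t => wx x t) t (vx x t)) by apply E_dt.
    assert (D3 : is_derive (fun t => v x t) t (vt x t)) by apply E_dt.
    auto_derive; [repeat split; eexists; eauto|].
    der D1; der D2; der D3. ring.
  - intros x t _.
    assert (D1 : is_derive (fun x => w x t) x (wx x t)) by (apply E_dx; eauto).
    assert (D2 : is_derive (fun x => wx x t) x (wxx x t)) by (apply E_dx; eauto).
    assert (D3 : is_derive (fun x => v x t) x (vx x t)) by (apply E_dx; eauto).
    auto_derive; [repeat split; eexists; eauto|].
    der D1; der D2; der D3. ring.
  - intros x t _.
    assert (D1 : is_derive (fun x => w x t) x (wx x t)) by (apply E_dx; eauto).
    assert (D2 : is_derive (fun x => wx x t) x (wxx x t)) by (apply E_dx; eauto).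
    assert (D3 : is_derive (fun x => v x t) x (vx x t)) by (apply E_dx; eauto).
    assert (D4 : is_derive (fun x => vx x t) x (vxx x t)) by (apply E_dx; eauto).
    assert (D5 : is_derive (fun x => wxx x t) x (wxxx x t)) by (apply E_dx; eauto).
    auto_derive; [repeat split; eexists; eauto|].
    der D1; der D2; der D3; der D4; der D5. ring.
  - intros x t Hx Ht.
    assert (O1 : v x t = (1 - x ^ 2) * wxx x t - 4 * x * wx x t) by (apply E_ode; auto).
    assert (O2 : vt x t = (1 - x ^ 2) * vxx x t - 4 * x * vx x t) by (apply E_ode; auto).
    assert (O3 : vx x t = (1 - x ^ 2) * wxxx x t - 6 * x * wxx x t - 4 * wx x t) by (apply E_ode'; auto).
    assert (Hx2 : 0 <= 1 - x ^ 2) by nra.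
    apply Rminus_le.
    match goal with |- ?X <= 0 => replace X with
     (- (2 * t ^ 2 * ((1 - x ^ 2) * vx x t ^ 2) + t * (6 * ((1 - x ^ 2) * wxx x t) ^ 2 + 24 * ((1 - x ^ 2) * wx x t ^ 2)))) end.
    + pose proof (pow2_ge_0 (vx x t)). pose proof (pow2_ge_0 (wx x t)). pose proof (pow2_ge_0 ((1 - x ^ 2) * wxx x t)).
      pose proof (pow2_ge_0 t).
      pose proof (Rmult_le_pos _ _ Hx2 H). pose proof (Rmult_le_pos _ _ Hx2 H1).
      apply Rge_le, Ropp_0_le_ge_contravar. apply Rplus_le_le_0_compat.
      * apply Rmult_le_pos; lra.
      * apply Rmult_le_pos; lra.
    + rewrite O2, O1. generalize O3. generalize (vx x t). intros y ->. ring.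
  - intros x Hx. specialize (H0 x Hx).
    assert (w x 0 ^ 2 <= B ^ 2) by (rewrite <- (pow2_abs (w x 0)); apply pow_incr; split; auto; apply Rabs_pos).
    lra. }
intros x t Hx Ht. specialize (K x t Hx Ht).
assert (0 <= 4 * t * (1 - x ^ 2) * wx x t ^ 2).
{ apply Rmult_le_pos; [|apply pow2_ge_0]. apply Rmult_le_pos; nra. }
pose proof (pow2_ge_0 (w x t)). pose proof (pow2_ge_0 (t * v x t)).
rewrite Rpow_mult_distr in H2. pose proof (pow2_ge_0 (t * v x t)).
split; apply Rsqr_incr_0_var; try lra; rewrite <- Rsqr_abs; unfold Rsqr; [nra|].
replace (t * v x t * (t * v x t)) with (t ^ 2 * v x t ^ 2) by ring. nra.
Qed.
End Bernstein.

(** Restarts the flow at time t: t^j (d/dt)^j of the flow, frozen at t, becomes the initial value of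
    a new flow. *)
Definition slice (fl : list (R * mode)) j t := map (fun cm => (fst cm * (- lam (snd cm) * t) ^ j * exp (- lam (snd cm) * t), snd cm)) fl.

Lemma slice_valid fl j t : valid fl -> valid (slice fl j t).
Proof. apply (valid_map (fun c m => c * (- lam m * t) ^ j * exp (- lam m * t))). Qed.

Lemma W_slice fl j t i x s : W (slice fl j t) i x s =
  ls (fun c m => c * (- lam m * t) ^ j * exp (- lam m * t) * (- lam m * s) ^ i * exp (- lam m * s) * e0 m x) fl.
Proof.
unfold W, slice.
apply (ls_map (fun c m => c * (- lam m * t) ^ j * exp (- lam m * t)) (fun c m => c * (- lam m * s) ^ i * exp (- lam m * s) * e0 m x) fl).
Qed.

Lemma W_slice0 fl j t x : W (slice fl j t) 0 x 0 = W fl j x t.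
Proof. rewrite W_slice. apply ls_ext. intros. simpl. rewrite Rmult_0_r, exp_0. ring. Qed.

(** Semigroup property: j derivatives are spent on the first half of the time and one on the second.
    The power of 2 converts t/2 back into t. *)
Lemma W_half fl j x t : W fl (S j) x t = 2 ^ S j * W (slice fl j (t / 2)) 1 x (t / 2).
Proof.
rewrite W_slice. unfold W. rewrite ls_scal. apply ls_ext. intros c m _.
replace (- lam m * t) with ((- lam m * (t / 2)) + (- lam m * (t / 2))) by field.
rewrite exp_plus. set (q := - lam m * (t / 2)). replace (q + q) with (2 * q) by ring.
rewrite Rpow_mult_distr. simpl. ring.
Qed.

Lemma W_odd fl j x t : valid fl -> W fl j (- x) t = - W fl j x t.
Proof.
intros V. unfold W. replace (- ls _ fl) with (-1 * ls (fun c m => c * (- lam m * t) ^ j * exp (- lam m * t) * e0 m x) fl) by ring.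
rewrite ls_scal. apply ls_ext. intros c m I. rewrite (e_odd m (valid_in _ _ _ V I)). ring.
Qed.

(** Per derivative, 2 is the constant in Bernstein's estimate and 2^(j+1) the cost of halving the
    time. *)
Fixpoint Cj (j : nat) : R := match j with O => 1 | S i => 2 ^ S i * (2 * Cj i) end.
Lemma Cj_pos j : 0 < Cj j.
Proof. induction j; simpl; [lra|]. pose proof (pow_lt 2 j). nra. Qed.

Lemma W_bound1 fl B : valid fl -> (forall x, 0 <= x <= 1 -> Rabs (W fl 0 x 0) <= B) ->
  forall x t, 0 <= x <= 1 -> 0 <= t -> Rabs (W fl 0 x t) <= B /\ Rabs (W fl 1 x t) <= 2 * B.
Proof.
intros V H x t Hx Ht.
assert (E0 : forall x t, W fl 0 x t = ls (E e0 (fun _ => 1) x t) fl).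
{ intros. apply ls_ext. intros. unfold E. simpl. ring. }
destruct (bernstein_estimate fl V B) with x t as [A1 A2]; auto; try lra.
- intros y Hy. rewrite <- E0. destruct (Rle_dec 0 y); [apply H; lra|].
  replace y with (- - y) by ring. rewrite W_odd, Rabs_Ropp by auto. apply H; lra.
- rewrite E0. split; auto. replace (W fl 1 x t) with (t * ls (E e0 (fun l => - l * 1) x t) fl); auto.
  rewrite ls_scal. apply ls_ext. intros. unfold E. simpl. ring.
Qed.

Lemma W_bound fl j B : valid fl -> (forall x, 0 <= x <= 1 -> Rabs (W fl 0 x 0) <= B) ->
  forall x t, 0 <= x <= 1 -> 0 <= t -> Rabs (W fl j x t) <= Cj j * B.
Proof.
intros V H. induction j as [|j IH]; intros x t Hx Ht.
- simpl. rewrite Rmult_1_l. apply W_bound1; auto.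
- rewrite W_half, Rabs_mult, (Rabs_pos_eq (2 ^ S j)) by (apply pow_le; lra).
  simpl Cj. rewrite !Rmult_assoc.
  pose proof (pow_lt 2 j ltac:(lra)).
  assert (Rabs (W (slice fl j (t / 2)) 1 x (t / 2)) <= 2 * (Cj j * B)).
  { apply W_bound1; auto; try lra; try (apply slice_valid; auto).
    intros y Hy. rewrite W_slice0. apply IH; auto; lra. }
  simpl. nra.
Qed.

Lemma W_cont fl j : valid fl -> cont2 (W fl j).
Proof.
intros V p. apply (ls_cont (fun c m p => c * (- lam m * snd p) ^ j * exp (- lam m * snd p) * e0 m (fst p))).
intros c m I. pose proof (is_derive_cont1 _ _ (e0_der m (valid_in _ _ _ V I))). ct.
Qed.

(** Since l d/dl acts as t d/dt, the derivative in the scale l is again a combination of [W],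
    bounded as t -> 0. *)
Lemma W_dscale fl j x t l : l <> 0 ->
  is_derive (fun l => W fl j x (l * t)) l ((INR j * W fl j x (l * t) + W fl (S j) x (l * t)) / l).
Proof.
intros Hl. unfold Rdiv. rewrite Rmult_comm. unfold W at 2 3. rewrite ls_scal, ls_plus, ls_scal.
apply (ls_derive (fun c m l => c * (- lam m * (l * t)) ^ j * exp (- lam m * (l * t)) * e0 m x)).
intros c m _. auto_derive; auto.
destruct j as [|j]; [simpl; field; auto|].
replace (Nat.pred (S j)) with j by auto.
rewrite <- !tech_pow_Rmult. set (A := (- lam m * (l * t)) ^ j). rewrite S_INR. field. auto.
Qed.

(** Controls (j^2 - j) W_j + 2 j W_(j+1) + W_(j+2), the numerator of the second derivative in l. *)
Definition Dj j := (INR j ^ 2 + INR j) * Cj j + 2 * INR j * Cj (S j) + Cj (S (S j)).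

(** Taylor expansion in l around 1. The 4 bounds 1/l^2 for l >= 1/2. The error is uniform in t >= 0
    and involves the initial value only through its sup norm, so it survives approximation of the
    data. *)
Lemma W_taylor fl j B l : valid fl -> (forall x, 0 <= x <= 1 -> Rabs (W fl 0 x 0) <= B) -> Rabs (l - 1) <= 1/2 ->
  forall x t, 0 <= x <= 1 -> 0 <= t ->
  Rabs (W fl j x (l * t) - W fl j x t - (l - 1) * (INR j * W fl j x t + W fl (S j) x t)) <= 4 * (Dj j * B) * (l - 1) ^ 2.
Proof.
intros V H Hl x t Hx Ht.
assert (HB : 0 <= B) by (apply Rle_trans with (2 := H 0 ltac:(lra)); apply Rabs_pos).
pose proof (taylor2 (fun l => W fl j x (l * t)) (fun l => (INR j * W fl j x (l * t) + W fl (S j) x (l * t)) / l)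
  (fun l => ((INR j ^ 2 - INR j) * W fl j x (l * t) + 2 * INR j * W fl (S j) x (l * t) + W fl (S (S j)) x (l * t)) / l ^ 2)
  1 l (4 * (Dj j * B))) as T. cbv beta in T.
replace ((INR j * W fl j x (1 * t) + W fl (S j) x (1 * t)) / 1) with (INR j * W fl j x t + W fl (S j) x t) in T by (rewrite Rmult_1_l; field).
rewrite Rmult_1_l in T. apply T. clear T. intros z Hz.
assert (Hz' : 1/2 <= z).
{ revert Hz Hl. unfold Rmin, Rmax, Rabs. destruct Rle_dec, Rcase_abs; lra. }
assert (Hz0 : z <> 0) by lra.
split; [apply W_dscale; auto|]. split.
- pose proof (W_dscale fl j x t z Hz0) as D1. pose proof (W_dscale fl (S j) x t z Hz0) as D2.
  assert (Q : forall F G F' G' : R -> R, is_derive F z (F' z) -> is_derive G z (G' z) ->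
    is_derive (fun l => (INR j * F l + G l) / l) z ((INR j * F' z + G' z) / z - (INR j * F z + G z) / z ^ 2)).
  { intros F G F' G' DF DG. auto_derive; [repeat split; try (eexists; eauto); auto|]. der DF; der DG. field. auto. }
  specialize (Q _ _ (fun z => _) (fun z => _) D1 D2). cbv beta in Q.
  match type of Q with is_derive _ _ ?l => match goal with |- is_derive _ _ ?k => replace k with l; [exact Q|] end end.
  rewrite S_INR. field. auto.
- unfold Rdiv. rewrite Rabs_mult, Rmult_comm, (Rabs_pos_eq (/ z ^ 2)).
  2:{ apply Rlt_le, Rinv_0_lt_compat. nra. }
  assert (/ z ^ 2 <= 4).
  { replace 4 with (/ (1/4)) by field. apply Rinv_le_contravar; nra. }
  apply Rmult_le_compat; auto; try apply Rabs_pos.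
  { apply Rlt_le, Rinv_0_lt_compat. nra. }
  assert (Hzt : 0 <= z * t) by (apply Rmult_le_pos; lra).
  pose proof (W_bound fl j B V H x (z*t) Hx Hzt) as B0.
  pose proof (W_bound fl (S j) B V H x (z*t) Hx Hzt) as B1.
  pose proof (W_bound fl (S (S j)) B V H x (z*t) Hx Hzt) as B2.
  pose proof (pos_INR j) as Pj.
  unfold Dj. eapply Rle_trans; [apply Rabs_triang|]. rewrite (Rmult_plus_distr_r _ (Cj (S (S j)))).
  apply Rplus_le_compat; auto. eapply Rle_trans; [apply Rabs_triang|]. rewrite Rmult_plus_distr_r.
  apply Rplus_le_compat; rewrite Rabs_mult, Rmult_assoc; apply Rmult_le_compat; auto; try apply Rabs_pos.
  + unfold Rabs; destruct Rcase_abs; nra.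
  + rewrite Rabs_pos_eq; lra.
Qed.

(** * Odd polynomials as sums of eigenfunctions *)

Lemma is_derive_scal_pow (c : R) (k n : nat) (x l : R) : n = S k -> l = c * INR n * x ^ k -> is_derive (fun x => c * x ^ n) x l.
Proof.
intros -> ->. rewrite Rmult_assoc. apply is_derive_scal.
replace (INR (S k) * x ^ k) with (INR (S k) * 1 * x ^ pred (S k)) by (simpl pred; ring).
apply (is_derive_pow (fun x => x) (S k) x 1). apply (is_derive_id (K := R_AbsRing)).
Qed.

(** The eigenvalue N(N+3) of spherical harmonics of degree N = 2n+1 on S^4. *)
Definition evn n := (2 * INR n + 1) * (2 * INR n + 4).

(* Triangular inversion: [x^(2n+1)] is an eigenfunction plus lower eigenfunctions. *)
Lemma monomial_span n : exists fl : list (R * mode), valid fl /\ (forall c m, In (c, m) fl -> lam m < evn (S n)) /\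
  forall x, x ^ (2 * n + 1) = ls (fun c m => c * e0 m x) fl.
Proof.
induction n as [|n IH].
- exists ((1, Mode 4 (fun x => x) (fun _ => 1) (fun _ => 0) (fun _ => 0)) :: nil). split; [|split].
  + constructor; [|constructor]. constructor; simpl; intros; try lra; auto_derive; auto; ring.
  + intros c m [[= <- <-]|[]]. unfold evn. simpl. lra.
  + intros x. simpl. ring.
- destruct IH as [fl [V [L Ex]]].
  set (N := INR (2 * S n + 1)).
  assert (EN : N = 2 * INR n + 3) by (unfold N; replace (2 * S n + 1)%nat with (n + n + 3)%nat by lia; rewrite !plus_INR; simpl; ring).
  assert (Ev : evn (S n) = N * (N + 3)) by (unfold evn; rewrite S_INR, EN; ring).
  assert (Pn : 0 <= INR n) by apply pos_INR.
  (* The operator sends x^N to N(N-1) x^(N-2) - N(N+3) x^N. The remainder x^(N-2) is already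
     expanded, and dividing each term by its spectral gap removes it; the strict bound on [lam]
     keeps the gaps nonzero. *)
  set (b := fun (c : R) m => N * (N - 1) * c / (evn (S n) - lam m)).
  assert (Pm : forall x, x ^ (2 * S n + 1) = x ^ 2 * x ^ (2 * n + 1)).
  { intros x. rewrite <- pow_add. f_equal. lia. }
  set (m0 := Mode (evn (S n)) (fun x => x ^ (2 * S n + 1) - ls (fun c m => b c m * e0 m x) fl)
    (fun x => N * x ^ (2 * n + 2) - ls (fun c m => b c m * e1 m x) fl)
    (fun x => N * (N - 1) * x ^ (2 * n + 1) - ls (fun c m => b c m * e2 m x) fl)
    (fun x => N * (N - 1) * (N - 2) * x ^ (2 * n) - ls (fun c m => b c m * e3 m x) fl)).
  exists ((1, m0) :: map (fun cm => (b (fst cm) (snd cm), snd cm)) fl).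
  assert (S1 : forall (p : R -> R) (p' : R -> R) (e e' : mode -> R -> R) x, is_derive p x (p' x) ->
     (forall c m, In (c, m) fl -> is_derive (e m) x (e' m x)) ->
     is_derive (fun x => p x - ls (fun c m => b c m * e m x) fl) x (p' x - ls (fun c m => b c m * e' m x) fl)).
  { intros p p' e e' x Hp He. apply (is_derive_minus (V:=R_NormedModule)); auto.
    apply (ls_derive (fun c m x => b c m * e m x)). intros c m I. apply is_derive_scal. exact (He c m I). }
  split; [|split].
  + constructor; [|apply (valid_map b); auto]. constructor; simpl snd.
    * simpl. rewrite Ev. nra.
    * intros x. apply (S1 (fun x => x ^ (2 * S n + 1)) (fun x => N * x ^ (2 * n + 2))).
      -- apply is_derive_ext with (fun x => 1 * x ^ (2 * S n + 1)); [intros; apply Rmult_1_l|].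
         apply is_derive_scal_pow with (2 * n + 2)%nat; [lia|]. fold N. ring.
      -- intros c m I. apply (e0_der m (valid_in _ _ _ V I)).
    * intros x. apply (S1 (fun x => N * x ^ (2 * n + 2)) (fun x => N * (N - 1) * x ^ (2 * n + 1))).
      -- apply is_derive_scal_pow with (2 * n + 1)%nat; [lia|].
         replace (INR (2 * n + 2)) with (N - 1); [ring|]. rewrite EN. replace (2 * n)%nat with (n + n)%nat by lia. rewrite !plus_INR; simpl; ring.
      -- intros c m I. apply (e1_der m (valid_in _ _ _ V I)).
    * intros x. apply (S1 (fun x => N * (N - 1) * x ^ (2 * n + 1)) (fun x => N * (N - 1) * (N - 2) * x ^ (2 * n))).
      -- apply is_derive_scal_pow with (2 * n)%nat; [lia|].
         replace (INR (2 * n + 1)) with (N - 2); [ring|]. rewrite EN. replace (2 * n)%nat with (n + n)%nat by lia. rewrite !plus_INR; simpl; ring.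
      -- intros c m I. apply (e2_der m (valid_in _ _ _ V I)).
    * intros x. unfold m0; cbn [e0 e1 e2 lam].
      assert (Q : (1 - x ^ 2) * ls (fun c m => b c m * e2 m x) fl - 4 * x * ls (fun c m => b c m * e1 m x) fl
         = N * (N - 1) * ls (fun c m => c * e0 m x) fl - evn (S n) * ls (fun c m => b c m * e0 m x) fl).
      { rewrite !ls_scal, !ls_minus. apply ls_ext. intros c m I.
        pose proof (e_ode m (valid_in _ _ _ V I) x) as O. pose proof (L c m I).
        replace ((1 - x ^ 2) * (b c m * e2 m x) - 4 * x * (b c m * e1 m x)) with (b c m * (- lam m * e0 m x)) by (rewrite <- O; ring).
        unfold b. field. lra. }
      rewrite <- Ex in Q. rewrite Pm in *. rewrite Ev in *.
      replace (x ^ (2 * n + 2)) with (x * x ^ (2 * n + 1)) by (replace (2 * n + 2)%nat with (S (2 * n + 1)) by lia; reflexivity).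
      revert Q. generalize (ls (fun c m => b c m * e2 m x) fl) (ls (fun c m => b c m * e1 m x) fl)
       (ls (fun c m => b c m * e0 m x) fl). intros u v w Q.
      replace ((1 - x ^ 2) * (N * (N - 1) * x ^ (2 * n + 1) - u) - 4 * x * (N * (x * x ^ (2 * n + 1)) - v)) with
       ((1 - x ^ 2) * (N * (N - 1) * x ^ (2 * n + 1)) - 4 * x * (N * (x * x ^ (2 * n + 1))) - ((1 - x ^ 2) * u - 4 * x * v)) by ring.
      rewrite Q. ring.
    * intros x. unfold m0; cbn [e0].
      replace (ls (fun c m => b c m * e0 m (- x)) fl) with (-1 * ls (fun c m => b c m * e0 m x) fl).
      2:{ rewrite ls_scal. apply ls_ext. intros c m I. rewrite (e_odd m (valid_in _ _ _ V I)). ring. }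
      replace ((- x) ^ (2 * S n + 1)) with (- x ^ (2 * S n + 1)); [ring|].
      rewrite !pow_add, !pow_mult. replace ((- x) ^ 2) with (x ^ 2) by ring. ring.
  + assert (evn (S n) < evn (S (S n))) by (unfold evn; rewrite !S_INR; nra).
    intros c m [[= <- <-]|I]; auto.
    apply in_map_iff in I. destruct I as [[c' m'] [[= <- <-] I]]. specialize (L _ _ I). simpl. lra.
  + intros x. change (x ^ (2 * S n + 1) = 1 * (x ^ (2 * S n + 1) - ls (fun c m => b c m * e0 m x) fl)
      + ls (fun c m => c * e0 m x) (map (fun cm => (b (fst cm) (snd cm), snd cm)) fl)).
    rewrite (ls_map b (fun c m => c * e0 m x)). ring.
Qed.

Definition odd_poly f := exists fl : list (R * mode), valid fl /\ forall x, f x = ls (fun c m => c * e0 m x) fl.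

Lemma odd_poly_minus f g : odd_poly f -> odd_poly g -> odd_poly (fun x => f x - g x).
Proof.
intros [fl [V H]] [gl [V' H']].
exists (fl ++ map (fun cm => (-1 * fst cm, snd cm)) gl). split.
- apply valid_app; auto. apply (valid_map (fun c (m : mode) => -1 * c)); auto.
- intros x. rewrite ls_app, H, H', (ls_map (fun c (m : mode) => -1 * c) (fun c m => c * e0 m x)).
  unfold Rminus. f_equal. replace (- ls (fun c m => c * e0 m x) gl) with (-1 * ls (fun c m => c * e0 m x) gl) by ring.
  rewrite ls_scal. apply ls_ext. intros. ring.
Qed.

(** Induction through (1-x^2)^(l+1) = (1-x^2)^l - x^2 (1-x^2)^l. These are x times the products of
    which Bernstein polynomials in x^2 are made. *)
Lemma odd_poly_bernstein l j : odd_poly (fun x => x * ((x ^ 2) ^ j * (1 - x ^ 2) ^ l)).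
Proof.
revert j; induction l as [|l IH]; intros j.
- destruct (monomial_span j) as [fl [V [_ H]]]. exists fl; split; auto. intros x. rewrite <- H, pow_add, pow_mult. ring.
- destruct (odd_poly_minus _ _ (IH j) (IH (S j))) as [fl [V H]]. exists fl; split; auto. intros x. rewrite <- H. simpl. ring.
Qed.

(** * Density of the odd polynomials *)

(** Makes kr the polar angle on a hemisphere: pole at r = 0, equator at r = 1. *)
Definition kk := PI / 2.
Lemma kk_pos : 0 < kk.
Proof. unfold kk. pose proof PI_RGT_0. lra. Qed.
Lemma cos_kk1 : cos (kk * 1) = 0.
Proof. unfold kk. rewrite Rmult_1_r. apply cos_PI2. Qed.
Lemma cos_kk_in r : 0 <= r <= 1 -> 0 <= cos (kk * r) <= 1.
Proof.
intros H. pose proof kk_pos. split; [|apply COS_bound].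
apply cos_ge_0; unfold kk in *; nra.
Qed.

(* Bernstein polynomials through de Casteljau's recursion. *)
Fixpoint bern (n : nat) (a : nat -> R) (X : R) : R :=
  match n with O => a O | S n => (1 - X) * bern n a X + X * bern n (fun i => a (S i)) X end.

Lemma bern_le n a b X : 0 <= X <= 1 -> (forall i, (i <= n)%nat -> a i <= b i) -> bern n a X <= bern n b X.
Proof.
intros HX. revert a b. induction n as [|n IH]; simpl; intros a b H; auto.
assert (bern n a X <= bern n b X) by (apply IH; intros; apply H; lia).
assert (bern n (fun i => a (S i)) X <= bern n (fun i => b (S i)) X) by (apply IH; intros; apply H; lia).
nra.
Qed.

Lemma bern_ext n a b X : (forall i, (i <= n)%nat -> a i = b i) -> bern n a X = bern n b X.
Proof.
revert a b. induction n as [|n IH]; simpl; intros a b H; auto.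
rewrite (IH a b), (IH (fun i => a (S i)) (fun i => b (S i))); auto; intros; apply H; lia.
Qed.

Lemma bern_lin n a b c d X : bern n (fun i => c * a i + d * b i) X = c * bern n a X + d * bern n b X.
Proof. revert a b. induction n as [|n IH]; simpl; intros a b; auto. rewrite !IH. ring. Qed.

Lemma bern_moments n X : bern n (fun _ => 1) X = 1 /\ bern n INR X = INR n * X /\
  bern n (fun i => INR i ^ 2) X = INR n ^ 2 * X ^ 2 + INR n * X * (1 - X).
Proof.
assert (H1 : forall n, bern n (fun _ => 1) X = 1) by (intros m; induction m; simpl; [auto|]; rewrite IHm; ring).
split; [auto|]. induction n as [|n [I1 I2]]; [simpl; split; ring|]. cbn [bern].
replace (bern n (fun i => INR (S i)) X) with (1 * bern n INR X + 1 * bern n (fun _ => 1) X).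
2:{ rewrite <- bern_lin. apply bern_ext. intros. rewrite S_INR. ring. }
replace (bern n (fun i => INR (S i) ^ 2) X) with
  (1 * bern n (fun i => 1 * INR i ^ 2 + 2 * INR i) X + 1 * bern n (fun _ => 1) X).
2:{ rewrite <- bern_lin. apply bern_ext. intros. rewrite S_INR. ring. }
rewrite (bern_lin n (fun i => INR i ^ 2) INR), H1, I1, I2, S_INR. split; ring.
Qed.

Lemma bern_variance n X : (0 < n)%nat -> bern n (fun i => (INR i / INR n - X) ^ 2) X = X * (1 - X) / INR n.
Proof.
intros Hn. assert (INR n <> 0) by (apply not_0_INR; lia).
destruct (bern_moments n X) as [M0 [M1 M2]].
rewrite (bern_ext n _ (fun i => / INR n ^ 2 * INR i ^ 2 + 1 * ((- 2 * X / INR n) * INR i + X ^ 2 * 1))).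
2:{ intros. field. auto. }
rewrite (bern_lin n (fun i => INR i ^ 2) (fun i => (- 2 * X / INR n) * INR i + X ^ 2 * 1)).
rewrite (bern_lin n INR (fun _ => 1)), M0, M1, M2. field. auto.
Qed.

(** Chebyshev's argument: the quadratic allowance averages to K times the variance X(1-X)/n of the
    binomial law. *)
Lemma bern_error n a c X eps K : (0 < n)%nat -> 0 <= X <= 1 -> 0 <= K ->
  (forall i, (i <= n)%nat -> Rabs (a i - c) <= eps + K * (INR i / INR n - X) ^ 2) ->
  Rabs (bern n a X - c) <= eps + K / INR n.
Proof.
intros Hn HX HK H. assert (Pn : 0 < INR n) by (apply lt_0_INR; auto).
pose proof (bern_variance n X Hn) as Va. destruct (bern_moments n X) as [M0 _].
assert (E1 : forall s, bern n (fun i => c * 1 + s * (eps * 1 + K * (INR i / INR n - X) ^ 2)) X = c + s * (eps + K * (X * (1 - X) / INR n))).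
{ intros s. rewrite (bern_lin n (fun _ => 1) (fun i => eps * 1 + K * (INR i / INR n - X) ^ 2)).
  rewrite (bern_lin n (fun _ => 1) (fun i => (INR i / INR n - X) ^ 2)), M0, Va. ring. }
assert (Q : K * (X * (1 - X) / INR n) <= K / INR n).
{ unfold Rdiv. apply Rmult_le_compat_l; auto. rewrite <- (Rmult_1_l (/ INR n)) at 2.
  apply Rmult_le_compat_r; [apply Rlt_le, Rinv_0_lt_compat; auto|nra]. }
assert (L := bern_le n (fun i => c * 1 + -1 * (eps * 1 + K * (INR i / INR n - X) ^ 2)) a X HX).
assert (L' := bern_le n a (fun i => c * 1 + 1 * (eps * 1 + K * (INR i / INR n - X) ^ 2)) X HX).
rewrite E1 in L, L'.
assert (c + -1 * (eps + K * (X * (1 - X) / INR n)) <= bern n a X).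
{ apply L. intros i Hi. specialize (H i Hi). apply Rabs_le_between in H. lra. }
assert (bern n a X <= c + 1 * (eps + K * (X * (1 - X) / INR n))).
{ apply L'. intros i Hi. specialize (H i Hi). apply Rabs_le_between in H. lra. }
apply Rabs_le_between. lra.
Qed.

(** Finite sums of separated functions: the sources for which Duhamel's integral can be computed
    mode by mode. *)
Definition tspan (f : R -> R -> R) := exists tf : list ((R -> R) * mode), valid tf /\
  (forall h m, In (h, m) tf -> cont1 h) /\
  forall r t, f r t = ls (fun h m => h t * e0 m (cos (kk * r))) tf.

Lemma tspan_plus f g : tspan f -> tspan g -> tspan (fun r t => f r t + g r t).
Proof.
intros [fl [V [C H]]] [gl [V' [C' H']]]. exists (fl ++ gl). split; [|split].
- apply valid_app; auto.
- intros h m I. apply in_app_or in I. destruct I; eauto.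
- intros. rewrite ls_app, H, H'. auto.
Qed.

Lemma tspan_ext f g : (forall r t, f r t = g r t) -> tspan f -> tspan g.
Proof. intros H [fl [V [C E]]]. exists fl. split; [|split]; auto. intros. rewrite <- H. auto. Qed.

(** The factor cos(kr) supplies oddness; the Bernstein polynomial is taken in x^2, with coefficients
    depending on time. The powers [j] and [l] let de Casteljau's recursion close. *)
Lemma tspan_bern n h j l : (forall i, cont1 (h i)) ->
  tspan (fun r t => cos (kk * r) * ((cos (kk * r) ^ 2) ^ j * (1 - cos (kk * r) ^ 2) ^ l) * bern n (fun i => h i t) (cos (kk * r) ^ 2)).
Proof.
revert h j l. induction n as [|n IH]; intros h j l Ch; cbn [bern].
- destruct (odd_poly_bernstein l j) as [fl [V H]].
  exists (map (fun cm => ((fun t => fst cm * h O t), snd cm)) fl). split; [|split].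
  + apply (valid_map (fun c (m : mode) t => c * h O t)); auto.
  + intros g m I. apply in_map_iff in I. destruct I as [[c m'] [[= <- <-] I]].
    pose proof (Ch O). intros x. ct.
  + intros r t. rewrite (ls_map (fun c (m : mode) t => c * h O t) (fun h m => h t * e0 m (cos (kk * r)))).
    rewrite H, Rmult_comm, ls_scal. apply ls_ext. intros. ring.
- eapply tspan_ext; [|apply (tspan_plus _ _ (IH h j (S l) Ch) (IH (fun i => h (S i)) (S j) l (fun i => Ch (S i))))].
  intros r t. simpl. ring.
Qed.

(** Bernstein nodes are spaced in X = cos(kr)^2, whereas the modulus of continuity is in r; this
    turns distance in r into distance in X. The cosines differ by at least 2 sin(kd/2)^2, and their
    sum is at least their difference. *)
Lemma cos2_gap d r s : 0 < d <= 1 -> 0 <= r <= 1 -> 0 <= s <= 1 -> d <= Rabs (r - s) ->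
  4 * sin (kk * d / 2) ^ 4 <= Rabs (cos (kk * r) ^ 2 - cos (kk * s) ^ 2) /\ 0 < sin (kk * d / 2).
Proof.
intros Hd Hr Hs Hrs. pose proof kk_pos as Hk. pose proof PI_RGT_0.
assert (HkP : kk = PI / 2) by auto.
assert (S0 : 0 < sin (kk * d / 2)) by (apply sin_gt_0; nra).
split; auto.
assert (G : forall r s, 0 <= r <= 1 -> 0 <= s <= 1 -> d <= r - s -> 2 * sin (kk * d / 2) ^ 2 <= cos (kk * s) - cos (kk * r)).
{ clear r s Hr Hs Hrs. intros r s Hr Hs Hrs. rewrite form2.
  assert (sin (kk * d / 2) <= sin ((kk * s + kk * r) / 2)) by (apply sin_incr_1; nra).
  assert (sin (kk * d / 2) <= sin ((kk * r - kk * s) / 2)) by (apply sin_incr_1; nra).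
  replace ((kk * s - kk * r) / 2) with (- ((kk * r - kk * s) / 2)) by field. rewrite sin_neg. nra. }
assert (G2 : 2 * sin (kk * d / 2) ^ 2 <= Rabs (cos (kk * r) - cos (kk * s))).
{ revert Hrs. unfold Rabs at 1. destruct Rcase_abs; intros.
  - specialize (G s r Hs Hr ltac:(lra)). rewrite Rabs_pos_eq; nra.
  - specialize (G r s Hr Hs ltac:(lra)). rewrite Rabs_minus_sym, Rabs_pos_eq; nra. }
pose proof (cos_kk_in r Hr). pose proof (cos_kk_in s Hs).
replace (cos (kk * r) ^ 2 - cos (kk * s) ^ 2) with ((cos (kk * r) - cos (kk * s)) * (cos (kk * r) + cos (kk * s))) by ring.
rewrite Rabs_mult. rewrite (Rabs_pos_eq (cos (kk * r) + cos (kk * s))) by lra.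
assert (Rabs (cos (kk * r) - cos (kk * s)) <= cos (kk * r) + cos (kk * s)) by (unfold Rabs; destruct Rcase_abs; lra).
replace (4 * sin (kk * d / 2) ^ 4) with ((2 * sin (kk * d / 2) ^ 2) * (2 * sin (kk * d / 2) ^ 2)) by ring.
apply Rmult_le_compat; nra.
Qed.

Lemma tspan_dense_aux h T eps : 0 <= T -> cont2 h -> 0 < eps -> exists f, tspan f /\
  forall r t, 0 <= r <= 1 -> 0 <= t <= T -> Rabs (f r t - cos (kk * r) * h r t) <= eps.
Proof.
intros HT C He.
destruct (cont2_unif h 0 1 0 T (eps / 2) C ltac:(lra)) as [d' [Hd' U]].
set (d := Rmin d' 1). assert (Hd : 0 < d <= 1 /\ d <= d') by (unfold d, Rmin; destruct Rle_dec; lra).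
destruct (cont2_bounded h 0 1 0 T C) as [M [HM B]].
destruct (cos2_gap d 0 1) as [_ S0]; try lra. { rewrite Rminus_0_l, Rabs_Ropp, Rabs_R1. lra. }
set (eta := 4 * sin (kk * d / 2) ^ 4) in *. assert (Heta : 0 < eta).
{ unfold eta. apply Rmult_lt_0_compat; [lra|]. apply pow_lt; auto. }
(* Chosen so that, at nodes farther than d, the trivial bound 2M lies below [K] times the squared
   gap in X. *)
set (K := 2 * M / eta ^ 2).
assert (HK : 0 < K) by (apply Rdiv_lt_0_compat; [lra|apply pow_lt; auto]).
destruct (archimed_cor1 (eps / 2 / K)) as [n [Hn1 Hn]]; [apply Rdiv_lt_0_compat; lra|].
pose proof kk_pos as Hk.
(* The point of [0,1] at which cos(kr)^2 equals i/n. *)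
set (node := fun i : nat => acos (sqrt (INR i / INR n)) / kk).
assert (Pn : 0 < INR n) by (apply lt_0_INR; auto).
assert (Nd : forall i, (i <= n)%nat -> 0 <= node i <= 1 /\ cos (kk * node i) ^ 2 = INR i / INR n).
{ intros i Hi. assert (0 <= INR i / INR n <= 1).
  { split; [apply Rdiv_le_0_compat; auto; apply pos_INR|].
    apply Rmult_le_reg_r with (INR n); auto. unfold Rdiv. rewrite Rmult_assoc, Rinv_l by lra. apply le_INR in Hi. lra. }
  assert (0 <= sqrt (INR i / INR n) <= 1).
  { split; [apply sqrt_pos|]. rewrite <- sqrt_1. apply sqrt_le_1; lra. }
  unfold node. replace (kk * (acos (sqrt (INR i / INR n)) / kk)) with (acos (sqrt (INR i / INR n))) by (field; lra).
  rewrite cos_acos by lra. split; [|simpl; rewrite Rmult_1_r; apply sqrt_sqrt; lra].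
  destruct (acos_bound (sqrt (INR i / INR n))).
  assert (acos (sqrt (INR i / INR n)) <= kk).
  { apply Rnot_lt_le. intros L. pose proof PI_RGT_0. unfold kk in L.
    assert (cos (acos (sqrt (INR i / INR n))) < 0) by (apply cos_lt_0; lra).
    rewrite cos_acos in *; lra. }
  split; [apply Rdiv_le_0_compat; lra|]. apply Rmult_le_reg_r with kk; auto.
  unfold Rdiv. rewrite Rmult_assoc, Rinv_l; lra. }
eexists. split.
- apply (tspan_bern n (fun i t => h (node i) t) 0 0). intros i. apply cont2_sec_t. auto.
- intros r t Hr Ht. cbv beta. simpl ((_ ^ 2) ^ 0). simpl ((1 - _) ^ 0).
  pose proof (cos_kk_in r Hr) as Hc. set (x := cos (kk * r)) in *.
  replace (x * (1 * 1) * bern n (fun i => h (node i) t) (x ^ 2) - x * h r t) with (x * (bern n (fun i => h (node i) t) (x ^ 2) - h r t)) by ring.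
  rewrite Rabs_mult, (Rabs_pos_eq x) by lra.
  assert (Rabs (bern n (fun i => h (node i) t) (x ^ 2) - h r t) <= eps / 2 + K / INR n).
  { apply bern_error; auto; try lra; [nra|]. intros i Hi. destruct (Nd i Hi) as [N1 N2].
    destruct (Rlt_le_dec (Rabs (node i - r)) d) as [L|L].
    - assert (Rabs (h (node i) t - h r t) < eps / 2) by (apply U; auto; try lra; rewrite Rminus_diag, Rabs_R0; lra).
      pose proof (pow2_ge_0 (INR i / INR n - x ^ 2)). nra.
    - destruct (cos2_gap d (node i) r) as [Gp _]; auto; try lra. fold eta in Gp. rewrite N2 in Gp. fold x in Gp.
      pose proof (B (node i) t ltac:(auto) ltac:(auto)). pose proof (B r t ltac:(auto) ltac:(auto)).
      assert (Rabs (h (node i) t - h r t) <= 2 * M).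
      { unfold Rminus. eapply Rle_trans; [apply Rabs_triang|]. rewrite Rabs_Ropp. lra. }
      assert (2 * M <= K * (INR i / INR n - x ^ 2) ^ 2); [|lra].
      rewrite <- (pow2_abs (INR i / INR n - x ^ 2)).
      replace (2 * M) with (K * eta ^ 2) by (unfold K; field; lra).
      apply Rmult_le_compat_l; [lra|]. apply pow_incr. lra. }
  assert (K / INR n <= eps / 2).
  { unfold Rdiv. apply Rmult_le_reg_l with (/ K); [apply Rinv_0_lt_compat; auto|].
    rewrite <- Rmult_assoc, Rinv_l by lra. unfold Rdiv in Hn1. lra. }
  pose proof (Rabs_pos (bern n (fun i => h (node i) t) (x ^ 2) - h r t)). nra.
Qed.

(** The preceding lemma reaches products cos(kr) h. A function vanishing at r = 1 is nearly of this
    form: multiplying it by x^2/(x^2 + d), x = cos(kr), changes little, because near r = 1 it is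
    small itself and elsewhere x is bounded below. *)
Lemma tspan_dense g T eps : 0 <= T -> cont2 g -> (forall t, 0 <= t -> g 1 t = 0) -> 0 < eps -> exists f, tspan f /\
  forall r t, 0 <= r <= 1 -> 0 <= t <= T -> Rabs (g r t - f r t) <= eps.
Proof.
intros HT C Hg He.
destruct (cont2_unif g 0 1 0 T (eps / 2) C ltac:(lra)) as [dl' [Hdl' U]].
set (dl := Rmin dl' 1). assert (Hdl : 0 < dl <= 1 /\ dl <= dl') by (unfold dl, Rmin; destruct Rle_dec; lra).
destruct (cont2_bounded g 0 1 0 T C) as [M [HM B]].
pose proof kk_pos as Hk. pose proof PI_RGT_0. assert (HkP : kk = PI / 2) by auto.
set (x0 := cos (kk * (1 - dl))).
assert (Hx0 : 0 < x0) by (apply cos_gt_0; nra).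
(* Makes M d / x0^2 equal to eps/2, the allowed error where x >= x0. *)
set (d := eps / 2 * x0 ^ 2 / M).
assert (Hd : 0 < d) by (apply Rdiv_lt_0_compat; auto; apply Rmult_lt_0_compat; [lra|apply pow_lt; auto]).
assert (Pd : forall x, x ^ 2 + d <> 0) by (intros x; pose proof (pow2_ge_0 x); lra).
destruct (tspan_dense_aux (fun r t => g r t * (cos (kk * r) / (cos (kk * r) ^ 2 + d))) T (eps / 2)) as [f [Tf Hf]]; auto; try lra.
{ intros p. apply cR_mult; [ct|]. apply cR_div; auto; ct. }
exists f. split; auto. intros r t Hr Ht. specialize (Hf r t Hr Ht). cbv beta in Hf.
set (x := cos (kk * r)) in *.
assert (Q : Rabs (g r t - x * (g r t * (x / (x ^ 2 + d)))) <= eps / 2).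
{ replace (g r t - x * (g r t * (x / (x ^ 2 + d)))) with (g r t * (d / (x ^ 2 + d))) by (field; apply Pd).
  pose proof (pow2_ge_0 x) as Px. assert (P1 : 0 < d / (x ^ 2 + d)) by (apply Rdiv_lt_0_compat; lra).
  assert (P2 : d / (x ^ 2 + d) <= 1).
  { apply Rmult_le_reg_r with (x ^ 2 + d); [lra|]. unfold Rdiv. rewrite Rmult_assoc, Rinv_l by auto. lra. }
  rewrite Rabs_mult, (Rabs_pos_eq (_ / _)) by lra.
  destruct (Rlt_le_dec (1 - dl) r) as [L|L].
  - assert (Rabs (g r t - g 1 t) < eps / 2).
    { apply U; auto; try lra; try (rewrite Rminus_diag, Rabs_R0; lra). unfold Rabs; destruct Rcase_abs; lra. }
    rewrite Hg, Rminus_0_r in H0 by lra. pose proof (Rabs_pos (g r t)). nra.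
  - assert (x0 <= x).
    { unfold x0, x. destruct (Req_dec r (1 - dl)) as [->|]; [lra|]. left. apply cos_decreasing_1; nra. }
    specialize (B r t Hr Ht).
    assert (d / (x ^ 2 + d) <= d / x0 ^ 2).
    { unfold Rdiv. apply Rmult_le_compat_l; [lra|]. apply Rinv_le_contravar; [apply pow_lt; auto|]. nra. }
    replace (eps / 2) with (M * (d / x0 ^ 2)) by (unfold d; field; lra).
    apply Rmult_le_compat; try lra. apply Rabs_pos. }
replace (g r t - f r t) with ((g r t - x * (g r t * (x / (x ^ 2 + d)))) - (f r t - x * (g r t * (x / (x ^ 2 + d))))) by ring.
eapply Rle_trans; [apply Rabs_triang|]. rewrite Rabs_Ropp. lra.
Qed.

(** * The Dirichlet semigroup *)

Lemma le_eps K x y : (forall eps, 0 < eps -> x <= y + K * eps) -> x <= y.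
Proof.
intros H. apply Rnot_lt_le. intros N.
assert (0 < Rabs K + 1) by (pose proof (Rabs_pos K); lra).
specialize (H ((x - y) / (2 * (Rabs K + 1))) ltac:(apply Rdiv_lt_0_compat; lra)).
assert (K * ((x - y) / (2 * (Rabs K + 1))) <= (x - y) / 2); [|lra].
replace ((x - y) / 2) with ((Rabs K + 1) * ((x - y) / (2 * (Rabs K + 1)))) by (field; lra).
apply Rmult_le_compat_r; [apply Rdiv_le_0_compat; lra|]. pose proof (Rle_abs K). lra.
Qed.

(** The factor [kk ^ 2] in time comes from the two derivatives in r of a function of cos(kr). *)
Definition V (fl : list (R * mode)) j r t := W fl j (cos (kk * r)) (kk ^ 2 * t).

(* The Dirichlet semigroup S on [0,1] and its scaled derivatives: [Psi j f r t = t^j (d/dt)^j (S(t) f)(r)].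
   Every flow whose initial value is b-close to f confines the value to an interval of radius [Cj j * b]. *)
Definition Psi j f r t := real (Lub_Rbar (fun z => exists fl b, valid fl /\
  (forall s, 0 <= s <= 1 -> Rabs (f s - V fl 0 s 0) <= b) /\ z = V fl j (cl r) (tp t) - Cj j * b)).

Definition X0 f := cont1 f /\ f 1 = 0.

Lemma V_minus fl gl j r t : V (fl ++ map (fun cm => (-1 * fst cm, snd cm)) gl) j r t = V fl j r t - V gl j r t.
Proof.
unfold V, W. rewrite ls_app.
rewrite (ls_map (fun c (m : mode) => -1 * c) (fun c m => c * (- lam m * (kk ^ 2 * t)) ^ j * exp (- lam m * (kk ^ 2 * t)) * e0 m (cos (kk * r)))).
unfold Rminus. f_equal.
match goal with |- _ = - ?x => replace (- x) with (-1 * x) by ring end.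
rewrite ls_scal. apply ls_ext. intros. ring.
Qed.

Lemma kk2_pos t : 0 <= t -> 0 <= kk ^ 2 * t.
Proof. intros. apply Rmult_le_pos; auto. apply pow2_ge_0. Qed.

Lemma V_W0 fl B : (forall r, 0 <= r <= 1 -> Rabs (V fl 0 r 0) <= B) -> forall x, 0 <= x <= 1 -> Rabs (W fl 0 x 0) <= B.
Proof.
intros H x Hx. pose proof kk_pos as Hk. pose proof PI_RGT_0. assert (HkP : kk = PI / 2) by auto.
specialize (H (acos x / kk)). unfold V in H.
replace (kk * (acos x / kk)) with (acos x) in H by (field; lra). rewrite cos_acos, Rmult_0_r in H by lra. apply H.
destruct (acos_bound x).
assert (acos x <= kk).
{ apply Rnot_lt_le. intros L. assert (cos (acos x) < 0) by (apply cos_lt_0; lra). rewrite cos_acos in *; lra. }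
split; [apply Rdiv_le_0_compat; lra|]. apply Rmult_le_reg_r with kk; auto. unfold Rdiv. rewrite Rmult_assoc, Rinv_l; lra.
Qed.

Lemma V_bound fl j B : valid fl -> (forall r, 0 <= r <= 1 -> Rabs (V fl 0 r 0) <= B) ->
  forall r t, 0 <= r <= 1 -> 0 <= t -> Rabs (V fl j r t) <= Cj j * B.
Proof. intros Va H r t Hr Ht. apply W_bound; auto; [apply V_W0; auto|apply cos_kk_in; auto|apply kk2_pos; auto]. Qed.

Lemma V_diff fl gl j b : valid fl -> valid gl -> (forall r, 0 <= r <= 1 -> Rabs (V fl 0 r 0 - V gl 0 r 0) <= b) ->
  forall r t, 0 <= r <= 1 -> 0 <= t -> Rabs (V fl j r t - V gl j r t) <= Cj j * b.
Proof.
intros Vf Vg H r t Hr Ht. rewrite <- V_minus. apply V_bound; auto.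
- apply valid_app; auto. apply (valid_map (fun c (m : mode) => -1 * c)); auto.
- intros. rewrite V_minus. auto.
Qed.

Lemma V_cont fl j : valid fl -> cont2 (V fl j).
Proof. intros Va p. unfold V. pose proof (W_cont fl j Va). ct. Qed.

Lemma V_1 fl j t : valid fl -> V fl j 1 t = 0.
Proof.
intros Va. unfold V. rewrite cos_kk1. pose proof (W_odd fl j 0 (kk ^ 2 * t) Va) as H.
rewrite Ropp_0 in H. lra.
Qed.

Lemma V_S0 fl j r : V fl (S j) r 0 = 0.
Proof.
unfold V, W. rewrite Rmult_0_r. transitivity (0 * ls (fun (c : R) (m : mode) => 0) fl); [|ring].
rewrite ls_scal. apply ls_ext. intros. simpl. ring.
Qed.

Lemma V_approx f eps : X0 f -> 0 < eps -> exists fl, valid fl /\ forall s, 0 <= s <= 1 -> Rabs (f s - V fl 0 s 0) <= eps.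
Proof.
intros [Cf F1] He.
destruct (tspan_dense (fun r _ => f r) 0 eps) as [g [[tf [Va [_ E]]] H]]; auto; try lra.
{ intros p. ct. }
exists (map (fun hm => (fst hm 0, snd hm)) tf). split.
- apply (valid_map (fun h (m : mode) => h 0)); auto.
- intros s Hs. specialize (H s 0 Hs ltac:(lra)). rewrite E in H. unfold V, W.
  rewrite (ls_map (fun h (m : mode) => h 0) (fun c m => c * (- lam m * (kk ^ 2 * 0)) ^ 0 * exp (- lam m * (kk ^ 2 * 0)) * e0 m (cos (kk * s)))).
  erewrite ls_ext; [exact H|]. intros. cbv beta. rewrite !Rmult_0_r, exp_0. simpl. ring.
Qed.

Lemma X0_bounded f : cont1 f -> exists b, 0 < b /\ forall s, 0 <= s <= 1 -> Rabs (f s) <= b.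
Proof.
intros C. destruct (cont2_bounded (fun r _ => f r) 0 1 0 0) as [M [HM B]]; [intros p; ct|].
exists M. split; auto. intros s Hs. apply (B s 0); lra.
Qed.

(** The difference bound for flows makes any two of the confining intervals meet, so the supremum of
    the left endpoints lies in each of them. *)
Lemma Psi_close f j fl b r t : cont1 f -> valid fl -> (forall s, 0 <= s <= 1 -> Rabs (f s - V fl 0 s 0) <= b) ->
  Rabs (Psi j f r t - V fl j (cl r) (tp t)) <= Cj j * b.
Proof.
intros Cf Va H. unfold Psi.
set (P := fun z => _).
assert (Q : forall fl gl b b', valid fl -> valid gl -> (forall s, 0 <= s <= 1 -> Rabs (f s - V fl 0 s 0) <= b) ->
   (forall s, 0 <= s <= 1 -> Rabs (f s - V gl 0 s 0) <= b') -> V gl j (cl r) (tp t) - Cj j * b' <= V fl j (cl r) (tp t) + Cj j * b).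
{ clear fl b Va H. intros fl gl b b' Vf Vg Hf Hg.
  assert (D : Rabs (V gl j (cl r) (tp t) - V fl j (cl r) (tp t)) <= Cj j * (b + b')).
  { apply V_diff; auto. intros s Hs. specialize (Hf s Hs). specialize (Hg s Hs).
    apply Rabs_le_between in Hf. apply Rabs_le_between in Hg. apply Rabs_le_between. lra. }
  apply Rabs_le_between in D. lra. }
destruct (Lub_Rbar_correct P) as [U1 U2].
assert (A1 : Rbar_le (V fl j (cl r) (tp t) - Cj j * b) (Lub_Rbar P)) by (apply U1; exists fl, b; auto).
assert (A2 : Rbar_le (Lub_Rbar P) (V fl j (cl r) (tp t) + Cj j * b)).
{ apply U2. intros z [gl [b' [Vg [Hg ->]]]]. simpl. apply Q; auto. }
destruct (Lub_Rbar P); simpl in *; try contradiction. apply Rabs_le_between. lra.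
Qed.

Lemma Psi_close0 f j eps : X0 f -> 0 < eps -> exists fl, valid fl /\ (forall s, 0 <= s <= 1 -> Rabs (f s - V fl 0 s 0) <= eps) /\
  forall i r t, (i <= j)%nat -> 0 <= r <= 1 -> 0 <= t -> Rabs (Psi i f r t - V fl i r t) <= Cj i * eps.
Proof.
intros [Cf F1] He. destruct (V_approx f eps (conj Cf F1) He) as [fl [Va H]]. exists fl. split; [|split]; auto.
intros i r t _ Hr Ht. pose proof (Psi_close f i fl eps r t Cf Va H) as Q. rewrite cl_id, tp_id in Q by auto. auto.
Qed.

(** Like most of the properties below, this is exact for flows; approximating the data transfers it
    up to a multiple of eps, which [le_eps] removes. *)
Lemma Psi_lin f g a b j r t : X0 f -> X0 g -> Psi j (fun s => a * f s + b * g s) r t = a * Psi j f r t + b * Psi j g r t.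
Proof.
intros Hf Hg. apply Rminus_diag_uniq, Rabs_eq_0, Rle_antisym; [|apply Rabs_pos].
apply le_eps with (K := 2 * Cj j * (Rabs a + Rabs b)). intros eps He.
destruct (V_approx f eps Hf He) as [fl [Vf Ef]]. destruct (V_approx g eps Hg He) as [gl [Vg Eg]].
set (hl := map (fun cm => (a * fst cm, snd cm)) fl ++ map (fun cm => (b * fst cm, snd cm)) gl).
assert (EV : forall j r t, V hl j r t = a * V fl j r t + b * V gl j r t).
{ clear. intros j r t. unfold hl, V, W. rewrite ls_app.
  rewrite (ls_map (fun c (m : mode) => a * c) (fun c m => c * (- lam m * (kk ^ 2 * t)) ^ j * exp (- lam m * (kk ^ 2 * t)) * e0 m (cos (kk * r)))).
  rewrite (ls_map (fun c (m : mode) => b * c) (fun c m => c * (- lam m * (kk ^ 2 * t)) ^ j * exp (- lam m * (kk ^ 2 * t)) * e0 m (cos (kk * r)))).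
  rewrite !ls_scal. f_equal; apply ls_ext; intros; ring. }
assert (TT : forall x x' y y' e, Rabs (x - x') <= e -> Rabs (y - y') <= e ->
   Rabs ((a * x + b * y) - (a * x' + b * y')) <= (Rabs a + Rabs b) * e).
{ intros x x' y y' e A B. replace (_ - _) with (a * (x - x') + b * (y - y')) by ring.
  eapply Rle_trans; [apply Rabs_triang|]. rewrite !Rabs_mult.
  pose proof (Rabs_pos a). pose proof (Rabs_pos b). nra. }
pose proof (Psi_close f j fl eps r t (proj1 Hf) Vf Ef) as Pf.
pose proof (Psi_close g j gl eps r t (proj1 Hg) Vg Eg) as Pg.
assert (Ph : Rabs (Psi j (fun s => a * f s + b * g s) r t - V hl j (cl r) (tp t)) <= Cj j * ((Rabs a + Rabs b) * eps)).
{ apply Psi_close.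
  - destruct Hf as [Cf _], Hg as [Cg _]. intros x. ct.
  - apply valid_app; [apply (valid_map (fun c (m : mode) => a * c))|apply (valid_map (fun c (m : mode) => b * c))]; auto.
  - intros s Hs. rewrite EV. apply TT; auto. }
rewrite EV in Ph. pose proof (TT _ _ _ _ _ Pf Pg) as Pfg.
apply Rabs_le_between in Ph. apply Rabs_le_between in Pfg. apply Rabs_le_between. lra.
Qed.

Lemma Psi_dist f g j b r t : X0 f -> cont1 g -> (forall s, 0 <= s <= 1 -> Rabs (f s - g s) <= b) ->
  Rabs (Psi j f r t - Psi j g r t) <= Cj j * b.
Proof.
intros Hf Cg H. apply le_eps with (K := 2 * Cj j). intros eps He.
destruct (V_approx f eps Hf He) as [fl [Vf Ef]].
pose proof (Psi_close f j fl eps r t (proj1 Hf) Vf Ef) as Pf.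
assert (Pg : Rabs (Psi j g r t - V fl j (cl r) (tp t)) <= Cj j * (b + eps)).
{ apply Psi_close; auto. intros s Hs. specialize (H s Hs). specialize (Ef s Hs).
  apply Rabs_le_between in Ef. apply Rabs_le_between in H. apply Rabs_le_between. lra. }
apply Rabs_le_between in Pf. apply Rabs_le_between in Pg. apply Rabs_le_between. lra.
Qed.

Lemma Psi_ext f g j r t : X0 f -> cont1 g -> (forall s, 0 <= s <= 1 -> f s = g s) -> Psi j f r t = Psi j g r t.
Proof.
intros Hf Cg H. apply Rminus_diag_uniq, Rabs_eq_0, Rle_antisym; [|apply Rabs_pos].
rewrite <- (Rmult_0_r (Cj j)). apply Psi_dist; auto. intros s Hs. rewrite H, Rminus_diag, Rabs_R0; auto; lra.
Qed.

Lemma Psi_bd f j b r t : cont1 f -> (forall s, 0 <= s <= 1 -> Rabs (f s) <= b) -> Rabs (Psi j f r t) <= Cj j * b.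
Proof.
intros Cf H. pose proof (Psi_close f j nil b r t Cf (List.Forall_nil _)) as Q.
unfold V, W in Q. simpl in Q. rewrite Rminus_0_r in Q. apply Q. intros s Hs. rewrite Rminus_0_r. auto.
Qed.

Lemma Psi_00 f r : X0 f -> 0 <= r <= 1 -> Psi 0 f r 0 = f r.
Proof.
intros Hf Hr. apply Rminus_diag_uniq, Rabs_eq_0, Rle_antisym; [|apply Rabs_pos].
apply le_eps with (K := 2). intros eps He. destruct (Psi_close0 f 0 eps Hf He) as [fl [Vf [Ef P]]].
specialize (P O r 0 ltac:(lia) Hr ltac:(lra)). specialize (Ef r Hr). simpl in P.
apply Rabs_le_between in P. apply Rabs_le_between in Ef. apply Rabs_le_between. lra.
Qed.

Lemma Psi_S0 f j r : X0 f -> 0 <= r <= 1 -> Psi (S j) f r 0 = 0.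
Proof.
intros Hf Hr. apply Rabs_eq_0, Rle_antisym; [|apply Rabs_pos].
apply le_eps with (K := Cj (S j)). intros eps He. destruct (Psi_close0 f (S j) eps Hf He) as [fl [Vf [Ef P]]].
specialize (P (S j) r 0 ltac:(lia) Hr ltac:(lra)). rewrite V_S0 in P. rewrite Rminus_0_r in P. lra.
Qed.

Lemma Psi_r1 f j t : X0 f -> Psi j f 1 t = 0.
Proof.
intros Hf. apply Rabs_eq_0, Rle_antisym; [|apply Rabs_pos].
apply le_eps with (K := Cj j). intros eps He. destruct (V_approx f eps Hf He) as [fl [Vf Ef]].
pose proof (Psi_close f j fl eps 1 t (proj1 Hf) Vf Ef) as P. rewrite cl_id in P by lra. rewrite V_1, Rminus_0_r in P; auto. lra.
Qed.

Lemma Psi_cont f j : X0 f -> cont2 (Psi j f).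
Proof.
intros Hf. apply cont2_eps. intros r t eps He.
pose proof (Cj_pos j) as Hc.
destruct (V_approx f (eps / (4 * Cj j)) Hf) as [fl [Vf Ef]]; [apply Rdiv_lt_0_compat; lra|].
assert (C : cont2 (fun r t => V fl j (cl r) (tp t))) by (pose proof (V_cont fl j Vf); intros p; ct).
destruct (proj1 (cont2_eps _) C r t (eps / 2) ltac:(lra)) as [d [Hd D]].
exists d. split; auto. intros r' t' A B. specialize (D r' t' A B).
pose proof (Psi_close f j fl _ r t (proj1 Hf) Vf Ef) as P1.
pose proof (Psi_close f j fl _ r' t' (proj1 Hf) Vf Ef) as P2.
replace (Cj j * (eps / (4 * Cj j))) with (eps / 4) in * by (field; lra).
apply Rabs_le_between in P1. apply Rabs_le_between in P2. apply Rabs_lt_between in D. apply Rabs_lt_between. lra.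
Qed.

Lemma Psi_taylor f j b l r t : X0 f -> (forall s, 0 <= s <= 1 -> Rabs (f s) <= b) -> Rabs (l - 1) <= 1 / 2 -> 0 <= r <= 1 -> 0 <= t ->
  Rabs (Psi j f r (l * t) - Psi j f r t - (l - 1) * (INR j * Psi j f r t + Psi (S j) f r t)) <= 4 * (Dj j * b) * (l - 1) ^ 2.
Proof.
intros Hf Hb Hl Hr Ht.
apply le_eps with (K := 4 * Dj j * (l - 1) ^ 2 + 2 * Cj j + INR j * Cj j + Cj (S j)). intros eps He.
destruct (Psi_close0 f (S j) eps Hf He) as [fl [Vf [Ef P]]].
assert (Hlt : 0 <= l * t) by (apply Rmult_le_pos; auto; revert Hl; unfold Rabs; destruct Rcase_abs; lra).
pose proof (P j r (l * t) ltac:(lia) Hr Hlt) as P1. pose proof (P j r t ltac:(lia) Hr Ht) as P2.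
pose proof (P (S j) r t ltac:(lia) Hr Ht) as P3.
assert (T : Rabs (V fl j r (l * t) - V fl j r t - (l - 1) * (INR j * V fl j r t + V fl (S j) r t)) <= 4 * (Dj j * (b + eps)) * (l - 1) ^ 2).
{ unfold V. replace (kk ^ 2 * (l * t)) with (l * (kk ^ 2 * t)) by ring.
  apply W_taylor; auto; [|apply cos_kk_in; auto|apply kk2_pos; auto].
  apply V_W0. intros s Hs. specialize (Hb s Hs). specialize (Ef s Hs).
  apply Rabs_le_between in Hb. apply Rabs_le_between in Ef. apply Rabs_le_between. lra. }
set (x1 := Psi j f r (l * t)) in *. set (x2 := Psi j f r t) in *. set (x3 := Psi (S j) f r t) in *.
set (y1 := V fl j r (l * t)) in *. set (y2 := V fl j r t) in *. set (y3 := V fl (S j) r t) in *.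
replace (x1 - x2 - (l - 1) * (INR j * x2 + x3)) with
  ((y1 - y2 - (l - 1) * (INR j * y2 + y3)) + ((x1 - y1) - (x2 - y2) - (l - 1) * (INR j * (x2 - y2) + (x3 - y3)))) by ring.
eapply Rle_trans; [apply Rabs_triang|].
assert (Q : Rabs ((x1 - y1) - (x2 - y2) - (l - 1) * (INR j * (x2 - y2) + (x3 - y3))) <= (2 * Cj j + INR j * Cj j + Cj (S j)) * eps).
{ unfold Rminus at 1. eapply Rle_trans; [apply Rabs_triang|]. rewrite Rabs_Ropp, Rabs_mult.
  assert (Rabs (INR j * (x2 - y2) + (x3 - y3)) <= INR j * (Cj j * eps) + Cj (S j) * eps).
  { eapply Rle_trans; [apply Rabs_triang|]. apply Rplus_le_compat; auto.
    rewrite Rabs_mult, Rabs_pos_eq by apply pos_INR. apply Rmult_le_compat_l; auto. apply pos_INR. }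
  assert (Rabs (x1 - y1 - (x2 - y2)) <= 2 * (Cj j * eps)).
  { apply Rabs_le_between in P1. apply Rabs_le_between in P2. apply Rabs_le_between. lra. }
  pose proof (Rabs_pos (l - 1)). pose proof (Rabs_pos (INR j * (x2 - y2) + (x3 - y3))). nra. }
lra.
Qed.

Definition X2 (g : R -> R -> R) := cont2 g /\ forall t, 0 <= t -> g 1 t = 0.

Lemma X2_X0 g t : X2 g -> 0 <= t -> X0 (fun r => g r t).
Proof. intros [C H] Ht. split; auto. apply cont2_sec_r; auto. Qed.

Lemma Psi_cont3 g j : X2 g -> cont3 (fun r t s => Psi j (fun q => g q (tp s)) r t).
Proof.
intros Hg [[r t] s]. apply filterlim_locally. intros eps. simpl.
assert (HX : forall s, X0 (fun q => g q (tp s))) by (intros; apply X2_X0; auto).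
pose proof (Cj_pos j) as Hc.
destruct (cont2_unif (fun q s => g q (tp s)) 0 1 (s - 1) (s + 1) (eps / (2 * Cj j))) as [d1 [Hd1 U]].
{ destruct Hg as [Cg _]. intros p. ct. }
{ apply Rdiv_lt_0_compat; [apply eps|lra]. }
destruct (proj1 (cont2_eps _) (Psi_cont _ j (HX s)) r t (eps / 2)) as [d2 [Hd2 D]]; [pose proof (cond_pos eps); lra|].
set (d := Rmin (Rmin d1 1) d2).
assert (Hd : 0 < d /\ d <= d1 /\ d <= 1 /\ d <= d2) by (unfold d, Rmin; repeat destruct Rle_dec; lra).
exists (mkposreal d (proj1 Hd)). intros [[r' t'] s'] [[A1 A2] A3]. simpl in A1, A2, A3.
change (Rabs (r' - r) < d) in A1. change (Rabs (t' - t) < d) in A2. change (Rabs (s' - s) < d) in A3.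
specialize (D r' t' ltac:(lra) ltac:(lra)).
assert (Q : Rabs (Psi j (fun q => g q (tp s')) r' t' - Psi j (fun q => g q (tp s)) r' t') <= Cj j * (eps / (2 * Cj j))).
{ apply Psi_dist; auto; [apply HX|]. intros q Hq. left.
  assert (s - 1 <= s' <= s + 1) by (revert A3; unfold Rabs; destruct Rcase_abs; lra).
  apply (U q s q s'); auto; try lra. rewrite Rminus_diag, Rabs_R0; auto. }
replace (Cj j * (eps / (2 * Cj j))) with (eps / 2) in Q by (field; lra).
change (Rabs (Psi j (fun q => g q (tp s')) r' t' - Psi j (fun q => g q (tp s)) r t) < eps).
apply Rabs_le_between in Q. apply Rabs_lt_between in D. apply Rabs_lt_between. lra.
Qed.

(** * Duhamel's formula and regularity in time *)

(* The Duhamel integral [int_0^t ((t-s) d/dt)^j S(t-s) g(s) ds], rescaled to [0,1]. *)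
Definition KKi j (g : R -> R -> R) r t s := Psi j (fun q => g q (tp (tp t * s))) r (tp t * (1 - s)).
Definition KK j g r t := tp t * RInt (KKi j g r t) 0 1.

Lemma KKi_cont3 j g : X2 g -> cont3 (KKi j g).
Proof.
intros Hg p. unfold KKi. pose proof (Psi_cont3 g j Hg) as C.
apply (cont3_at _ (fun q => fst (fst q)) (fun q => tp (snd (fst q)) * (1 - snd q)) (fun q => tp (snd (fst q)) * snd q) p C); ct.
Qed.

Lemma KKi_RInt j g r t : X2 g -> ex_RInt (KKi j g r t) 0 1.
Proof. intros Hg. apply cont1_RInt, cont3_sec, KKi_cont3, Hg. Qed.

Lemma KK_cont j g : X2 g -> cont2 (KK j g).
Proof.
intros Hg. pose proof (RInt_cont2 _ (KKi_cont3 j g Hg)) as C. intros p. unfold KK. 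
apply cR_mult; [ct|]. exact (C p).
Qed.

Lemma X2_slice g t : X2 g -> X0 (fun q => g q (tp t)).
Proof. intros. apply X2_X0; auto. Qed.

Lemma KK_X2 j g : X2 g -> X2 (KK j g).
Proof.
intros Hg. split; [apply KK_cont; auto|]. intros t Ht. unfold KK.
rewrite (RInt_ext _ (fun _ => 0)).
- rewrite RInt_const. unfold scal; simpl; unfold mult; simpl. ring.
- intros s _. apply Psi_r1, X2_slice, Hg.
Qed.

Lemma KK_0 j g r : KK j g r 0 = 0.
Proof. unfold KK. rewrite tp_id; lra. Qed.

Lemma KK_bd j g b r t : X2 g -> 0 <= t -> (forall q s, 0 <= q <= 1 -> 0 <= s <= t -> Rabs (g q s) <= b) ->
  Rabs (KK j g r t) <= t * (Cj j * b).
Proof.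
intros Hg Ht H. unfold KK. rewrite Rabs_mult, tp_id, Rabs_pos_eq by auto.
apply Rmult_le_compat_l; auto. rewrite <- (Rmult_1_l (Cj j * b)). replace 1 with (1 - 0) at 2 by ring.
apply RInt_bound; [lra|apply KKi_RInt; auto|]. intros s Hs. unfold KKi. apply Psi_bd.
- apply X2_slice; auto.
- intros q Hq. rewrite (tp_id t) by auto. apply H; auto. rewrite tp_id by nra. nra.
Qed.

(** In the weight exp(Ls) the Duhamel integral gains a factor 1/L. This gives contraction on time
    intervals of any length. *)
Lemma KK_exp g B L r t : X2 g -> 0 <= t -> 0 < L -> 0 <= B ->
  (forall q s, 0 <= q <= 1 -> 0 <= s <= t -> Rabs (g q s) <= B * exp (L * s)) ->
  Rabs (KK 0 g r t) <= B * exp (L * t) / L.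
Proof.
intros Hg Ht HL HB H.
assert (D : is_RInt (fun s => t * (B * exp (L * (t * s)))) 0 1 (B * exp (L * (t * 1)) / L - B * exp (L * (t * 0)) / L)).
{ apply (is_RInt_derive (fun s => B * exp (L * (t * s)) / L)).
  - intros x _. auto_derive; auto. field. lra.
  - intros x _. ct. }
unfold KK. rewrite tp_id by auto. rewrite RInt_mul by (apply KKi_RInt; auto).
assert (C : cont1 (KKi 0 g r t)) by (apply cont3_sec, KKi_cont3; auto).
eapply Rle_trans; [apply abs_RInt_le; [lra|apply cont1_RInt; intros s; ct]|].
apply Rle_trans with (B * exp (L * (t * 1)) / L - B * exp (L * (t * 0)) / L).
- rewrite <- (is_RInt_unique _ _ _ _ D). apply RInt_le; [lra| | |].
  + apply cont1_RInt. intros s. ct.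
  + eexists; eauto.
  + intros s Hs. rewrite Rabs_mult, Rabs_pos_eq by auto. apply Rmult_le_compat_l; auto.
    rewrite <- (Rmult_1_l (B * _)). change 1 with (Cj 0). unfold KKi. apply Psi_bd; [apply X2_slice; auto|].
    intros q Hq. rewrite (tp_id t) by auto. rewrite tp_id by nra. apply H; auto. nra.
- rewrite Rmult_1_r, Rmult_0_r, Rmult_0_r, exp_0.
  assert (0 <= B * 1 / L) by (apply Rdiv_le_0_compat; lra). lra.
Qed.

Lemma X2_lin g h a b : X2 g -> X2 h -> X2 (fun r t => a * g r t + b * h r t).
Proof.
intros [Cg Zg] [Ch Zh]. split; [intros p; ct|]. intros t Ht. rewrite Zg, Zh; auto; ring.
Qed.

Lemma KK_lin j g h a b r t : X2 g -> X2 h -> KK j (fun r t => a * g r t + b * h r t) r t = a * KK j g r t + b * KK j h r t.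
Proof.
intros Hg Hh. unfold KK.
replace (a * (tp t * RInt (KKi j g r t) 0 1) + b * (tp t * RInt (KKi j h r t) 0 1)) with
 (tp t * (a * RInt (KKi j g r t) 0 1 + b * RInt (KKi j h r t) 0 1)) by ring.
f_equal. pose proof (KKi_RInt j g r t Hg) as Ig. pose proof (KKi_RInt j h r t Hh) as Ih.
rewrite (RInt_mul (KKi j g r t) a 0 1 Ig), (RInt_mul (KKi j h r t) b 0 1 Ih).
rewrite (RInt_add _ _ 0 1 (ex_RInt_mul _ a 0 1 Ig) (ex_RInt_mul _ b 0 1 Ih)).
apply RInt_ext. intros s _. unfold KKi.
apply (Psi_lin (fun q => g q (tp (tp t * s))) (fun q => h q (tp (tp t * s)))); apply X2_slice; auto.
Qed.

(** Differentiability in the scale of time, z standing for t y_t, uniformly on [0,1] x [0,T]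
    including t = 0. *)
Definition udiff (y z : R -> R -> R) := forall T eps, 0 < T -> 0 < eps -> exists d, 0 < d <= 1/2 /\
  forall l, Rabs (l - 1) < d -> forall r t, 0 <= r <= 1 -> 0 <= t <= T ->
  Rabs (y r (l * t) - y r t - (l - 1) * z r t) <= eps * Rabs (l - 1).

Definition scl (l : R) (g : R -> R -> R) r t := g r (l * t).

Lemma X2_scl l g : 0 <= l -> X2 g -> X2 (scl l g).
Proof.
intros Hl [C Z]. split; [intros p; unfold scl; ct|]. intros t Ht. apply Z. apply Rmult_le_pos; auto.
Qed.

Lemma scl_unif g T eps : cont2 g -> 0 < T -> 0 < eps -> exists d, 0 < d <= 1/2 /\
  forall l, Rabs (l - 1) < d -> forall r t, 0 <= r <= 1 -> 0 <= t <= T -> Rabs (scl l g r t - g r t) <= eps.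
Proof.
intros C HT He. destruct (cont2_unif g 0 1 0 (2 * T) eps C He) as [d0 [Hd0 U]].
set (d := Rmin (1/2) (d0 / (2 * T))).
assert (Hd : 0 < d /\ d <= 1/2 /\ d <= d0 / (2 * T)).
{ unfold d. assert (0 < d0 / (2 * T)) by (apply Rdiv_lt_0_compat; lra). unfold Rmin; destruct Rle_dec; lra. }
exists d. split; [lra|]. intros l Hl r t Hr Ht. left.
assert (1/2 <= l <= 3/2) by (revert Hl; unfold Rabs; destruct Rcase_abs; lra).
apply U; auto; try nra; [rewrite Rminus_diag, Rabs_R0; auto|].
replace (l * t - t) with ((l - 1) * t) by ring. rewrite Rabs_mult, (Rabs_pos_eq t) by lra.
assert (Rabs (l - 1) * t <= d * T) by (apply Rmult_le_compat; try lra; apply Rabs_pos).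
assert (d * T <= d0 / 2); [|lra]. replace (d0 / 2) with (d0 / (2 * T) * T) by (field; lra). apply Rmult_le_compat_r; lra.
Qed.

(** Three contributions in l: the prefactor of the integral, the semigroup, and the source. The
    change of the source is kept as a difference, so continuity of g is enough. *)
Lemma KK_scaling j g : X2 g -> forall T eps, 0 < T -> 0 < eps -> exists d, 0 < d <= 1/2 /\
  forall l, Rabs (l - 1) < d -> forall r t, 0 <= r <= 1 -> 0 <= t <= T ->
  Rabs (KK j g r (l * t) - KK j g r t - KK j (fun r t => 1 * scl l g r t + -1 * g r t) r t
     - (l - 1) * ((INR j + 1) * KK j g r t + KK (S j) g r t)) <= eps * Rabs (l - 1).
Proof.
intros Hg T eps HT He.
destruct (cont2_bounded g 0 1 0 (2 * T) (proj1 Hg)) as [b [Hb B]].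
pose proof (Cj_pos j) as Pj. pose proof (Cj_pos (S j)) as PSj. pose proof (pos_INR j) as Pn.
set (K1 := T * ((INR j + 1) * Cj j + Cj (S j))).
assert (PK1 : 0 < K1) by (apply Rmult_lt_0_compat; auto; nra).
assert (PD : 0 < Dj j).
{ unfold Dj. pose proof (Cj_pos (S (S j))). pose proof (pow2_ge_0 (INR j)). assert (0 <= 2 * INR j * Cj (S j)) by nra. nra. }
set (K2 := 2 * T * (4 * (Dj j * b)) + T * (INR j * (Cj j * b) + Cj (S j) * b)).
assert (PK2 : 0 < K2).
{ unfold K2. assert (0 < Dj j * b) by nra. assert (0 < Cj (S j) * b) by nra.
  assert (0 <= INR j * (Cj j * b)) by (apply Rmult_le_pos; nra). nra. }
destruct (scl_unif g T (eps / (2 * K1)) (proj1 Hg) HT) as [d1 [Hd1 U]]; [apply Rdiv_lt_0_compat; lra|].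
set (d := Rmin d1 (eps / (2 * K2))).
assert (Hd : 0 < d /\ d <= d1 /\ d <= eps / (2 * K2)).
{ unfold d. assert (0 < eps / (2 * K2)) by (apply Rdiv_lt_0_compat; lra). unfold Rmin; destruct Rle_dec; lra. }
exists d. split; [lra|]. intros l Hl r t Hr Ht.
assert (Hl2 : 1/2 <= l <= 3/2) by (revert Hl; unfold Rabs; destruct Rcase_abs; lra).
assert (Xl : X2 (scl l g)) by (apply X2_scl; auto; lra).
rewrite (KK_lin j (scl l g) g) by auto.
assert (Bl : forall q s, 0 <= q <= 1 -> 0 <= s <= T -> Rabs (scl l g q s) <= b) by (intros; apply B; auto; nra).
assert (Diff : forall i, Rabs (KK i (scl l g) r t - KK i g r t) <= T * (Cj i * (eps / (2 * K1)))).
{ intros i. pose proof (Cj_pos i).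
  replace (KK i (scl l g) r t - KK i g r t) with (1 * KK i (scl l g) r t + -1 * KK i g r t) by ring.
  rewrite <- KK_lin by auto. apply Rle_trans with (t * (Cj i * (eps / (2 * K1)))).
  - apply KK_bd; [apply X2_lin; auto|lra|]. intros q s Hq Hs.
    replace (1 * scl l g q s + -1 * g q s) with (scl l g q s - g q s) by ring. apply U; auto; lra.
  - apply Rmult_le_compat_r; [|lra]. apply Rmult_le_pos; [lra|]. apply Rlt_le, Rdiv_lt_0_compat; lra. }
assert (Bd : forall i, Rabs (KK i (scl l g) r t) <= T * (Cj i * b)).
{ intros i. pose proof (Cj_pos i). apply Rle_trans with (t * (Cj i * b)).
  - apply KK_bd; auto; try lra. intros; apply Bl; auto; lra.
  - apply Rmult_le_compat_r; [|lra]. nra. }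
(* Exact change of scale: at time lt the integral is l times the one with source [scl l g] and
   semigroup time multiplied by l. The Taylor bound under the integral then leaves an error
   quadratic in l - 1. *)
assert (Main : Rabs (KK j g r (l * t) - l * (KK j (scl l g) r t + (l - 1) * (INR j * KK j (scl l g) r t + KK (S j) (scl l g) r t)))
   <= 2 * T * (4 * (Dj j * b)) * (l - 1) ^ 2).
{ assert (Hlt : 0 <= l * t) by nra.
  set (A := fun s => Psi j (fun q => scl l g q (tp (t * s))) r (l * (t * (1 - s)))).
  assert (EA : KK j g r (l * t) = l * (t * RInt A 0 1)).
  { unfold KK. rewrite tp_id by auto. rewrite <- Rmult_assoc. f_equal. apply RInt_ext.
    rewrite Rmin_left, Rmax_right by lra. intros s Hs. unfold KKi, A. rewrite (tp_id (l * t)) by auto.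
    replace (l * (t * (1 - s))) with (l * t * (1 - s)) by ring. apply Psi_ext.
    - apply (X2_slice g); auto.
    - apply (X2_slice (scl l g) (t * s) Xl).
    - intros q Hq. unfold scl. rewrite !tp_id by nra. f_equal. ring. }
  assert (EB : forall i, KK i (scl l g) r t = t * RInt (KKi i (scl l g) r t) 0 1) by (intros; unfold KK; rewrite tp_id; auto; lra).
  assert (CA : cont1 A).
  { intros s. unfold A. pose proof (Psi_cont3 _ j Xl) as C.
    apply (cont3_at _ (fun s => r) (fun s => l * (t * (1 - s))) (fun s => t * s) s C); ct. }
  assert (CB : forall i, cont1 (KKi i (scl l g) r t)) by (intros; apply cont3_sec, KKi_cont3; auto).
  pose proof (CB j) as CBj. pose proof (CB (S j)) as CBS.
  rewrite EA, !EB.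
  set (G := fun s => (1 + (l - 1) * INR j) * KKi j (scl l g) r t s + (l - 1) * KKi (S j) (scl l g) r t s).
  assert (EG : RInt G 0 1 = (1 + (l - 1) * INR j) * RInt (KKi j (scl l g) r t) 0 1 + (l - 1) * RInt (KKi (S j) (scl l g) r t) 0 1).
  { pose proof (cont1_RInt _ 0 1 CBj) as Ij. pose proof (cont1_RInt _ 0 1 CBS) as IS.
    rewrite (RInt_mul _ (1 + (l - 1) * INR j) 0 1 Ij), (RInt_mul _ (l - 1) 0 1 IS).
    rewrite (RInt_add _ _ 0 1 (ex_RInt_mul _ _ 0 1 Ij) (ex_RInt_mul _ _ 0 1 IS)). auto. }
  assert (CG : cont1 G) by (intros s; unfold G; ct).
  replace (_ - _) with (l * t * (RInt A 0 1 - RInt G 0 1)) by (rewrite EG; ring).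
  rewrite RInt_sub by (apply cont1_RInt; auto).
  rewrite Rabs_mult, (Rabs_pos_eq (l * t)) by auto.
  assert (Q : Rabs (RInt (fun s => A s - G s) 0 1) <= (1 - 0) * (4 * (Dj j * b) * (l - 1) ^ 2)).
  { apply RInt_bound; [lra|apply cont1_RInt; intros s; ct|]. intros s Hs.
    pose proof (Psi_taylor (fun q => scl l g q (tp (t * s))) j b l r (t * (1 - s))) as TT.
    unfold G, KKi. unfold A. rewrite !(tp_id t) by lra.
    match goal with |- Rabs ?x <= _ => match type of TT with context [Rabs (?y - _ - _) <= 4 * _ * _] =>
      replace x with (y - Psi j (fun q => scl l g q (tp (t * s))) r (t * (1 - s)) -
       (l - 1) * (INR j * Psi j (fun q => scl l g q (tp (t * s))) r (t * (1 - s)) + Psi (S j) (fun q => scl l g q (tp (t * s))) r (t * (1 - s)))) by ring end end.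
    apply TT; auto.
    - apply (X2_slice (scl l g) (t * s) Xl).
    - intros q Hq. apply Bl; auto. rewrite tp_id; nra.
    - lra.
    - nra. }
  pose proof (Rabs_pos (RInt (fun s => A s - G s) 0 1)). assert (l * t <= 2 * T) by nra.
  assert (0 <= 4 * (Dj j * b) * (l - 1) ^ 2) by (apply Rmult_le_pos; [nra|apply pow2_ge_0]).
  replace (2 * T * (4 * (Dj j * b)) * (l - 1) ^ 2) with (2 * T * ((1 - 0) * (4 * (Dj j * b) * (l - 1) ^ 2))) by ring.
  apply Rmult_le_compat; auto. }
set (P := KK j (scl l g) r t) in *. set (Q := KK (S j) (scl l g) r t) in *.
set (P0 := KK j g r t) in *. set (Q0 := KK (S j) g r t) in *. set (e := l - 1) in *.
replace (KK j g r (l * t) - P0 - (1 * P + -1 * P0) - e * ((INR j + 1) * P0 + Q0)) with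
 ((KK j g r (l * t) - l * (P + e * (INR j * P + Q))) + (e * ((INR j + 1) * (P - P0) + (Q - Q0)) + e * e * (INR j * P + Q)))
 by (unfold e; ring).
eapply Rle_trans; [apply Rabs_triang|].
assert (Q1 : Rabs (e * ((INR j + 1) * (P - P0) + (Q - Q0))) <= Rabs e * (eps / 2)).
{ rewrite Rabs_mult. apply Rmult_le_compat_l; [apply Rabs_pos|].
  replace (eps / 2) with ((INR j + 1) * (T * (Cj j * (eps / (2 * K1)))) + T * (Cj (S j) * (eps / (2 * K1)))) by (unfold K1; field; unfold K1 in PK1; split; nra).
  eapply Rle_trans; [apply Rabs_triang|]. apply Rplus_le_compat; [|apply Diff].
  rewrite Rabs_mult, Rabs_pos_eq by lra. apply Rmult_le_compat_l; [lra|apply Diff]. }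
assert (Q2 : Rabs (e * e * (INR j * P + Q)) <= Rabs e * Rabs e * (T * (INR j * (Cj j * b) + Cj (S j) * b))).
{ rewrite !Rabs_mult. apply Rmult_le_compat_l; [apply Rmult_le_pos; apply Rabs_pos|].
  rewrite Rmult_plus_distr_l. eapply Rle_trans; [apply Rabs_triang|]. apply Rplus_le_compat; [|apply Bd].
  rewrite Rabs_mult, Rabs_pos_eq by lra. rewrite <- Rmult_assoc, (Rmult_comm T), Rmult_assoc.
  apply Rmult_le_compat_l; [lra|apply Bd]. }
assert (Q3 : Rabs e * Rabs e * K2 <= Rabs e * (eps / 2)).
{ rewrite Rmult_assoc. apply Rmult_le_compat_l; [apply Rabs_pos|].
  replace (eps / 2) with (eps / (2 * K2) * K2) by (field; lra). apply Rmult_le_compat_r; lra. }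
pose proof (Rabs_triang (e * ((INR j + 1) * (P - P0) + (Q - Q0))) (e * e * (INR j * P + Q))).
rewrite <- (pow2_abs e) in Main. unfold K2 in Q3. nra.
Qed.

Lemma KK_udiff j g g' : X2 g -> X2 g' -> udiff g g' ->
  udiff (KK j g) (fun r t => (INR j + 1) * KK j g r t + KK (S j) g r t + KK j g' r t).
Proof.
intros Hg Hg' D T eps HT He.
pose proof (Cj_pos j) as Pj.
destruct (KK_scaling j g Hg T (eps / 2) HT ltac:(lra)) as [d1 [Hd1 S1]].
destruct (D T (eps / (2 * T * Cj j)) HT) as [d2 [Hd2 S2]]; [apply Rdiv_lt_0_compat; auto; nra|].
exists (Rmin d1 d2). split; [unfold Rmin; destruct Rle_dec; lra|]. intros l Hl r t Hr Ht.
assert (Hl1 : Rabs (l - 1) < d1) by (revert Hl; unfold Rmin; destruct Rle_dec; lra).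
assert (Hl2 : Rabs (l - 1) < d2) by (revert Hl; unfold Rmin; destruct Rle_dec; lra).
assert (Hl3 : 0 <= l) by (revert Hl1; unfold Rabs; destruct Rcase_abs; lra).
specialize (S1 l Hl1 r t Hr Ht).
set (h := fun r t => 1 * scl l g r t + -1 * g r t) in *.
assert (Xh : X2 h) by (apply X2_lin; auto; apply X2_scl; auto).
assert (Q : Rabs (1 * KK j h r t + - (l - 1) * KK j g' r t) <= eps / 2 * Rabs (l - 1)).
{ rewrite <- KK_lin by auto. apply Rle_trans with (t * (Cj j * (eps / (2 * T * Cj j) * Rabs (l - 1)))).
  - apply KK_bd; [apply X2_lin; auto|lra|]. intros q s Hq Hs. specialize (S2 l Hl2 q s Hq ltac:(lra)).
    unfold h, scl. replace (1 * (1 * g q (l * s) + -1 * g q s) + - (l - 1) * g' q s) with (g q (l * s) - g q s - (l - 1) * g' q s) by ring. auto.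
  - replace (eps / 2 * Rabs (l - 1)) with (T * (Cj j * (eps / (2 * T * Cj j) * Rabs (l - 1)))) by (field; split; lra).
    apply Rmult_le_compat_r; [|lra]. apply Rmult_le_pos; [lra|]. apply Rmult_le_pos; [|apply Rabs_pos].
    apply Rlt_le, Rdiv_lt_0_compat; auto; nra. }
match goal with |- Rabs ?x <= _ => match type of S1 with Rabs ?y <= _ =>
 replace x with (y + (1 * KK j h r t + - (l - 1) * KK j g' r t)) by ring end end.
eapply Rle_trans; [apply Rabs_triang|]. lra.
Qed.

Lemma Psi_udiff j f : X0 f -> udiff (Psi j f) (fun r t => INR j * Psi j f r t + Psi (S j) f r t).
Proof.
intros Hf T eps HT He. destruct (X0_bounded f (proj1 Hf)) as [b [Hb B]].
set (K := 4 * (Dj j * b)). assert (PK : 0 <= K).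
{ unfold K, Dj. pose proof (Cj_pos j). pose proof (Cj_pos (S j)). pose proof (Cj_pos (S (S j))). pose proof (pos_INR j).
  assert (0 <= INR j ^ 2 + INR j) by nra. assert (0 <= 2 * INR j * Cj (S j)) by nra.
  assert (0 <= (INR j ^ 2 + INR j) * Cj j) by nra. nra. }
exists (Rmin (1/2) (eps / (K + 1))). assert (0 < eps / (K + 1)) by (apply Rdiv_lt_0_compat; lra).
split; [unfold Rmin; destruct Rle_dec; lra|]. intros l Hl r t Hr Ht.
assert (Hl1 : Rabs (l - 1) < 1/2 /\ Rabs (l - 1) < eps / (K + 1)) by (revert Hl; unfold Rmin; destruct Rle_dec; lra).
eapply Rle_trans; [apply (Psi_taylor f j b l r t Hf B); auto; lra|]. fold K.
rewrite <- (pow2_abs (l - 1)). replace (K * Rabs (l - 1) ^ 2) with (K * Rabs (l - 1) * Rabs (l - 1)) by ring.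
apply Rmult_le_compat_r; [apply Rabs_pos|].
apply Rle_trans with ((K + 1) * (eps / (K + 1))); [|right; field; lra].
pose proof (Rabs_pos (l - 1)). apply Rmult_le_compat; lra.
Qed.

Lemma geometric_limit (u : nat -> R) M : (forall i, Rabs (u (S i) - u i) <= M / 2 ^ i) ->
  forall i, Rabs (u i - real (Lim_seq u)) <= 2 * M / 2 ^ i.
Proof.
intros H.
assert (P2 : forall i, 0 < 2 ^ i) by (intros; apply pow_lt; lra).
assert (HM : 0 <= M) by (specialize (H O); simpl in H; pose proof (Rabs_pos (u 1%nat - u O)); lra).
assert (Q : forall i p, Rabs (u (i + p)%nat - u i) <= 2 * M / 2 ^ i - 2 * M / 2 ^ (i + p)).
{ intros i p. induction p as [|p IH].
  - rewrite Nat.add_0_r, Rminus_diag, Rabs_R0. lra.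
  - replace (i + S p)%nat with (S (i + p)) by lia. specialize (H (i + p)%nat).
    replace (u (S (i + p)) - u i) with ((u (S (i + p)) - u (i + p)%nat) + (u (i + p)%nat - u i)) by ring.
    eapply Rle_trans; [apply Rabs_triang|].
    replace (2 * M / 2 ^ S (i + p)) with (M / 2 ^ (i + p)) by (simpl; field; apply Rgt_not_eq, P2).
    replace (2 * M / 2 ^ (i + p)) with (2 * (M / 2 ^ (i + p))) in IH by (unfold Rdiv; ring). lra. }
assert (Q' : forall i p, Rabs (u (i + p)%nat - u i) <= 2 * M / 2 ^ i).
{ intros i p. specialize (Q i p). assert (0 <= 2 * M / 2 ^ (i + p)) by (apply Rdiv_le_0_compat; [lra|apply P2]). lra. }
assert (E : ex_finite_lim_seq u).
{ apply ex_lim_seq_cauchy_corr. intros eps.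
  destruct (archimed_cor1 (eps / (4 * (M + 1)))) as [N [HN HN0]]; [apply Rdiv_lt_0_compat; [apply eps|lra]|].
  assert (B : 2 * M / 2 ^ N < eps / 2).
  { assert (INR N < 2 ^ N) by (apply Rlt_le_trans with (INR (2 ^ N)); [apply lt_INR, Nat.pow_gt_lin_r; lia|rewrite pow_INR; replace (INR 2) with 2 by (simpl; ring); lra]).
    assert (0 < INR N) by (apply lt_0_INR; auto).
    assert (/ 2 ^ N < / INR N) by (apply Rinv_lt_contravar; auto; apply Rmult_lt_0_compat; auto).
    replace (eps / 2) with (2 * (M + 1) * (eps / (4 * (M + 1)))) by (field; lra).
    unfold Rdiv at 1. assert (0 < / 2 ^ N) by (apply Rinv_0_lt_compat; auto). nra. }
  exists N. intros n m Hn Hm.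
  replace n with (N + (n - N))%nat by lia. replace m with (N + (m - N))%nat by lia.
  pose proof (Q' N (n - N)%nat). pose proof (Q' N (m - N)%nat).
  apply Rabs_le_between in H0. apply Rabs_le_between in H1. apply Rabs_lt_between. lra. }
destruct E as [l Hl]. rewrite (is_lim_seq_unique _ _ Hl). simpl. intros i.
rewrite Rabs_minus_sym.
assert (L : is_lim_seq (fun p => Rabs (u (i + p)%nat - u i)) (Rabs (l - u i))).
{ apply (is_lim_seq_abs _ (Finite (l - u i))). apply is_lim_seq_minus'; [|apply is_lim_seq_const].
  apply is_lim_seq_ext with (fun p => u (p + i)%nat); [intros; f_equal; lia|]. apply is_lim_seq_incr_n. exact Hl. }
exact (is_lim_seq_le _ (fun _ => 2 * M / 2 ^ i) (Finite (Rabs (l - u i))) (Finite (2 * M / 2 ^ i)) (Q' i) L (is_lim_seq_const _)).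
Qed.

(** * Picard iteration for superposition (Nemytskii) operators *)

Definition nem (n : R -> R -> R -> R) (y : R -> R -> R) r t := n r t (y r t).

Section Picard.
Variables (n : R -> R -> R -> R) (F : R -> R -> R) (L : R).
Hypotheses (Cn : cont3 n) (HL : 0 < L) (Lip : forall r t y y', 0 <= r <= 1 -> 0 <= t -> Rabs (n r t y - n r t y') <= L * Rabs (y - y'))
  (n1 : forall t, 0 <= t -> n 1 t 0 = 0) (XF : X2 F).

Lemma nem_X2 y : X2 y -> X2 (nem n y).
Proof.
intros [C Z]. split.
- intros p. unfold nem. ct.
- intros t Ht. unfold nem. rewrite Z; auto.
Qed.

Fixpoint picard i : R -> R -> R := match i with O => F | S i => fun r t => 1 * F r t + 1 * KK 0 (nem n (picard i)) r t end.

Lemma picard_X2 i : X2 (picard i).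
Proof. induction i; simpl; auto. apply X2_lin; auto. apply KK_X2, nem_X2, IHi. Qed.

(** In the weight exp(2Lt) the Duhamel map of an L-Lipschitz source contracts by L/(2L) = 1/2,
    whatever T is. *)
Lemma picard_step T : 0 < T -> exists B, 0 < B /\ forall i r t, 0 <= r <= 1 -> 0 <= t <= T ->
  Rabs (picard (S i) r t - picard i r t) <= B * exp (2 * L * t) / 2 ^ i.
Proof.
intros HT.
destruct (cont2_bounded (KK 0 (nem n F)) 0 1 0 T (KK_cont 0 _ (nem_X2 F XF))) as [B [HB BB]].
exists B. split; auto. induction i as [|i IH]; intros r t Hr Ht.
- simpl. replace (1 * F r t + 1 * KK 0 (nem n F) r t - F r t) with (KK 0 (nem n F) r t) by ring.
  specialize (BB r t Hr Ht). assert (1 <= exp (2 * L * t)).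
  { rewrite <- exp_0. apply exp_le. nra. }
  assert (1 * B <= exp (2 * L * t) * B) by (apply Rmult_le_compat_r; lra). lra.
- replace (picard (S (S i)) r t - picard (S i) r t) with
    (1 * KK 0 (nem n (picard (S i))) r t + -1 * KK 0 (nem n (picard i)) r t) by (simpl; ring).
  assert (X1 := nem_X2 _ (picard_X2 (S i))). assert (X2' := nem_X2 _ (picard_X2 i)).
  rewrite <- KK_lin by auto.
  replace (B * exp (2 * L * t) / 2 ^ S i) with (L * B / 2 ^ i * exp (2 * L * t) / (2 * L)) by (simpl; field; split; [apply pow_nonzero; lra|lra]).
  apply KK_exp; auto; try lra; [apply X2_lin; auto| |].
  + apply Rdiv_le_0_compat; [nra|apply pow_lt; lra].
  + intros q s Hq Hs. unfold nem.
    replace (1 * n q s (picard (S i) q s) + -1 * n q s (picard i q s)) with (n q s (picard (S i) q s) - n q s (picard i q s)) by ring.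
    eapply Rle_trans; [apply Lip; auto; lra|]. specialize (IH q s Hq ltac:(lra)).
    replace (L * B / 2 ^ i * exp (2 * L * s)) with (L * (B * exp (2 * L * s) / 2 ^ i)) by (unfold Rdiv; ring).
    apply Rmult_le_compat_l; [lra|exact IH].
Qed.

Lemma picard_solution : exists y, X2 y /\ forall r t, 0 <= r <= 1 -> 0 <= t -> y r t = F r t + KK 0 (nem n y) r t.
Proof.
(* Clamped arguments make the limit continuous on the whole plane, as [X2] asks, while the iterates
   converge uniformly for bounded t in the closed domain. *)
set (y := fun r t => real (Lim_seq (fun i => picard i (cl r) (tp t)))).
assert (Cv : forall T, 0 < T -> exists M, 0 < M /\ forall i r t, tp t <= T -> Rabs (picard i (cl r) (tp t) - y r t) <= M / 2 ^ i).
{ intros T HT. destruct (picard_step T HT) as [B [HB S]].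
  exists (2 * (B * exp (2 * L * T))). split; [pose proof (exp_pos (2 * L * T)); nra|].
  intros i r t Ht. unfold y. apply (geometric_limit (fun i => picard i (cl r) (tp t)) (B * exp (2 * L * T))).
  intros k. pose proof (tp_pos t). eapply Rle_trans; [apply S; auto|].
  unfold Rdiv. apply Rmult_le_compat_r; [apply Rlt_le, Rinv_0_lt_compat, pow_lt; lra|].
  apply Rmult_le_compat_l; [lra|]. apply exp_le. nra. }
assert (Sm : forall M eps, 0 < M -> 0 < eps -> exists i, M / 2 ^ i < eps).
{ intros M eps HM He. destruct (archimed_cor1 (eps / M)) as [N [HN HN0]]; [apply Rdiv_lt_0_compat; lra|].
  exists N. assert (INR N < 2 ^ N) by (apply Rlt_le_trans with (INR (2 ^ N)); [apply lt_INR, Nat.pow_gt_lin_r; lia|rewrite pow_INR; replace (INR 2) with 2 by (simpl; ring); lra]).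
  assert (0 < INR N) by (apply lt_0_INR; auto).
  assert (/ 2 ^ N < / INR N) by (apply Rinv_lt_contravar; auto; apply Rmult_lt_0_compat; auto; apply pow_lt; lra).
  replace eps with (M * (eps / M)) by (field; lra). unfold Rdiv at 1. apply Rmult_lt_compat_l; auto. lra. }
assert (Xy : X2 y).
{ split.
  - apply cont2_eps. intros r t eps He.
    destruct (Cv (tp t + 1)) as [M [HM C]]; [pose proof (tp_pos t); lra|].
    destruct (Sm M (eps / 3) HM ltac:(lra)) as [i Hi].
    assert (Cp : cont2 (fun r t => picard i (cl r) (tp t))) by (pose proof (proj1 (picard_X2 i)); intros p; ct).
    destruct (proj1 (cont2_eps _) Cp r t (eps / 3) ltac:(lra)) as [d1 [Hd1 D1]].
    destruct (proj1 (continuous_eps _ _) (tp_cont t) 1 Rlt_0_1) as [d2 [Hd2 D2]].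
    exists (Rmin d1 d2). split; [unfold Rmin; destruct Rle_dec; lra|]. intros r' t' A1 A2.
    assert (A3 : Rmin d1 d2 <= d1 /\ Rmin d1 d2 <= d2) by (unfold Rmin; destruct Rle_dec; lra).
    specialize (D1 r' t' ltac:(lra) ltac:(lra)). specialize (D2 t' ltac:(lra)).
    pose proof (C i r t ltac:(lra)) as C1. pose proof (C i r' t') as C2.
    apply Rabs_lt_between in D2. specialize (C2 ltac:(lra)).
    apply Rabs_lt_between in D1. apply Rabs_le_between in C1. apply Rabs_le_between in C2. apply Rabs_lt_between. lra.
  - intros t Ht. apply Rabs_eq_0, Rle_antisym; [|apply Rabs_pos]. apply Rnot_lt_le. intros N.
    destruct (Cv (t + 1) ltac:(lra)) as [M [HM C]]. destruct (Sm M _ HM N) as [i Hi].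
    specialize (C i 1 t). rewrite tp_id, cl_id in C by lra. specialize (C ltac:(lra)).
    rewrite (proj2 (picard_X2 i) t Ht), Rminus_0_l, Rabs_Ropp in C. lra. }
exists y. split; auto. intros r t Hr Ht.
apply Rminus_diag_uniq, Rabs_eq_0, Rle_antisym; [|apply Rabs_pos]. apply Rnot_lt_le. intros N.
destruct (Cv (t + 1) ltac:(lra)) as [M [HM C]].
assert (PM : 0 < M * (1 + (t + 1) * L)) by (apply Rmult_lt_0_compat; nra).
destruct (Sm (M * (1 + (t + 1) * L)) _ PM N) as [i Hi].
pose proof (C (S i) r t ltac:(rewrite tp_id; lra)) as C1. rewrite cl_id, tp_id in C1 by lra. simpl picard in C1.
set (h := nem n (picard i)) in *.
assert (Xh : X2 h) by (apply nem_X2, picard_X2). assert (Xn : X2 (nem n y)) by (apply nem_X2; auto).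
assert (Q : Rabs (1 * KK 0 h r t + -1 * KK 0 (nem n y) r t) <= t * (Cj 0 * (L * (M / 2 ^ i)))).
{ rewrite <- KK_lin by auto. apply KK_bd; auto; [apply X2_lin; auto|]. intros q s Hq Hs. unfold h, nem.
  replace (1 * n q s (picard i q s) + -1 * n q s (y q s)) with (n q s (picard i q s) - n q s (y q s)) by ring.
  eapply Rle_trans; [apply Lip; auto; lra|]. apply Rmult_le_compat_l; [lra|].
  pose proof (C i q s ltac:(rewrite tp_id; lra)) as C2. rewrite cl_id, tp_id in C2 by lra. exact C2. }
simpl Cj in Q.
assert (P : 0 < / 2 ^ i) by (apply Rinv_0_lt_compat, pow_lt; lra).
assert (E1 : M / 2 ^ S i <= M * / 2 ^ i).
{ unfold Rdiv. apply Rmult_le_compat_l; [lra|]. apply Rinv_le_contravar; [apply pow_lt; lra|]. simpl. pose proof (pow_lt 2 i). lra. }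
assert (E2 : M * (1 + (t + 1) * L) / 2 ^ i = M * / 2 ^ i + (t + 1) * (L * (M * / 2 ^ i))) by (unfold Rdiv; ring).
assert (0 <= L * (M * / 2 ^ i)) by (apply Rmult_le_pos; nra). unfold Rdiv in Q.
replace (y r t - (F r t + KK 0 (nem n y) r t)) with (- ((1 * F r t + 1 * KK 0 h r t - y r t)) + (1 * KK 0 h r t + -1 * KK 0 (nem n y) r t)) in Hi by ring.
pose proof (Rabs_triang (- (1 * F r t + 1 * KK 0 h r t - y r t)) (1 * KK 0 h r t + -1 * KK 0 (nem n y) r t)) as T. rewrite Rabs_Ropp in T. nra.
Qed.
End Picard.

(** Formally, t y_t solves a linear equation of Duhamel type. That equation is solved by Picard
    iteration, and its solution z is then compared with the increments of y: the remainder y(lt) -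
    y(t) - (l-1) z obeys a linear integral inequality, hence is o(l-1). The last hypothesis
    linearizes the source, with [a] multiplying the increment of y and [b] collecting explicit
    dependence on time. *)
Lemma duhamel_udiff y P P' g a b L :
  X2 y -> X2 g -> X2 P' -> X2 b -> cont2 a -> 0 < L -> (forall r t, 0 <= r <= 1 -> 0 <= t -> Rabs (a r t) <= L) ->
  udiff P P' -> (forall r, 0 <= r <= 1 -> P' r 0 = 0) ->
  (forall r t, 0 <= r <= 1 -> 0 <= t -> y r t = P r t + KK 0 g r t) ->
  (forall T eps, 0 < T -> 0 < eps -> exists d, 0 < d <= 1/2 /\ forall l, Rabs (l - 1) < d -> forall r t, 0 <= r <= 1 -> 0 <= t <= T ->
     Rabs (g r (l * t) - g r t - a r t * (y r (l * t) - y r t) - (l - 1) * b r t) <= eps * (Rabs (l - 1) + Rabs (y r (l * t) - y r t))) ->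
  exists z, X2 z /\ udiff y z /\ (forall r, 0 <= r <= 1 -> z r 0 = 0) /\
   forall r t, 0 <= r <= 1 -> 0 <= t -> z r t = (P' r t + (KK 0 g r t + KK 1 g r t)) + KK 0 (fun r t => a r t * z r t + b r t) r t.
Proof.
intros Xy Xg XP Xb Ca HL Ba DP P0 Ey Hg.
set (F := fun r t => 1 * P' r t + 1 * (1 * KK 0 g r t + 1 * KK 1 g r t)).
assert (XF : X2 F).
{ apply (X2_lin P' (fun r t => 1 * KK 0 g r t + 1 * KK 1 g r t)); auto. apply X2_lin; apply KK_X2; auto. }
set (n := fun r t y => a r t * y + b r t).
destruct (picard_solution n F L) as [z [Xz Ez]]; auto.
{ destruct Xb as [Cb _]. intros p. unfold n. ct. }
{ intros r t y1 y2 Hr Ht. unfold n. replace (_ - _) with (a r t * (y1 - y2)) by ring. rewrite Rabs_mult.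
  apply Rmult_le_compat_r; auto. apply Rabs_pos. }
{ intros t Ht. unfold n. rewrite (proj2 Xb) by auto. ring. }
change (nem n z) with (fun r t => a r t * z r t + b r t) in Ez.
assert (Xn : X2 (fun r t => a r t * z r t + b r t)).
{ destruct Xb as [Cb Zb], Xz as [Cz Zz]. split; [intros p; ct|]. intros t Ht. rewrite Zb, Zz by auto. ring. }
exists z. split; [auto|]. split; [|split].
2:{ intros r Hr. rewrite Ez by lra. unfold F. rewrite P0, !KK_0 by auto. ring. }
2:{ intros r t Hr Ht. rewrite Ez by auto. unfold F. ring. }
intros T eps HT He.
destruct (cont2_bounded z 0 1 0 T (proj1 Xz)) as [Z [HZ BZ]].
(* The inequality for the remainder has Lipschitz constant at most L + e1 <= L + 1, so this weight
   yields the ratio 1/2 that [contraction_bound] uses. *)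
set (La := 2 * (L + 1)).
set (K := 2 * (2 + (1 + Z) / La) * exp (La * T)).
assert (PK : 0 < K).
{ unfold K. apply Rmult_lt_0_compat; [|apply exp_pos]. assert (0 < (1 + Z) / La) by (apply Rdiv_lt_0_compat; unfold La; lra). lra. }
set (e1 := Rmin 1 (eps / K)).
assert (He1 : 0 < e1 /\ e1 <= 1 /\ e1 <= eps / K).
{ unfold e1. assert (0 < eps / K) by (apply Rdiv_lt_0_compat; lra). unfold Rmin; destruct Rle_dec; lra. }
destruct (DP T e1 HT ltac:(lra)) as [d1 [Hd1 D1]].
destruct (KK_scaling 0 g Xg T e1 HT ltac:(lra)) as [d2 [Hd2 D2]].
destruct (Hg T e1 HT ltac:(lra)) as [d3 [Hd3 D3]].
set (d := Rmin d1 (Rmin d2 d3)).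
assert (Hd : 0 < d <= 1/2 /\ d <= d1 /\ d <= d2 /\ d <= d3) by (unfold d, Rmin; repeat destruct Rle_dec; lra).
exists d. split; [lra|]. intros l Hl.
assert (Hl0 : 0 <= l) by (assert (Rabs (l - 1) < 1/2) by lra; revert H; unfold Rabs; destruct Rcase_abs; lra).
specialize (D1 l ltac:(lra)). specialize (D2 l ltac:(lra)). specialize (D3 l ltac:(lra)).
set (e := fun r t => y r (l * t) - y r t - (l - 1) * z r t).
assert (Xe : X2 e).
{ destruct Xy as [Cy Zy], Xz as [Cz Zz]. split; [intros p; unfold e; ct|]. intros t Ht. unfold e. rewrite !Zy, Zz by (auto; apply Rmult_le_pos; auto). ring. }
assert (Xl : X2 (scl l g)) by (apply X2_scl; auto).
set (h := fun r t => 1 * scl l g r t + -1 * g r t) in *. assert (Xh : X2 h) by (apply X2_lin; auto).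
set (az := fun r t => a r t * z r t + b r t) in *.
assert (Rep : forall r t, 0 <= r <= 1 -> 0 <= t <= T ->
  Rabs (e r t) <= 2 * e1 * Rabs (l - 1) + Rabs (KK 0 (fun r t => 1 * h r t + - (l - 1) * az r t) r t)).
{ intros r t Hr Ht. rewrite KK_lin by auto. unfold e.
  rewrite (Ey r (l * t)), (Ey r t), (Ez r t) by (auto; try lra; apply Rmult_le_pos; lra).
  specialize (D1 r t Hr Ht). specialize (D2 r t Hr Ht). simpl INR in D2. unfold F.
  match type of D1 with Rabs ?x <= _ => match type of D2 with Rabs ?w <= _ => match goal with |- Rabs ?v <= _ + Rabs ?u =>
    replace v with (x + w + u) by ring; pose proof (Rabs_triang (x + w) u); pose proof (Rabs_triang x w) end end end. lra. }
assert (Fin : forall x : R * R, (0 <= fst x <= 1 /\ 0 <= snd x <= T) -> Rabs (e (fst x) (snd x)) * exp (- (La * snd x)) <= 2 * ((2 + (1 + Z) / La) * (e1 * Rabs (l - 1)))).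
{ destruct (cont2_bounded e 0 1 0 T (proj1 Xe)) as [B0 [HB0 BB]].
  assert (PLa : 0 < La) by (unfold La; lra).
  assert (P1 : 0 < (1 + Z) / La) by (apply Rdiv_lt_0_compat; lra).
  assert (Ple : 0 <= e1 * Rabs (l - 1)) by (apply Rmult_le_pos; [lra|apply Rabs_pos]).
  apply (contraction_bound _ (fun x : R * R => Rabs (e (fst x) (snd x)) * exp (- (La * snd x))) _ B0).
  - intros [r t] [Hr Ht]. simpl in *. rewrite <- (Rmult_1_r B0). apply Rmult_le_compat; [apply Rabs_pos|left; apply exp_pos|auto|].
    rewrite <- exp_0. apply exp_le. nra.
  - intros B HB H [r t] [Hr Ht]. simpl in *.
    assert (HeB : forall q s, 0 <= q <= 1 -> 0 <= s <= T -> Rabs (e q s) <= B * exp (La * s)).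
    { intros q s Hq Hs. specialize (H (q, s) (conj Hq Hs)). simpl in H.
      replace (Rabs (e q s)) with (Rabs (e q s) * exp (- (La * s)) * exp (La * s)).
      - apply Rmult_le_compat_r; auto. left; apply exp_pos.
      - rewrite Rmult_assoc, <- exp_plus. replace (- (La * s) + La * s) with 0 by ring. rewrite exp_0. ring. }
    assert (Q : Rabs (KK 0 (fun r t => 1 * h r t + - (l - 1) * az r t) r t) <= ((L + 1) * B + e1 * Rabs (l - 1) * (1 + Z)) * exp (La * t) / La).
    { apply KK_exp; auto; try lra; [apply X2_lin; auto| |].
      - apply Rplus_le_le_0_compat; apply Rmult_le_pos; lra.
      - intros q s Hq Hs. specialize (D3 q s Hq ltac:(lra)). specialize (HeB q s Hq ltac:(lra)). specialize (BZ q s Hq ltac:(lra)).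
        assert (E1 : 1 * h q s + - (l - 1) * az q s = a q s * e q s + (g q (l * s) - g q s - a q s * (y q (l * s) - y q s) - (l - 1) * b q s))
          by (unfold h, az, e, scl; ring).
        rewrite E1. eapply Rle_trans; [apply Rabs_triang|]. rewrite Rabs_mult.
        specialize (Ba q s Hq (proj1 Hs)).
        assert (E2 : Rabs (y q (l * s) - y q s) <= Rabs (e q s) + Rabs (l - 1) * Z).
        { replace (y q (l * s) - y q s) with (e q s + (l - 1) * z q s) by (unfold e; ring).
          eapply Rle_trans; [apply Rabs_triang|]. rewrite Rabs_mult. apply Rplus_le_compat_l, Rmult_le_compat_l; auto. apply Rabs_pos. }
        assert (E3 : 1 <= exp (La * s)) by (rewrite <- exp_0; apply exp_le; nra).
        pose proof (Rabs_pos (e q s)). pose proof (Rabs_pos (l - 1)). pose proof (Rabs_pos (a q s)).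
        apply Rle_trans with ((L + 1) * Rabs (e q s) + e1 * Rabs (l - 1) * (1 + Z)).
        + assert (Rabs (a q s) * Rabs (e q s) <= L * Rabs (e q s)) by (apply Rmult_le_compat_r; auto).
          assert (e1 * (Rabs (l - 1) + Rabs (y q (l * s) - y q s)) <= e1 * (Rabs (l - 1) + (Rabs (e q s) + Rabs (l - 1) * Z))) by (apply Rmult_le_compat_l; lra).
          assert (e1 * Rabs (e q s) <= 1 * Rabs (e q s)) by (apply Rmult_le_compat_r; lra). lra.
        + rewrite (Rmult_plus_distr_r ((L + 1) * B)). apply Rplus_le_compat.
          * rewrite Rmult_assoc. apply Rmult_le_compat_l; lra.
          * assert (0 <= e1 * Rabs (l - 1) * (1 + Z)) by (apply Rmult_le_pos; lra). nra. }
    specialize (Rep r t Hr Ht).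
    assert (Pe : 0 < exp (- (La * t))) by apply exp_pos.
    assert (Ee : exp (La * t) * exp (- (La * t)) = 1) by (rewrite <- exp_plus; replace (La * t + - (La * t)) with 0 by ring; apply exp_0).
    assert (Pe1 : exp (- (La * t)) <= 1) by (rewrite <- exp_0; apply exp_le; nra).
    apply Rle_trans with ((2 * e1 * Rabs (l - 1) + ((L + 1) * B + e1 * Rabs (l - 1) * (1 + Z)) * exp (La * t) / La) * exp (- (La * t))).
    { apply Rmult_le_compat_r; lra. }
    rewrite Rmult_plus_distr_r.
    replace (((L + 1) * B + e1 * Rabs (l - 1) * (1 + Z)) * exp (La * t) / La * exp (- (La * t))) with
      (((L + 1) * B + e1 * Rabs (l - 1) * (1 + Z)) / La * (exp (La * t) * exp (- (La * t)))) by (unfold Rdiv; ring).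
    rewrite Ee.
    replace ((2 + (1 + Z) / La) * (e1 * Rabs (l - 1)) + B / 2) with (2 * e1 * Rabs (l - 1) * 1 + ((L + 1) * B + e1 * Rabs (l - 1) * (1 + Z)) / La * 1) by (unfold La; field; lra).
    apply Rplus_le_compat_r. apply Rmult_le_compat_l; lra.
  - apply Rmult_le_pos; lra. }
intros r t Hr Ht. specialize (Fin (r, t) (conj Hr Ht)). simpl in Fin.
assert (PLa : 0 < La) by (unfold La; lra).
assert (Pr : Rabs (e r t) <= K * (e1 * Rabs (l - 1))).
{ replace (Rabs (e r t)) with (Rabs (e r t) * exp (- (La * t)) * exp (La * t)).
  2:{ rewrite Rmult_assoc, <- exp_plus. replace (- (La * t) + La * t) with 0 by ring. rewrite exp_0. ring. }
  replace (K * (e1 * Rabs (l - 1))) with (2 * ((2 + (1 + Z) / La) * (e1 * Rabs (l - 1))) * exp (La * T)) by (unfold K; ring).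
  apply Rmult_le_compat; auto.
  - apply Rmult_le_pos; [apply Rabs_pos|left; apply exp_pos].
  - left; apply exp_pos.
  - apply exp_le. nra. }
fold (e r t). eapply Rle_trans; [exact Pr|]. rewrite <- Rmult_assoc. apply Rmult_le_compat_r; [apply Rabs_pos|].
apply Rle_trans with (K * (eps / K)); [apply Rmult_le_compat_l; lra|right; field; lra].
Qed.

(* [z = t f_t] *)
Definition dpt (f z : R -> R -> R) := forall r t, 0 <= r <= 1 -> 0 < t -> is_derive (f r) t (z r t / t).

(** Regularity is counted in powers of t d/dt, each continuous up to t = 0 and vanishing there;
    derivatives in t itself could be unbounded near t = 0. *)
Fixpoint Dk k f := cont2 f /\ match k with
  | O => True
  | S k => exists z, Dk k z /\ (forall r, 0 <= r <= 1 -> z r 0 = 0) /\ dpt f z end.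

Lemma Dk_cont k f : Dk k f -> cont2 f.
Proof. destruct k; intros [C _]; auto. Qed.

(** The mean value theorem between t and lt: continuity of z up to t = 0 makes the pointwise
    derivative z/t a uniform expansion, and z = 0 settles t = 0. *)
Lemma dpt_udiff f z : cont2 z -> (forall r, 0 <= r <= 1 -> z r 0 = 0) -> dpt f z -> udiff f z.
Proof.
intros C Z D T eps HT He.
destruct (cont2_unif z 0 1 0 (2 * T) (eps / 2) C ltac:(lra)) as [d0 [Hd0 U]].
destruct (cont2_bounded z 0 1 0 (2 * T) C) as [B [HB BB]].
set (d := Rmin (1/2) (Rmin (d0 / (2 * T)) (eps / (4 * B)))).
assert (Hd : 0 < d <= 1/2 /\ d <= d0 / (2 * T) /\ d <= eps / (4 * B)).
{ assert (0 < d0 / (2 * T)) by (apply Rdiv_lt_0_compat; lra). assert (0 < eps / (4 * B)) by (apply Rdiv_lt_0_compat; lra).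
  unfold d, Rmin; repeat destruct Rle_dec; lra. }
exists d. split; [lra|]. intros l Hl r t Hr Ht.
assert (Hl2 : 1/2 <= l <= 3/2) by (revert Hl; unfold Rabs; destruct Rcase_abs; lra).
destruct (Rle_lt_or_eq_dec 0 t (proj1 Ht)) as [Hp|<-].
2:{ rewrite Z, !Rmult_0_r by auto. replace (f r 0 - f r 0 - 0) with 0 by ring. rewrite Rabs_R0. apply Rmult_le_pos; [lra|apply Rabs_pos]. }
assert (Hmin : t / 2 <= Rmin t (l * t)) by (unfold Rmin; destruct Rle_dec; nra).
assert (Hmax : Rmax t (l * t) <= 2 * T) by (unfold Rmax; destruct Rle_dec; nra).
destruct (MVT_abs (f r) (fun s => z r s / s) t (l * t)) as [c [Hc E]].
{ intros x Hx. apply D; auto; lra. }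
rewrite E. assert (Hc0 : t / 2 <= c <= 2 * T) by lra.
replace (z r c / c * (l * t - t) - (l - 1) * z r t) with ((l - 1) * ((z r c - z r t) + z r c * ((t - c) / c))) by (field; lra).
rewrite Rabs_mult, Rmult_comm. apply Rmult_le_compat_r; [apply Rabs_pos|].
assert (Hct : Rabs (c - t) <= Rabs (l - 1) * t).
{ replace (Rabs (l - 1) * t) with (Rabs (l * t - t)) by (rewrite <- (Rabs_pos_eq t) at 3 by lra; rewrite <- Rabs_mult; f_equal; ring).
  revert Hc. unfold Rmin, Rmax. destruct Rle_dec; intros; unfold Rabs; repeat destruct Rcase_abs; lra. }
eapply Rle_trans; [apply Rabs_triang|].
assert (Rabs (z r c - z r t) < eps / 2).
{ apply U; auto; try lra; [rewrite Rminus_diag, Rabs_R0; auto|].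
  apply Rle_lt_trans with (d * T).
  - eapply Rle_trans; [exact Hct|]. apply Rmult_le_compat; try lra. apply Rabs_pos.
  - apply Rle_lt_trans with (d0 / (2 * T) * T); [apply Rmult_le_compat_r; lra|].
    replace (d0 / (2 * T) * T) with (d0 / 2) by (field; lra). lra. }
assert (Rabs (z r c * ((t - c) / c)) <= eps / 2); [|lra].
rewrite Rabs_mult. replace (eps / 2) with (B * (2 * (eps / (4 * B)))) by (field; lra).
apply Rmult_le_compat; try apply Rabs_pos; [apply BB; auto; lra|].
unfold Rdiv at 1. rewrite Rabs_mult, Rabs_minus_sym, Rabs_inv, (Rabs_pos_eq c) by lra.
apply Rmult_le_reg_r with c; [lra|]. rewrite Rmult_assoc, Rinv_l, Rmult_1_r by lra.
eapply Rle_trans; [exact Hct|]. assert (Rabs (l - 1) * t <= eps / (4 * B) * t) by (apply Rmult_le_compat_r; lra).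
assert (eps / (4 * B) * t <= eps / (4 * B) * (2 * c)); [|lra]. apply Rmult_le_compat_l; lra.
Qed.

Lemma udiff_dpt f z : udiff f z -> dpt f z.
Proof.
intros D r t Hr Ht. apply is_derive_Reals. intros eps He.
destruct (D t (eps * t / 2) Ht) as [d [Hd H]]; [nra|].
exists (mkposreal (d * t) ltac:(nra)). intros h Hh0 Hh. simpl in Hh.
specialize (H (1 + h / t)). replace ((1 + h / t - 1)) with (h / t) in H by ring.
assert (E : Rabs (h / t) = Rabs h / t) by (unfold Rdiv; rewrite Rabs_mult, Rabs_inv, (Rabs_pos_eq t); lra).
assert (Hht : Rabs (h / t) < d).
{ rewrite E. apply Rmult_lt_reg_r with t; auto. unfold Rdiv. rewrite Rmult_assoc, Rinv_l; lra. }
specialize (H Hht r t Hr ltac:(lra)). replace ((1 + h / t) * t) with (t + h) in H by (field; lra).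
replace ((f r (t + h) - f r t) / h - z r t / t) with ((f r (t + h) - f r t - h / t * z r t) / h) by (field; lra).
unfold Rdiv at 1. rewrite Rabs_mult, Rabs_inv. assert (0 < Rabs h) by (apply Rabs_pos_lt; auto).
apply Rmult_lt_reg_r with (Rabs h); auto. rewrite Rmult_assoc, Rinv_l, Rmult_1_r by lra.
eapply Rle_lt_trans; [exact H|]. rewrite E. replace (eps * t / 2 * (Rabs h / t)) with (eps * Rabs h / 2) by (field; lra). nra.
Qed.

Lemma Dk_mono k f : Dk (S k) f -> Dk k f.
Proof.
revert f; induction k as [|k IH]; intros f [C [z [Hz [Z D]]]]; (split; [exact C|]); auto.
exists z. split; [apply IH, Hz|split; auto].
Qed.

Lemma Dk_ext k f g : Dk k f -> cont2 g -> (forall r t, 0 <= r <= 1 -> 0 <= t -> f r t = g r t) -> Dk k g.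
Proof.
destruct k; intros Df Cg E; split; auto. destruct Df as [_ [z [Hz [Z D]]]].
exists z. split; [auto|split; auto]. intros r t Hr Ht. apply is_derive_ext_loc with (f r); auto.
exists (mkposreal t Ht). intros s Hs. apply E; auto. change (Rabs (s - t) < t) in Hs. revert Hs. unfold Rabs; destruct Rcase_abs; lra.
Qed.

Lemma Dk_plus k f g : Dk k f -> Dk k g -> Dk k (fun r t => f r t + g r t).
Proof.
revert f g; induction k as [|k IH]; intros f g Df Dg; destruct Df as [Cf Hf], Dg as [Cg Hg]; (split; [intros p; ct|]); auto.
destruct Hf as [z [Hz [Z D]]], Hg as [z' [Hz' [Z' D']]].
exists (fun r t => z r t + z' r t). split; [auto|]. split; [intros; rewrite Z, Z'; auto; ring|].
intros r t Hr Ht. replace ((z r t + z' r t) / t) with (z r t / t + z' r t / t) by (field; lra).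
apply (is_derive_plus (V:=R_NormedModule)); auto.
Qed.

Lemma Dk_mult k f g : Dk k f -> Dk k g -> Dk k (fun r t => f r t * g r t).
Proof.
revert f g; induction k as [|k IH]; intros f g Df Dg.
- destruct Df as [Cf _], Dg as [Cg _]. split; auto. intros p; ct.
- pose proof (Dk_mono _ _ Df) as Mf. pose proof (Dk_mono _ _ Dg) as Mg.
  destruct Df as [Cf [z [Hz [Z D]]]], Dg as [Cg [z' [Hz' [Z' D']]]]. split; [intros p; ct|].
  exists (fun r t => z r t * g r t + f r t * z' r t). split; [apply Dk_plus; auto|].
  split; [intros; rewrite Z, Z'; auto; ring|].
  intros r t Hr Ht. specialize (D r t Hr Ht). specialize (D' r t Hr Ht).
  auto_derive; [repeat split; eexists; eauto|]. der D. der D'. field. lra.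
Qed.

Lemma Dk_space k h : cont1 h -> Dk k (fun r _ => h r).
Proof.
intros Ch. revert h Ch. induction k as [|k IH]; intros h Ch; (split; [intros p; ct|]); auto.
exists (fun r t => 0). split; [apply (IH (fun _ => 0)); intros x; ct|]. split; auto.
intros r t _ Ht. unfold Rdiv. rewrite Rmult_0_l. apply (is_derive_const (V:=R_NormedModule) (h r)).
Qed.

(** The family [H] lists the successive derivatives in u, so the induction on k can pass from [H i]
    to [H (S i)]. *)
Lemma Dk_comp k (H : nat -> R -> R -> R) y i : (forall i, cont2 (H i)) ->
  (forall i r u, 0 <= r <= 1 -> is_derive (H i r) u (H (S i) r u)) -> Dk k y -> Dk k (fun r t => H i r (y r t)).
Proof.
intros CH DH. revert i. induction k as [|k IH]; intros i Dy.
- destruct Dy as [Cy _]. pose proof (CH i). split; auto. intros p; ct.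
- pose proof (Dk_mono _ _ Dy) as My. pose proof (Dk_cont _ _ My) as Cy. pose proof (CH i) as Ci.
  split; [intros p; ct|]. destruct Dy as [_ [z [Hz [Z D]]]].
  exists (fun r t => H (S i) r (y r t) * z r t). split; [apply Dk_mult; auto|].
  split; [intros; rewrite Z; auto; ring|].
  intros r t Hr Ht. replace (H (S i) r (y r t) * z r t / t) with (scal (z r t / t) (H (S i) r (y r t))).
  + apply (is_derive_comp (H i r) (y r)); auto.
  + unfold scal; simpl; unfold mult; simpl. field. lra.
Qed.

Lemma dpt_X2 g z : X2 g -> cont2 z -> z 1 0 = 0 -> dpt g z -> X2 z.
Proof.
intros [C Z] Cz Z0 D. split; auto. intros t Ht. destruct (Rle_lt_or_eq_dec 0 t Ht) as [Hp|<-]; auto.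
assert (E : z 1 t / t = 0).
{ rewrite <- (is_derive_unique _ _ _ (D 1 t ltac:(lra) Hp)). apply is_derive_unique.
  apply is_derive_ext_loc with (fun _ => 0); [|apply (is_derive_const (V:=R_NormedModule) 0)].
  exists (mkposreal t Hp). intros s Hs. change (Rabs (s - t) < t) in Hs. symmetry. apply Z. revert Hs. unfold Rabs; destruct Rcase_abs; lra. }
replace (z 1 t) with (z 1 t / t * t) by (field; lra). rewrite E. ring.
Qed.

Lemma Dk_Psi k j f : X0 f -> Dk k (Psi j f).
Proof.
intros Hf. revert j. induction k as [|k IH]; intros j; (split; [apply Psi_cont; auto|]); auto.
exists (fun r t => INR j * Psi j f r t + Psi (S j) f r t). split; [|split].
- apply Dk_plus; auto. apply Dk_mult; auto. apply (Dk_space k (fun _ => INR j)). intros x; ct.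
- intros r Hr. rewrite (Psi_S0 f j) by auto. destruct j; [simpl; ring|]. rewrite Psi_S0 by auto. ring.
- apply udiff_dpt, Psi_udiff, Hf.
Qed.

Lemma Dk_KK k j g : X2 g -> Dk k g -> Dk k (KK j g).
Proof.
revert j g. induction k as [|k IH]; intros j g Xg Dg; (split; [apply KK_cont; auto|]); auto.
pose proof (Dk_mono _ _ Dg) as Mg. destruct Dg as [C [z [Hz [Z D]]]].
assert (Xz : X2 z) by (apply (dpt_X2 g); auto; [apply (Dk_cont k); auto|apply Z; lra]).
exists (fun r t => (INR j + 1) * KK j g r t + KK (S j) g r t + KK j z r t). split; [|split].
- apply Dk_plus; auto. apply Dk_plus; auto. apply Dk_mult; auto. apply (Dk_space k (fun _ => INR j + 1)). intros x; ct.
- intros r Hr. rewrite !KK_0. ring.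
- apply udiff_dpt, KK_udiff; auto. apply dpt_udiff; auto. apply (Dk_cont k); auto.
Qed.

Lemma X2_aq a q b : cont2 a -> X2 q -> X2 b -> X2 (fun r t => a r t * q r t + b r t).
Proof.
intros Ca [Cq Zq] [Cb Zb]. split; [intros p; ct|]. intros t Ht. rewrite Zq, Zb by auto. ring.
Qed.

(** The function t q_t solves an equation of the same form: same coefficient [a], new inhomogeneity
    a' q + b', and free term P' + KK 0 g + KK 1 g. If q has k derivatives, so do these data, and the
    induction hypothesis applies to t q_t. *)
Lemma Dk_linear k : forall q P a b L, X2 q -> X2 P -> X2 b -> Dk k P -> Dk k a -> Dk k b -> 0 < L ->
  (forall r t, 0 <= r <= 1 -> 0 <= t -> Rabs (a r t) <= L) ->
  (forall r t, 0 <= r <= 1 -> 0 <= t -> q r t = P r t + KK 0 (fun r t => a r t * q r t + b r t) r t) -> Dk k q.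
Proof.
induction k as [|k IH]; intros q P a b L Xq XP Xb DP Da Db HL Ba E.
{ split; auto. apply Xq. }
assert (Dq : Dk k q) by (apply (IH q P a b L); auto; apply Dk_mono; auto).
pose proof (Dk_mono _ _ Da) as Ma. pose proof (Dk_mono _ _ Db) as Mb.
set (g := fun r t => a r t * q r t + b r t) in *.
assert (Ca : cont2 a) by (apply (Dk_cont k); auto).
assert (Xg : X2 g) by (apply X2_aq; auto).
assert (Dg : Dk k g) by (apply Dk_plus; auto; apply Dk_mult; auto).
destruct DP as [_ [P' [DP' [ZP' HP']]]]. destruct Da as [_ [a' [Da' [Za' Ha']]]]. destruct Db as [_ [b' [Db' [Zb' Hb']]]].
assert (Ca' : cont2 a') by (apply (Dk_cont k); auto).
assert (XP' : X2 P') by (apply (dpt_X2 P); auto; [apply (Dk_cont k); auto|apply ZP'; lra]).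
assert (Xb' : X2 b') by (apply (dpt_X2 b); auto; [apply (Dk_cont k); auto|apply Zb'; lra]).
assert (Ua : udiff a a') by (apply dpt_udiff; auto).
assert (Ub : udiff b b') by (apply dpt_udiff; auto; apply Xb').
set (b2 := fun r t => a' r t * q r t + b' r t).
assert (Xb2 : X2 b2) by (apply X2_aq; auto).
assert (Db2 : Dk k b2) by (apply Dk_plus; auto; apply Dk_mult; auto).
destruct (duhamel_udiff q P P' g a b2 L) as [z [Xz [Uz [Zz Ez]]]]; auto.
{ apply dpt_udiff; auto. apply XP'. }
{ intros T eps HT He.
  destruct (cont2_bounded q 0 1 0 (2 * T) (proj1 Xq)) as [Q [HQ BQ]].
  destruct (cont2_bounded a' 0 1 0 T Ca') as [A' [HA' BA']].
  destruct (Ua T (eps / (2 * Q)) HT) as [d1 [Hd1 D1]]; [apply Rdiv_lt_0_compat; lra|].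
  destruct (Ub T (eps / 2) HT ltac:(lra)) as [d2 [Hd2 D2]].
  set (d := Rmin d1 (Rmin d2 (eps / A'))).
  assert (Hd : 0 < d <= 1/2 /\ d <= d1 /\ d <= d2 /\ d <= eps / A').
  { assert (0 < eps / A') by (apply Rdiv_lt_0_compat; lra). unfold d, Rmin; repeat destruct Rle_dec; lra. }
  exists d. split; [lra|]. intros l Hl r t Hr Ht.
  assert (Hl2 : 1/2 <= l <= 3/2) by (revert Hl; unfold Rabs; destruct Rcase_abs; lra).
  specialize (D1 l ltac:(lra) r t Hr Ht). specialize (D2 l ltac:(lra) r t Hr Ht).
  specialize (BQ r (l * t) Hr ltac:(nra)). specialize (BA' r t Hr Ht).
  replace (g r (l * t) - g r t - a r t * (q r (l * t) - q r t) - (l - 1) * b2 r t) with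
   ((a r (l * t) - a r t - (l - 1) * a' r t) * q r (l * t) + (l - 1) * a' r t * (q r (l * t) - q r t)
     + (b r (l * t) - b r t - (l - 1) * b' r t)) by (unfold g, b2; ring).
  eapply Rle_trans; [apply Rabs_triang|].
  pose proof (Rabs_triang ((a r (l * t) - a r t - (l - 1) * a' r t) * q r (l * t)) ((l - 1) * a' r t * (q r (l * t) - q r t))) as Tr.
  rewrite !Rabs_mult in Tr.
  assert (E1 : Rabs (a r (l * t) - a r t - (l - 1) * a' r t) * Rabs (q r (l * t)) <= eps / 2 * Rabs (l - 1)).
  { replace (eps / 2 * Rabs (l - 1)) with (eps / (2 * Q) * Rabs (l - 1) * Q) by (field; lra). apply Rmult_le_compat; auto; apply Rabs_pos. }
  assert (E2 : Rabs (l - 1) * Rabs (a' r t) <= eps).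
  { replace eps with (eps / A' * A') by (field; lra). apply Rmult_le_compat; try apply Rabs_pos; lra. }
  pose proof (Rabs_pos (q r (l * t) - q r t)). 
  assert (Rabs (l - 1) * Rabs (a' r t) * Rabs (q r (l * t) - q r t) <= eps * Rabs (q r (l * t) - q r t)) by (apply Rmult_le_compat_r; auto).
  lra. }
assert (Dz : Dk k z).
{ apply (IH z (fun r t => P' r t + (KK 0 g r t + KK 1 g r t)) a b2 L); auto.
  - destruct XP' as [C1 Z1], (KK_X2 0 g Xg) as [C2 Z2], (KK_X2 1 g Xg) as [C3 Z3]. split; [intros p; ct|].
    intros t Ht. rewrite Z1, Z2, Z3 by auto. ring.
  - apply Dk_plus; auto. apply Dk_plus; apply Dk_KK; auto. }
split; [apply Xq|]. exists z. split; [auto|split; auto]. apply udiff_dpt; auto.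
Qed.

(** * Regularity in time for the nonlinear problem *)

Section Nonlinear.
Variables (n ny : R -> R -> R) (L : R) (y : R -> R -> R) (y0 : R -> R).
Hypotheses (Cn : cont2 n) (Cny : cont2 ny) (HL : 0 < L)
  (Dn : forall r u, 0 <= r <= 1 -> is_derive (n r) u (ny r u)) (Bn : forall r u, 0 <= r <= 1 -> Rabs (ny r u) <= L)
  (n1 : n 1 0 = 0) (Xy : X2 y) (Xy0 : X0 y0)
  (Ey : forall r t, 0 <= r <= 1 -> 0 <= t -> y r t = Psi 0 y0 r t + KK 0 (fun r t => n r (y r t)) r t).
Let g r t := n r (y r t).
Let a r t := ny r (y r t).

Lemma nonlinear_X2 : X2 g.
Proof.
destruct Xy as [Cy Zy]. split; [intros p; unfold g; ct|]. intros t Ht. unfold g. rewrite Zy; auto.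
Qed.

(** Linearization along y with a = n_u(r, y) and b = 0, as n does not depend on t. The mean value
    theorem and uniform continuity of [ny] give the expansion of the source. *)
Lemma nonlinear_udiff : exists z, X2 z /\ udiff y z /\ (forall r, 0 <= r <= 1 -> z r 0 = 0) /\
  forall r t, 0 <= r <= 1 -> 0 <= t -> z r t = (Psi 1 y0 r t + (KK 0 g r t + KK 1 g r t)) + KK 0 (fun r t => a r t * z r t + 0) r t.
Proof.
pose proof nonlinear_X2 as Xg. pose proof (proj1 Xy) as Cy.
apply (duhamel_udiff y (Psi 0 y0) (Psi 1 y0) g a (fun _ _ => 0) L); auto.
- split; [apply Psi_cont; auto|]. intros; apply Psi_r1; auto.
- split; [intros p; ct|auto].
- intros p. unfold a. ct.
- intros. apply Bn; auto.
- intros T eps HT He. destruct (Psi_udiff 0 y0 Xy0 T eps HT He) as [d [Hd H]]. exists d. split; auto.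
  intros l Hl r t Hr Ht. specialize (H l Hl r t Hr Ht). simpl in H. rewrite Rmult_0_l, Rplus_0_l in H. auto.
- intros; apply Psi_S0; auto.
- intros T eps HT He.
  destruct (cont2_bounded y 0 1 0 (2 * T) Cy) as [Y [HY BY]].
  destruct (cont2_unif ny 0 1 (- Y) Y eps Cny He) as [d0 [Hd0 U]].
  destruct (scl_unif y T (d0 / 2) Cy HT ltac:(lra)) as [d [Hd S]].
  exists d. split; auto. intros l Hl r t Hr Ht.
  assert (Hl2 : 1/2 <= l <= 3/2) by (revert Hl; unfold Rabs; destruct Rcase_abs; lra).
  specialize (S l Hl r t Hr Ht). unfold scl in S.
  pose proof (BY r (l * t) Hr ltac:(nra)) as B1. pose proof (BY r t Hr ltac:(lra)) as B2.
  apply Rabs_le_between in B1. apply Rabs_le_between in B2.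
  destruct (MVT_abs (n r) (ny r) (y r t) (y r (l * t))) as [c [Hc E]]; [intros; apply Dn; auto|].
  unfold g, a. rewrite E.
  replace (ny r c * (y r (l * t) - y r t) - ny r (y r t) * (y r (l * t) - y r t) - (l - 1) * 0) with
    ((ny r c - ny r (y r t)) * (y r (l * t) - y r t)) by ring.
  rewrite Rabs_mult.
  assert (Rabs (ny r c - ny r (y r t)) <= eps).
  { left. apply U; auto; [revert Hc; unfold Rmin, Rmax; destruct Rle_dec; lra|rewrite Rminus_diag, Rabs_R0; auto|].
    revert Hc S. unfold Rmin, Rmax. destruct Rle_dec; unfold Rabs; repeat destruct Rcase_abs; lra. }
  pose proof (Rabs_pos (l - 1)). pose proof (Rabs_pos (y r (l * t) - y r t)).
  assert (Rabs (ny r c - ny r (y r t)) * Rabs (y r (l * t) - y r t) <= eps * Rabs (y r (l * t) - y r t)) by (apply Rmult_le_compat_r; auto).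
  nra.
Qed.

(** In the application n contains a cutoff that spoils higher derivatives. The family [H] is smooth
    and agrees with n and n_u along the solution, which is where regularity is propagated: k
    derivatives of y give k derivatives of the coefficient, hence of t y_t. *)
Lemma nonlinear_Dk (H : nat -> R -> R -> R) : (forall i, cont2 (H i)) ->
  (forall i r u, 0 <= r <= 1 -> is_derive (H i r) u (H (S i) r u)) ->
  (forall r t, 0 <= r <= 1 -> 0 <= t -> n r (y r t) = H 0%nat r (y r t) /\ ny r (y r t) = H 1%nat r (y r t)) -> forall k, Dk k y.
Proof.
intros CH DH EH k. pose proof nonlinear_X2 as Xg. pose proof (proj1 Xy) as Cy.
destruct nonlinear_udiff as [z [Xz [Uz [Zz Ez]]]].
induction k as [|k IH]; split; auto.
assert (Dg : Dk k g).
{ apply Dk_ext with (fun r t => H 0%nat r (y r t)); [apply Dk_comp; auto|apply Xg|]. intros; symmetry; apply EH; auto. }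
assert (Da : Dk k a).
{ apply Dk_ext with (fun r t => H 1%nat r (y r t)); [apply Dk_comp; auto|intros p; unfold a; ct|]. intros; symmetry; apply EH; auto. }
exists z. split; [|split; [auto|apply udiff_dpt; auto]].
apply (Dk_linear k z (fun r t => Psi 1 y0 r t + (KK 0 g r t + KK 1 g r t)) a (fun _ _ => 0) L); auto.
- destruct (KK_X2 0 g Xg) as [C2 Z2], (KK_X2 1 g Xg) as [C3 Z3]. pose proof (Psi_cont y0 1 Xy0) as C1. split; [intros p; ct|].
  intros t Ht. rewrite Psi_r1, Z2, Z3 by auto. ring.
- split; [intros p; ct|auto].
- apply Dk_plus; [apply Dk_Psi; auto|]. apply Dk_plus; apply Dk_KK; auto.
- apply (Dk_space k (fun _ => 0)). intros x; ct.
- intros. apply Bn; auto.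
Qed.
End Nonlinear.

(** * The inverse of the generator *)

(* [GG] inverts the generator [sin(kr)^-3 (sin(kr)^3 f_r)_r] with the Dirichlet condition at r = 1. *)
Definition flux (f : R -> R) p := RInt (fun s => sin (kk * s) ^ 3 * f s) 0 p.
Definition GG (f : R -> R) r := - RInt (fun p => flux f p / sin (kk * p) ^ 3) r 1.

Ltac Rsimp := simpl; match goal with |- ?a = ?b => change (@eq R a b) end.

Lemma sin_kk_pos p : 0 < p <= 1 -> 0 < sin (kk * p).
Proof. intros Hp. pose proof kk_pos. pose proof PI_RGT_0. apply sin_gt_0; unfold kk in *; nra. Qed.

Lemma cont1_weight f : cont1 f -> cont1 (fun s => sin (kk * s) ^ 3 * f s).
Proof. intros C x. ct. Qed.

Lemma RInt_derive f a p : cont1 f -> is_derive (fun p => RInt f a p) p (f p).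
Proof.
intros C. apply (is_derive_RInt (V := R_NormedModule) f (fun p => RInt f a p) a p); auto.
apply filter_forall. intros q. apply (RInt_correct (V:=R_CompleteNormedModule)), cont1_RInt, C.
Qed.

Lemma RInt_cont1 f a : cont1 f -> cont1 (fun p => RInt f a p).
Proof. intros C. apply is_derive_cont1 with f. intros x. apply RInt_derive; auto. Qed.

Lemma flux_derive f p : cont1 f -> is_derive (flux f) p (sin (kk * p) ^ 3 * f p).
Proof. intros C. apply (RInt_derive (fun s => sin (kk * s) ^ 3 * f s)), cont1_weight, C. Qed.

Lemma flux_cont f : cont1 f -> cont1 (flux f).
Proof. intros C. apply RInt_cont1, cont1_weight, C. Qed.

Lemma flux_quot_cont f p : cont1 f -> 0 < p <= 1 -> continuous (fun p => flux f p / sin (kk * p) ^ 3) p.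
Proof.
intros C Hp. pose proof (flux_cont f C). apply cR_div; [ct|ct|]. apply pow_nonzero. pose proof (sin_kk_pos p Hp). lra.
Qed.

Lemma flux_quot_RInt f r : cont1 f -> 0 < r <= 1 -> ex_RInt (fun p => flux f p / sin (kk * p) ^ 3) r 1.
Proof.
intros C Hr. apply (ex_RInt_continuous (V:=R_CompleteNormedModule)). rewrite Rmin_left, Rmax_right by lra.
intros z Hz. apply flux_quot_cont; auto. lra.
Qed.

Lemma flux_lin f g a b p : cont1 f -> cont1 g -> flux (fun s => a * f s + b * g s) p = a * flux f p + b * flux g p.
Proof.
intros Cf Cg. unfold flux.
pose proof (cont1_RInt _ 0 p (cont1_weight f Cf)) as If. pose proof (cont1_RInt _ 0 p (cont1_weight g Cg)) as Ig.
rewrite (RInt_mul _ a 0 p If), (RInt_mul _ b 0 p Ig).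
rewrite (RInt_add _ _ 0 p (ex_RInt_mul _ a 0 p If) (ex_RInt_mul _ b 0 p Ig)).
apply RInt_ext. intros; simpl; ring.
Qed.

Lemma GG_lin f g a b r : cont1 f -> cont1 g -> 0 < r <= 1 -> GG (fun s => a * f s + b * g s) r = a * GG f r + b * GG g r.
Proof.
intros Cf Cg Hr. unfold GG.
pose proof (flux_quot_RInt f r Cf Hr) as If. pose proof (flux_quot_RInt g r Cg Hr) as Ig.
replace (a * - RInt (fun p => flux f p / sin (kk * p) ^ 3) r 1 + b * - RInt (fun p => flux g p / sin (kk * p) ^ 3) r 1) with
 (- (a * RInt (fun p => flux f p / sin (kk * p) ^ 3) r 1 + b * RInt (fun p => flux g p / sin (kk * p) ^ 3) r 1)) by ring.
rewrite (RInt_mul _ a r 1 If), (RInt_mul _ b r 1 Ig).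
rewrite (RInt_add _ _ r 1 (ex_RInt_mul _ a r 1 If) (ex_RInt_mul _ b r 1 Ig)).
f_equal. apply RInt_ext. rewrite Rmin_left, Rmax_right by lra. intros x Hx. rewrite flux_lin by auto.
simpl. field. pose proof (sin_kk_pos x). lra.
Qed.

Lemma GG_bound f b r : cont1 f -> 0 < r <= 1 -> (forall s, 0 <= s <= 1 -> Rabs (f s) <= b) -> Rabs (GG f r) <= / sin (kk * r) ^ 3 * b.
Proof.
intros C Hr H. pose proof (sin_kk_pos r Hr) as S0.
assert (Hb : 0 <= b) by (apply Rle_trans with (2 := H 0 ltac:(lra)); apply Rabs_pos).
unfold GG. rewrite Rabs_Ropp. apply Rle_trans with ((1 - r) * (/ sin (kk * r) ^ 3 * b)).
- apply RInt_bound; [lra|apply flux_quot_RInt; auto|]. intros p Hp.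
  assert (F : Rabs (flux f p) <= (p - 0) * b).
  { apply RInt_bound; [lra|apply cont1_RInt, cont1_weight; auto|]. intros s Hs. rewrite Rabs_mult, <- RPow_abs.
    rewrite <- (Rmult_1_l b). apply Rmult_le_compat; try apply Rabs_pos; [apply pow_le, Rabs_pos| |apply H; lra].
    rewrite <- (pow1 3). apply pow_incr. split; [apply Rabs_pos|]. apply Rabs_le_between. pose proof (SIN_bound (kk * s)). lra. }
  assert (sin (kk * r) <= sin (kk * p)).
  { pose proof kk_pos. pose proof PI_RGT_0. apply sin_incr_1; unfold kk in *; nra. }
  unfold Rdiv. rewrite Rabs_mult, Rabs_inv, Rmult_comm, (Rabs_pos_eq (sin (kk * p) ^ 3)) by (apply pow_le; lra).
  apply Rmult_le_compat; try apply Rabs_pos.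
  + apply Rlt_le, Rinv_0_lt_compat, pow_lt. lra.
  + apply Rinv_le_contravar; [apply pow_lt; lra|]. apply pow_incr. lra.
  + nra.
- assert (0 <= / sin (kk * r) ^ 3 * b) by (apply Rmult_le_pos; auto; apply Rlt_le, Rinv_0_lt_compat, pow_lt; lra). nra.
Qed.

Lemma GG_ext f g r : 0 < r <= 1 -> (forall s, 0 <= s <= 1 -> f s = g s) -> GG f r = GG g r.
Proof.
intros Hr H. unfold GG. f_equal. apply RInt_ext. rewrite Rmin_left, Rmax_right by lra. intros x Hx. f_equal.
unfold flux. apply RInt_ext. rewrite Rmin_left, Rmax_right by lra. intros s Hs. rewrite H; auto; lra.
Qed.

Lemma mode_cont m : is_mode m -> cont1 (fun s => e0 m (cos (kk * s))).
Proof. intros M. pose proof (is_derive_cont1 _ _ (e0_der m M)). intros x. ct. Qed.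

(** By the eigenvalue equation the flux is -k sin(kr)^4 e1(cos(kr)); divided by sin(kr)^3 it is the
    derivative of e0(cos(kr)). Oddness makes the value at the equator vanish. *)
Lemma GG_mode m r : is_mode m -> 0 < r <= 1 -> GG (fun s => - (kk ^ 2 * lam m) * e0 m (cos (kk * s))) r = e0 m (cos (kk * r)).
Proof.
intros M Hr. pose proof (mode_cont m M) as Cm.
pose proof (is_derive_cont1 _ _ (e0_der m M)) as C0. pose proof (is_derive_cont1 _ _ (e1_der m M)) as C1.
set (f := fun s => - (kk ^ 2 * lam m) * e0 m (cos (kk * s))).
assert (Cf : cont1 f) by (intros x; unfold f; ct).
assert (Ffl : forall p, flux f p = - kk * sin (kk * p) ^ 4 * e1 m (cos (kk * p))).
{ intros p. unfold flux.
  assert (D : is_RInt (fun s => sin (kk * s) ^ 3 * f s) 0 p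
    (- kk * sin (kk * p) ^ 4 * e1 m (cos (kk * p)) - (- kk * sin (kk * 0) ^ 4 * e1 m (cos (kk * 0))))).
  { apply (is_RInt_derive (fun p => - kk * sin (kk * p) ^ 4 * e1 m (cos (kk * p)))).
    - intros x _. pose proof (e1_der m M (cos (kk * x))) as D1.
      pose proof (e_ode m M (cos (kk * x))) as O.
      auto_derive; [repeat split; auto; eexists; exact D1|]. der D1. unfold f.
      replace (sin (kk * x) ^ 3 * (- (kk ^ 2 * lam m) * e0 m (cos (kk * x)))) with (kk ^ 2 * sin (kk * x) ^ 3 * (- lam m * e0 m (cos (kk * x)))) by ring.
      rewrite <- O. replace (1 - cos (kk * x) ^ 2) with (sin (kk * x) ^ 2) by (rewrite <- !Rsqr_pow2, sin2; ring).
      Rsimp. ring.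
    - intros x _. ct. }
  rewrite (is_RInt_unique _ _ _ _ D). rewrite Rmult_0_r, sin_0. Rsimp. ring. }
unfold GG.
assert (D : is_RInt (fun p => flux f p / sin (kk * p) ^ 3) r 1 (e0 m (cos (kk * 1)) - e0 m (cos (kk * r)))).
{ apply is_RInt_ext with (fun p => - kk * sin (kk * p) * e1 m (cos (kk * p))).
  - rewrite Rmin_left, Rmax_right by lra. intros x Hx. rewrite Ffl. Rsimp. field. apply Rgt_not_eq, sin_kk_pos; lra.
  - apply (is_RInt_derive (fun p => e0 m (cos (kk * p)))).
    + intros x _. pose proof (e0_der m M (cos (kk * x))) as D1. auto_derive; [repeat split; eexists; exact D1|]. der D1. ring.
    + intros x _. ct. }
rewrite (is_RInt_unique _ _ _ _ D). rewrite cos_kk1.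
pose proof (e_odd m M 0) as O. rewrite Ropp_0 in O. lra.
Qed.

Lemma GG_0 r : 0 < r <= 1 -> GG (fun _ => 0) r = 0.
Proof.
intros Hr. apply Rabs_eq_0, Rle_antisym; [|apply Rabs_pos].
apply Rle_trans with (/ sin (kk * r) ^ 3 * 0); [|right; ring]. apply GG_bound; auto; [intros x; ct|]. intros; cbv beta; rewrite Rabs_R0; lra.
Qed.

Lemma GG_flow fl r t : valid fl -> 0 < r <= 1 -> GG (fun s => V fl 1 s t) r = t * V fl 0 r t.
Proof.
intros Va Hr. induction fl as [|[c m] fl IH].
- unfold V, W; simpl. rewrite GG_0 by auto. ring.
- inversion Va as [|? ? M Va']; subst. specialize (IH Va'). simpl in M.
  pose proof (mode_cont m M) as Cm.
  assert (Cv : cont1 (fun s => V fl 1 s t)) by (apply cont2_sec_r, V_cont; auto).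
  transitivity (GG (fun s => (c * t * exp (- lam m * (kk ^ 2 * t))) * (- (kk ^ 2 * lam m) * e0 m (cos (kk * s))) + 1 * V fl 1 s t) r).
  { apply GG_ext; auto. intros s _. unfold V, W. simpl. ring. }
  rewrite (GG_lin (fun s => - (kk ^ 2 * lam m) * e0 m (cos (kk * s))) (fun s => V fl 1 s t)) by (auto; intros x; ct).
  rewrite GG_mode, IH by auto. unfold V, W. simpl. ring.
Qed.

Lemma GG_dist f g b r : cont1 f -> cont1 g -> 0 < r <= 1 -> (forall s, 0 <= s <= 1 -> Rabs (f s - g s) <= b) ->
  Rabs (GG f r - GG g r) <= / sin (kk * r) ^ 3 * b.
Proof.
intros Cf Cg Hr H. replace (GG f r - GG g r) with (1 * GG f r + -1 * GG g r) by ring.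
rewrite <- GG_lin by auto. apply GG_bound; auto; [intros x; ct|]. intros s Hs.
replace (1 * f s + -1 * g s) with (f s - g s) by ring. auto.
Qed.

Lemma GG_Psi f r t : X0 f -> 0 < r <= 1 -> 0 <= t -> GG (fun s => Psi 1 f s t) r = t * Psi 0 f r t.
Proof.
intros Hf Hr Ht. apply Rminus_diag_uniq, Rabs_eq_0, Rle_antisym; [|apply Rabs_pos].
apply le_eps with (K := / sin (kk * r) ^ 3 * Cj 1 + t * Cj 0). intros eps He.
destruct (Psi_close0 f 1 eps Hf He) as [fl [Va [_ P]]].
assert (D : Rabs (GG (fun s => Psi 1 f s t) r - GG (fun s => V fl 1 s t) r) <= / sin (kk * r) ^ 3 * (Cj 1 * eps)).
{ apply GG_dist; auto; [apply cont2_sec_r, Psi_cont; auto|apply cont2_sec_r, V_cont; auto]. }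
rewrite GG_flow in D by auto.
pose proof (P O r t ltac:(lia) ltac:(lra) Ht) as P0.
assert (Rabs (t * (Psi 0 f r t - V fl 0 r t)) <= t * (Cj 0 * eps)).
{ rewrite Rabs_mult, Rabs_pos_eq by auto. apply Rmult_le_compat_l; auto. }
apply Rabs_le_between in D. apply Rabs_le_between in H. apply Rabs_le_between. lra.
Qed.

(** * The evolution equation for Duhamel's integral *)

Lemma RInt_scale f t : cont1 f -> RInt f 0 t = t * RInt (fun s => f (t * s)) 0 1.
Proof.
intros C. pose proof (RInt_comp_lin (V:=R_CompleteNormedModule) f t 0 0 1) as E.
replace (t * 0 + 0) with 0 in E by ring. replace (t * 1 + 0) with t in E by ring.
rewrite <- E by (apply cont1_RInt; auto).
rewrite RInt_mul.
- apply RInt_ext. intros x _. unfold scal; simpl; unfold mult; simpl. rewrite Rplus_0_r. auto.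
- apply cont1_RInt. intros x. ct.
Qed.

Lemma RInt_time_cont g t : cont2 g -> cont1 (fun q => RInt (g q) 0 t).
Proof.
intros C x. apply continuous_ext with (fun q => t * RInt (fun s => g q (t * s)) 0 1).
- intros q. symmetry. apply RInt_scale. apply cont2_sec_t; auto.
- apply cR_mult; [apply continuous_const|].
  assert (C3 : cont3 (fun q (_ : R) s => g q (t * s))) by (intros p; ct).
  apply (cont2_sec_r _ 0 (RInt_cont2 _ C3)).
Qed.

(** The time-integrated form of d/dt KK = A KK + g, with A inverted. Unlike the differential form,
    it passes to uniform limits in g. *)
Definition duhamel_identity T g := forall r t, 0 < r <= 1 -> 0 <= t <= T ->
  GG (fun q => KK 0 g q t - RInt (g q) 0 t) r = RInt (KK 0 g r) 0 t.

Lemma duhamel_cont g t : X2 g -> cont1 (fun q => KK 0 g q t - RInt (g q) 0 t).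
Proof.
intros Xg x. apply cR_minus; [apply (cont2_sec_r _ t (KK_cont 0 g Xg))|apply RInt_time_cont, Xg].
Qed.

Lemma duhamel_identity_plus T g h : X2 g -> X2 h -> duhamel_identity T g -> duhamel_identity T h ->
  duhamel_identity T (fun r t => 1 * g r t + 1 * h r t).
Proof.
intros Xg Xh Ig Ih r t Hr Ht. specialize (Ig r t Hr Ht). specialize (Ih r t Hr Ht).
pose proof (fun q => cont1_RInt (g q) 0 t (cont2_sec_t _ q (proj1 Xg))) as Rg.
pose proof (fun q => cont1_RInt (h q) 0 t (cont2_sec_t _ q (proj1 Xh))) as Rh.
transitivity (GG (fun q => 1 * (KK 0 g q t - RInt (g q) 0 t) + 1 * (KK 0 h q t - RInt (h q) 0 t)) r).
- apply GG_ext; auto. intros q _. rewrite KK_lin by auto.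
  rewrite <- (RInt_add _ _ 0 t (ex_RInt_mul _ 1 0 t (Rg q)) (ex_RInt_mul _ 1 0 t (Rh q))).
  rewrite <- (RInt_mul _ 1 0 t (Rg q)), <- (RInt_mul _ 1 0 t (Rh q)). ring.
- rewrite GG_lin by (auto; apply duhamel_cont; auto). rewrite Ig, Ih.
  pose proof (cont1_RInt _ 0 t (cont2_sec_t _ r (KK_cont 0 g Xg))) as Kg.
  pose proof (cont1_RInt _ 0 t (cont2_sec_t _ r (KK_cont 0 h Xh))) as Kh.
  rewrite (RInt_mul _ 1 0 t Kg), (RInt_mul _ 1 0 t Kh).
  rewrite (RInt_add _ _ 0 t (ex_RInt_mul _ 1 0 t Kg) (ex_RInt_mul _ 1 0 t Kh)).
  apply RInt_ext. intros s _. rewrite KK_lin; auto.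
Qed.

Lemma RInt_eq_0 T h : cont1 h -> h 0 = 0 -> (forall t, 0 <= t -> is_derive h t 0) -> 0 <= T -> h T = 0.
Proof.
intros _ H0 D HT. destruct (MVT_abs h (fun _ => 0) 0 T) as [c [_ E]].
- rewrite Rmin_left by lra. intros x Hx. apply D. lra.
- lra.
Qed.

Lemma mode_X2 h m : cont1 h -> is_mode m -> X2 (fun r t => h t * e0 m (cos (kk * r))).
Proof.
intros Ch M. pose proof (is_derive_cont1 _ _ (e0_der m M)). split; [intros p; ct|]. intros t _.
rewrite cos_kk1. pose proof (e_odd m M 0) as O. rewrite Ropp_0 in O. replace (e0 m 0) with 0 by lra. ring.
Qed.

(** On one mode Duhamel's integral is the mode times the solution [Ei] of the scalar equation Ei' =
    -mu Ei + h, and the identity is that equation integrated in time. *)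
Lemma duhamel_identity_mode T h m : cont1 h -> is_mode m -> duhamel_identity T (fun r t => h t * e0 m (cos (kk * r))).
Proof.
intros Ch M r t Hr Ht. set (mu := kk ^ 2 * lam m). pose proof (mode_cont m M) as Cm.
set (g := fun r t => h t * e0 m (cos (kk * r))). assert (Xg : X2 g) by (apply mode_X2; auto).
set (Ei := fun t => exp (- (mu * t)) * RInt (fun u => exp (mu * u) * h u) 0 t).
assert (Cw : cont1 (fun u => exp (mu * u) * h u)) by (intros x; ct).
assert (DE : forall t, is_derive Ei t (- mu * Ei t + h t)).
{ intros s. pose proof (RInt_derive _ 0 s Cw) as D.
  assert (D2 : is_derive (fun s => exp (- (mu * s))) s (- mu * exp (- (mu * s)))) by (auto_derive; auto; ring).
  replace (- mu * Ei s + h s) with (plus (mult (- mu * exp (- (mu * s))) (RInt (fun u => exp (mu * u) * h u) 0 s))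
    (mult (exp (- (mu * s))) (exp (mu * s) * h s))).
  - apply (is_derive_mult (fun s => exp (- (mu * s))) (fun p => RInt (fun u => exp (mu * u) * h u) 0 p)); auto. intros; apply Rmult_comm.
  - unfold plus, mult; simpl. unfold Ei. rewrite <- (Rmult_assoc (exp (- (mu * s)))), <- exp_plus.
    replace (- (mu * s) + mu * s) with 0 by ring. rewrite exp_0. ring. }
assert (CE : cont1 Ei) by (eapply is_derive_cont1; apply DE).
assert (EK : forall q s, 0 <= q <= 1 -> 0 <= s -> KK 0 g q s = Ei s * e0 m (cos (kk * q))).
{ intros q s Hq Hs. unfold KK. rewrite tp_id by auto. unfold Ei. rewrite (RInt_scale _ s Cw).
  assert (Cs : cont1 (fun s0 => exp (mu * (s * s0)) * h (s * s0))) by (intros x; ct).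
  transitivity ((s * (exp (- (mu * s)) * e0 m (cos (kk * q)))) * RInt (fun s0 => exp (mu * (s * s0)) * h (s * s0)) 0 1); [|ring].
  rewrite Rmult_assoc. f_equal. rewrite (RInt_mul _ (exp (- (mu * s)) * e0 m (cos (kk * q))) 0 1 (cont1_RInt _ 0 1 Cs)). apply RInt_ext.
  rewrite Rmin_left, Rmax_right by lra. intros x Hx. unfold KKi. rewrite !(tp_id s) by auto.
  assert (Hsx : 0 <= s * (1 - x)) by nra. assert (Hsx2 : 0 <= s * x) by nra. rewrite (tp_id (s * x)) by auto.
  assert (P : Rabs (Psi 0 (fun q => g q (s * x)) q (s * (1 - x)) - V ((h (s * x), m) :: nil) 0 (cl q) (tp (s * (1 - x)))) <= Cj 0 * 0).
  { apply Psi_close.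
    - apply cont2_sec_r, Xg.
    - constructor; auto; constructor.
    - intros p Hp. unfold V, W, g. simpl. rewrite !Rmult_0_r, exp_0.
      match goal with |- Rabs ?z <= 0 => replace z with 0 by ring end. rewrite Rabs_R0. lra. }
  rewrite cl_id, tp_id in P by auto. rewrite Rmult_0_r in P.
  assert (P0 := Rle_antisym _ _ P (Rabs_pos _)). apply Rabs_eq_0, Rminus_diag_uniq in P0. rewrite P0.
  unfold V, W. simpl. replace (- lam m * (kk * (kk * 1) * (s * (1 - x)))) with (- (mu * s) + mu * (s * x)) by (unfold mu; ring).
  rewrite exp_plus. ring. }
assert (EH : forall s, 0 <= s -> Ei s - RInt h 0 s = - mu * RInt Ei 0 s).
{ intros s Hs. apply Rminus_diag_uniq.
  apply (RInt_eq_0 s (fun s => Ei s - RInt h 0 s - - mu * RInt Ei 0 s)); auto.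
  - pose proof (RInt_cont1 h 0 Ch) as Q1. pose proof (RInt_cont1 Ei 0 CE) as Q2. intros x.
    apply cR_minus; [apply cR_minus; [apply CE|apply Q1]|apply cR_mult; [apply continuous_const|apply Q2]].
  - unfold Ei at 1. rewrite !(RInt_point (V:=R_CompleteNormedModule)). unfold zero; simpl. ring.
  - intros x _. match goal with |- is_derive ?f ?a _ => cut (is_derive f a ((- mu * Ei x + h x - h x) - - mu * Ei x));
      [intros Q; replace ((- mu * Ei x + h x - h x) - - mu * Ei x) with 0 in Q by ring; exact Q|] end.
    apply (is_derive_minus (V:=R_NormedModule)).
    + apply (is_derive_minus (V:=R_NormedModule)); auto. apply RInt_derive; auto.
    + apply (is_derive_scal (fun p => RInt Ei 0 p)). apply RInt_derive; auto. }
transitivity (GG (fun q => RInt Ei 0 t * (- mu * e0 m (cos (kk * q))) + 0 * 0) r).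
- apply GG_ext; auto. intros q Hq. rewrite EK by (auto; lra).
  assert (Eg : RInt (fun t0 => h t0 * e0 m (cos (kk * q))) 0 t = e0 m (cos (kk * q)) * RInt h 0 t).
  { rewrite (RInt_mul h) by (apply cont1_RInt; auto). apply RInt_ext. intros; apply Rmult_comm. }
  rewrite Eg.
  replace (Ei t * e0 m (cos (kk * q)) - e0 m (cos (kk * q)) * RInt h 0 t) with ((Ei t - RInt h 0 t) * e0 m (cos (kk * q))) by ring.
  rewrite EH by lra. ring.
- rewrite (GG_lin (fun q => - mu * e0 m (cos (kk * q))) (fun _ => 0)) by (auto; intros x; ct).
  unfold mu. rewrite GG_mode by auto.
  transitivity (e0 m (cos (kk * r)) * RInt Ei 0 t); [ring|].
  rewrite RInt_mul by (apply cont1_RInt; auto). apply RInt_ext.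
  rewrite Rmin_left, Rmax_right by lra. intros s Hs. rewrite EK by lra. Rsimp; ring.
Qed.

(** Both sides are continuous in g in the sup norm; for fixed r > 0 the operator [GG] costs the
    finite factor 1/sin(kr)^3. *)
Lemma duhamel_identity_all T g : 0 <= T -> X2 g -> duhamel_identity T g.
Proof.
intros HT Xg r t Hr Ht.
apply Rminus_diag_uniq, Rabs_eq_0, Rle_antisym; [|apply Rabs_pos].
set (S3 := / sin (kk * r) ^ 3).
apply le_eps with (K := S3 * (2 * T) + T * T). intros eps He.
destruct (tspan_dense g T eps HT (proj1 Xg) (proj2 Xg) He) as [f [[tf [Va [Ct Ef]]] Hf]].
assert (If : forall tf : list ((R -> R) * mode), valid tf -> (forall h m, In (h, m) tf -> cont1 h) ->
   X2 (fun r t => ls (fun h m => h t * e0 m (cos (kk * r))) tf) /\ duhamel_identity T (fun r t => ls (fun h m => h t * e0 m (cos (kk * r))) tf)).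
{ clear tf Va Ct Ef. intros tf. induction tf as [|[h m] tf IH]; intros Va Ct.
  - simpl. assert (X : X2 (fun _ _ => 0)) by (split; [intros p; ct|auto]). split; auto.
    intros q s Hq Hs.
    assert (KZ : forall q s, 0 <= s -> KK 0 (fun _ _ => 0) q s = 0).
    { intros. apply Rabs_eq_0, Rle_antisym; [|apply Rabs_pos]. 
      pose proof (KK_bd 0 (fun _ _ => 0) 0 q0 s0 X H) as Q. rewrite !Rmult_0_r in Q. apply Q. intros; cbv beta; rewrite Rabs_R0; lra. }
    rewrite (GG_ext _ (fun _ => 0)); auto.
    + rewrite GG_0 by auto. symmetry. rewrite (RInt_ext _ (fun _ => 0)).
      * rewrite RInt_const. unfold scal; simpl; unfold mult; simpl. ring.
      * rewrite Rmin_left, Rmax_right by lra. intros x Hx. apply KZ. lra.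
    + intros p _. rewrite KZ by lra. rewrite RInt_const. unfold scal; simpl; unfold mult; simpl. ring.
  - inversion Va as [|? ? M Va']; subst. simpl in M. destruct (IH Va') as [X I]; [intros; eapply Ct; right; eauto|].
    assert (Ch : cont1 h) by (eapply Ct; left; eauto).
    pose proof (mode_X2 h m Ch M) as Xm.
    assert (Ee : (fun r t => ls (fun h m => h t * e0 m (cos (kk * r))) ((h, m) :: tf)) =
       (fun r t => 1 * (h t * e0 m (cos (kk * r))) + 1 * ls (fun h m => h t * e0 m (cos (kk * r))) tf)).
    { apply FunctionalExtensionality.functional_extensionality; intros a. apply FunctionalExtensionality.functional_extensionality; intros b. simpl. ring. }
    rewrite Ee. split; [apply (X2_lin (fun r t => h t * e0 m (cos (kk * r)))); auto|].
    apply (duhamel_identity_plus T (fun r t => h t * e0 m (cos (kk * r)))); auto. apply duhamel_identity_mode; auto. }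
destruct (If tf Va Ct) as [Xf' I']. clear If.
set (f' := fun r t => ls (fun h m => h t * e0 m (cos (kk * r))) tf) in *.
assert (Hf' : forall r t, 0 <= r <= 1 -> 0 <= t <= T -> Rabs (g r t - f' r t) <= eps) by (intros; unfold f'; rewrite <- Ef; auto).
specialize (I' r t Hr Ht).
assert (DK : forall q s, 0 <= q <= 1 -> 0 <= s <= T -> Rabs (KK 0 g q s - KK 0 f' q s) <= T * eps).
{ intros q s Hq Hs. replace (KK 0 g q s - KK 0 f' q s) with (1 * KK 0 g q s + -1 * KK 0 f' q s) by ring.
  rewrite <- KK_lin by auto. apply Rle_trans with (s * (Cj 0 * eps)); [|simpl; rewrite Rmult_1_l; apply Rmult_le_compat_r; lra].
  apply KK_bd; try lra; [apply X2_lin; auto|]. intros a b Ha Hb. replace (1 * g a b + -1 * f' a b) with (g a b - f' a b) by ring. apply Hf'; auto; lra. }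
assert (D1 : Rabs (GG (fun q => KK 0 g q t - RInt (g q) 0 t) r - GG (fun q => KK 0 f' q t - RInt (f' q) 0 t) r) <= S3 * (T * eps + T * eps)).
{ apply GG_dist; auto; try apply duhamel_cont; auto. intros q Hq. specialize (DK q t Hq Ht).
  pose proof (cont2_sec_t _ q (proj1 Xg)) as Cg. pose proof (cont2_sec_t _ q (proj1 Xf')) as Cf.
  assert (Rabs (RInt (g q) 0 t - RInt (f' q) 0 t) <= (t - 0) * eps).
  { rewrite RInt_sub by (apply cont1_RInt; auto). apply RInt_bound; [lra|apply cont1_RInt; intros x; apply cR_minus; auto|]. intros; apply Hf'; auto; lra. }
  assert ((t - 0) * eps <= T * eps) by (apply Rmult_le_compat_r; lra).
  apply Rabs_le_between in H. apply Rabs_le_between in DK. apply Rabs_le_between. lra. }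
assert (D2 : Rabs (RInt (KK 0 g r) 0 t - RInt (KK 0 f' r) 0 t) <= T * (T * eps)).
{ pose proof (cont2_sec_t _ r (KK_cont 0 g Xg)) as Cg. pose proof (cont2_sec_t _ r (KK_cont 0 f' Xf')) as Cf.
  rewrite RInt_sub by (apply cont1_RInt; auto). apply Rle_trans with ((t - 0) * (T * eps)).
  - apply RInt_bound; [lra|apply cont1_RInt; intros x; apply cR_minus; auto|]. intros; apply DK; lra.
  - apply Rmult_le_compat_r; [apply Rmult_le_pos|]; lra. }
rewrite I' in D1. apply Rabs_le_between in D1. apply Rabs_le_between in D2. apply Rabs_le_between. lra.
Qed.

(** Difference quotients of the integrated identity over [t, t+h]. Differentiability of [KK 0 g] is
    supplied through [udiff], with derivative z/t. *)
Lemma duhamel_generator g z : X2 g -> cont2 z -> udiff (KK 0 g) z -> forall r t, 0 < r <= 1 -> 0 < t ->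
  GG (fun q => z q t / t - g q t) r = KK 0 g r t.
Proof.
intros Xg Cz U r t Hr Ht.
apply Rminus_diag_uniq, Rabs_eq_0, Rle_antisym; [|apply Rabs_pos].
set (S3 := / sin (kk * r) ^ 3).
apply le_eps with (K := S3 * (/ t + 1) + 1). intros eps He.
destruct (U t eps Ht He) as [d1 [Hd1 D1]].
destruct (cont2_unif g 0 1 0 (2 * t) eps (proj1 Xg) He) as [d2 [Hd2 D2]].
destruct (cont2_unif (KK 0 g) 0 1 0 (2 * t) eps (KK_cont 0 g Xg) He) as [d3 [Hd3 D3]].
set (h := Rmin (d1 * t / 2) (Rmin (d2 / 2) (d3 / 2))).
assert (Hh : 0 < h /\ h <= d1 * t / 2 /\ h <= d2 / 2 /\ h <= d3 / 2).
{ assert (0 < d1 * t) by nra. unfold h, Rmin; repeat destruct Rle_dec; lra. }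
assert (Hht : h <= t) by nra.
pose proof (duhamel_identity_all (2 * t) g ltac:(lra) Xg r (t + h) Hr ltac:(lra)) as I1.
pose proof (duhamel_identity_all (2 * t) g ltac:(lra) Xg r t Hr ltac:(lra)) as I0.
pose proof (duhamel_cont g (t + h) Xg) as C1. pose proof (duhamel_cont g t Xg) as C0.
pose proof (GG_lin _ _ (/ h) (- / h) r C1 C0 Hr) as L. rewrite I1, I0 in L.
assert (Z0 : Rabs (t - t) < Rmin d2 d3) by (rewrite Rminus_diag, Rabs_R0; unfold Rmin; destruct Rle_dec; lra).
assert (Avg : forall f d, cont1 f -> 0 < d -> h <= d / 2 -> (forall s, 0 <= s <= 2 * t -> Rabs (s - t) < d -> Rabs (f s - f t) <= eps) ->
   Rabs (/ h * RInt f 0 (t + h) + - / h * RInt f 0 t - f t) <= eps).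
{ intros f d Cf Hd Hhd Hf.
  pose proof (RInt_Chasles (V:=R_CompleteNormedModule) f 0 t (t + h) (cont1_RInt f 0 t Cf) (cont1_RInt f t (t + h) Cf)) as Ch.
  unfold plus in Ch; simpl in Ch. rewrite <- Ch.
  assert (Ec : RInt (fun _ => f t) t (t + h) = h * f t) by (rewrite RInt_const; unfold scal; simpl; unfold mult; simpl; ring).
  replace (/ h * (RInt f 0 t + RInt f t (t + h)) + - / h * RInt f 0 t - f t) with (/ h * (RInt f t (t + h) - RInt (fun _ => f t) t (t + h))) by (rewrite Ec; field; lra).
  rewrite RInt_sub by (apply cont1_RInt; auto; intros x; ct).
  rewrite Rabs_mult, Rabs_pos_eq by (apply Rlt_le, Rinv_0_lt_compat; lra).
  apply Rmult_le_reg_l with h; [lra|]. rewrite <- Rmult_assoc, Rinv_r, Rmult_1_l by lra.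
  replace (h * eps) with ((t + h - t) * eps) by ring.
  apply RInt_bound; [lra|apply cont1_RInt; intros x; ct|].
  intros s Hs. apply Hf; [lra|]. rewrite Rabs_pos_eq; lra. }
assert (Q1 : Rabs (/ h * RInt (KK 0 g r) 0 (t + h) + - / h * RInt (KK 0 g r) 0 t - KK 0 g r t) <= eps).
{ apply Avg with d3; auto; try lra; [apply cont2_sec_t, KK_cont; auto|]. intros s Hs Hst. left. apply D3; auto; try lra. rewrite Rminus_diag, Rabs_R0; auto. }
assert (Q2 : Rabs (GG (fun q => z q t / t - g q t) r
   - GG (fun s => / h * (KK 0 g s (t + h) - RInt (g s) 0 (t + h)) + - / h * (KK 0 g s t - RInt (g s) 0 t)) r) <= S3 * (/ t * eps + eps)).
{ destruct Xg as [Cg Zg]. apply GG_dist; auto.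
  - intros x. unfold Rdiv. ct.
  - intros x. apply cR_plus; apply cR_mult; try apply continuous_const; auto.
  - intros q Hq.
    assert (A1 : Rabs (/ h * RInt (g q) 0 (t + h) + - / h * RInt (g q) 0 t - g q t) <= eps).
    { apply Avg with d2; auto; try lra; [apply cont2_sec_t; auto|]. intros s Hs Hst. left. apply D2; auto; try lra. rewrite Rminus_diag, Rabs_R0; auto. }
    specialize (D1 (1 + h / t)). replace (1 + h / t - 1) with (h / t) in D1 by ring.
    assert (Pht : 0 < h / t) by (apply Rdiv_lt_0_compat; lra).
    rewrite Rabs_pos_eq in D1 by lra.
    specialize (D1 ltac:(apply Rmult_lt_reg_r with t; auto; unfold Rdiv; rewrite Rmult_assoc, Rinv_l by lra; lra) q t Hq ltac:(lra)).
    replace ((1 + h / t) * t) with (t + h) in D1 by (field; lra).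
    assert (A2 : Rabs (/ h * (KK 0 g q (t + h) - KK 0 g q t - h / t * z q t)) <= / t * eps).
    { rewrite Rabs_mult, (Rabs_pos_eq (/ h)) by (apply Rlt_le, Rinv_0_lt_compat; lra).
      replace (/ t * eps) with (/ h * (eps * (h / t))) by (field; lra). apply Rmult_le_compat_l; auto. apply Rlt_le, Rinv_0_lt_compat; lra. }
    match goal with |- Rabs ?x <= _ => replace x with
      ((/ h * RInt (g q) 0 (t + h) + - / h * RInt (g q) 0 t - g q t) - / h * (KK 0 g q (t + h) - KK 0 g q t - h / t * z q t)) by (field; lra) end.
    apply Rabs_le_between in A1. apply Rabs_le_between in A2. apply Rabs_le_between. lra. }
rewrite L in Q2. apply Rabs_le_between in Q1. apply Rabs_le_between in Q2. apply Rabs_le_between. lra.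
Qed.

(** * Smooth functions of two variables *)

Definition open2 (U : R -> R -> Prop) := forall x y, U x y -> exists d, 0 < d /\
  forall x' y', Rabs (x' - x) < d -> Rabs (y' - y) < d -> U x' y'.

(** Class C^k on U with the partial derivatives as existential witnesses; the algebraic closure
    lemmas then avoid iterated [Derive]. *)
Fixpoint Sm (U : R -> R -> Prop) k (f : R -> R -> R) : Prop :=
  (forall x y, U x y -> continuous (fun p : R * R => f (fst p) (snd p)) (x, y)) /\ match k with
  | O => True
  | S k => exists fx fy : R -> R -> R, (forall x y, U x y -> is_derive (fun a => f a y) x (fx x y)) /\
      (forall x y, U x y -> is_derive (f x) y (fy x y)) /\ Sm U k fx /\ Sm U k fy end.

Section Smooth.
Variable U : R -> R -> Prop.

Lemma Sm_cont k f x y : Sm U k f -> U x y -> continuous (fun p : R * R => f (fst p) (snd p)) (x, y).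
Proof. destruct k; intros [C _]; auto. Qed.

Lemma Sm_mono k f : Sm U (S k) f -> Sm U k f.
Proof.
revert f. induction k as [|k IH]; intros f [C [fx [fy [D1 [D2 [S1 S2]]]]]]; (split; [exact C|]); auto.
exists fx, fy. split; [auto|]. split; [auto|]. split; apply IH; auto.
Qed.

Lemma Sm_plus k f g : Sm U k f -> Sm U k g -> Sm U k (fun x y => f x y + g x y).
Proof.
revert f g. induction k as [|k IH]; intros f g [Cf Hf] [Cg Hg]; (split; [intros x y H; apply (cR_plus (fun p : R * R => f (fst p) (snd p))); auto|]); auto.
destruct Hf as [fx [fy [D1 [D2 [S1 S2]]]]], Hg as [gx [gy [D1' [D2' [S1' S2']]]]].
exists (fun x y => fx x y + gx x y), (fun x y => fy x y + gy x y).
split; [|split; [|split; apply IH; auto]]; intros x y H; apply (is_derive_plus (V:=R_NormedModule)); auto.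
Qed.

Lemma Sm_mult k f g : Sm U k f -> Sm U k g -> Sm U k (fun x y => f x y * g x y).
Proof.
revert f g. induction k as [|k IH]; intros f g Hf Hg.
- destruct Hf as [Cf _], Hg as [Cg _]. split; auto. intros x y H; apply (cR_mult (fun p : R * R => f (fst p) (snd p))); auto.
- pose proof (Sm_mono _ _ Hf) as Mf. pose proof (Sm_mono _ _ Hg) as Mg.
  destruct Hf as [Cf [fx [fy [D1 [D2 [S1 S2]]]]]], Hg as [Cg [gx [gy [D1' [D2' [S1' S2']]]]]].
  split; [intros x y H; apply (cR_mult (fun p : R * R => f (fst p) (snd p))); auto|].
  exists (fun x y => fx x y * g x y + f x y * gx x y), (fun x y => fy x y * g x y + f x y * gy x y).
  split; [|split; [|split; apply Sm_plus; apply IH; auto]]; intros x y H.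
  + apply (is_derive_mult (fun a => f a y) (fun a => g a y)); auto. intros; apply Rmult_comm.
  + apply (is_derive_mult (f x) (g x)); auto. intros; apply Rmult_comm.
Qed.

Lemma Sm_const k c : Sm U k (fun _ _ => c).
Proof.
revert c. induction k as [|k IH]; intros c; (split; [intros; apply continuous_const|]); auto.
exists (fun _ _ => 0), (fun _ _ => 0).
split; [|split; [|split; apply IH]]; intros; apply (is_derive_const (V:=R_NormedModule) c).
Qed.

Lemma Sm_x k : Sm U k (fun x _ => x).
Proof.
destruct k as [|k]; (split; [intros; apply c_fst|]); auto.
exists (fun _ _ => 1), (fun _ _ => 0).
split; [|split; [|split; apply Sm_const]]; intros; [apply (is_derive_id (K:=R_AbsRing))|apply (is_derive_const (V:=R_NormedModule) x)].
Qed.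

Lemma Sm_y k : Sm U k (fun _ y => y).
Proof.
destruct k as [|k]; (split; [intros; apply c_snd|]); auto.
exists (fun _ _ => 0), (fun _ _ => 1).
split; [|split; [|split; apply Sm_const]]; intros; [apply (is_derive_const (V:=R_NormedModule) y)|apply (is_derive_id (K:=R_AbsRing))].
Qed.

Lemma Sm_pow k f n : Sm U k f -> Sm U k (fun x y => f x y ^ n).
Proof. intros H. induction n as [|n IH]; simpl; [apply Sm_const|apply Sm_mult; auto]. Qed.

Lemma Sm_comp k (h : nat -> R -> R) i f :
  (forall i x y, U x y -> is_derive (h i) (f x y) (h (S i) (f x y))) -> Sm U k f -> Sm U k (fun x y => h i (f x y)).
Proof.
intros Dh. revert i. induction k as [|k IH]; intros i Hf.
- destruct Hf as [Cf _]. split; auto. intros x y H. apply (cR_comp (h i) (fun p : R * R => f (fst p) (snd p))); auto.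
  apply (ex_derive_continuous (V:=R_NormedModule)). eexists; apply Dh; auto.
- pose proof (Sm_mono _ _ Hf) as Mf. destruct Hf as [Cf [fx [fy [D1 [D2 [S1 S2]]]]]].
  split.
  { intros x y H. apply (cR_comp (h i) (fun p : R * R => f (fst p) (snd p))); auto.
    apply (ex_derive_continuous (V:=R_NormedModule)). eexists; apply Dh; auto. }
  exists (fun x y => fx x y * h (S i) (f x y)), (fun x y => fy x y * h (S i) (f x y)).
  split; [|split; [|split; apply Sm_mult; auto]]; intros x y H.
  + apply (is_derive_comp (h i) (fun a => f a y)); auto.
  + apply (is_derive_comp (h i) (f x)); auto.
Qed.

Lemma Sm_inv k f : (forall x y, U x y -> f x y <> 0) -> Sm U k f -> Sm U k (fun x y => / f x y).
Proof.
intros Hn Hf.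
set (h := fix h (i : nat) (z : R) : R := match i with O => / z | S i => - INR (S i) * (h i z * / z) end).
apply (Sm_comp k h O); auto.
assert (Dh : forall i z, z <> 0 -> is_derive (h i) z (h (S i) z)).
{ intros i z Hz. induction i as [|i IH].
  - simpl. auto_derive; auto. field. auto.
  - change (is_derive (fun z => - INR (S i) * (h i z * / z)) z (- INR (S (S i)) * ((- INR (S i) * (h i z * / z)) * / z))).
    assert (DI : is_derive (h i) z (- INR (S i) * (h i z * / z))) by exact IH.
    rewrite (S_INR (S i)). generalize dependent (INR (S i)). intros c DI.
    auto_derive; [repeat split; auto; eexists; exact DI|]. der DI. field. auto. }
intros. apply Dh; auto.
Qed.

Hypothesis HU : open2 U.

Lemma Sm_ext k f g : (forall x y, U x y -> f x y = g x y) -> Sm U k f -> Sm U k g.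
Proof.
intros E.
assert (L1 : forall x y, U x y -> locally x (fun a => f a y = g a y)).
{ intros x y H. destruct (HU x y H) as [d [Hd Q]]. exists (mkposreal d Hd). intros a Ha. apply E, Q; auto.
  rewrite Rminus_diag, Rabs_R0; auto. }
assert (L2 : forall x y, U x y -> locally y (fun b => f x b = g x b)).
{ intros x y H. destruct (HU x y H) as [d [Hd Q]]. exists (mkposreal d Hd). intros a Ha. apply E, Q; auto.
  rewrite Rminus_diag, Rabs_R0; auto. }
assert (LC : (forall x y, U x y -> continuous (fun p : R * R => f (fst p) (snd p)) (x, y)) ->
   forall x y, U x y -> continuous (fun p : R * R => g (fst p) (snd p)) (x, y)).
{ intros C x y H. apply (continuous_ext_loc _ (fun p : R * R => f (fst p) (snd p))); auto.
  destruct (HU x y H) as [d [Hd Q]]. exists (mkposreal d Hd). intros [a b] [Ha Hb]. simpl. apply E, Q; auto. }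
destruct k as [|k]; intros [C H]; (split; [apply LC; auto|]); auto.
destruct H as [fx [fy [D1 [D2 [S1 S2]]]]]. exists fx, fy. split; [|split; [|split; auto]].
- intros x y H. apply is_derive_ext_loc with (fun a => f a y); auto.
- intros x y H. apply is_derive_ext_loc with (f x); auto.
Qed.

Lemma Sm_dx k f : Sm U (S k) f -> Sm U k (dx f).
Proof.
intros [_ [fx [fy [D1 [D2 [S1 S2]]]]]]. apply Sm_ext with fx; auto.
intros x y H. symmetry. apply is_derive_unique. auto.
Qed.

Lemma Sm_dy k f : Sm U (S k) f -> Sm U k (dy f).
Proof.
intros [_ [fx [fy [D1 [D2 [S1 S2]]]]]]. apply Sm_ext with fy; auto.
intros x y H. symmetry. apply is_derive_unique. apply (D2 x y H).
Qed.

Lemma Sm_smooth2_on f : (forall k, Sm U k f) -> smooth2_on U f.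
Proof.
intros H l.
assert (P : forall k, Sm U k (pder l f)).
{ induction l as [|b l IH]; simpl; auto. intros k. destruct b; [apply Sm_dx|apply Sm_dy]; auto. }
intros x y Hxy. destruct (P 1%nat) as [C [fx [fy [D1 [D2 _]]]]].
split; [auto|split]; eexists; eauto.
Qed.
End Smooth.

Lemma smooth2_on_Sm U f : smooth2_on U f -> forall k, Sm U k f.
Proof.
intros H k. assert (P : forall l, Sm U k (pder l f)); [|exact (P nil)].
induction k as [|k IH]; intros l; (split; [intros x y Hxy; destruct (H l x y Hxy) as [C _]; exact C|]); auto.
exists (pder (true :: l) f), (pder (false :: l) f). split; [|split; [|split; apply IH]]; intros x y Hxy; destruct (H l x y Hxy) as [_ [D1 D2]].
- apply Derive_correct. exact D1.
- apply Derive_correct. exact D2.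
Qed.

(** * Power series for the sine and smoothness of the reaction term *)

Fixpoint iterD (i : nat) (a : nat -> R) := match i with O => a | S i => PS_derive (iterD i a) end.
Definition s1c := sin_n.
Definition s2c := PS_opp (PS_decr_1 sin_n).
(* [sin x = x * s1 (x^2)] and [x - sin x = x^3 * s2 (x^2)] *)
Definition s1 := PSeries s1c.
Definition s2 := PSeries s2c.
Definition s1d i := PSeries (iterD i s1c).
Definition s2d i := PSeries (iterD i s2c).

Lemma s1c_radius : CV_radius s1c = p_infty.
Proof.
apply CV_radius_infinite_DAlembert.
- intros n. unfold s1c, sin_n. apply Rmult_integral_contrapositive_currified.
  + apply pow_nonzero. lra.
  + apply Rinv_neq_0_compat, INR_fact_neq_0.
- apply is_lim_seq_Reals. intros eps He. destruct (Alembert_sin eps He) as [N HN]. exists N. intros n Hn.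
  specialize (HN n Hn). exact HN.
Qed.

Lemma s2c_radius : CV_radius s2c = p_infty.
Proof. unfold s2c. rewrite CV_radius_opp, CV_radius_decr_1. apply s1c_radius. Qed.

Lemma iterD_radius a i : CV_radius a = p_infty -> CV_radius (iterD i a) = p_infty.
Proof. intros H. induction i; simpl; auto. rewrite CV_radius_derive. auto. Qed.

Lemma s1d_derive i x : is_derive (s1d i) x (s1d (S i) x).
Proof. apply is_derive_PSeries. rewrite iterD_radius; simpl; auto. apply s1c_radius. Qed.
Lemma s2d_derive i x : is_derive (s2d i) x (s2d (S i) x).
Proof. apply is_derive_PSeries. rewrite iterD_radius; simpl; auto. apply s2c_radius. Qed.
Lemma s1_cont : cont1 s1.
Proof. apply (is_derive_cont1 _ _ (s1d_derive 0)). Qed.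
Lemma s2_cont : cont1 s2.
Proof. apply (is_derive_cont1 _ _ (s2d_derive 0)). Qed.

Lemma sin_s1 x : sin x = x * s1 (x ^ 2).
Proof.
unfold sin. destruct (exist_sin (Rsqr x)) as [l Hl].
replace (s1 (x ^ 2)) with l; auto. symmetry. rewrite <- Rsqr_pow2.
apply is_pseries_unique, is_pseries_R, is_series_Reals. exact Hl.
Qed.

Lemma s1_s2 z : s1 z = 1 - z * s2 z.
Proof.
unfold s1. rewrite PSeries_decr_1.
- unfold s2, s2c. rewrite PSeries_opp. unfold s1c, sin_n at 1. simpl. field.
- apply CV_radius_inside. rewrite s1c_radius. simpl. auto.
Qed.

Lemma s2_sin x : x - sin x = x ^ 3 * s2 (x ^ 2).
Proof. rewrite sin_s1, s1_s2. ring. Qed.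

Lemma s1_pos r : 0 <= r <= 1 -> 0 < s1 (kk ^ 2 * r ^ 2).
Proof.
intros Hr. replace (kk ^ 2 * r ^ 2) with ((kk * r) ^ 2) by ring.
destruct (Rle_lt_or_eq_dec 0 r (proj1 Hr)) as [Hp| <-].
- pose proof (sin_kk_pos r ltac:(lra)) as S. rewrite sin_s1 in S. pose proof kk_pos.
  assert (0 < kk * r) by nra. apply Rnot_le_lt. intros N. assert (kk * r * s1 ((kk * r) ^ 2) <= 0) by nra. lra.
- rewrite s1_s2, Rmult_0_r. replace (0 ^ 2) with 0 by ring. lra.
Qed.

(* With [phi = r u], the nonlinearity [(phi - sin(2 phi)/2)/r^3]. *)
Definition Gn r u := 4 * u ^ 3 * s2 (4 * r ^ 2 * u ^ 2).
(** Derivatives of [Gn] in u: [false] differentiates in the second variable. *)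
Definition Gd i := pder (repeat false i) Gn.

Definition plane : R -> R -> Prop := fun _ _ => True.
Lemma plane_open : open2 plane.
Proof. intros x y _. exists 1. split; [lra|]. intros; exact I. Qed.

Lemma Gn_comp_Sm U k a b : Sm U k a -> Sm U k b -> Sm U k (fun x y => Gn (a x y) (b x y)).
Proof.
intros Ha Hb. unfold Gn. apply Sm_mult.
- apply Sm_mult; [apply Sm_const|apply Sm_pow; auto].
- apply (Sm_comp U k s2d O (fun x y => 4 * a x y ^ 2 * b x y ^ 2)); [intros; apply s2d_derive|].
  apply Sm_mult; [apply Sm_mult; [apply Sm_const|]|]; apply Sm_pow; auto.
Qed.

Lemma Gn_smooth : smooth2_on plane Gn.
Proof. apply Sm_smooth2_on; [apply plane_open|]. intros k. apply (Gn_comp_Sm plane k (fun x _ => x) (fun _ y => y)); [apply Sm_x|apply Sm_y]. Qed.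

Lemma Gd_cont i : cont2 (Gd i).
Proof. intros [x y]. apply (Gn_smooth (repeat false i) x y I). Qed.

Lemma Gd_derive i r u : is_derive (Gd i r) u (Gd (S i) r u).
Proof. apply Derive_correct. apply (Gn_smooth (repeat false i) r u I). Qed.

Lemma Gn_sin r u : r <> 0 -> Gn r u = (r * u - sin (2 * (r * u)) / 2) / r ^ 3.
Proof.
intros Hr. unfold Gn. pose proof (s2_sin (2 * (r * u))) as E.
replace (sin (2 * (r * u))) with (2 * (r * u) - (2 * (r * u)) ^ 3 * s2 ((2 * (r * u)) ^ 2)) by lra.
replace ((2 * (r * u)) ^ 2) with (4 * r ^ 2 * u ^ 2) by ring. field. auto.
Qed.

(** * The reduced equation *)

(* The substitution [u = U0 + m y] turns [u_rr + (3/r - r) u_r] into the zonal Laplacian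
   [y_rr + 3 k cot(kr) y_r] plus a bounded potential, and makes the reaction vanish at r = 1, y = 0. *)
Definition cA A := - sin (2 * A) / 12.
(** The operator sends A + c(1-r^2) to c(2r^2 - 8), which is -6c at r = 1, where the remaining terms
    -u + G equal -sin(2A)/2. The value c = -sin(2A)/12 cancels them. *)
Definition U0c A r := A + cA A * (1 - cl r ^ 2).
(** This is exp(r^2/4) (sin(kr)/(kr))^(3/2), determined by 2 m'/m + 3/r - r = 3 k cot(kr). Writing
    it through [s1] makes it regular at r = 0. *)
Definition mm r := exp (r ^ 2 / 4 + 3 / 2 * ln (s1 (kk ^ 2 * r ^ 2))).
Definition mmc r := mm (cl r).
(** The potential m''/m + (3/r - r) m'/m. Its inverse squares k^2/sin(kr)^2 and 1/r^2 cancel at the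
    axis, and [s2] carries out the cancellation. *)
Definition VV r := 3 / 4 * kk ^ 2 * s2 (kk ^ 2 * r ^ 2) * (1 + s1 (kk ^ 2 * r ^ 2)) / s1 (kk ^ 2 * r ^ 2) ^ 2
   - 9 * kk ^ 2 / 4 - r ^ 2 / 4 + 2.
Definition VVc r := VV (cl r).
(** A cutoff equal to 1 up to M and 0 beyond M+1. Its primitive [theta] is the identity on [-M,M]
    and constant beyond M+1 on either side, which makes the reaction globally Lipschitz until the
    barrier shows that the truncation is never active. *)
Definition tau M s := Rmax 0 (Rmin 1 (M + 1 - Rabs s)).
Definition theta M u := RInt (tau M) 0 u.
(** All of the equation for y outside the S^4 operator: the potential, the image c(2r^2 - 8) of
    [U0c], and the truncated -u + G, divided by m. *)
Definition nn A M r y := VVc r * y + (cA A * (2 * cl r ^ 2 - 8) - (U0c A r + mmc r * y) + Gn (cl r) (theta M (U0c A r + mmc r * y))) / mmc r.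
Definition nny A M r y := VVc r - 1 + Gd 1 (cl r) (theta M (U0c A r + mmc r * y)) * tau M (U0c A r + mmc r * y).

Lemma U0c_cont A : cont1 (U0c A).
Proof. intros x. unfold U0c. ct. Qed.
Lemma mmc_cont : cont1 mmc.
Proof.
intros x. unfold mmc, mm. pose proof s1_cont as C. apply cR_exp. apply cR_plus; [unfold Rdiv; ct|].
apply cR_mult; [ct|]. apply (cR_comp ln); [ct|]. apply continuity_pt_filterlim.
apply derivable_continuous_pt. exists (/ s1 (kk ^ 2 * cl x ^ 2)). apply derivable_pt_lim_ln, s1_pos, cl_in.
Qed.
Lemma VVc_cont : cont1 VVc.
Proof.
intros x. unfold VVc, VV. pose proof s1_cont as C. pose proof s2_cont as C'.
apply cR_plus; [|ct]. apply cR_minus; [|unfold Rdiv; ct]. apply cR_minus; [|ct].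
apply cR_div; [ct|ct|]. apply pow_nonzero, Rgt_not_eq, s1_pos, cl_in.
Qed.
Lemma tau_cont M : cont1 (tau M).
Proof. intros x. unfold tau. ct. Qed.
Lemma theta_cont M : cont1 (theta M).
Proof. apply RInt_cont1, tau_cont. Qed.
Lemma mmc_pos r : 0 < mmc r.
Proof. apply exp_pos. Qed.
Lemma tau_in M s : 0 <= tau M s <= 1.
Proof. unfold tau, Rmax, Rmin. repeat destruct Rle_dec; lra. Qed.

Lemma theta_bound M u : Rabs (theta M u) <= Rabs u.
Proof.
assert (B : forall s, Rabs (tau M s) <= 1) by (intros; pose proof (tau_in M s); rewrite Rabs_pos_eq; lra).
pose proof (fun a b => cont1_RInt _ a b (tau_cont M)) as I. unfold theta.
destruct (Rle_dec 0 u) as [H|H].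
- replace (Rabs u) with ((u - 0) * 1) by (rewrite Rabs_pos_eq; lra). apply RInt_bound; auto.
- rewrite <- (opp_RInt_swap (V:=R_CompleteNormedModule)) by auto. unfold opp; simpl. rewrite Rabs_Ropp.
  replace (Rabs u) with ((0 - u) * 1) by (rewrite <- Rabs_Ropp, Rabs_pos_eq; lra). apply RInt_bound; auto; lra.
Qed.

Lemma theta_id M u : Rabs u <= M -> theta M u = u.
Proof.
intros H. unfold theta. rewrite (RInt_ext _ (fun _ => 1)).
- rewrite RInt_const. unfold scal; simpl; unfold mult; simpl. ring.
- intros s Hs. unfold tau. rewrite Rmin_left; [apply Rmax_right; lra|].
  revert H Hs. unfold Rmin, Rmax, Rabs. repeat destruct Rle_dec; repeat destruct Rcase_abs; intros; lra.
Qed.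

Lemma nn_cont A M : cont2 (nn A M).
Proof.
intros p. unfold nn. pose proof VVc_cont. pose proof (U0c_cont A). pose proof mmc_cont. pose proof (theta_cont M).
pose proof (Gd_cont 0) as CG. change (Gd 0) with Gn in CG.
apply cR_plus; [ct|]. apply cR_div; [ct|ct|]. apply Rgt_not_eq, mmc_pos.
Qed.

Lemma nny_cont A M : cont2 (nny A M).
Proof.
intros p. unfold nny. pose proof VVc_cont. pose proof (U0c_cont A). pose proof mmc_cont. pose proof (theta_cont M).
pose proof (tau_cont M). pose proof (Gd_cont 1) as CG. ct.
Qed.

Lemma affine_reaction_derive (Q : R -> R) q V c0 a m y : m <> 0 -> is_derive Q (a + m * y) q ->
  is_derive (fun y => V * y + (c0 - (a + m * y) + Q (a + m * y)) / m) y (V - 1 + q).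
Proof.
intros Hm DQ. auto_derive; [repeat split; eexists; exact DQ|]. der DQ. field. auto.
Qed.

Lemma is_derive_comp_R (f g : R -> R) x df dg : is_derive f (g x) df -> is_derive g x dg -> is_derive (fun x => f (g x)) x (df * dg).
Proof. intros Df Dg. rewrite Rmult_comm. apply (is_derive_comp f g); auto. Qed.

Lemma nn_derive A M r y : is_derive (nn A M r) y (nny A M r y).
Proof.
unfold nn, nny. apply (affine_reaction_derive (fun U => Gn (cl r) (theta M U))).
- apply Rgt_not_eq, mmc_pos.
- apply (is_derive_comp_R (Gn (cl r)) (theta M)).
  + apply (Gd_derive 0).
  + apply RInt_derive, tau_cont.
Qed.

Lemma nny_bound A M : 0 <= M -> exists L, 0 < L /\ forall r y, 0 <= r <= 1 -> Rabs (nny A M r y) <= L.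
Proof.
intros HM. destruct (cont2_bounded (Gd 1) 0 1 (- (M + 1)) (M + 1) (Gd_cont 1)) as [B [HB BG]].
destruct (X0_bounded VVc VVc_cont) as [B' [HB' BV]].
exists (B' + 1 + B). split; [lra|]. intros r y Hr. unfold nny. set (U := U0c A r + mmc r * y).
specialize (BV r Hr).
assert (Rabs (Gd 1 (cl r) (theta M U) * tau M U) <= B).
{ pose proof (tau_in M U). destruct (Rle_dec (Rabs U) (M + 1)) as [H1|H1].
  - pose proof (theta_bound M U) as T. assert (T2 : Rabs (theta M U) <= M + 1) by lra. apply Rabs_le_between in T2.
    specialize (BG (cl r) (theta M U) (cl_in r) T2). rewrite Rabs_mult, (Rabs_pos_eq (tau M U)) by lra.
    pose proof (Rabs_pos (Gd 1 (cl r) (theta M U))). nra.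
  - replace (tau M U) with 0; [rewrite Rmult_0_r, Rabs_R0; lra|].
    unfold tau. rewrite Rmin_right by lra. rewrite Rmax_left; lra. }
eapply Rle_trans; [apply Rabs_triang|]. apply Rplus_le_compat; auto.
unfold Rminus. eapply Rle_trans; [apply Rabs_triang|]. rewrite Rabs_Ropp, Rabs_R1. lra.
Qed.

Lemma nn_1 A M : Rabs A <= M -> nn A M 1 0 = 0.
Proof.
intros HA. unfold nn. rewrite cl_id by lra. unfold U0c. rewrite cl_id by lra.
replace (A + cA A * (1 - 1 ^ 2) + mmc 1 * 0) with A by ring. rewrite theta_id by auto. rewrite Gn_sin by lra.
unfold cA. rewrite Rmult_1_l. field. apply Rgt_not_eq, mmc_pos.
Qed.

Definition beta r := r / 2 + 3 / 2 * (kk * cos (kk * r) / sin (kk * r) - / r).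

Lemma mm_sin r : 0 < r <= 1 -> mm r = exp (r ^ 2 / 4 + 3 / 2 * ln (sin (kk * r) / (kk * r))).
Proof.
intros Hr. unfold mm. do 4 f_equal. rewrite sin_s1. replace ((kk * r) ^ 2) with (kk ^ 2 * r ^ 2) by ring.
field. pose proof kk_pos. lra.
Qed.

Lemma near_interior r (P : R -> Prop) : 0 < r < 1 -> (forall q, 0 < q < 1 -> P q) -> locally r P.
Proof.
intros Hr HP. exists (mkposreal (Rmin r (1 - r)) ltac:(unfold Rmin; destruct Rle_dec; lra)). intros q Hq. apply HP.
change (Rabs (q - r) < Rmin r (1 - r)) in Hq. revert Hq. unfold Rmin, Rabs. destruct Rle_dec, Rcase_abs; lra.
Qed.

Lemma mm_derive r : 0 < r < 1 -> is_derive mm r (mm r * beta r).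
Proof.
intros Hr. pose proof (sin_kk_pos r ltac:(lra)). pose proof kk_pos.
apply is_derive_ext_loc with (fun r => exp (r ^ 2 / 4 + 3 / 2 * ln (sin (kk * r) / (kk * r)))).
- apply near_interior; auto. intros q Hq. symmetry. apply mm_sin. lra.
- rewrite mm_sin by lra. auto_derive.
  + assert (0 < kk * r) by nra. repeat split; auto; [lra|]. apply Rdiv_lt_0_compat; auto.
  + change (exp (r * (r * 1) * / 4 + 3 / 2 * ln (sin (kk * r) * / (kk * r)))) with (exp (r ^ 2 / 4 + 3 / 2 * ln (sin (kk * r) / (kk * r)))).
    unfold beta. field. lra.
Qed.

Lemma beta_derive r : 0 < r < 1 -> is_derive beta r (1 / 2 + 3 / 2 * (- kk ^ 2 / sin (kk * r) ^ 2 + / r ^ 2)).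
Proof.
intros Hr. pose proof (sin_kk_pos r ltac:(lra)). unfold beta. auto_derive.
- repeat split; auto; lra.
- replace (kk * (kk * 1 * - sin (kk * r)) * / sin (kk * r) + kk * cos (kk * r) * (- (kk * 1 * cos (kk * r)) * / (sin (kk * r) * sin (kk * r))))
    with (- kk ^ 2 * (Rsqr (sin (kk * r)) + Rsqr (cos (kk * r))) / sin (kk * r) ^ 2) by (unfold Rsqr; field; lra).
  rewrite sin2_cos2. field. lra.
Qed.

Lemma VV_sin r : 0 < r < 1 -> VV r = 3 / 4 * (kk ^ 2 / sin (kk * r) ^ 2 - / r ^ 2) - 9 * kk ^ 2 / 4 - r ^ 2 / 4 + 2.
Proof.
intros Hr. pose proof (sin_kk_pos r ltac:(lra)) as S. pose proof kk_pos. unfold VV. rewrite sin_s1 in *.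
replace ((kk * r) ^ 2) with (kk ^ 2 * r ^ 2) in * by ring.
pose proof (s1_pos r ltac:(lra)) as P. pose proof (s1_s2 (kk ^ 2 * r ^ 2)) as E.
assert (E2 : s2 (kk ^ 2 * r ^ 2) = (1 - s1 (kk ^ 2 * r ^ 2)) / (kk ^ 2 * r ^ 2)) by (rewrite E; field; lra).
rewrite E2. field. lra.
Qed.

Lemma liouville_identity r m y Y1 f c A yt G u : 0 < r < 1 -> m <> 0 -> u = A + c * (1 - r ^ 2) + m * y ->
  yt - (VV r * y + (c * (2 * r ^ 2 - 8) - u + G) / m) = f ->
  m * yt = (- 2 * c + m * (beta r ^ 2 + (1 / 2 + 3 / 2 * (- kk ^ 2 / sin (kk * r) ^ 2 + / r ^ 2))) * y + 2 * m * beta r * Y1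
     + m * (f - 3 * kk * cos (kk * r) / sin (kk * r) * Y1))
   + (3 / r - r) * (- 2 * c * r + m * beta r * y + m * Y1) - u + G.
Proof.
intros Hr Hm Hu <-. pose proof (sin_kk_pos r ltac:(lra)) as S. rewrite VV_sin by auto. unfold beta.
set (s := sin (kk * r)) in *. set (co := cos (kk * r)).
assert (E : co ^ 2 = 1 - s ^ 2).
{ pose proof (sin2_cos2 (kk * r)) as Q. unfold Rsqr in Q. fold s in Q. fold co in Q. nra. }
(* Since [field] does not know that the squares of sine and cosine sum to 1, a multiple of that
   relation is added to the right side and afterwards vanishes. *)
match goal with |- ?a = ?b => replace b with (a + m * y * (9 * kk ^ 2 / 4 / s ^ 2) * (co ^ 2 - (1 - s ^ 2))) by (field; lra) end.
rewrite E. ring.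
Qed.

(** The regularity clause is conditional: it holds once |u| <= M, where truncated and smooth
    reactions coincide. *)
Lemma truncated_solution A M u0 : cont1 u0 -> u0 1 = A -> Rabs A <= M -> exists u ut ur urr : R -> R -> R,
  cont2 u /\ (forall r, 0 <= r <= 1 -> u r 0 = u0 r) /\ (forall t, 0 <= t -> u 1 t = A) /\
  (forall r t, 0 <= r <= 1 -> 0 < t -> is_derive (u r) t (ut r t)) /\
  (forall r t, 0 < r < 1 -> 0 < t -> is_derive (fun q => u q t) r (ur r t) /\ is_derive (fun q => ur q t) r (urr r t) /\
     ut r t = urr r t + (3 / r - r) * ur r t - u r t + Gn r (theta M (u r t))) /\
  ((forall r t, 0 <= r <= 1 -> 0 <= t -> Rabs (u r t) <= M) -> forall k, Dk k u).
Proof.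
intros Cu HA HM.
assert (HM0 : 0 <= M) by (pose proof (Rabs_pos A); lra).
destruct (nny_bound A M HM0) as [L [HL BL]].
set (y0 := fun r => (u0 (cl r) - U0c A r) / mmc r).
pose proof (U0c_cont A) as CU. pose proof mmc_cont as Cm.
assert (U1 : U0c A 1 = A) by (unfold U0c; rewrite cl_id by lra; ring).
assert (Xy0 : X0 y0).
{ split.
  - intros x. unfold y0. apply cR_div; [ct|ct|]. apply Rgt_not_eq, mmc_pos.
  - unfold y0. rewrite cl_id, HA, U1 by lra. field. apply Rgt_not_eq, mmc_pos. }
pose proof (nn_cont A M) as Cn. pose proof (nny_cont A M) as Cny.
destruct (picard_solution (fun r _ y => nn A M r y) (Psi 0 y0) L) as [y [Xy Ey]]; auto.
{ intros p. ct. }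
{ intros r t y1 y2 Hr Ht. destruct (MVT_abs (nn A M r) (nny A M r) y2 y1) as [c [_ E]]; [intros; apply nn_derive|].
  rewrite E, Rabs_mult. apply Rmult_le_compat_r; [apply Rabs_pos|auto]. }
{ intros. apply nn_1; auto. }
{ split; [apply Psi_cont; auto|]. intros; apply Psi_r1; auto. }
change (nem (fun r _ y => nn A M r y) y) with (fun r t => nn A M r (y r t)) in Ey.
set (g := fun r t => nn A M r (y r t)) in *.
assert (Xg : X2 g).
{ destruct Xy as [Cy Zy]. split; [intros p; unfold g; ct|]. intros t Ht. unfold g. rewrite Zy by auto. apply nn_1; auto. }
destruct (nonlinear_udiff (nn A M) (nny A M) L y y0) as [z [Xz [Uz [Zz Ez]]]]; auto.
{ intros; apply nn_derive. }
{ apply nn_1; auto. }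
pose proof (udiff_dpt _ _ Uz) as Dz.
set (f := fun q t => z q t / t - g q t).
destruct Xy as [Cy Zy]. pose proof Xz as [Cz _]. pose proof Xg as [Cg _].
assert (Cf : forall t, cont1 (fun q => f q t)) by (intros t x; unfold f, Rdiv; ct).
(* Inverts the generator on y_t - g. The two parts of y = Psi 0 y0 + KK 0 g are handled separately,
   and [zK] is t d/dt of the Duhamel part. *)
assert (Gen : forall r t, 0 < r <= 1 -> 0 < t -> GG (fun q => f q t) r = y r t).
{ intros r t Hr Ht. set (zK := fun q s => z q s - Psi 1 y0 q s).
  pose proof (Psi_cont y0 1 Xy0) as CP.
  assert (CzK : cont2 zK) by (intros p; unfold zK; ct).
  assert (UK : udiff (KK 0 g) zK).
  { intros T eps HT He. destruct (Uz T (eps/2) HT ltac:(lra)) as [d1 [Hd1 D1]].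
    destruct (Psi_udiff 0 y0 Xy0 T (eps/2) HT ltac:(lra)) as [d2 [Hd2 D2]].
    exists (Rmin d1 d2). split; [unfold Rmin; destruct Rle_dec; lra|]. intros l Hl q s Hq Hs.
    assert (Hl' : Rabs (l - 1) < d1 /\ Rabs (l - 1) < d2) by (revert Hl; unfold Rmin; destruct Rle_dec; lra).
    assert (0 <= l) by (assert (Rabs (l - 1) < 1/2) by lra; revert H; unfold Rabs; destruct Rcase_abs; lra).
    specialize (D1 l (proj1 Hl') q s Hq Hs). specialize (D2 l (proj2 Hl') q s Hq Hs). simpl in D2.
    rewrite (Ey q (l * s)), (Ey q s) in D1 by (auto; try lra; apply Rmult_le_pos; lra).
    unfold zK. match goal with |- Rabs ?x <= _ => match type of D1 with Rabs ?x1 <= _ => match type of D2 with Rabs ?x2 <= _ =>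
      replace x with (x1 - x2) by ring end end end.
    unfold Rminus at 1. eapply Rle_trans; [apply Rabs_triang|]. rewrite Rabs_Ropp. lra. }
  pose proof (duhamel_generator g zK Xg CzK UK r t Hr Ht) as E1.
  pose proof (GG_Psi y0 r t Xy0 Hr ltac:(lra)) as E2.
  rewrite Ey by lra.
  transitivity (GG (fun q => 1 * (zK q t / t - g q t) + / t * Psi 1 y0 q t) r).
  - apply GG_ext; auto. intros q _. unfold f, zK. field. lra.
  - rewrite (GG_lin (fun q => zK q t / t - g q t) (fun q => Psi 1 y0 q t)); auto; [|intros x; unfold Rdiv; ct|apply cont2_sec_r; auto].
    rewrite E1, E2. field. lra. }
(* The derivatives in r are read off the integral formula for [GG]: [Y1] is the first one, and
   differentiating the flux gives the second-order equation. *)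
set (Y1 := fun r t => flux (fun q => f q t) r / sin (kk * r) ^ 3).
assert (DY : forall r t, 0 < r < 1 -> 0 < t -> is_derive (fun q => y q t) r (Y1 r t)).
{ intros r t Hr Ht. apply is_derive_ext_loc with (fun q => GG (fun q => f q t) q).
  - apply near_interior; auto. intros q Hq. apply Gen; auto; lra.
  - unfold GG. replace (Y1 r t) with (opp (opp (Y1 r t))) by (unfold opp; simpl; ring).
    apply (is_derive_opp (V:=R_NormedModule)).
    apply (is_derive_RInt' (V:=R_NormedModule) (fun p => flux (fun q => f q t) p / sin (kk * p) ^ 3) _ r 1).
    + apply near_interior; auto. intros q Hq. apply (RInt_correct (V:=R_CompleteNormedModule)), flux_quot_RInt; auto; lra.
    + apply flux_quot_cont; auto. lra. }
assert (DY1 : forall r t, 0 < r < 1 -> 0 < t -> is_derive (fun q => Y1 q t) r (f r t - 3 * kk * cos (kk * r) / sin (kk * r) * Y1 r t)).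
{ intros r t Hr Ht. pose proof (sin_kk_pos r ltac:(lra)) as S. pose proof (flux_derive _ r (Cf t)) as DF.
  unfold Y1. set (F := flux (fun q => f q t)) in *.
  auto_derive; [repeat split; [eexists; exact DF|apply Rgt_not_eq; repeat apply Rmult_lt_0_compat; lra]|]. der DF. field. lra. }
set (u := fun r t => U0c A r + mmc r * y r t).
exists u, (fun r t => mmc r * (z r t / t)), (fun r t => - 2 * cA A * r + mm r * beta r * y r t + mm r * Y1 r t),
 (fun r t => - 2 * cA A + mm r * (beta r ^ 2 + (1 / 2 + 3 / 2 * (- kk ^ 2 / sin (kk * r) ^ 2 + / r ^ 2))) * y r t + 2 * mm r * beta r * Y1 r t
     + mm r * (f r t - 3 * kk * cos (kk * r) / sin (kk * r) * Y1 r t)).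
split; [intros p; unfold u; ct|]. split; [|split; [|split; [|split]]].
- intros r Hr. unfold u. rewrite Ey, KK_0, Psi_00 by (auto; lra). unfold y0. rewrite (cl_id r) by auto. field. apply Rgt_not_eq, mmc_pos.
- intros t Ht. unfold u. rewrite Zy, U1 by auto. ring.
- intros r t Hr Ht. unfold u. pose proof (Dz r t Hr Ht) as D. auto_derive; [eexists; exact D|]. der D. ring.
- intros r t Hr Ht. pose proof (mm_derive r Hr) as Dm. pose proof (beta_derive r Hr) as Db.
  pose proof (DY r t Hr Ht) as D1. pose proof (DY1 r t Hr Ht) as D2. split; [|split].
  + apply is_derive_ext_loc with (fun q => A + cA A * (1 - q ^ 2) + mm q * y q t).
    * apply near_interior; auto. intros q Hq. unfold u, U0c, mmc. rewrite cl_id by lra. auto.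
    * auto_derive; [repeat split; eexists; eauto|]. der Dm. der D1. ring.
  + auto_derive; [repeat split; eexists; eauto|]. der Dm. der Db. der D1. der D2. ring.
  + assert (Hm : mmc r = mm r) by (unfold mmc; rewrite cl_id; auto; lra). rewrite Hm.
    apply liouville_identity with A; auto.
    * apply Rgt_not_eq, exp_pos.
    * unfold u, U0c. rewrite Hm, cl_id by lra. auto.
    * unfold f, g, nn, VVc, u. rewrite !Hm, !cl_id by lra. reflexivity.
- intros Hb k. apply Dk_plus; [apply (Dk_space k (U0c A)); auto|]. apply Dk_mult; [apply (Dk_space k mmc); auto|].
  (* The reaction with the truncation removed, followed by its derivatives in y; each derivative
     beyond the first brings a factor m. *)
  set (H := fun i r yy => match i with
    | O => VVc r * yy + (cA A * (2 * cl r ^ 2 - 8) - (U0c A r + mmc r * yy) + Gd 0 (cl r) (U0c A r + mmc r * yy)) / mmc r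
    | S O => VVc r - 1 + Gd 1 (cl r) (U0c A r + mmc r * yy)
    | S (S j) => mmc r ^ (S j) * Gd (S (S j)) (cl r) (U0c A r + mmc r * yy) end).
  assert (Da : forall i r yy, is_derive (fun yy => Gd i (cl r) (U0c A r + mmc r * yy)) yy (mmc r * Gd (S i) (cl r) (U0c A r + mmc r * yy))).
  { intros i r yy. apply (is_derive_comp (Gd i (cl r)) (fun yy => U0c A r + mmc r * yy)); [apply Gd_derive|].
    auto_derive; auto. ring. }
  apply (nonlinear_Dk (nn A M) (nny A M) L y y0 Cn Cny HL (fun r u _ => nn_derive A M r u) (fun r u Hr => BL r u Hr) (nn_1 A M HM) (conj Cy Zy) Xy0 Ey H).
  + pose proof VVc_cont as CV. intros i p. pose proof (Gd_cont i) as CG. unfold H. destruct i as [|[|j]]; [|ct|ct].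
    apply cR_plus; [ct|]. apply cR_div; [ct|ct|apply Rgt_not_eq, mmc_pos].
  + intros i r yy Hr. specialize (Da i r yy). unfold H. destruct i as [|[|j]].
    * apply (affine_reaction_derive (fun U => Gd 0 (cl r) U)); [apply Rgt_not_eq, mmc_pos|apply Gd_derive].
    * replace (mmc r ^ 1 * Gd 2 (cl r) (U0c A r + mmc r * yy)) with (plus 0 (mmc r * Gd 2 (cl r) (U0c A r + mmc r * yy))) by (unfold plus; simpl; ring).
      apply (is_derive_plus (V:=R_NormedModule) (fun _ => VVc r - 1)); [apply (is_derive_const (V:=R_NormedModule) (VVc r - 1))|exact Da].
    * replace (mmc r ^ S (S j) * Gd (S (S (S j))) (cl r) (U0c A r + mmc r * yy)) with
        (mmc r ^ S j * (mmc r * Gd (S (S (S j))) (cl r) (U0c A r + mmc r * yy))) by (simpl; ring).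
      apply is_derive_scal. exact Da.
  + intros r t Hr Ht. specialize (Hb r t Hr Ht). fold (u r t) in *. unfold nn, nny, H.
    change (U0c A r + mmc r * y r t) with (u r t).
    rewrite theta_id by auto. replace (tau M (u r t)) with 1; [split; [reflexivity|ring]|].
    unfold tau. rewrite Rmin_left, Rmax_right; lra.
Qed.

(** * The barrier *)

Section Barrier.
Variable a : R.
Hypothesis Ha : 0 < a <= 1.
Let kap := 1 / 32.

(* [PI - 2 atan (a/r)] is the stationary harmonic map; the logarithmic correction makes it a supersolution. *)
Definition ww r := a / r - 1 / 32 * a * r * ln (1 + r ^ 2 / a ^ 2).
Definition ww1 r := - a / r ^ 2 - 1 / 32 * a * ln (1 + r ^ 2 / a ^ 2) - 1 / 32 * a * (2 * r ^ 2 / (a ^ 2 + r ^ 2)).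
Definition ww2 r := 2 * a / r ^ 3 - 1 / 32 * a * (2 * r / (a ^ 2 + r ^ 2)) - 1 / 32 * a * (4 * r * a ^ 2 / (a ^ 2 + r ^ 2) ^ 2).

Lemma ln_sqrt_bound s : 0 <= s -> 0 <= ln (1 + s ^ 2) <= s.
Proof.
intros Hs. split; [rewrite <- ln_1; apply ln_le; nra|].
destruct (MVT_abs (fun s => s - ln (1 + s ^ 2)) (fun s => (1 - s) ^ 2 / (1 + s ^ 2)) 0 s) as [c [_ E]].
- intros x _. auto_derive; [nra|]. field. nra.
- replace (0 - ln (1 + 0 ^ 2)) with 0 in E by (replace (1 + 0 ^ 2) with 1 by ring; rewrite ln_1; ring).
  assert (0 <= (1 - c) ^ 2 / (1 + c ^ 2)) by (apply Rdiv_le_0_compat; [apply pow2_ge_0|nra]). nra.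
Qed.

Lemma ww_log_bound r : 0 < r -> 0 <= ln (1 + r ^ 2 / a ^ 2) <= r / a.
Proof.
intros Hr. replace (r ^ 2 / a ^ 2) with ((r / a) ^ 2) by (field; lra). apply ln_sqrt_bound. apply Rdiv_le_0_compat; lra.
Qed.

Lemma ww_derive r : 0 < r -> is_derive ww r (ww1 r) /\ is_derive ww1 r (ww2 r).
Proof.
intros Hr.
assert (P : 0 < 1 + r ^ 2 / a ^ 2) by (assert (0 < r ^ 2 / a ^ 2) by (apply Rdiv_lt_0_compat; nra); lra).
split; unfold ww, ww1, ww2; auto_derive.
- repeat split; auto; lra.
- change (r * (r * 1) * / (a * (a * 1))) with (r ^ 2 / a ^ 2). field. repeat split; nra.
- repeat split; auto; try (apply Rgt_not_eq; nra).
- field. repeat split; nra.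
Qed.

(** Here w0 = a/r is the harmonic map, p the logarithmic term, and q, q2 come from its derivatives.
    The pure harmonic map terms cancel, and the drift contributes the positive r^2 w0 = ar times 1 +
    w^2. The errors total less than half of this; the 1/32 in the correction is what keeps them
    small. *)
Lemma ww_cubic_bound w w0 p q q2 r : 0 < r <= 1 -> w0 = a / r -> w = w0 - p -> 0 <= w -> 0 <= p -> 0 <= q -> 0 <= q2 ->
  p * w0 <= 1 / 32 * a * r -> q * w0 <= 1 / 32 * a * r -> q <= 2 / 32 * a * r -> q2 <= 1 / 32 * a * r ->
  0 <= (w0 - p - 2 * q - q2) * (1 + w ^ 2) - 2 * w * (- w0 - p - q) ^ 2 - w * (1 - w ^ 2) - r ^ 2 * (- w0 - p - q) * (1 + w ^ 2).
Proof.
intros Hr Hw0 Hw Pw Pp Pq Pq2 B1 B2 B3 B4.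
set (k := a * r) in *. assert (Pk : 0 < k <= 1) by (unfold k; split; nra).
assert (Ew0 : r ^ 2 * w0 = k) by (rewrite Hw0; unfold k; field; lra).
assert (Pw0 : 0 < w0) by (rewrite Hw0; apply Rdiv_lt_0_compat; lra).
replace ((w0 - p - 2 * q - q2) * (1 + w ^ 2) - 2 * w * (- w0 - p - q) ^ 2 - w * (1 - w ^ 2) - r ^ 2 * (- w0 - p - q) * (1 + w ^ 2))
 with (r ^ 2 * w0 * (1 + w ^ 2) + r ^ 2 * (p + q) * (1 + w ^ 2) - (2 * q + q2) * (1 + w ^ 2) - w * (8 * (p * w0) + 4 * p * q + 4 * (q * w0) + 2 * q ^ 2)) by (rewrite Hw; ring).
rewrite Ew0.
assert (A1 : p * q <= 1 / 32 * k).
{ apply Rle_trans with (q * w0); [rewrite Rmult_comm; apply Rmult_le_compat_l; lra|unfold k; lra]. }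
assert (A2 : q ^ 2 <= 4 / 1024 * k) by (assert (q * q <= 2 / 32 * k * (2 / 32 * k)) by (apply Rmult_le_compat; unfold k in *; lra); nra).
assert (A3 : 2 * w <= 1 + w ^ 2) by (pose proof (pow2_ge_0 (w - 1)); lra).
assert (A4 : 8 * (p * w0) + 4 * p * q + 4 * (q * w0) + 2 * q ^ 2 <= (16 / 32 + 8 / 1024) * k) by (unfold k in *; lra).
assert (A5 : w * (8 * (p * w0) + 4 * p * q + 4 * (q * w0) + 2 * q ^ 2) <= (16 / 32 + 8 / 1024) * k * ((1 + w ^ 2) / 2)).
{ apply Rle_trans with (w * ((16 / 32 + 8 / 1024) * k)); [apply Rmult_le_compat_l; auto|].
  rewrite Rmult_comm. apply Rmult_le_compat_l; lra. }
assert (A6 : 0 <= r ^ 2 * (p + q) * (1 + w ^ 2)) by (apply Rmult_le_pos; [apply Rmult_le_pos|]; nra).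
assert (A7 : (2 * q + q2) * (1 + w ^ 2) <= 5 / 32 * k * (1 + w ^ 2)) by (apply Rmult_le_compat_r; [nra|unfold k in *; lra]).
assert (0 <= k * (1 + w ^ 2)) by (apply Rmult_le_pos; [lra|pose proof (pow2_ge_0 w); lra]). lra.
Qed.

Lemma ww_supersolution r : 0 < r <= 1 -> 0 <= ww r ->
  0 <= (r ^ 2 * ww2 r + r * ww1 r) * (1 + ww r ^ 2) - 2 * ww r * (r * ww1 r) ^ 2 - ww r * (1 - ww r ^ 2) - r ^ 3 * ww1 r * (1 + ww r ^ 2).
Proof.
intros Hr Hw. destruct (ww_log_bound r ltac:(lra)) as [L1 L2].
set (l := ln (1 + r ^ 2 / a ^ 2)) in *.
set (p := 1 / 32 * a * r * l). set (q := 1 / 32 * a * (2 * r ^ 3 / (a ^ 2 + r ^ 2))). set (q2 := 1 / 32 * a * (4 * r ^ 3 * a ^ 2 / (a ^ 2 + r ^ 2) ^ 2)).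
assert (PS : 0 < a ^ 2 + r ^ 2) by nra.
assert (Pr3 : 0 < r ^ 3) by (apply pow_lt; lra). assert (Pa2 : 0 < a ^ 2) by nra.
assert (El : a * l <= r) by (apply Rmult_le_reg_r with (/ a); [apply Rinv_0_lt_compat; lra|]; replace (a * l * / a) with l by (field; lra); exact L2).
pose proof (ww_cubic_bound (ww r) (a / r) p q q2 r Hr eq_refl eq_refl Hw) as Q.
replace (r ^ 2 * ww2 r + r * ww1 r) with (a / r - p - 2 * q - q2) by (unfold ww1, ww2, p, q, q2; fold l; field; split; lra).
replace (r ^ 3 * ww1 r) with (r ^ 2 * (- (a / r) - p - q)) by (unfold ww1, p, q; fold l; field; split; lra).
replace (r * ww1 r) with (- (a / r) - p - q) by (unfold ww1, p, q; fold l; field; split; lra).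
apply Q.
- unfold p. apply Rmult_le_pos; auto. apply Rmult_le_pos; lra.
- unfold q. apply Rmult_le_pos; [lra|]. apply Rdiv_le_0_compat; lra.
- unfold q2. apply Rmult_le_pos; [lra|]. apply Rdiv_le_0_compat; [|apply pow_lt; auto]. apply Rmult_le_pos; lra.
- unfold p. replace (1 / 32 * a * r * l * (a / r)) with (1 / 32 * a * (a * l)) by (field; lra). apply Rmult_le_compat_l; lra.
- unfold q. replace (1 / 32 * a * (2 * r ^ 3 / (a ^ 2 + r ^ 2)) * (a / r)) with (1 / 32 * a * (2 * a * r / (a ^ 2 + r ^ 2) * r)) by (field; lra).
  apply Rmult_le_compat_l; [lra|].
  assert (T : 2 * a * r / (a ^ 2 + r ^ 2) <= 1).
  { apply Rmult_le_reg_r with (a ^ 2 + r ^ 2); auto. unfold Rdiv. rewrite Rmult_assoc, Rinv_l by lra. pose proof (pow2_ge_0 (a - r)). lra. }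
  apply Rle_trans with (1 * r); [apply Rmult_le_compat_r; lra|lra].
- unfold q. replace (2 / 32 * a * r) with (1 / 32 * a * (2 * r)) by field. apply Rmult_le_compat_l; [lra|].
  apply Rmult_le_reg_r with (a ^ 2 + r ^ 2); auto. unfold Rdiv. rewrite Rmult_assoc, Rinv_l by lra. nra.
- unfold q2. apply Rmult_le_compat_l; [lra|].
  apply Rmult_le_reg_r with ((a ^ 2 + r ^ 2) ^ 2); [apply pow_lt; auto|]. unfold Rdiv. rewrite Rmult_assoc, Rinv_l by (apply pow_nonzero; lra).
  assert (4 * (a ^ 2 * r ^ 2) <= (a ^ 2 + r ^ 2) ^ 2) by (pose proof (pow2_ge_0 (a ^ 2 - r ^ 2)); nra). nra.
Qed.

Definition Bw r := PI - 2 * atan (ww r).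
Definition Bw1 r := - 2 * ww1 r / (1 + ww r ^ 2).
Definition Bw2 r := - 2 * ww2 r / (1 + ww r ^ 2) + 4 * ww r * ww1 r ^ 2 / (1 + ww r ^ 2) ^ 2.
(** The constant PI is itself stationary, and a minimum of two supersolutions is again a barrier. *)
Definition BB r := Rmin PI (Bw r).

Lemma Bw_derive r : 0 < r -> is_derive Bw r (Bw1 r) /\ is_derive Bw1 r (Bw2 r).
Proof.
intros Hr. destruct (ww_derive r Hr) as [D1 D2].
assert (P : 0 < 1 + ww r ^ 2) by nra.
split.
- unfold Bw. assert (DA : is_derive (fun q => atan (ww q)) r (/ (1 + ww r ^ 2) * ww1 r)).
  { apply is_derive_comp_R; auto. apply is_derive_Reals. apply derivable_pt_lim_atan. }
  replace (Bw1 r) with (0 - 2 * (/ (1 + ww r ^ 2) * ww1 r)) by (unfold Bw1; field; lra).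
  apply (is_derive_minus (V:=R_NormedModule)); [apply (is_derive_const (V:=R_NormedModule) PI)|]. apply is_derive_scal. exact DA.
- unfold Bw1. auto_derive; [repeat split; try (eexists; eauto); lra|]. der D1. der D2. unfold Bw2. field. lra.
Qed.

Lemma sin_4atan w : sin (2 * (PI - 2 * atan w)) = - (4 * w * (1 - w ^ 2) / (1 + w ^ 2) ^ 2).
Proof.
replace (2 * (PI - 2 * atan w)) with (- (2 * (2 * atan w)) + 2 * PI) by ring.
rewrite sin_plus, sin_2PI, cos_2PI, sin_neg, Rmult_0_r, Rmult_1_r, Rplus_0_r.
rewrite sin_2a, cos_2a, sin_2a, sin_atan, cos_atan.
assert (P : 0 < 1 + w ^ 2) by nra. rewrite Rsqr_pow2.
pose proof (sqrt_lt_R0 _ P) as S. pose proof (sqrt_sqrt (1 + w ^ 2) ltac:(lra)) as E.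
replace ((1 + w ^ 2) ^ 2) with (sqrt (1 + w ^ 2) ^ 4).
- field. lra.
- transitivity ((sqrt (1 + w ^ 2) * sqrt (1 + w ^ 2)) ^ 2); [ring|rewrite E; ring].
Qed.

(** The left side is r^2 times the stationary operator of the equation for phi, drift included. *)
Lemma Bw_supersolution r : 0 < r <= 1 -> 0 <= ww r ->
  r ^ 2 * Bw2 r + r * Bw1 r - r ^ 3 * Bw1 r - sin (2 * Bw r) / 2 <= 0.
Proof.
intros Hr Hw. pose proof (ww_supersolution r Hr Hw) as Q. unfold Bw. rewrite sin_4atan. unfold Bw1, Bw2.
assert (P : 0 < 1 + ww r ^ 2) by nra.
match type of Q with 0 <= ?x => match goal with |- ?y <= 0 => replace y with (- (2 * x / (1 + ww r ^ 2) ^ 2)) by (field; lra) end end.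
assert (0 <= 2 * ((r ^ 2 * ww2 r + r * ww1 r) * (1 + ww r ^ 2) - 2 * ww r * (r * ww1 r) ^ 2 - ww r * (1 - ww r ^ 2) - r ^ 3 * ww1 r * (1 + ww r ^ 2)) / (1 + ww r ^ 2) ^ 2); [|lra].
apply Rdiv_le_0_compat; [lra|apply pow_lt; auto].
Qed.

Lemma BB_pos r : 0 <= BB r <= PI.
Proof.
unfold BB, Bw. pose proof (atan_bound (ww r)). pose proof PI_RGT_0. unfold Rmin; destruct Rle_dec; lra.
Qed.

Lemma atan_le x : 0 <= x -> atan x <= x.
Proof.
intros Hx. destruct (MVT_abs atan (fun x => / (1 + x ^ 2)) 0 x) as [c [_ E]].
- intros y _. apply is_derive_Reals. apply derivable_pt_lim_atan.
- rewrite atan_0 in E. assert (/ (1 + c ^ 2) <= 1) by (rewrite <- Rinv_1; apply Rinv_le_contravar; nra). nra.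
Qed.

Lemma atan_ge x : 0 <= x <= 1 -> x / 2 <= atan x.
Proof.
intros Hx. destruct (MVT_abs atan (fun x => / (1 + x ^ 2)) 0 x) as [c [Hc E]].
- intros y _. apply is_derive_Reals. apply derivable_pt_lim_atan.
- rewrite atan_0 in E. rewrite Rmin_left, Rmax_right in Hc by lra.
  assert (/ 2 <= / (1 + c ^ 2)) by (apply Rinv_le_contravar; nra). nra.
Qed.

(** The bound that excludes concentration at the axis: it controls u = phi/r by 4/a for all times.
    For r <= a the logarithm takes at most half of a/r; for r > a, PI <= 4 is enough. *)
Lemma BB_linear r : 0 < r <= 1 -> BB r <= 4 / a * r.
Proof.
intros Hr. destruct (Rle_lt_dec r a) as [H|H].
- destruct (ww_log_bound r ltac:(lra)) as [L1 L2].
  assert (W : a / (2 * r) <= ww r).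
  { unfold ww. assert (1 / 32 * a * r * ln (1 + r ^ 2 / a ^ 2) <= 1 / 32 * a * r * (r / a)) by (apply Rmult_le_compat_l; nra).
    assert (1 / 32 * a * r * (r / a) <= a / (2 * r)).
    { replace (1 / 32 * a * r * (r / a)) with (1 / 32 * r ^ 2) by (field; lra).
      apply Rmult_le_reg_r with (2 * r); [lra|]. replace (a / (2 * r) * (2 * r)) with a by (field; lra).
      replace (1 / 32 * r ^ 2 * (2 * r)) with (1 / 16 * r * r * r) by field. assert (r * r <= 1) by nra. nra. }
    replace (a / (2 * r)) with (a / r - a / (2 * r)) by (field; lra). lra. }
  assert (Pa : 0 < a / (2 * r)) by (apply Rdiv_lt_0_compat; lra).
  unfold BB. eapply Rle_trans; [apply Rmin_r|]. unfold Bw.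
  replace (PI - 2 * atan (ww r)) with (2 * (PI / 2 - atan (ww r))) by field. rewrite <- atan_inv by lra.
  assert (Pi : 0 < / ww r) by (apply Rinv_0_lt_compat; lra). pose proof (atan_le (/ ww r) ltac:(lra)).
  assert (/ ww r <= / (a / (2 * r))) by (apply Rinv_le_contravar; auto).
  replace (4 / a * r) with (2 * / (a / (2 * r))) by (field; lra). lra.
- pose proof (BB_pos r). pose proof PI_4. assert (1 <= r / a).
  { apply Rmult_le_reg_r with a; [lra|]. unfold Rdiv. rewrite Rmult_assoc, Rinv_l; lra. }
  replace (4 / a * r) with (4 * (r / a)) by (unfold Rdiv; ring). lra.
Qed.

(** Beyond radius rho the logarithm has made [ww] nonpositive and the barrier equals PI, so x <= PI
    is enough. Inside, the barrier lies above 2 atan(r/a), which exceeds r/rho because a <= rho. *)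
Lemma BB_above rho x r : 0 < rho <= 1 -> a = rho * exp (- 16 / rho ^ 2) -> 0 < r <= 1 -> x <= PI -> x <= r / rho -> x <= BB r.
Proof.
intros Hrho Ea Hr HP Hx. unfold BB. apply Rmin_glb; auto. unfold Bw.
destruct (Rle_lt_dec (ww r) 0) as [W|W].
- assert (atan (ww r) <= 0); [|lra]. rewrite <- atan_0. destruct W as [W|W]; [left; apply atan_increasing; auto|rewrite W; lra].
- assert (He : exp (- 16 / rho ^ 2) <= 1).
  { rewrite <- exp_0. apply exp_le. assert (0 < 16 / rho ^ 2) by (apply Rdiv_lt_0_compat; nra). unfold Rdiv in *. lra. }
  assert (Har : a <= rho) by nra.
  assert (Hlt : r < rho).
  { apply Rnot_le_lt. intros N. revert W. apply Rle_not_lt. unfold ww.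
    (* The exponent 16 in [a] gives rho^2/a^2 = exp(32/rho^2), and the 32 cancels the coefficient
       1/32 of the logarithm. *)
    assert (Lr : 32 / rho ^ 2 <= ln (1 + r ^ 2 / a ^ 2)).
    { rewrite <- (ln_exp (32 / rho ^ 2)). apply ln_le; [apply exp_pos|].
      assert (E2 : rho ^ 2 / a ^ 2 = exp (32 / rho ^ 2)).
      { rewrite Ea. replace (rho ^ 2 / (rho * exp (- 16 / rho ^ 2)) ^ 2) with (/ (exp (- 16 / rho ^ 2) * exp (- 16 / rho ^ 2))).
        - rewrite <- exp_plus, <- exp_Ropp. f_equal. field. lra.
        - field. split; [apply Rgt_not_eq, exp_pos|lra]. }
      rewrite <- E2. assert (rho ^ 2 / a ^ 2 <= r ^ 2 / a ^ 2); [|lra].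
      unfold Rdiv. apply Rmult_le_compat_r; [apply Rlt_le, Rinv_0_lt_compat; nra|nra]. }
    assert (a / r <= 1 / 32 * a * r * (32 / rho ^ 2)).
    { replace (1 / 32 * a * r * (32 / rho ^ 2)) with (a / r * (r ^ 2 / rho ^ 2)) by (field; lra).
      rewrite <- (Rmult_1_r (a / r)) at 1. apply Rmult_le_compat_l; [apply Rdiv_le_0_compat; lra|].
      apply Rmult_le_reg_r with (rho ^ 2); [nra|]. unfold Rdiv. rewrite Rmult_assoc, Rinv_l by nra. nra. }
    assert (1 / 32 * a * r * (32 / rho ^ 2) <= 1 / 32 * a * r * ln (1 + r ^ 2 / a ^ 2)) by (apply Rmult_le_compat_l; nra).
    lra. }
  assert (Hw : ww r <= a / r).
  { unfold ww. destruct (ww_log_bound r ltac:(lra)) as [L1 _]. assert (0 <= 1 / 32 * a * r * ln (1 + r ^ 2 / a ^ 2)) by (apply Rmult_le_pos; nra). lra. }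
  assert (Ha2 : atan (ww r) <= atan (a / r)) by (destruct Hw as [Hw|Hw]; [left; apply atan_increasing; auto|rewrite Hw; lra]).
  assert (Ei : PI / 2 - atan (a / r) = atan (r / a)).
  { rewrite <- atan_inv by (apply Rdiv_lt_0_compat; lra). f_equal. field. lra. }
  destruct (Rle_lt_dec a r) as [H|H].
  + assert (1 <= r / a) by (apply Rmult_le_reg_r with a; [lra|]; unfold Rdiv; rewrite Rmult_assoc, Rinv_l; lra).
    assert (PI / 4 <= atan (r / a)).
    { rewrite <- atan_1. destruct H0 as [H0|H0]; [left; apply atan_increasing; auto|rewrite <- H0; lra]. }
    assert (r / rho <= 1) by (apply Rmult_le_reg_r with rho; [lra|]; unfold Rdiv; rewrite Rmult_assoc, Rinv_l; lra).
    pose proof PI2_3_2. lra.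
  + assert (Hra : 0 <= r / a <= 1).
    { split; [apply Rdiv_le_0_compat; lra|]. apply Rmult_le_reg_r with a; [lra|]. unfold Rdiv. rewrite Rmult_assoc, Rinv_l; lra. }
    pose proof (atan_ge _ Hra).
    assert (r / rho <= r / a) by (unfold Rdiv; apply Rmult_le_compat_l; [lra|]; apply Rinv_le_contravar; lra). lra.
Qed.
End Barrier.

(** * Comparison with the barrier and removal of the truncation *)

Lemma reaction_lip M : 0 <= M -> exists L, 0 < L /\ forall r u v, 0 <= r <= 1 -> v <= u ->
  Gn r (theta M u) - Gn r (theta M v) <= L * (u - v).
Proof.
intros HM. destruct (cont2_bounded (Gd 1) 0 1 (- (M + 1)) (M + 1) (Gd_cont 1)) as [B [HB BG]].
exists B. split; auto. intros r u v Hr Hv.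
destruct (MVT_abs (fun u => Gn r (theta M u)) (fun u => Gd 1 r (theta M u) * tau M u) v u) as [c [_ E]].
- intros x _. apply (is_derive_comp_R (Gn r) (theta M)); [apply (Gd_derive 0)|apply RInt_derive, tau_cont].
- cbv beta in E. rewrite E. apply Rmult_le_compat_r; [lra|]. pose proof (tau_in M c).
  destruct (Rle_dec (Rabs c) (M + 1)) as [H1|H1].
  + pose proof (theta_bound M c) as T. assert (T2 : Rabs (theta M c) <= M + 1) by lra. apply Rabs_le_between in T2.
    specialize (BG r (theta M c) Hr T2). apply Rabs_le_between in BG. nra.
  + replace (tau M c) with 0; [lra|]. unfold tau. rewrite Rmin_right by lra. rewrite Rmax_left; lra.
Qed.

(** The algebra at an interior maximum of e (u - B/r) - eps/r^2. The function 1/r^2 is harmonic in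
    dimension 4, so the penalty contributes just 2 eps/r^2, through the drift, and this is less than
    twice the weighted excess; hence the rate L + 2. *)
Lemma touching_contradiction r e eps u ut ur urr B B1 B2 F L : 0 < r < 1 -> 0 < e -> 0 < L ->
  ut = urr + (3 / r - r) * ur - u + F -> F - (B - sin (2 * B) / 2) / r ^ 3 <= L * (u - B / r) ->
  r ^ 2 * B2 + r * B1 - r ^ 3 * B1 - sin (2 * B) / 2 <= 0 ->
  0 < e * (u - B / r) - eps / r ^ 2 -> 0 < eps ->
  0 <= e * (ut - (L + 2) * (u - B / r)) ->
  e * (ur - B1 / r + B / r ^ 2) + 2 * eps / r ^ 3 = 0 ->
  e * (urr - B2 / r + 2 * B1 / r ^ 2 - 2 * B / r ^ 3) - 6 * eps / r ^ 4 <= 0 -> False.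
Proof.
intros Hr He HL Eut HF HB Hd Heps Ht H1 H2.
set (X := r ^ 2 * B2 + r * B1 - r ^ 3 * B1 - sin (2 * B) / 2) in *.
assert (HX : e * (X / r ^ 3) <= 0).
{ assert (0 <= e * (- X / r ^ 3)).
  - apply Rmult_le_pos; [lra|]. apply Rdiv_le_0_compat; [lra|apply pow_lt; lra].
  - unfold Rdiv in *. lra. }
set (Y1 := e * (ur - B1 / r + B / r ^ 2) + 2 * eps / r ^ 3) in *.
set (Y2 := e * (urr - B2 / r + 2 * B1 / r ^ 2 - 2 * B / r ^ 3) - 6 * eps / r ^ 4) in *.
set (Y3 := F - (B - sin (2 * B) / 2) / r ^ 3) in *.
assert (E : e * ut = Y2 + (3 / r - r) * Y1 + e * (X / r ^ 3) - e * (u - B / r) + 2 * (eps / r ^ 2) + e * Y3).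
{ unfold Y1, Y2, Y3, X. rewrite Eut. field. lra. }
rewrite H1, Rmult_0_r, Rplus_0_r in E.
assert (e * Y3 <= e * (L * (u - B / r))) by (apply Rmult_le_compat_l; lra).
assert (e * (ut - (L + 2) * (u - B / r)) = e * ut - (L + 2) * (e * (u - B / r))) by ring.
assert (e * (L * (u - B / r)) = L * (e * (u - B / r))) by ring.
assert (0 < eps / r ^ 2) by (apply Rdiv_lt_0_compat; [lra|apply pow_lt; lra]). lra.
Qed.

(** A maximum principle for u - BB/r. The penalty -eps/r^2 keeps the maximum away from the axis,
    where the equation for u is singular. *)
Lemma upper_barrier a M u ut ur urr : 0 < a <= 1 -> 4 / a <= M -> cont2 u ->
  (forall r, 0 < r <= 1 -> r * u r 0 <= BB a r) -> (forall t, 0 <= t -> u 1 t <= BB a 1) ->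
  (forall r t, 0 <= r <= 1 -> 0 < t -> is_derive (u r) t (ut r t)) ->
  (forall r t, 0 < r < 1 -> 0 < t -> is_derive (fun q => u q t) r (ur r t) /\ is_derive (fun q => ur q t) r (urr r t) /\
     ut r t = urr r t + (3 / r - r) * ur r t - u r t + Gn r (theta M (u r t))) ->
  forall r t, 0 < r <= 1 -> 0 <= t -> r * u r t <= BB a r.
Proof.
intros Ha HM Cu H0 H1 Dt Dx r1 t1 Hr1 Ht1. apply Rnot_lt_le. intros N.
assert (HM0 : 0 <= M) by (assert (0 < 4 / a) by (apply Rdiv_lt_0_compat; lra); lra).
destruct (reaction_lip M HM0) as [L [HL Lip]].
destruct (cont2_bounded u 0 1 0 t1 Cu) as [Bu [HBu BBu]].
set (K := L + 2).
set (d1 := u r1 t1 - BB a r1 / r1).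
assert (Hd1 : 0 < d1).
{ unfold d1. assert (BB a r1 / r1 < u r1 t1); [|lra]. apply Rmult_lt_reg_r with r1; [lra|]. unfold Rdiv. rewrite Rmult_assoc, Rinv_l; lra. }
(* Half of the weighted excess at (r1,t1), so that the penalized function is still positive
   there. *)
set (eps := exp (- (K * t1)) * d1 * r1 ^ 2 / 2).
assert (Heps : 0 < eps).
{ unfold eps. assert (0 < exp (- (K * t1)) * d1 * r1 ^ 2); [|lra]. apply Rmult_lt_0_compat; [|apply pow_lt; lra]. apply Rmult_lt_0_compat; auto. apply exp_pos. }
(* At this radius the penalty already exceeds the bound [Bu] on u, so the maximum cannot lie on the
   inner edge. *)
set (rho := Rmin r1 (eps / (Bu + 1))).
assert (Hrho : 0 < rho /\ rho <= r1 /\ rho <= eps / (Bu + 1)).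
{ assert (0 < eps / (Bu + 1)) by (apply Rdiv_lt_0_compat; lra). unfold rho, Rmin; destruct Rle_dec; lra. }
set (RR := fun q => Rmax rho q).
assert (RRp : forall q, 0 < RR q) by (intros q; unfold RR; pose proof (Rmax_l rho q); lra).
assert (RRid : forall q, rho <= q -> RR q = q) by (intros q Hq; apply Rmax_right; auto).
set (H := fun q s => exp (- (K * s)) * (u q s - BB a (RR q) / RR q) - eps / RR q ^ 2).
assert (CH : cont2 H).
{ assert (CR : cont1 RR) by (intros x; unfold RR; ct).
  intros p. unfold H. apply cR_minus.
  - apply cR_mult; [ct|]. apply cR_minus; [ct|]. apply cR_div; [|ct|apply Rgt_not_eq, RRp].
    unfold BB. apply cR_min. apply (cR_comp (Bw a) (fun q : R * R => RR (fst q))); [ct|].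
    apply (ex_derive_continuous (V:=R_NormedModule)). exists (Bw1 a (RR (fst p))). exact (proj1 (Bw_derive a Ha _ (RRp _))).
  - apply cR_div; [ct|ct|]. apply pow_nonzero, Rgt_not_eq, RRp. }
destruct (cont2_max H rho 1 0 t1) as [r0 [t0 [Hr0 [Ht0 Hmax]]]]; auto; try lra.
assert (Hpos : 0 < H r0 t0).
{ apply Rlt_le_trans with (H r1 t1); [|apply Hmax; lra]. unfold H. rewrite RRid by lra. fold d1.
  replace (eps / r1 ^ 2) with (exp (- (K * t1)) * d1 / 2) by (unfold eps; field; lra).
  assert (0 < exp (- (K * t1)) * d1) by (apply Rmult_lt_0_compat; auto; apply exp_pos). lra. }
assert (Neg : forall q s, rho <= q <= 1 -> q * u q s <= BB a q -> H q s <= 0).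
{ intros q s Hq Hb. unfold H. rewrite RRid by lra.
  assert (u q s - BB a q / q <= 0).
  { assert (u q s <= BB a q / q); [|lra]. apply Rmult_le_reg_r with q; [lra|]. unfold Rdiv. rewrite Rmult_assoc, Rinv_l; lra. }
  assert (0 < eps / q ^ 2) by (apply Rdiv_lt_0_compat; [lra|apply pow_lt; lra]). pose proof (exp_pos (- (K * s))). nra. }
assert (Hr0' : rho < r0 < 1).
{ split.
  - destruct (Rle_lt_or_eq_dec rho r0 (proj1 Hr0)) as [|E]; auto. exfalso. subst r0.
    revert Hpos. apply Rle_not_lt. unfold H. rewrite RRid by lra.
    pose proof (BBu rho t0 ltac:(lra) Ht0) as Bu0. apply Rabs_le_between in Bu0.
    assert (0 <= BB a rho / rho) by (apply Rdiv_le_0_compat; [apply BB_pos|lra]).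
    assert (exp (- (K * t0)) <= 1) by (rewrite <- exp_0; apply exp_le; unfold K; nra).
    pose proof (exp_pos (- (K * t0))).
    assert (exp (- (K * t0)) * (u rho t0 - BB a rho / rho) <= Bu) by nra.
    assert (Bu + 1 <= eps / rho ^ 2); [|lra].
    apply Rmult_le_reg_r with (rho ^ 2); [apply pow_lt; lra|]. unfold Rdiv at 1. rewrite Rmult_assoc, Rinv_l by (apply pow_nonzero; lra).
    assert (rho * (Bu + 1) <= eps).
    { apply Rle_trans with (eps / (Bu + 1) * (Bu + 1)); [apply Rmult_le_compat_r; lra|right; field; lra]. }
    assert (rho ^ 2 <= rho) by nra. nra.
  - destruct (Rle_lt_or_eq_dec r0 1 (proj2 Hr0)) as [|E]; auto. exfalso. subst r0.
    revert Hpos. apply Rle_not_lt, Neg; [lra|]. rewrite Rmult_1_l. apply H1; lra. }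
assert (Ht0' : 0 < t0).
{ destruct (Rle_lt_or_eq_dec 0 t0 (proj1 Ht0)) as [|E]; auto. exfalso. subst t0.
  revert Hpos. apply Rle_not_lt, Neg; [lra|]. apply H0; lra. }
(* [BB] has a corner. At the touching point it is replaced by the branch attaining the minimum,
   which is smooth, lies above [BB] and touches it there. *)
assert (Br : exists B B1 B2 : R -> R, (forall q, 0 < q -> BB a q <= B q /\ is_derive B q (B1 q) /\ is_derive B1 q (B2 q)) /\ BB a r0 = B r0 /\
   r0 ^ 2 * B2 r0 + r0 * B1 r0 - r0 ^ 3 * B1 r0 - sin (2 * B r0) / 2 <= 0).
{ destruct (Rle_lt_dec (ww a r0) 0) as [W|W].
  - exists (fun _ => PI), (fun _ => 0), (fun _ => 0). split; [|split].
    + intros q _. split; [apply BB_pos|]. split; [apply (is_derive_const (V:=R_NormedModule) PI)|apply (is_derive_const (V:=R_NormedModule) 0)].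
    + unfold BB. apply Rmin_left. unfold Bw. assert (atan (ww a r0) <= 0); [|lra].
      rewrite <- atan_0. destruct W as [W|W]; [left; apply atan_increasing; auto|rewrite W; lra].
    + rewrite sin_2PI. lra.
  - exists (Bw a), (Bw1 a), (Bw2 a). split; [|split].
    + intros q Hq. split; [apply Rmin_r|apply Bw_derive; auto].
    + unfold BB. apply Rmin_right. unfold Bw. assert (0 < atan (ww a r0)); [|lra]. rewrite <- atan_0. apply atan_increasing; auto.
    + apply Bw_supersolution; auto; lra. }
destruct Br as [B [B1 [B2 [HB [EB SB]]]]].
set (h := fun q s => exp (- (K * s)) * (u q s - B q / q) - eps / q ^ 2).
assert (hmax : forall q s, rho <= q <= 1 -> 0 <= s <= t1 -> h q s <= h r0 t0).
{ intros q s Hq Hs. apply Rle_trans with (H q s).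
  - unfold h, H. rewrite RRid by lra. pose proof (exp_pos (- (K * s))). destruct (HB q ltac:(lra)) as [Q _].
    assert (BB a q / q <= B q / q) by (unfold Rdiv; apply Rmult_le_compat_r; auto; apply Rlt_le, Rinv_0_lt_compat; lra). nra.
  - eapply Rle_trans; [apply Hmax; auto|]. unfold h, H. rewrite RRid, EB by lra. lra. }
assert (hpos : 0 < h r0 t0) by (revert Hpos; unfold h, H; rewrite RRid, EB by lra; auto).
destruct (Dx r0 t0 ltac:(lra) Ht0') as [_ [_ PDE]].
set (e := exp (- (K * t0))).
assert (T1 : 0 <= e * (ut r0 t0 - K * (u r0 t0 - B r0 / r0))).
{ apply (is_derive_max_left (fun s => h r0 s) t0 _ t0); auto.
  - pose proof (Dt r0 t0 ltac:(lra) Ht0') as D. unfold h. auto_derive; [eexists; exact D|]. der D. unfold e, Rminus, Rdiv. ring.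
  - intros s Hs. apply hmax; lra. }
set (d := Rmin (r0 - rho) (1 - r0)).
assert (Hd : 0 < d /\ d <= r0 - rho /\ d <= 1 - r0) by (unfold d, Rmin; destruct Rle_dec; lra).
destruct (is_derive_max_int (fun q => h q t0) (fun q => e * (ur q t0 - B1 q / q + B q / q ^ 2) + 2 * eps / q ^ 3) r0
   (e * (urr r0 t0 - B2 r0 / r0 + 2 * B1 r0 / r0 ^ 2 - 2 * B r0 / r0 ^ 3) - 6 * eps / r0 ^ 4) d) as [Z1 Z2]; try tauto.
- intros q Hq. assert (Hq' : rho < q < 1) by (revert Hq; unfold Rabs; destruct Rcase_abs; lra).
  destruct (Dx q t0 ltac:(lra) Ht0') as [D1 _]. destruct (HB q ltac:(lra)) as [_ [D2 _]].
  unfold h. fold e. auto_derive; [repeat split; try (eexists; eauto); try (apply Rgt_not_eq; nra)|]. der D1. der D2. field. lra.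
- destruct (Dx r0 t0 ltac:(lra) Ht0') as [_ [D1 _]]. destruct (HB r0 ltac:(lra)) as [_ [D2 D3]].
  auto_derive; [repeat split; try (eexists; eauto); try (apply Rgt_not_eq; repeat apply Rmult_lt_0_compat; lra)|]. der D1. der D2. der D3. field. lra.
- intros q Hq. apply hmax; [|lra]. revert Hq; unfold Rabs; destruct Rcase_abs; lra.
- assert (Hdel : 0 < u r0 t0 - B r0 / r0).
  { assert (0 < eps / r0 ^ 2) by (apply Rdiv_lt_0_compat; [lra|apply pow_lt; lra]). unfold h in hpos. pose proof (exp_pos (- (K * t0))). nra. }
  apply (touching_contradiction r0 e eps (u r0 t0) (ut r0 t0) (ur r0 t0) (urr r0 t0) (B r0) (B1 r0) (B2 r0) (Gn r0 (theta M (u r0 t0))) L); auto; try lra.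
  + apply exp_pos.
  + replace ((B r0 - sin (2 * B r0) / 2) / r0 ^ 3) with (Gn r0 (theta M (B r0 / r0))).
    * apply Lip; lra.
    * assert (Hb : Rabs (B r0 / r0) <= M).
      { rewrite <- EB. rewrite Rabs_pos_eq by (apply Rdiv_le_0_compat; [apply BB_pos|lra]).
        apply Rle_trans with (4 / a); auto. apply Rmult_le_reg_r with r0; [lra|].
        replace (BB a r0 / r0 * r0) with (BB a r0) by (field; lra). apply BB_linear; auto; lra. }
      rewrite theta_id by exact Hb. rewrite Gn_sin by lra.
      replace (r0 * (B r0 / r0)) with (B r0) by (field; lra). auto.
Qed.

Lemma theta_odd M u : theta M (- u) = - theta M u.
Proof.
unfold theta. rewrite (RInt_scale _ (- u) (tau_cont M)), (RInt_scale _ u (tau_cont M)), <- Ropp_mult_distr_l.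
do 2 f_equal. apply RInt_ext. intros x _. unfold tau. rewrite <- Ropp_mult_distr_l, Rabs_Ropp. auto.
Qed.

(** The barrier is applied to u and, as the reaction is odd, to -u. It yields |u| <= M with the same
    M as in the truncation, which is therefore inactive; the value at r = 0 follows by
    continuity. *)
Lemma bounded_solution u0 : cont1 u0 -> (forall r, 0 <= r <= 1 -> Rabs (r * u0 r) <= PI) -> exists u ut ur urr : R -> R -> R,
  cont2 u /\ (forall r, 0 <= r <= 1 -> u r 0 = u0 r) /\ (forall t, 0 <= t -> u 1 t = u0 1) /\
  (forall r t, 0 <= r <= 1 -> 0 < t -> is_derive (u r) t (ut r t)) /\
  (forall r t, 0 < r < 1 -> 0 < t -> is_derive (fun q => u q t) r (ur r t) /\ is_derive (fun q => ur q t) r (urr r t) /\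
     ut r t = urr r t + (3 / r - r) * ur r t - u r t + Gn r (u r t)) /\
  (forall k, Dk k u).
Proof.
intros Cu HP. destruct (X0_bounded u0 Cu) as [C [HC BC]].
(* Turns the bound C on u0 into r u0 <= r/rho, the hypothesis on the datum near the axis. *)
set (rho := / (C + 1)). assert (Hrho : 0 < rho <= 1).
{ unfold rho. split; [apply Rinv_0_lt_compat; lra|]. rewrite <- Rinv_1. apply Rinv_le_contravar; lra. }
set (a := rho * exp (- 16 / rho ^ 2)).
assert (He : 0 < exp (- 16 / rho ^ 2) <= 1).
{ split; [apply exp_pos|]. rewrite <- exp_0. apply exp_le. assert (0 < 16 / rho ^ 2) by (apply Rdiv_lt_0_compat; nra). unfold Rdiv in *. lra. }
assert (Ha : 0 < a <= 1) by (unfold a; nra).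
set (M := 4 / a). assert (HM4 : 4 <= M).
{ unfold M. apply Rmult_le_reg_r with a; [lra|]. unfold Rdiv. rewrite Rmult_assoc, Rinv_l by lra. lra. }
assert (HA : Rabs (u0 1) <= M).
{ specialize (HP 1 ltac:(lra)). rewrite Rmult_1_l in HP. pose proof PI_4. lra. }
assert (H0 : forall s, (s = 1 \/ s = -1) -> forall r, 0 < r <= 1 -> r * (s * u0 r) <= BB a r).
{ intros s Hs r Hr. specialize (HP r ltac:(lra)). specialize (BC r ltac:(lra)).
  apply Rabs_le_between in HP. apply Rabs_le_between in BC.
  apply (BB_above a Ha rho); auto.
  - destruct Hs; subst s; lra.
  - unfold Rdiv, rho. rewrite Rinv_inv. apply Rmult_le_compat_l; [lra|]. destruct Hs; subst s; lra. }
destruct (truncated_solution (u0 1) M u0 Cu eq_refl HA) as [u [ut [ur [urr [Cuu [I0 [I1 [Dt [Dx Reg]]]]]]]]].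
assert (Up : forall r t, 0 < r <= 1 -> 0 <= t -> r * u r t <= BB a r).
{ apply (upper_barrier a M u ut ur urr); auto; [unfold M; lra| |].
  - intros r Hr. rewrite I0 by lra. specialize (H0 1 ltac:(auto) r Hr). lra.
  - intros t Ht. rewrite I1 by auto. specialize (H0 1 ltac:(auto) 1 ltac:(lra)). lra. }
assert (Lo : forall r t, 0 < r <= 1 -> 0 <= t -> r * (- u r t) <= BB a r).
{ apply (upper_barrier a M (fun r t => - u r t) (fun r t => - ut r t) (fun r t => - ur r t) (fun r t => - urr r t)); auto; [unfold M; lra|intros p; ct| | | |].
  - intros r Hr. rewrite I0 by lra. specialize (H0 (-1) ltac:(auto) r Hr). lra.
  - intros t Ht. rewrite I1 by auto. specialize (H0 (-1) ltac:(auto) 1 ltac:(lra)). lra.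
  - intros r t Hr Ht. apply (is_derive_opp (V:=R_NormedModule) (u r)). auto.
  - intros r t Hr Ht. destruct (Dx r t Hr Ht) as [D1 [D2 E]]. split; [|split].
    + apply (is_derive_opp (V:=R_NormedModule) (fun q => u q t)). auto.
    + apply (is_derive_opp (V:=R_NormedModule) (fun q => ur q t)). auto.
    + assert (EG : Gn r (theta M (- u r t)) = - Gn r (theta M (u r t))).
      { rewrite theta_odd. unfold Gn. replace ((- theta M (u r t)) ^ 2) with (theta M (u r t) ^ 2) by ring. ring. }
      rewrite EG, E. Rsimp. ring. }
assert (Bd1 : forall r t, 0 < r <= 1 -> 0 <= t -> Rabs (u r t) <= M).
{ intros r t Hr Ht. pose proof (BB_linear a Ha r Hr) as Lb. fold M in Lb.
  specialize (Up r t Hr Ht). specialize (Lo r t Hr Ht). apply Rabs_le_between.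
  split; apply Rmult_le_reg_r with r; lra. }
assert (Bd : forall r t, 0 <= r <= 1 -> 0 <= t -> Rabs (u r t) <= M).
{ intros r t Hr Ht. destruct (Rle_lt_or_eq_dec 0 r (proj1 Hr)) as [Hp| <-]; [apply Bd1; auto; lra|].
  apply Rnot_lt_le. intros Nn.
  destruct (proj1 (cont2_eps _) Cuu 0 t (Rabs (u 0 t) - M) ltac:(lra)) as [d [Hd D]].
  set (q := Rmin (d / 2) 1). assert (Hq : 0 < q <= 1 /\ q < d) by (unfold q, Rmin; destruct Rle_dec; lra).
  specialize (D q t ltac:(rewrite Rabs_pos_eq; lra) ltac:(rewrite Rminus_diag, Rabs_R0; lra)).
  pose proof (Bd1 q t ltac:(lra) Ht). revert D Nn H. unfold Rabs. repeat destruct Rcase_abs; lra. }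
exists u, ut, ur, urr. split; auto. split; auto. split; auto. split; auto. split; auto.
intros r t Hr Ht. destruct (Dx r t Hr Ht) as [D1 [D2 E]]. split; auto. split; auto.
rewrite theta_id in E; auto. apply Bd; lra.
Qed.

(** * Regularity up to the axis *)

(** A derivative with a continuous limit at an exceptional point exists there too, by the mean value
    theorem. It serves at the axis and at the junction of the extension. *)
Lemma derive_glue (f F : R -> R) x0 d : 0 < d -> (forall y, Rabs (y - x0) < d -> continuous f y) ->
  (forall y, Rabs (y - x0) < d -> y <> x0 -> is_derive f y (F y)) -> continuous F x0 -> is_derive f x0 (F x0).
Proof.
intros Hd Cf D CF. apply is_derive_Reals. intros eps He.
destruct (proj1 (continuous_eps F x0) CF eps He) as [e [He' Q]].
exists (mkposreal (Rmin d e) ltac:(unfold Rmin; destruct Rle_dec; lra)). intros h Hh0 Hh. simpl in Hh.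
assert (Hh' : Rabs h < d /\ Rabs h < e) by (revert Hh; unfold Rmin; destruct Rle_dec; lra).
destruct (MVT_gen f x0 (x0 + h) F) as [c [Hc E]].
- intros y Hy. apply D; revert Hy Hh'; unfold Rmin, Rmax, Rabs; repeat destruct Rle_dec; repeat destruct Rcase_abs; lra.
- intros y Hy. apply continuity_pt_filterlim, Cf. revert Hy Hh'; unfold Rmin, Rmax, Rabs; repeat destruct Rle_dec; repeat destruct Rcase_abs; lra.
- rewrite E. replace (F c * (x0 + h - x0) / h - F x0) with (F c - F x0) by (field; auto). apply Q.
  revert Hc Hh'; unfold Rmin, Rmax, Rabs; repeat destruct Rle_dec; repeat destruct Rcase_abs; lra.
Qed.

Definition cl2 x := Rmax (-1) (Rmin 1 x).
Lemma cl2_in x : -1 <= cl2 x <= 1.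
Proof. unfold cl2, Rmax, Rmin; repeat destruct Rle_dec; lra. Qed.
Lemma cl2_id x : -1 <= x <= 1 -> cl2 x = x.
Proof. unfold cl2, Rmax, Rmin; repeat destruct Rle_dec; lra. Qed.
Lemma cl2_cont : cont1 cl2.
Proof. intros x. unfold cl2. ct. Qed.

(* Continuity on [-1,1] x (0,oo), expressed on the whole plane through clamping. *)
Definition ccont (f : R -> R -> R) := forall t1, 0 < t1 -> cont2 (fun r t => f (cl2 r) (Rmax t1 t)).

(** At most m derivatives in r and k in t, taken in any order. The two counts are separate because
    all orders in t are known from the start, while those in r are gained one at a time. Derivatives
    in r are required only inside, but extend continuously to r = 1 and r = -1. *)
Fixpoint Cls (m : nat) {struct m} : nat -> (R -> R -> R) -> Prop := fix Clsm (k : nat) (f : R -> R -> R) {struct k} : Prop :=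
  ccont f /\
  match k with O => True | S k' => exists ft : R -> R -> R,
     (forall r t, -1 <= r <= 1 -> 0 < t -> is_derive (f r) t (ft r t)) /\ Clsm k' ft end /\
  match m with O => True | S m' => exists fr : R -> R -> R,
     (forall r t, -1 < r < 1 -> 0 < t -> is_derive (fun q => f q t) r (fr r t)) /\ Cls m' k fr end.

Lemma Cls_eq m k f : Cls m k f <-> (ccont f /\
  match k with O => True | S k' => exists ft : R -> R -> R,
     (forall r t, -1 <= r <= 1 -> 0 < t -> is_derive (f r) t (ft r t)) /\ Cls m k' ft end /\
  match m with O => True | S m' => exists fr : R -> R -> R,
     (forall r t, -1 < r < 1 -> 0 < t -> is_derive (fun q => f q t) r (fr r t)) /\ Cls m' k fr end).
Proof. destruct m, k; reflexivity. Qed.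

Lemma Cls_cont m k f : Cls m k f -> ccont f.
Proof. rewrite Cls_eq. tauto. Qed.

Lemma Cls_ind2 (P : nat -> nat -> Prop) :
  (forall m k, (forall m' k', (m' + k' < m + k)%nat -> (m' <= m)%nat -> (k' <= k)%nat -> P m' k') -> P m k) -> forall m k, P m k.
Proof.
intros H. assert (Q : forall n m k, (m + k < n)%nat -> P m k).
{ induction n as [|n IH]; intros m k Hn; [lia|]. apply H. intros. apply IH. lia. }
intros m k. apply (Q (S (m + k))). lia.
Qed.

Lemma ccont_ext f g : (forall r t, -1 <= r <= 1 -> 0 < t -> f r t = g r t) -> ccont f -> ccont g.
Proof.
intros E C t1 Ht1 p. apply (continuous_ext (fun p : R * R => f (cl2 (fst p)) (Rmax t1 (snd p)))); [|apply (C t1 Ht1 p)].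
intros q. apply E; [apply cl2_in|]. apply Rlt_le_trans with t1; [auto|apply Rmax_l].
Qed.

Lemma near_pos t (P : R -> Prop) : 0 < t -> (forall s, 0 < s -> P s) -> locally t P.
Proof.
intros Ht H. exists (mkposreal t Ht). intros s Hs. apply H. change (Rabs (s - t) < t) in Hs. revert Hs. unfold Rabs; destruct Rcase_abs; lra.
Qed.

Lemma near_strip r (P : R -> Prop) : -1 < r < 1 -> (forall s, -1 < s < 1 -> P s) -> locally r P.
Proof.
intros Hr H. exists (mkposreal (Rmin (r + 1) (1 - r)) ltac:(unfold Rmin; destruct Rle_dec; lra)). intros s Hs. apply H.
change (Rabs (s - r) < Rmin (r + 1) (1 - r)) in Hs. revert Hs. unfold Rmin, Rabs; destruct Rle_dec, Rcase_abs; lra.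
Qed.

Lemma Cls_ext m k f g : (forall r t, -1 <= r <= 1 -> 0 < t -> f r t = g r t) -> Cls m k f -> Cls m k g.
Proof.
intros E. rewrite !Cls_eq. intros [C [Ht Hr]]. split; [apply ccont_ext with f; auto|]. split.
- destruct k; auto. destruct Ht as [ft [D H]]. exists ft. split; auto. intros r t Hr' Ht'.
  apply is_derive_ext_loc with (f r); auto. apply near_pos; auto.
- destruct m; auto. destruct Hr as [fr [D H]]. exists fr. split; auto. intros r t Hr' Ht'.
  apply is_derive_ext_loc with (fun q => f q t); auto. apply near_strip; auto. intros; apply E; auto; lra.
Qed.

Lemma Cls_mono m k : forall m' k' f, (m' <= m)%nat -> (k' <= k)%nat -> Cls m k f -> Cls m' k' f.
Proof.
revert m k. apply (Cls_ind2 (fun m k => forall m' k' f, (m' <= m)%nat -> (k' <= k)%nat -> Cls m k f -> Cls m' k' f)).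
intros m k IH m' k' f Hm Hk. rewrite !Cls_eq. intros [C [Ht Hr]]. split; auto. split.
- destruct k'; auto. destruct k; [lia|]. destruct Ht as [ft [D H]]. exists ft. split; auto. apply (IH m k); auto; lia.
- destruct m'; auto. destruct m; [lia|]. destruct Hr as [fr [D H]]. exists fr. split; auto. apply (IH m (k)); auto; lia.
Qed.

Lemma Cls_plus m k : forall f g, Cls m k f -> Cls m k g -> Cls m k (fun r t => f r t + g r t).
Proof.
revert m k. apply (Cls_ind2 (fun m k => forall f g, Cls m k f -> Cls m k g -> Cls m k (fun r t => f r t + g r t))).
intros m k IH f g. rewrite !Cls_eq. intros [C [Ht Hr]] [C' [Ht' Hr']]. split; [|split].
- intros t1 H1 p. pose proof (C t1 H1 p). pose proof (C' t1 H1 p). apply (cR_plus (fun p : R * R => f (cl2 (fst p)) (Rmax t1 (snd p)))); auto.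
- destruct k; auto. destruct Ht as [ft [D H]], Ht' as [gt [D' H']]. exists (fun r t => ft r t + gt r t). split; [|apply IH; auto; lia].
  intros. apply (is_derive_plus (V:=R_NormedModule)); auto.
- destruct m; auto. destruct Hr as [fr [D H]], Hr' as [gr [D' H']]. exists (fun r t => fr r t + gr r t). split; [|apply IH; auto; lia].
  intros. apply (is_derive_plus (V:=R_NormedModule)); auto.
Qed.

Lemma Cls_mult m k : forall f g, Cls m k f -> Cls m k g -> Cls m k (fun r t => f r t * g r t).
Proof.
revert m k. apply (Cls_ind2 (fun m k => forall f g, Cls m k f -> Cls m k g -> Cls m k (fun r t => f r t * g r t))).
intros m k IH f g Hf Hg. pose proof Hf as Hf0. pose proof Hg as Hg0. revert Hf Hg. rewrite !Cls_eq.
intros [C [Ht Hr]] [C' [Ht' Hr']]. split; [|split].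
- intros t1 H1 p. pose proof (C t1 H1 p). pose proof (C' t1 H1 p). apply (cR_mult (fun p : R * R => f (cl2 (fst p)) (Rmax t1 (snd p)))); auto.
- destruct k; auto. destruct Ht as [ft [D H]], Ht' as [gt [D' H']]. exists (fun r t => ft r t * g r t + f r t * gt r t).
  split; [|apply Cls_plus; apply IH; auto; try lia; apply (Cls_mono m (S k)); auto].
  intros r t Hr1 Ht1. apply (is_derive_mult (f r) (g r)); auto. intros; apply Rmult_comm.
- destruct m; auto. destruct Hr as [fr [D H]], Hr' as [gr [D' H']]. exists (fun r t => fr r t * g r t + f r t * gr r t).
  split; [|apply Cls_plus; apply IH; auto; try lia; apply (Cls_mono (S m) k); auto].
  intros r t Hr1 Ht1. apply (is_derive_mult (fun q => f q t) (fun q => g q t)); auto. intros; apply Rmult_comm.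
Qed.

Lemma Cls_const m k : forall c, Cls m k (fun _ _ => c).
Proof.
revert m k. apply (Cls_ind2 (fun m k => forall c, Cls m k (fun _ _ => c))). intros m k IH c. rewrite Cls_eq. split; [|split].
- intros t1 _ p. ct.
- destruct k; auto. exists (fun _ _ => 0). split; [intros; apply (is_derive_const (V:=R_NormedModule) c)|apply IH; lia].
- destruct m; auto. exists (fun _ _ => 0). split; [intros; apply (is_derive_const (V:=R_NormedModule) c)|apply IH; lia].
Qed.

Lemma Cls_r m k : Cls m k (fun r _ => r).
Proof.
revert m k. apply (Cls_ind2 (fun m k => Cls m k (fun r _ => r))). intros m k IH. rewrite Cls_eq. split; [|split].
- intros t1 _ p. pose proof cl2_cont. ct.
- destruct k; auto. exists (fun _ _ => 0). split; [intros; apply (is_derive_const (V:=R_NormedModule) r)|apply Cls_const].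
- destruct m; auto. exists (fun _ _ => 1). split; [intros; apply (is_derive_id (K:=R_AbsRing))|apply Cls_const].
Qed.

Lemma Cls_pow m k f n : Cls m k f -> Cls m k (fun r t => f r t ^ n).
Proof. intros H. induction n as [|n IH]; simpl; [apply Cls_const|apply Cls_mult; auto]. Qed.

Lemma Cls_comp (h : nat -> R -> R) : (forall i x, is_derive (h i) x (h (S i) x)) ->
  forall m k i f, Cls m k f -> Cls m k (fun r t => h i (f r t)).
Proof.
intros Dh. apply (Cls_ind2 (fun m k => forall i f, Cls m k f -> Cls m k (fun r t => h i (f r t)))).
intros m k IH i f Hf. pose proof Hf as Hf0. revert Hf. rewrite !Cls_eq.
intros [C [Ht Hr]]. split; [|split].
- intros t1 H1 p. pose proof (C t1 H1 p). apply (cR_comp (h i) (fun p : R * R => f (cl2 (fst p)) (Rmax t1 (snd p)))); auto.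
  apply (is_derive_cont1 _ _ (Dh i)).
- destruct k; auto. destruct Ht as [ft [D H]]. exists (fun r t => h (S i) (f r t) * ft r t).
  split; [|apply Cls_mult; auto; apply IH; try lia; apply (Cls_mono m (S k)); auto].
  intros r t Hr1 Ht1. apply (is_derive_comp_R (h i) (f r)); auto.
- destruct m; auto. destruct Hr as [fr [D H]]. exists (fun r t => h (S i) (f r t) * fr r t).
  split; [|apply Cls_mult; auto; apply IH; try lia; apply (Cls_mono (S m) k); auto].
  intros r t Hr1 Ht1. apply (is_derive_comp_R (h i) (fun q => f q t)); auto.
Qed.

Lemma Cls_Gn m k f : Cls m k f -> Cls m k (fun r t => Gn r (f r t)).
Proof.
intros H. unfold Gn. apply Cls_mult.
- apply Cls_mult; [apply Cls_const|apply Cls_pow; auto].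
- apply (Cls_comp s2d s2d_derive m k O (fun r t => 4 * r ^ 2 * f r t ^ 2)).
  apply Cls_mult; [apply Cls_mult; [apply Cls_const|apply Cls_pow, Cls_r]|apply Cls_pow; auto].
Qed.

(** Clamping s gives the integrand values on both sides of s = 0 and s = 1, while the hypotheses
    concern only [0,1]. *)
Lemma is_derive_RInt_unit (H Hx : R -> R -> R) x d : 0 < d ->
  (forall y s, Rabs (y - x) < d -> 0 <= s <= 1 -> is_derive (fun y => H y s) y (Hx y s)) ->
  (forall s, 0 <= s <= 1 -> continuity_2d_pt (fun y s => Hx y (cl s)) x s) ->
  (forall y, Rabs (y - x) < d -> ex_RInt (H y) 0 1) ->
  is_derive (fun y => RInt (H y) 0 1) x (RInt (Hx x) 0 1).
Proof.
intros Hd D C I.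
assert (L : locally x (fun y => Rabs (y - x) < d)) by (exists (mkposreal d Hd); intros y Hy; exact Hy).
assert (R1 : forall y, RInt (fun s => H y (cl s)) 0 1 = RInt (H y) 0 1).
{ intros y. apply RInt_ext. rewrite Rmin_left, Rmax_right by lra. intros s Hs. rewrite cl_id; auto; lra. }
apply is_derive_ext with (fun y => RInt (fun s => H y (cl s)) 0 1); [intros; apply R1|].
replace (RInt (Hx x) 0 1) with (RInt (fun s => Derive (fun u => H u (cl s)) x) 0 1).
2:{ apply RInt_ext. rewrite Rmin_left, Rmax_right by lra. intros s Hs. rewrite cl_id by lra. apply is_derive_unique, D; [|lra].
    rewrite Rminus_diag, Rabs_R0; auto. }
apply (is_derive_RInt_param (fun y s => H y (cl s)) 0 1 x); rewrite ?Rmin_left, ?Rmax_right by lra.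
- revert L. apply filter_imp. intros y Hy s Hs. eexists. apply D; auto.
- intros s Hs. apply continuity_2d_pt_ext_loc with (fun y s => Hx y (cl s)); auto.
  exists (mkposreal d Hd). intros y s' Hy _. symmetry. apply is_derive_unique, D; auto.
- revert L. apply filter_imp. intros y Hy. apply (ex_RInt_ext (H y)); [|apply I; auto].
  rewrite Rmin_left, Rmax_right by lra. intros s Hs. rewrite cl_id; auto; lra.
Qed.

(** The regular form of division by a power of r: the integral of s^n f over [0,r] is r^(n+1) times
    this average, which is as smooth as f. *)
Definition TT n (f : R -> R -> R) r t := RInt (fun s => s ^ n * f (r * s) t) 0 1.

Lemma ccont_pt f r t : ccont f -> -1 < r < 1 -> 0 < t -> continuous (fun p : R * R => f (fst p) (snd p)) (r, t).
Proof.
intros C Hr Ht. apply (continuous_ext_loc _ (fun p : R * R => f (cl2 (fst p)) (Rmax (t / 2) (snd p)))); [|apply (C (t / 2)); lra].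
set (d := Rmin (Rmin (r + 1) (1 - r)) (t / 2)). assert (Hd : 0 < d) by (unfold d, Rmin; repeat destruct Rle_dec; lra).
exists (mkposreal d Hd). intros [a b] [A B]. simpl in *. change (Rabs (a - r) < d) in A. change (Rabs (b - t) < d) in B.
assert (d <= r + 1 /\ d <= 1 - r /\ d <= t / 2) by (unfold d, Rmin; repeat destruct Rle_dec; lra).
apply Rabs_lt_between in A. apply Rabs_lt_between in B. rewrite cl2_id, Rmax_right by lra. auto.
Qed.

Lemma TT_ex n f r t : ccont f -> -1 <= r <= 1 -> 0 < t -> ex_RInt (fun s => s ^ n * f (r * s) t) 0 1.
Proof.
intros C Hr Ht. apply (ex_RInt_ext (fun s => s ^ n * f (cl2 (r * s)) (Rmax t t))).
- rewrite Rmin_left, Rmax_right by lra. intros s Hs. rewrite cl2_id, Rmax_left by nra. auto.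
- specialize (C t Ht). apply cont1_RInt. intros s. apply cR_mult; [ct|].
  apply (cont2_at (fun r0 t0 => f (cl2 r0) (Rmax t t0)) (fun s => r * s) (fun _ => t) s C); ct.
Qed.

Lemma TT_ccont n f : ccont f -> ccont (TT n f).
Proof.
intros C t1 Ht1. specialize (C t1 Ht1).
assert (C3 : cont3 (fun r t s => s ^ n * f (cl2 (cl2 r * s)) (Rmax t1 t))).
{ intros p. pose proof cl2_cont. apply cR_mult; [ct|].
  apply (cont2_at (fun r0 t0 => f (cl2 r0) (Rmax t1 t0)) (fun q : R * R * R => cl2 (fst (fst q)) * snd q) (fun q => snd (fst q)) p C); ct. }
pose proof (RInt_cont2 _ C3) as Q. intros p.
apply (continuous_ext (fun q : R * R => RInt (fun s => s ^ n * f (cl2 (cl2 (fst q) * s)) (Rmax t1 (snd q))) 0 1)); [|apply Q].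
intros q. unfold TT. apply RInt_ext. rewrite Rmin_left, Rmax_right by lra. intros s Hs.
match goal with |- _ = _ * f (cl2 ?x * s) _ => pose proof (cl2_in x); rewrite (cl2_id (cl2 x * s)) by nra end. auto.
Qed.

Lemma Cls_TT m k : forall n f, Cls m k f -> Cls m k (TT n f).
Proof.
revert m k. apply (Cls_ind2 (fun m k => forall n f, Cls m k f -> Cls m k (TT n f))).
intros m k IH n f. rewrite !Cls_eq. intros [C [Ht Hr]]. split; [apply TT_ccont; auto|split].
- destruct k; auto. destruct Ht as [ft [D H]]. exists (TT n ft). split; [|apply IH; auto; lia].
  pose proof (Cls_cont _ _ _ H) as Cft.
  intros r t Hr1 Ht1. apply (is_derive_RInt_unit (fun t s => s ^ n * f (r * s) t) (fun t s => s ^ n * ft (r * s) t) t t); auto.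
  + intros y s Hy Hs. apply Rabs_lt_between in Hy. apply is_derive_scal. apply D; [nra|lra].
  + intros s Hs. apply continuity_2d_pt_filterlim.
    change (continuous (fun p : R * R => cl (snd p) ^ n * ft (r * cl (snd p)) (fst p)) (t, s)).
    apply (continuous_ext_loc _ (fun p : R * R => cl (snd p) ^ n * ft (cl2 (r * cl (snd p))) (Rmax (t / 2) (fst p)))).
    * exists (mkposreal (t / 2) ltac:(lra)). intros [a b] [A _]. simpl in *. change (Rabs (a - t) < t / 2) in A. apply Rabs_lt_between in A.
      pose proof (cl_in b). rewrite cl2_id, Rmax_right by nra. auto.
    * specialize (Cft (t / 2) ltac:(lra)). apply cR_mult; [ct|].
      apply (cont2_at (fun r0 t0 => ft (cl2 r0) (Rmax (t / 2) t0)) (fun p : R * R => r * cl (snd p)) (fun p => fst p) _ Cft); ct.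
  + intros y Hy. apply Rabs_lt_between in Hy. apply TT_ex; auto; lra.
- destruct m; auto. destruct Hr as [fr [D H]]. exists (TT (S n) fr). split; [|apply IH; auto; lia].
  pose proof (Cls_cont _ _ _ H) as Cfr.
  intros r t Hr1 Ht1. set (d := Rmin (r + 1) (1 - r)). assert (Hd : 0 < d /\ d <= r + 1 /\ d <= 1 - r) by (unfold d, Rmin; destruct Rle_dec; lra).
  apply (is_derive_RInt_unit (fun r s => s ^ n * f (r * s) t) (fun r s => s ^ S n * fr (r * s) t) r d); auto; try lra.
  + intros y s Hy Hs. apply Rabs_lt_between in Hy. replace (s ^ S n * fr (y * s) t) with (s ^ n * (fr (y * s) t * s)) by (simpl; ring).
    apply (is_derive_scal (fun y => f (y * s) t)). apply (is_derive_comp_R (fun q => f q t) (fun y => y * s)); [apply D; auto; nra|].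
    auto_derive; auto; ring.
  + intros s Hs. apply continuity_2d_pt_filterlim.
    change (continuous (fun p : R * R => cl (snd p) ^ S n * fr (fst p * cl (snd p)) t) (r, s)).
    apply (continuous_ext_loc _ (fun p : R * R => cl (snd p) ^ S n * fr (cl2 (fst p * cl (snd p))) (Rmax t t))).
    * exists (mkposreal d ltac:(lra)). intros [a b] [A _]. change (Rabs (a - r) < d) in A. apply Rabs_lt_between in A.
      pose proof (cl_in b). unfold fst, snd. rewrite cl2_id, Rmax_left by nra. auto.
    * specialize (Cfr t Ht1). apply cR_mult; [ct|].
      apply (cont2_at (fun r0 t0 => fr (cl2 r0) (Rmax t t0)) (fun p : R * R => fst p * cl (snd p)) (fun p => t) _ Cfr); ct.
  + intros y Hy. apply Rabs_lt_between in Hy. apply TT_ex; auto; lra.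
Qed.

(** Symmetry of mixed derivatives, including existence of the one in the conclusion: the mean value
    theorem in both variables on a double difference quotient, then the time step tends to 0. *)
Lemma mixed_swap f F ft Ft r t : ccont Ft -> -1 < r < 1 -> 0 < t ->
  (forall r t, -1 < r < 1 -> 0 < t -> is_derive (fun q => f q t) r (F r t)) ->
  (forall r t, -1 <= r <= 1 -> 0 < t -> is_derive (f r) t (ft r t)) ->
  (forall r t, -1 <= r <= 1 -> 0 < t -> is_derive (F r) t (Ft r t)) ->
  is_derive (fun q => ft q t) r (Ft r t).
Proof.
intros C Hr Ht DF Df DFt. apply is_derive_Reals. intros eps He.
pose proof (ccont_pt Ft r t C Hr Ht) as Cp.
apply filterlim_locally with (eps := mkposreal (eps / 2) ltac:(lra)) in Cp. destruct Cp as [d0 Q].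
set (d := Rmin (Rmin d0 t) (Rmin (r + 1) (1 - r))).
assert (Hd : 0 < d /\ d <= d0 /\ d <= t /\ d <= r + 1 /\ d <= 1 - r).
{ pose proof (cond_pos d0). unfold d, Rmin; repeat destruct Rle_dec; lra. }
exists (mkposreal d (proj1 Hd)). intros q Hq0 Hq. simpl in Hq.
assert (Hq' := Hq). apply Rabs_lt_between in Hq'.
assert (K : forall h, h <> 0 -> Rabs h < d ->
   Rabs ((f (r + q) (t + h) - f (r + q) t) / h - (f r (t + h) - f r t) / h - q * Ft r t) <= Rabs q * (eps / 2)).
{ intros h Hh0 Hh. assert (Hh' := Hh). apply Rabs_lt_between in Hh'.
  destruct (MVT_abs (fun x => (f x (t + h) - f x t) / h) (fun x => (F x (t + h) - F x t) / h) r (r + q)) as [c [Hc E]].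
  { intros x Hx. assert (-1 < x < 1) by (revert Hx; unfold Rmin, Rmax; destruct Rle_dec; lra).
    pose proof (DF x (t + h) ltac:(auto) ltac:(lra)) as D1. pose proof (DF x t ltac:(auto) Ht) as D2.
    auto_derive; [split; [eexists; exact D1|split; [eexists; exact D2|auto]]|]. der D1. der D2. field. auto. }
  assert (Hcr : -1 < c < 1) by (revert Hc; unfold Rmin, Rmax; destruct Rle_dec; lra).
  destruct (MVT_abs (F c) (Ft c) t (t + h)) as [s [Hs E2]].
  { intros x Hx. apply DFt; [lra|]. revert Hx; unfold Rmin, Rmax; destruct Rle_dec; lra. }
  cbv beta in E. rewrite E, E2.
  replace (Ft c s * (t + h - t) / h * (r + q - r) - q * Ft r t) with (q * (Ft c s - Ft r t)) by (field; auto).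
  rewrite Rabs_mult. apply Rmult_le_compat_l; [apply Rabs_pos|]. left.
  apply (Q (c, s)). split; [change (Rabs (c - r) < d0)|change (Rabs (s - t) < d0)]; apply Rabs_lt_between.
  - revert Hc; unfold Rmin, Rmax; destruct Rle_dec; lra.
  - revert Hs; unfold Rmin, Rmax; destruct Rle_dec; lra. }
assert (Lim : Rabs (ft (r + q) t - ft r t - q * Ft r t) <= Rabs q * (eps / 2)).
{ apply le_eps with (K := 2). intros e Hee.
  pose proof (Df (r + q) t ltac:(lra) Ht) as D1. pose proof (Df r t ltac:(lra) Ht) as D2.
  apply is_derive_Reals in D1. apply is_derive_Reals in D2.
  destruct (D1 e Hee) as [d1 Q1]. destruct (D2 e Hee) as [d2 Q2].
  set (h := Rmin (d / 2) (Rmin (d1 / 2) (d2 / 2))).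
  assert (Hh : 0 < h /\ h < d /\ h < d1 /\ h < d2).
  { pose proof (cond_pos d1). pose proof (cond_pos d2). unfold h, Rmin; repeat destruct Rle_dec; lra. }
  specialize (Q1 h ltac:(lra) ltac:(rewrite Rabs_pos_eq; lra)). specialize (Q2 h ltac:(lra) ltac:(rewrite Rabs_pos_eq; lra)).
  specialize (K h ltac:(lra) ltac:(rewrite Rabs_pos_eq; lra)).
  apply Rabs_lt_between in Q1. apply Rabs_lt_between in Q2. apply Rabs_le_between in K. apply Rabs_le_between. lra. }
replace ((ft (r + q) t - ft r t) / q - Ft r t) with ((ft (r + q) t - ft r t - q * Ft r t) / q) by (field; auto).
assert (0 < Rabs q) by (apply Rabs_pos_lt; auto).
unfold Rdiv at 1. rewrite Rabs_mult, Rabs_inv. apply Rmult_lt_reg_r with (Rabs q); auto.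
rewrite Rmult_assoc, Rinv_l, Rmult_1_r by lra. nra.
Qed.

Lemma Cls_time m f : (forall k, Cls m k f) -> exists ft,
  (forall r t, -1 <= r <= 1 -> 0 < t -> is_derive (f r) t (ft r t)) /\ forall k, Cls m k ft.
Proof.
intros H. pose proof (H 1%nat) as H1. rewrite Cls_eq in H1. destruct H1 as [_ [[ft [D _]] _]].
exists ft. split; auto. intros k. pose proof (H (S k)) as Hk. rewrite Cls_eq in Hk. destruct Hk as [_ [[ft' [D' H']] _]].
apply Cls_ext with ft'; auto. intros r t Hr Ht.
rewrite <- (is_derive_unique _ _ _ (D r t Hr Ht)). symmetry. apply is_derive_unique. apply D'; auto.
Qed.

(** Gains one derivative in r. The induction on k passes to time derivatives, for which [mixed_swap]
    supplies the derivative in r. *)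
Lemma Cls_raise m k : forall f F, (forall k, Cls m k f) -> (forall k, Cls m k F) ->
  (forall r t, -1 < r < 1 -> 0 < t -> is_derive (fun q => f q t) r (F r t)) -> Cls (S m) k f.
Proof.
induction k as [|k IH]; intros f F Hf HF D; rewrite Cls_eq; (split; [apply (Cls_cont _ _ _ (Hf O))|split]); auto.
- exists F. auto.
- destruct (Cls_time m f Hf) as [ft [Dt Ht]]. destruct (Cls_time m F HF) as [Ft [DFt HFt]].
  exists ft. split; auto. apply (IH ft Ft); auto. intros r t Hr Ht'.
  apply (mixed_swap f F ft Ft); auto. apply (Cls_cont _ _ _ (HFt O)).
- exists F. auto.
Qed.

Definition even_ext (u : R -> R -> R) r t := u (Rabs r) t.

(** Returning from t d/dt to d/dt accumulates powers of 1/t, which the statement carries so that the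
    induction closes. *)
Lemma Dk_Cls k j : forall f, Dk k f -> Cls 0 k (fun r t => f (Rabs r) t * (/ t) ^ j).
Proof.
revert j. induction k as [|k IH]; intros j f Df; rewrite Cls_eq; (split; [|split; [|exact I]]); auto.
1,2: pose proof (Dk_cont _ _ Df) as C; pose proof cl2_cont as C2; intros t1 Ht1 p; apply cR_mult; [ct|]; apply cR_pow;
  apply cR_inv; [ct|]; apply Rgt_not_eq; apply Rlt_le_trans with t1; [auto|apply Rmax_l].
pose proof (Dk_mono _ _ Df) as Mf. destruct Df as [C [z [Hz [Z D]]]].
exists (fun r t => (z (Rabs r) t + - INR j * f (Rabs r) t) * (/ t) ^ S j). split.
- intros r t Hr Ht. assert (Hr' : 0 <= Rabs r <= 1) by (split; [apply Rabs_pos|apply Rabs_le_between; lra]).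
  pose proof (D (Rabs r) t Hr' Ht) as D1.
  assert (D2 : is_derive (fun t => (/ t) ^ j) t (- INR j * (/ t) ^ S j)).
  { destruct j as [|j].
    - simpl. replace (- 0 * (/ t * 1)) with 0 by ring. apply (is_derive_const (V:=R_NormedModule) 1).
    - replace (- INR (S j) * (/ t) ^ S (S j)) with (INR (S j) * (- 1 / t ^ 2) * (/ t) ^ pred (S j)).
      + apply (is_derive_pow (fun t => / t)). auto_derive; [lra|]. field. lra.
      + simpl pred. replace ((/ t) ^ S (S j)) with (/ t * (/ t * (/ t) ^ j)) by reflexivity. field. lra. }
  replace ((z (Rabs r) t + - INR j * f (Rabs r) t) * (/ t) ^ S j) with
   (plus (mult (z (Rabs r) t / t) ((/ t) ^ j)) (mult (f (Rabs r) t) (- INR j * (/ t) ^ S j))).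
  + apply (is_derive_mult (f (Rabs r)) (fun t => (/ t) ^ j)); auto. intros; apply Rmult_comm.
  + unfold plus, mult; simpl. unfold Rdiv. ring.
- apply (IH (S j) (fun r t => z r t + - INR j * f r t)). apply Dk_plus; auto. apply Dk_mult; auto.
  apply (Dk_space k (fun _ => - INR j)). intros x; ct.
Qed.

(** If c were nonzero, the derivative would be of size |c|/r^3, and integrating over [r, 2r] would
    make u unbounded as r -> 0. *)
Lemma singular_constant (u ur : R -> R) c B : (forall r, 0 < r < 1 -> is_derive u r (ur r)) -> (forall r, 0 <= r <= 1 -> Rabs (u r) <= B) -> 0 < B ->
  (forall r, 0 < r < 1 -> Rabs (ur r - c / r ^ 3) <= B) -> c = 0.
Proof.
intros D Bu HB Bur. apply NNPP. intros Hc. assert (Pc : 0 < Rabs c) by (apply Rabs_pos_lt; auto).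
set (r := Rmin (1 / 4) (Rabs c / (32 * B))).
assert (Hr : 0 < r <= 1 / 4 /\ r <= Rabs c / (32 * B)).
{ assert (0 < Rabs c / (32 * B)) by (apply Rdiv_lt_0_compat; lra). unfold r, Rmin; destruct Rle_dec; lra. }
destruct (MVT_abs u ur r (2 * r)) as [x [Hx E]]; rewrite ?Rmin_left, ?Rmax_right in * by lra; [intros; apply D; lra|].
pose proof (Bu r ltac:(lra)) as B1. pose proof (Bu (2 * r) ltac:(lra)) as B2. pose proof (Bur x ltac:(lra)) as B3.
assert (Px : 0 < x ^ 3) by (apply pow_lt; lra).
assert (Hx3 : x ^ 3 <= 8 * r ^ 3) by (replace (8 * r ^ 3) with ((2 * r) ^ 3) by ring; apply pow_incr; lra).
assert (Rabs (c / x ^ 3) <= 3 * B / r).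
{ replace (c / x ^ 3) with ((u (2 * r) - u r) / r - (ur x - c / x ^ 3)) by (rewrite E; field; split; lra).
  assert (Rabs ((u (2 * r) - u r) / r) <= 2 * B / r).
  { unfold Rdiv. rewrite Rabs_mult, Rabs_inv, (Rabs_pos_eq r) by lra. apply Rmult_le_compat_r; [apply Rlt_le, Rinv_0_lt_compat; lra|].
    apply Rabs_le_between in B1. apply Rabs_le_between in B2. apply Rabs_le_between. lra. }
  assert (B <= B / r) by (apply Rmult_le_reg_r with r; [lra|]; unfold Rdiv; rewrite Rmult_assoc, Rinv_l by lra; nra).
  replace (3 * B / r) with (2 * B / r + B / r) by (field; lra).
  apply Rabs_le_between in H. apply Rabs_le_between in B3. apply Rabs_le_between. lra. }
assert (Rabs c / (8 * r ^ 3) <= Rabs (c / x ^ 3)).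
{ unfold Rdiv. rewrite Rabs_mult, Rabs_inv, (Rabs_pos_eq (x ^ 3)) by lra. apply Rmult_le_compat_l; [lra|]. apply Rinv_le_contravar; lra. }
assert (Rabs c <= 24 * B * r ^ 2).
{ apply Rmult_le_reg_r with (/ (8 * r ^ 3)); [apply Rinv_0_lt_compat; assert (0 < r ^ 3) by (apply pow_lt; lra); lra|].
  replace (24 * B * r ^ 2 * / (8 * r ^ 3)) with (3 * B / r) by (field; lra). unfold Rdiv in *. lra. }
assert (32 * B * r <= Rabs c).
{ apply Rle_trans with (32 * B * (Rabs c / (32 * B))); [apply Rmult_le_compat_l; lra|right; field; lra]. }
nra.
Qed.

Section Bootstrap.
Variables u ut ur urr : R -> R -> R.
Hypotheses (Dt : forall r t, 0 <= r <= 1 -> 0 < t -> is_derive (u r) t (ut r t))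
  (Dx : forall r t, 0 < r < 1 -> 0 < t -> is_derive (fun q => u q t) r (ur r t) /\ is_derive (fun q => ur q t) r (urr r t) /\
     ut r t = urr r t + (3 / r - r) * ur r t - u r t + Gn r (u r t))
  (Reg : forall k, Dk k u).
Let ue := even_ext u.

Lemma even_ext_Cls0 k : Cls 0 k ue.
Proof.
apply Cls_ext with (fun r t => u (Rabs r) t * (/ t) ^ 0); [intros; unfold ue, even_ext; simpl; ring|]. apply Dk_Cls, Reg.
Qed.

Section Flux.
Variable vt : R -> R -> R.
Hypotheses (Dvt : forall r t, -1 <= r <= 1 -> 0 < t -> is_derive (ue r) t (vt r t)) (Cvt : forall k, Cls 0 k vt).
(** Divergence form of the equation: (r^3 (u_r - r u))_r = r^3 (u_t - 3u - G). Its integral from the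
    axis, divided by r^3, is the formula [flx] for u_r, without singular coefficients. *)
Definition src r t := vt r t + (-3 * ue r t + -1 * Gn r (ue r t)).
Definition flx r t := r * ue r t + r * TT 3 src r t.

Lemma src_Cls m k : Cls m k ue -> Cls m k vt -> Cls m k src.
Proof.
intros Hu Hv. apply Cls_plus; auto. apply Cls_plus; (apply Cls_mult; [apply Cls_const|]); auto. apply Cls_Gn; auto.
Qed.

Lemma flx_Cls m k : Cls m k ue -> Cls m k vt -> Cls m k flx.
Proof.
intros Hu Hv. apply Cls_plus; apply Cls_mult; auto using Cls_r. apply Cls_TT, src_Cls; auto.
Qed.

Lemma vt_even r t : -1 <= r <= 1 -> 0 < t -> vt (- r) t = vt r t.
Proof.
intros Hr Ht. rewrite <- (is_derive_unique _ _ _ (Dvt r t Hr Ht)), <- (is_derive_unique _ _ _ (Dvt (- r) t ltac:(lra) Ht)).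
unfold ue, even_ext. rewrite Rabs_Ropp. auto.
Qed.

Lemma flx_odd r t : -1 <= r <= 1 -> 0 < t -> flx (- r) t = - flx r t.
Proof.
intros Hr Ht. assert (E1 : ue (- r) t = ue r t) by (unfold ue, even_ext; rewrite Rabs_Ropp; auto).
assert (E2 : TT 3 src (- r) t = TT 3 src r t).
{ unfold TT. apply RInt_ext. rewrite Rmin_left, Rmax_right by lra. intros s Hs. f_equal.
  replace (- r * s) with (- (r * s)) by ring. unfold src. rewrite vt_even by (auto; nra).
  assert (E3 : ue (- (r * s)) t = ue (r * s) t) by (unfold ue, even_ext; rewrite Rabs_Ropp; auto). rewrite E3.
  unfold Gn. replace ((- (r * s)) ^ 2) with ((r * s) ^ 2) by ring. auto. }
unfold flx. rewrite E1, E2. ring.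
Qed.

(** Integrating the divergence form leaves an unknown c/r^3; boundedness of u forces c = 0. *)
Lemma ur_flx r t : 0 < r < 1 -> 0 < t -> ur r t = flx r t.
Proof.
intros Hr Ht.
assert (Cs : ccont src) by (apply (Cls_cont 0 0), src_Cls; auto; apply even_ext_Cls0).
assert (Cflx : ccont flx) by (apply (Cls_cont 0 0), flx_Cls; auto; apply even_ext_Cls0).
set (w := fun s => s ^ 3 * src (cl2 s) t).
assert (Cw : cont1 w).
{ intros s. unfold w. apply cR_mult; [ct|]. apply (continuous_ext (fun s => src (cl2 s) (Rmax t t))); [intros; rewrite Rmax_left; auto; lra|].
  specialize (Cs t Ht). apply (cont2_at (fun r0 t0 => src (cl2 r0) (Rmax t t0)) (fun s => s) (fun _ => t) s Cs); ct. }
assert (EJ : forall q, 0 < q < 1 -> RInt w 0 q = q ^ 4 * TT 3 src q t).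
{ intros q Hq. rewrite RInt_scale by auto. unfold TT.
  pose proof (TT_ex 3 src q t Cs ltac:(lra) Ht) as I.
  replace (q ^ 4 * RInt (fun s => s ^ 3 * src (q * s) t) 0 1) with (q * (q ^ 3 * RInt (fun s => s ^ 3 * src (q * s) t) 0 1)) by ring.
  f_equal. rewrite (RInt_mul _ (q ^ 3) 0 1 I). apply RInt_ext. rewrite Rmin_left, Rmax_right by lra. intros s Hs.
  unfold w. rewrite cl2_id by nra. Rsimp. ring. }
assert (Evt : forall q, 0 < q < 1 -> vt q t = ut q t).
{ intros q Hq. rewrite <- (is_derive_unique _ _ _ (Dvt q t ltac:(lra) Ht)), <- (is_derive_unique _ _ _ (Dt q t ltac:(lra) Ht)).
  unfold ue, even_ext. rewrite Rabs_pos_eq by lra. auto. }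
assert (Eue : forall q, 0 < q < 1 -> ue q t = u q t) by (intros q Hq; unfold ue, even_ext; rewrite Rabs_pos_eq; auto; lra).
set (Ef := fun q => q ^ 3 * (ur q t - q * u q t) - RInt w 0 q).
assert (DE : forall q, 0 < q < 1 -> is_derive Ef q 0).
{ intros q Hq. destruct (Dx q t Hq Ht) as [D1 [D2 P]]. pose proof (RInt_derive w 0 q Cw) as D3.
  assert (D4 : is_derive (fun q => q ^ 3 * (ur q t - q * u q t)) q (q ^ 3 * src q t)).
  { auto_derive; [repeat split; eexists; eauto|]. der D1. der D2. unfold src. rewrite Evt, Eue, P by auto. field. lra. }
  assert (Z : q ^ 3 * src q t - w q = 0) by (unfold w; rewrite cl2_id by lra; ring). rewrite <- Z.
  apply (is_derive_minus (V:=R_NormedModule)); auto. }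
set (c := Ef (1 / 2)).
assert (Ec : forall q, 0 < q < 1 -> ur q t = flx q t + c / q ^ 3).
{ intros q Hq. destruct (MVT_abs Ef (fun _ => 0) (1/2) q) as [x [_ E]].
  - intros x Hx. apply DE. revert Hx. unfold Rmin, Rmax; destruct Rle_dec; lra.
  - assert (EE : Ef q = c) by (unfold c; lra). rewrite <- EE. unfold Ef. rewrite EJ by auto. unfold flx. rewrite Eue by auto. field. lra. }
assert (C0 : c = 0).
{ assert (Cu : cont2 u) by (apply (Dk_cont O), Reg).
  destruct (X0_bounded _ (cont2_sec_r u t Cu)) as [B1 [HB1 BB1]].
  assert (Cf : cont2 (fun r t0 => flx (cl2 r) (Rmax t t0))) by (apply Cflx; auto).
  destruct (X0_bounded _ (cont2_sec_r _ t Cf)) as [B2 [HB2 BB2]].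
  apply (singular_constant (fun q => u q t) (fun q => ur q t) c (B1 + B2)); try lra.
  - intros q Hq. apply Dx; auto.
  - intros q Hq. specialize (BB1 q Hq). cbv beta in BB1. lra.
  - intros q Hq. rewrite Ec by auto. replace (flx q t + c / q ^ 3 - c / q ^ 3) with (flx q t) by ring.
    specialize (BB2 q ltac:(lra)). cbv beta in BB2. rewrite cl2_id, Rmax_left in BB2 by lra. lra. }
rewrite Ec, C0 by auto. unfold Rdiv. ring.
Qed.

Lemma even_ext_dx r t : -1 < r < 1 -> 0 < t -> is_derive (fun q => ue q t) r (flx r t).
Proof.
intros Hr Ht.
assert (Pos : forall r, 0 < r < 1 -> is_derive (fun q => ue q t) r (flx r t)).
{ intros q Hq. rewrite <- ur_flx by auto. apply is_derive_ext_loc with (fun q => u q t); [|apply Dx; auto].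
  apply near_interior; auto. intros s Hs. unfold ue, even_ext. rewrite Rabs_pos_eq; auto; lra. }
assert (Neg : forall r, -1 < r < 0 -> is_derive (fun q => ue q t) r (flx r t)).
{ intros q Hq. apply is_derive_ext with (fun q => ue (- q) t); [intros; unfold ue, even_ext; rewrite Rabs_Ropp; auto|].
  replace (flx q t) with (flx (- q) t * -1) by (rewrite flx_odd by (auto; lra); ring).
  apply (is_derive_comp_R (fun q => ue q t) (fun q => - q)); [apply Pos; lra|]. auto_derive; auto. }
destruct (Rtotal_order r 0) as [H|[->|H]]; [apply Neg; lra| |apply Pos; lra].
assert (Cu : cont2 u) by (apply (Dk_cont O), Reg).
assert (Cflx : ccont flx) by (apply (Cls_cont 0 0), flx_Cls; auto; apply even_ext_Cls0).
apply (derive_glue (fun q => ue q t) (fun q => flx q t) 0 1); [lra| | |].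
- intros y Hy. unfold ue, even_ext. ct.
- intros y Hy Hy0. apply Rabs_lt_between in Hy. destruct (Rtotal_order y 0) as [H|[H|H]]; [apply Neg; lra|contradiction|apply Pos; lra].
- apply (continuous_comp_2 (fun q => q) (fun _ => t) flx); try ct. apply ccont_pt; auto.
Qed.
End Flux.

(** The formula for u_r contains u, u_t and an average, but no derivative in r. So m derivatives in
    r of u, at all orders in t, give as many of u_r. *)
Lemma even_ext_Cls m : forall k, Cls m k ue.
Proof.
induction m as [|m IH]; [apply even_ext_Cls0|]. intros k.
destruct (Cls_time m ue IH) as [vt [Dvt Cvt]].
assert (C0 : forall k, Cls 0 k vt) by (intros; apply (Cls_mono m k0); auto; lia).
apply (Cls_raise m k ue (flx vt)); auto.
- intros. apply flx_Cls; auto.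
- intros. apply even_ext_dx; auto.
Qed.
End Bootstrap.

(** * Seeley's extension *)

(* Coefficients of the entire function prod_(j>=0) (1 - z / 2^j), which vanishes at every z = 2^n. *)
Fixpoint ek (k : nat) : R := match k with O => 1 | S j => - 2 * ek j / (2 ^ S j - 1) end.

Lemma pow2_gt1 k : 2 <= 2 ^ S k.
Proof. simpl. assert (1 <= 2 ^ k) by (apply pow_R1_Rle; lra). lra. Qed.
Lemma pow2_pos k : 1 <= 2 ^ k.
Proof. apply pow_R1_Rle; lra. Qed.

Lemma ek_neq k : ek k <> 0.
Proof.
induction k as [|k IH]; simpl; [lra|]. pose proof (pow2_gt1 k) as P. simpl in P.
unfold Rdiv. apply Rmult_integral_contrapositive_currified; [apply Rmult_integral_contrapositive_currified; [lra|auto]|].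
apply Rinv_neq_0_compat. lra.
Qed.

Lemma ek_abs n : ex_series (fun k => Rabs (ek k * (2 ^ k) ^ n)).
Proof.
apply (ex_series_DAlembert (fun k => ek k * (2 ^ k) ^ n) 0); [lra| |].
- intros k. apply Rmult_integral_contrapositive_currified; [apply ek_neq|]. apply pow_nonzero, pow_nonzero. lra.
- assert (P2n : 0 < 2 ^ n) by (apply pow_lt; lra).
  apply (is_lim_seq_le_le (fun _ => 0) _ (fun k => 2 * 2 ^ n * (/ 2) ^ k)).
  + intros k. split; [apply Rabs_pos|].
    pose proof (pow2_gt1 k) as P. pose proof (pow2_pos k) as Pk. pose proof (ek_neq k) as Nk.
    replace (ek (S k) * (2 ^ S k) ^ n / (ek k * (2 ^ k) ^ n)) with (- (2 * 2 ^ n / (2 ^ S k - 1))).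
    * rewrite Rabs_Ropp, Rabs_pos_eq by (apply Rdiv_le_0_compat; lra). rewrite pow_inv.
      unfold Rdiv. apply Rmult_le_compat_l; [lra|]. apply Rinv_le_contravar; [lra|]. simpl in *. lra.
    * change (ek (S k)) with (- 2 * ek k / (2 ^ S k - 1)). replace (2 ^ S k) with (2 * 2 ^ k) in * by reflexivity. rewrite Rpow_mult_distr.
      field. repeat split; auto; try lra; apply pow_nonzero; lra.
  + apply is_lim_seq_const.
  + replace (Finite 0) with (Rbar_mult (2 * 2 ^ n) 0) by (simpl; f_equal; ring).
    apply (is_lim_seq_scal_l (fun k => (/ 2) ^ k) (2 * 2 ^ n) 0). apply is_lim_seq_geom. rewrite Rabs_pos_eq; lra.
Qed.

Lemma series_bound (b c : nat -> R) B : ex_series (fun k => Rabs (b k)) -> (forall k, Rabs (c k) <= B) ->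
  ex_series (fun k => b k * c k) /\ Rabs (Series (fun k => b k * c k)) <= B * Series (fun k => Rabs (b k)).
Proof.
intros Hb Hc.
assert (HB : ex_series (fun k => B * Rabs (b k))) by (apply (ex_series_scal (V:=R_NormedModule) B (fun k => Rabs (b k))); auto).
assert (Q : forall k, 0 <= Rabs (b k * c k) <= B * Rabs (b k)).
{ intros k. split; [apply Rabs_pos|]. rewrite Rabs_mult, Rmult_comm. apply Rmult_le_compat_r; auto. apply Rabs_pos. }
assert (A : ex_series (fun k => Rabs (b k * c k))).
{ apply (ex_series_le (K:=R_AbsRing) (V:=R_CompleteNormedModule) _ (fun k => B * Rabs (b k))); auto.
  intros k. change (Rabs (Rabs (b k * c k)) <= B * Rabs (b k)). rewrite Rabs_Rabsolu. apply Q. }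
split; [apply ex_series_Rabs; auto|].
eapply Rle_trans; [apply Series_Rabs; auto|]. rewrite <- Series_scal_l. apply Series_le; auto.
Qed.

Lemma ek_half : ex_series (fun k => ek k * (/ 2) ^ k).
Proof.
apply series_bound with 1.
- apply (ex_series_ext (fun k => Rabs (ek k * (2 ^ k) ^ 0))); [intros; simpl; rewrite Rmult_1_r; auto|apply ek_abs].
- intros k. rewrite Rabs_pos_eq by (apply pow_le; lra). rewrite <- (pow1 k). apply pow_incr. lra.
Qed.

Lemma ek_ex n : ex_series (fun k => ek k * (2 ^ k) ^ n).
Proof. apply ex_series_Rabs, ek_abs. Qed.

(** The product formula as a functional equation: F(2q) = (1 - 2q) F(q) for F(q) = sum of ek q^k. *)
Lemma ek_step q : ex_series (fun k => ek k * q ^ k) -> ex_series (fun k => ek k * (2 * q) ^ k) ->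
  Series (fun k => ek k * (2 * q) ^ k) = (1 - 2 * q) * Series (fun k => ek k * q ^ k).
Proof.
intros E1 E2.
assert (H : Series (fun k => ek k * (2 * q) ^ k) - Series (fun k => ek k * q ^ k) = - 2 * q * Series (fun k => ek k * q ^ k)).
{ rewrite <- Series_minus by auto. rewrite Series_incr_1 by (apply (ex_series_minus (V:=R_NormedModule)); auto).
  rewrite <- Series_scal_l. simpl. rewrite !Rmult_1_r, Rminus_diag, Rplus_0_l. apply Series_ext. intros k.
  rewrite Rpow_mult_distr. pose proof (pow2_gt1 k) as P. simpl in P. field. lra. }
lra.
Qed.

(** F(1) = 0 from the functional equation at q = 1/2, and doubling carries the zero from 2^n to
    2^(n+1). *)
Lemma ek_zero n : Series (fun k => ek k * (2 ^ k) ^ n) = 0.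
Proof.
assert (Q : forall n k, (2 ^ k) ^ n = (2 ^ n) ^ k) by (intros; rewrite <- !pow_mult; f_equal; lia).
induction n as [|n IH].
- transitivity (Series (fun k => ek k * (2 * / 2) ^ k)).
  + apply Series_ext. intros k. rewrite Rinv_r, pow1 by lra. simpl. auto.
  + rewrite ek_step; [replace (1 - 2 * / 2) with 0 by field; ring|apply ek_half|].
    apply (ex_series_ext (fun k => ek k * (2 ^ k) ^ 0)); [|apply ek_ex]. intros k. rewrite Rinv_r, pow1 by lra. simpl. auto.
- transitivity (Series (fun k => ek k * (2 * 2 ^ n) ^ k)).
  + apply Series_ext. intros k. rewrite Q. auto.
  + rewrite ek_step.
    * replace (Series (fun k => ek k * (2 ^ n) ^ k)) with 0; [ring|]. rewrite <- IH. apply Series_ext. intros; rewrite Q; auto.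
    * apply (ex_series_ext (fun k => ek k * (2 ^ k) ^ n)); [intros; rewrite Q; auto|apply ek_ex].
    * apply (ex_series_ext (fun k => ek k * (2 ^ k) ^ S n)); [intros; rewrite Q; auto|apply ek_ex].
Qed.

Lemma inv1p_bound k : 0 < / (1 + 2 ^ k) <= 1.
Proof.
pose proof (pow2_pos k). split; [apply Rinv_0_lt_compat; lra|]. rewrite <- Rinv_1. apply Rinv_le_contravar; lra.
Qed.

Lemma dk_abs n : ex_series (fun k => Rabs (ek k / (1 + 2 ^ k) * (2 ^ k) ^ n)).
Proof.
apply (ex_series_le (K:=R_AbsRing) (V:=R_CompleteNormedModule) _ (fun k => Rabs (ek k * (2 ^ k) ^ n))); [|apply ek_abs].
intros k. change (Rabs (Rabs (ek k / (1 + 2 ^ k) * (2 ^ k) ^ n)) <= Rabs (ek k * (2 ^ k) ^ n)). rewrite Rabs_Rabsolu.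
replace (ek k / (1 + 2 ^ k) * (2 ^ k) ^ n) with (ek k * (2 ^ k) ^ n * / (1 + 2 ^ k)) by (unfold Rdiv; ring).
rewrite Rabs_mult. pose proof (inv1p_bound k). rewrite (Rabs_pos_eq (/ _)) by lra.
pose proof (Rabs_pos (ek k * (2 ^ k) ^ n)). nra.
Qed.

Definition D1 := Series (fun k => ek k / (1 + 2 ^ k)).

(** A numerical check: the first four terms sum to at least 0.05, and from the fifth on the terms at
    least halve in size, so the tail is at most 0.02. *)
Lemma D1_pos : D1 <> 0.
Proof.
set (c := fun k => ek k / (1 + 2 ^ k)).
assert (Ea : ex_series (fun k => Rabs (c k))).
{ apply (ex_series_ext (fun k => Rabs (ek k / (1 + 2 ^ k) * (2 ^ k) ^ 0))); [intros; simpl; rewrite Rmult_1_r; auto|apply dk_abs]. }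
assert (Tail : forall j, Rabs (c (4 + j)%nat) <= Rabs (c 4%nat) * (/ 2) ^ j).
{ induction j as [|j IH]; [simpl; lra|].
  replace (4 + S j)%nat with (S (4 + j)) by lia. set (k := (4 + j)%nat) in *.
  assert (Pk : 16 <= 2 ^ k) by (unfold k; rewrite pow_add; pose proof (pow2_pos j); simpl; lra).
  assert (E : c (S k) = c k * (- (2 * (1 + 2 ^ k) / ((2 * 2 ^ k - 1) * (1 + 2 * 2 ^ k))))) .
  { clearbody k. change (c (S k)) with (- 2 * ek k / (2 * 2 ^ k - 1) / (1 + 2 * 2 ^ k)). unfold c. field. repeat split; lra. }
  assert (Pq : 0 < (2 * 2 ^ k - 1) * (1 + 2 * 2 ^ k)) by (apply Rmult_lt_0_compat; lra).
  rewrite E, Rabs_mult, Rabs_Ropp, (Rabs_pos_eq (_ / _)) by (apply Rdiv_le_0_compat; lra).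
  assert (2 * (1 + 2 ^ k) / ((2 * 2 ^ k - 1) * (1 + 2 * 2 ^ k)) <= / 2).
  { apply Rmult_le_reg_r with ((2 * 2 ^ k - 1) * (1 + 2 * 2 ^ k)); auto. unfold Rdiv. rewrite Rmult_assoc, Rinv_l by lra. nra. }
  simpl. pose proof (Rabs_pos (c k)). assert (0 <= (/ 2) ^ j) by (apply pow_le; lra).
  apply Rle_trans with (Rabs (c k) * / 2); [apply Rmult_le_compat_l; auto|]. lra. }
assert (Sum : D1 = sum_f_R0 c 3 + Series (fun j => c (4 + j)%nat)).
{ unfold D1. fold c. rewrite (Series_incr_n c 4); [auto|lia|apply ex_series_Rabs; auto]. }
assert (T : Rabs (Series (fun j => c (4 + j)%nat)) <= Rabs (c 4%nat) * 2).
{ assert (Eg : ex_series (fun j => Rabs (c 4%nat) * (/ 2) ^ j)).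
  { apply (ex_series_scal (V:=R_NormedModule) (Rabs (c 4%nat)) (fun j => (/ 2) ^ j)). apply ex_series_geom. rewrite Rabs_pos_eq; lra. }
  assert (Et : ex_series (fun j => Rabs (c (4 + j)%nat))) by (apply (ex_series_incr_n (fun k => Rabs (c k)) 4); auto).
  eapply Rle_trans; [apply Series_Rabs; auto|].
  eapply Rle_trans; [apply (Series_le _ (fun j => Rabs (c 4%nat) * (/ 2) ^ j)); auto; intros; split; [apply Rabs_pos|apply Tail]|].
  rewrite Series_scal_l, Series_geom by (rewrite Rabs_pos_eq; lra). right. field. }
assert (C4 : Rabs (c 4%nat) <= 1 / 100) by (unfold c; simpl; rewrite Rabs_pos_eq; lra).
assert (S3 : 5 / 100 <= sum_f_R0 c 3) by (unfold c; simpl; lra).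
apply Rabs_le_between in T. lra.
Qed.

Definition sk k := ek k / (1 + 2 ^ k) / D1.

Lemma sk_abs n : ex_series (fun k => Rabs (sk k * (- 2 ^ k) ^ n)).
Proof.
apply (ex_series_ext (fun k => Rabs (/ D1) * Rabs (ek k / (1 + 2 ^ k) * (2 ^ k) ^ n))).
- intros k. rewrite <- Rabs_mult. unfold sk.
  replace (- 2 ^ k) with (-1 * 2 ^ k) by ring. rewrite Rpow_mult_distr.
  rewrite !Rabs_mult, pow_1_abs. unfold Rdiv. rewrite !Rabs_mult. Rsimp. ring.
- apply (ex_series_scal (V:=R_NormedModule) (Rabs (/ D1)) (fun k => Rabs (ek k / (1 + 2 ^ k) * (2 ^ k) ^ n))), dk_abs.
Qed.

(** Moments n and n+1 differ by the sum of sk (-2^k)^n (1 + 2^k). The last factor cancels the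
    denominator of [sk] and leaves a multiple of F(2^n) = 0. The zeroth moment is 1 by
    normalization. *)
Lemma sk_sum n : Series (fun k => sk k * (- 2 ^ k) ^ n) = 1.
Proof.
induction n as [|n IH].
- transitivity (/ D1 * D1); [|field; apply D1_pos]. unfold D1 at 2. rewrite <- Series_scal_l. apply Series_ext. intros k. unfold sk. simpl. unfold Rdiv. ring.
- assert (E : Series (fun k => sk k * (- 2 ^ k) ^ n) - Series (fun k => sk k * (- 2 ^ k) ^ S n) = 0); [|lra].
  rewrite <- Series_minus by apply ex_series_Rabs, sk_abs.
  transitivity (((-1) ^ n / D1) * Series (fun k => ek k * (2 ^ k) ^ n)); [|rewrite ek_zero; ring].
  rewrite <- Series_scal_l. apply Series_ext. intros k. unfold sk.
  replace ((- 2 ^ k) ^ n) with ((-1) ^ n * (2 ^ k) ^ n) by (rewrite <- Rpow_mult_distr; f_equal; ring).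
  simpl. replace ((- 2 ^ k) ^ n) with ((-1) ^ n * (2 ^ k) ^ n) by (rewrite <- Rpow_mult_distr; f_equal; ring).
  field. split; [apply D1_pos|]. pose proof (pow2_pos k). lra.
Qed.

Definition Cinf f := forall m k, Cls m k f.

Lemma Cinf_dt f : Cinf f -> exists ft, (forall r t, -1 <= r <= 1 -> 0 < t -> is_derive (f r) t (ft r t)) /\ Cinf ft.
Proof.
intros H. destruct (Cls_time 0 f (fun k => H O k)) as [ft [D Ht]]. exists ft. split; auto. intros m k.
destruct (Cls_time m f (H m)) as [ft' [D' Ht']]. apply Cls_ext with ft'; auto. intros r t Hr Htt.
rewrite <- (is_derive_unique _ _ _ (D r t Hr Htt)). symmetry. apply is_derive_unique. apply D'; auto.
Qed.

(** Derivatives in r are pinned down only inside, so two witnesses are identified up to the boundary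
    by continuity. *)
Lemma ccont_boundary f g t : ccont f -> ccont g -> 0 < t -> (forall r, -1 < r < 1 -> f r t = g r t) -> forall r, -1 <= r <= 1 -> f r t = g r t.
Proof.
intros Cf Cg Ht E r Hr.
set (h := fun q => f (cl2 q) (Rmax t t) - g (cl2 q) (Rmax t t)).
assert (Ch : cont1 h).
{ pose proof (cont2_sec_r _ t (Cf t Ht)) as C1. pose proof (cont2_sec_r _ t (Cg t Ht)) as C2.
  intros x. exact (cR_minus _ _ x (C1 x) (C2 x)). }
assert (Z : h r = 0).
{ apply Rabs_eq_0, Rle_antisym; [|apply Rabs_pos]. apply Rnot_lt_le. intros N.
  destruct (proj1 (continuous_eps h r) (Ch r) _ N) as [d [Hd Q]].
  set (s := Rmin (d / 2) (1 / 2)). assert (Hs : 0 < s <= 1/2 /\ s < d) by (unfold s, Rmin; destruct Rle_dec; lra).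
  set (q := r * (1 - s)).
  assert (Hq : -1 < q < 1) by (unfold q; nra).
  assert (Hqr : Rabs (q - r) < d).
  { unfold q. replace (r * (1 - s) - r) with (- (r * s)) by ring. rewrite Rabs_Ropp, Rabs_mult, (Rabs_pos_eq s) by lra.
    assert (Rabs r <= 1) by (apply Rabs_le_between; lra). pose proof (Rabs_pos r). nra. }
  specialize (Q q Hqr). unfold h in Q at 1. rewrite cl2_id, Rmax_left, E in Q by lra.
  revert Q N. replace (g q t - g q t - h r) with (- h r) by ring. rewrite Rabs_Ropp. lra. }
unfold h in Z. rewrite cl2_id, Rmax_left in Z by lra. lra.
Qed.

Lemma Cinf_dr f : Cinf f -> exists fr, (forall r t, -1 < r < 1 -> 0 < t -> is_derive (fun q => f q t) r (fr r t)) /\ Cinf fr.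
Proof.
intros H. pose proof (H 1%nat O) as H1. rewrite Cls_eq in H1. destruct H1 as [_ [_ [fr [D Hr]]]].
exists fr. split; auto. intros m k. pose proof (H (S m) k) as Hk. rewrite Cls_eq in Hk. destruct Hk as [_ [_ [fr' [D' H']]]].
apply Cls_ext with fr'; auto. intros r t Hr' Ht.
apply (ccont_boundary fr' fr t); auto; [apply (Cls_cont _ _ _ H')|apply (Cls_cont _ _ _ Hr)|].
intros q Hq. rewrite <- (is_derive_unique _ _ _ (D q t Hq Ht)). symmetry. apply is_derive_unique. apply D'; auto.
Qed.

Lemma Cinf_bound f t1 t2 : Cinf f -> 0 < t1 -> exists B, 0 < B /\ forall r t, -1 <= r <= 1 -> t1 <= t <= t2 -> Rabs (f r t) <= B.
Proof.
intros H Ht1. destruct (cont2_bounded _ (-1) 1 t1 t2 (Cls_cont _ _ _ (H O O) t1 Ht1)) as [B [HB BB]].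
exists B. split; auto. intros r t Hr Ht. specialize (BB r t Hr Ht). cbv beta in BB. rewrite cl2_id, Rmax_right in BB by lra. auto.
Qed.

Lemma quad_derive (F : R -> R) x l C d : 0 < d -> (forall h, Rabs h < d -> Rabs (F (x + h) - F x - h * l) <= C * h ^ 2) -> is_derive F x l.
Proof.
intros Hd H. apply is_derive_Reals. intros eps He.
set (C' := Rabs C + 1). assert (HC : 0 < C') by (unfold C'; pose proof (Rabs_pos C); lra).
exists (mkposreal (Rmin d (eps / C')) ltac:(assert (0 < eps / C') by (apply Rdiv_lt_0_compat; lra); unfold Rmin; destruct Rle_dec; lra)).
intros h Hh0 Hh. simpl in Hh. assert (Hh' : Rabs h < d /\ Rabs h < eps / C') by (revert Hh; unfold Rmin; destruct Rle_dec; lra).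
replace ((F (x + h) - F x) / h - l) with ((F (x + h) - F x - h * l) / h) by (field; auto).
assert (Ph : 0 < Rabs h) by (apply Rabs_pos_lt; auto).
unfold Rdiv at 1. rewrite Rabs_mult, Rabs_inv. apply Rmult_lt_reg_r with (Rabs h); auto.
rewrite Rmult_assoc, Rinv_l, Rmult_1_r by lra. eapply Rle_lt_trans; [apply H; tauto|].
rewrite <- (pow2_abs h). apply Rle_lt_trans with (C' * Rabs h * Rabs h).
- replace (C * Rabs h ^ 2) with (C * (Rabs h * Rabs h)) by ring. rewrite Rmult_assoc. apply Rmult_le_compat_r; [nra|].
  unfold C'. pose proof (Rle_abs C). lra.
- apply Rmult_lt_compat_r; auto. apply Rlt_le_trans with (C' * (eps / C')); [apply Rmult_lt_compat_l; tauto|right; field; lra].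
Qed.

(* Seeley's extension in the coordinate [r = 1/(1+y)], in which (0,1] becomes the half-line [y >= 0]. *)
Definition GE n (f : R -> R -> R) y t :=
  if Rle_dec 0 y then f (/ (1 + y)) t else Series (fun k => sk k * (- 2 ^ k) ^ n * f (/ (1 + 2 ^ k * - y)) t).
Definition SA n := Series (fun k => Rabs (sk k * (- 2 ^ k) ^ n)).

Lemma SA_pos n : 0 <= SA n.
Proof.
unfold SA. rewrite <- (Rmult_0_l (Series (fun _ => 0))), <- Series_scal_l.
apply Series_le; [intros; split; [lra|rewrite Rmult_0_l; apply Rabs_pos]|apply sk_abs].
Qed.

Lemma rho_in x : 0 <= x -> 0 < / (1 + x) <= 1.
Proof. intros Hx. split; [apply Rinv_0_lt_compat; lra|]. rewrite <- Rinv_1. apply Rinv_le_contravar; lra. Qed.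

Lemma scaled_pos k y : y < 0 -> 0 < 2 ^ k * - y.
Proof. intros Hy. apply Rmult_lt_0_compat; [apply pow_lt|]; lra. Qed.

(** The derivative in the half-line coordinate x, with 1/(1+x) = r, as a function of r; explicitly
    -r^2 f_r. *)
Definition dlx (f df : R -> R -> R) := forall x t, 0 < x -> 0 < t -> is_derive (fun x => f (/ (1 + x)) t) x (df (/ (1 + x)) t).

Lemma Cinf_dlx f : Cinf f -> exists df, Cinf df /\ dlx f df.
Proof.
intros H. destruct (Cinf_dr f H) as [fr [D Hr]]. exists (fun r t => -1 * (r ^ 2 * fr r t)). split.
- intros m k. apply Cls_mult; [apply Cls_const|]. apply Cls_mult; [apply Cls_pow, Cls_r|apply Hr].
- intros x t Hx Ht. pose proof (rho_in x ltac:(lra)) as Hrho.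
  assert (Hrho1 : / (1 + x) < 1) by (rewrite <- Rinv_1; apply Rinv_lt_contravar; lra).
  replace (-1 * ((/ (1 + x)) ^ 2 * fr (/ (1 + x)) t)) with (fr (/ (1 + x)) t * (- / (1 + x) ^ 2)) by (field; lra).
  apply (is_derive_comp_R (fun q => f q t) (fun x => / (1 + x))); [apply D; auto; lra|].
  auto_derive; [lra|field; lra].
Qed.

Lemma phi_cont f x t : Cinf f -> 0 <= x -> 0 < t -> continuous (fun x => f (cl2 (/ (1 + x))) t) x.
Proof.
intros H Hx Ht. pose proof (Cls_cont _ _ _ (H O O) t Ht) as C.
assert (Et : Rmax t t = t) by (apply Rmax_left; lra).
apply (continuous_ext (fun x => f (cl2 (/ (1 + x))) (Rmax t t))); [intros z; rewrite Et; reflexivity|].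
apply (cont2_at (fun r0 t0 => f (cl2 r0) (Rmax t t0)) (fun x => / (1 + x)) (fun _ => t) x C); [|ct].
assert (Hx1 : 1 + x <> 0) by lra. apply (cR_inv (fun x : R => 1 + x)); [ct|exact Hx1].
Qed.

Lemma phi_lip f df B x t : Cinf f -> dlx f df -> 0 <= x -> 0 < t -> (forall r, -1 <= r <= 1 -> Rabs (df r t) <= B) ->
  Rabs (f (/ (1 + x)) t - f 1 t) <= B * x.
Proof.
intros H D Hx Ht HB.
assert (E0 : forall x, 0 <= x -> f (cl2 (/ (1 + x))) t = f (/ (1 + x)) t).
{ intros z Hz. pose proof (rho_in z Hz). rewrite cl2_id; auto; lra. }
destruct (MVT_gen (fun x => f (cl2 (/ (1 + x))) t) 0 x (fun x => df (/ (1 + x)) t)) as [c [Hc E]]; rewrite ?Rmin_left, ?Rmax_right in * by lra.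
- intros z Hz. apply is_derive_ext_loc with (fun x => f (/ (1 + x)) t); [|apply D; lra].
  apply near_pos; [lra|]. intros s Hs. symmetry. apply E0. lra.
- intros z Hz. apply continuity_pt_filterlim, phi_cont; auto; lra.
- rewrite !E0 in E by lra. replace (/ (1 + 0)) with 1 in E by field. rewrite E, Rminus_0_r, Rabs_mult, (Rabs_pos_eq x) by auto.
  apply Rmult_le_compat_r; auto. apply HB. pose proof (rho_in c ltac:(lra)). lra.
Qed.

(** Sums termwise Taylor remainders: each term is allowed a multiple of |s k|, and the
    differentiated series comes out with a quadratic error. *)
Lemma series_comb (p q r s : nat -> R) h Q : ex_series p -> ex_series q -> ex_series r -> ex_series (fun k => Rabs (s k)) ->
  (forall k, Rabs (p k - q k - h * r k) <= Q * Rabs (s k)) ->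
  Rabs (Series p - Series q - h * Series r) <= Q * Series (fun k => Rabs (s k)).
Proof.
intros Ep Eq Er Es HQ.
assert (Ehr : ex_series (fun k => h * r k)) by (apply (ex_series_scal (V:=R_NormedModule) h r); auto).
assert (Epq : ex_series (fun k => p k - q k)) by (apply (ex_series_minus (V:=R_NormedModule)); auto).
assert (EQ : ex_series (fun k => Q * Rabs (s k))) by (apply (ex_series_scal (V:=R_NormedModule) Q (fun k => Rabs (s k))); auto).
rewrite <- Series_scal_l, <- Series_minus, <- Series_minus by auto.
rewrite <- Series_scal_l.
assert (Ea : ex_series (fun k => Rabs (p k - q k - h * r k))).
{ apply (ex_series_le (K:=R_AbsRing) (V:=R_CompleteNormedModule) _ (fun k => Q * Rabs (s k))); auto.
  intros k. change (Rabs (Rabs (p k - q k - h * r k)) <= Q * Rabs (s k)). rewrite Rabs_Rabsolu. apply HQ. }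
eapply Rle_trans; [apply Series_Rabs; auto|]. apply Series_le; auto. intros; split; [apply Rabs_pos|apply HQ].
Qed.

Lemma GE_ex n f y t : Cinf f -> y < 0 -> 0 < t -> ex_series (fun k => sk k * (- 2 ^ k) ^ n * f (/ (1 + 2 ^ k * - y)) t).
Proof.
intros H Hy Ht. destruct (Cinf_bound f t t H Ht) as [B [HB BB]].
apply (series_bound (fun k => sk k * (- 2 ^ k) ^ n) (fun k => f (/ (1 + 2 ^ k * - y)) t) B); [apply sk_abs|].
intros k. apply BB; [|lra]. pose proof (rho_in (2 ^ k * - y)). pose proof (scaled_pos k y Hy). lra.
Qed.

Lemma GE_bound n f y t B : Cinf f -> 0 <= B -> 0 < t -> (forall r, -1 <= r <= 1 -> Rabs (f r t) <= B) -> Rabs (GE n f y t) <= B * (1 + SA n).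
Proof.
intros H HB Ht BB. pose proof (SA_pos n). unfold GE. destruct (Rle_dec 0 y) as [Hy|Hy].
- pose proof (rho_in y Hy). specialize (BB (/ (1 + y)) ltac:(lra)). nra.
- destruct (series_bound (fun k => sk k * (- 2 ^ k) ^ n) (fun k => f (/ (1 + 2 ^ k * - y)) t) B) as [_ Q]; [apply sk_abs| |fold (SA n) in Q; nra].
  intros k. apply BB. pose proof (scaled_pos k y ltac:(lra)). pose proof (rho_in (2 ^ k * - y)). lra.
Qed.

Lemma GE_dt n f ft y t : Cinf f -> Cinf ft -> (forall r t, -1 <= r <= 1 -> 0 < t -> is_derive (f r) t (ft r t)) -> 0 < t ->
  is_derive (GE n f y) t (GE n ft y t).
Proof.
intros Hf Hft D Ht. destruct (Cinf_dt ft Hft) as [ftt [D2 Htt]].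
destruct (Cinf_bound ftt (t / 2) (2 * t) Htt ltac:(lra)) as [B [HB BB]].
unfold GE. destruct (Rle_dec 0 y) as [Hy|Hy].
- pose proof (rho_in y Hy). apply D; auto; lra.
- apply (quad_derive _ _ _ (B * SA n) (t / 2)); [lra|]. intros h Hh. apply Rabs_lt_between in Hh.
  replace (B * SA n * h ^ 2) with (B * h ^ 2 * SA n) by ring.
  apply (series_comb _ _ _ (fun k => sk k * (- 2 ^ k) ^ n)); try (apply GE_ex; auto; lra); [apply sk_abs|].
  intros k. set (b := sk k * (- 2 ^ k) ^ n).
  pose proof (scaled_pos k y ltac:(lra)) as Sp. pose proof (rho_in (2 ^ k * - y) ltac:(lra)) as Hr. set (r := / (1 + 2 ^ k * - y)) in *.
  replace (b * f r (t + h) - b * f r t - h * (b * ft r t)) with (b * (f r (t + h) - f r t - (t + h - t) * ft r t)) by ring.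
  rewrite Rabs_mult, Rmult_comm. apply Rmult_le_compat_r; [apply Rabs_pos|].
  replace (B * h ^ 2) with (B * (t + h - t) ^ 2) by ring.
  apply (taylor2 (f r) (ft r) (ftt r)). intros x Hx.
  assert (t / 2 <= x <= 2 * t) by (revert Hx; unfold Rmin, Rmax; destruct Rle_dec; lra).
  split; [apply D; lra|]. split; [apply D2; lra|]. apply BB; lra.
Qed.

Lemma GE_dy_neq n f df y t : Cinf f -> Cinf df -> dlx f df -> 0 < t -> y <> 0 ->
  is_derive (fun y => GE n f y t) y (GE (S n) df y t).
Proof.
intros Hf Hdf D Ht Hy. destruct (Rlt_le_dec 0 y) as [Hp|Hn].
- unfold GE at 2. destruct (Rle_dec 0 y); [|lra]. apply is_derive_ext_loc with (fun y => f (/ (1 + y)) t); [|apply D; auto].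
  apply near_pos; auto. intros s Hs. unfold GE. destruct (Rle_dec 0 s); auto; lra.
- assert (Hy0 : y < 0) by lra. destruct (Cinf_dlx df Hdf) as [ddf [Hddf D2]].
  destruct (Cinf_bound ddf t t Hddf Ht) as [B [HB BB]].
  apply (quad_derive _ _ _ (B * SA (S (S n))) (- y)); [lra|]. intros h Hh. apply Rabs_lt_between in Hh.
  unfold GE. destruct (Rle_dec 0 (y + h)); [lra|]. destruct (Rle_dec 0 y); [lra|].
  replace (B * SA (S (S n)) * h ^ 2) with (B * h ^ 2 * SA (S (S n))) by ring.
  apply (series_comb _ _ _ (fun k => sk k * (- 2 ^ k) ^ S (S n))); try (apply GE_ex; auto; lra); [apply sk_abs|].
  intros k. set (b := sk k * (- 2 ^ k) ^ n).
  pose proof (scaled_pos k y ltac:(lra)) as Sp. pose proof (scaled_pos k (y + h) ltac:(lra)) as Sp'.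
  set (x := 2 ^ k * - y) in *. set (x' := 2 ^ k * - (y + h)) in *.
  assert (Ex : x' - x = - 2 ^ k * h) by (unfold x, x'; ring).
  replace (sk k * (- 2 ^ k) ^ S n) with (b * - 2 ^ k) by (unfold b; simpl; ring).
  replace (sk k * (- 2 ^ k) ^ S (S n)) with (b * (- 2 ^ k) ^ 2) by (unfold b; simpl; ring).
  replace (b * f (/ (1 + x')) t - b * f (/ (1 + x)) t - h * (b * - 2 ^ k * df (/ (1 + x)) t)) with
   (b * (f (/ (1 + x')) t - f (/ (1 + x)) t - (x' - x) * df (/ (1 + x)) t)) by (rewrite Ex; ring).
  rewrite !Rabs_mult. replace (B * h ^ 2 * (Rabs b * Rabs ((- 2 ^ k) ^ 2))) with (Rabs b * (B * (x' - x) ^ 2)).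
  + apply Rmult_le_compat_l; [apply Rabs_pos|].
    apply (taylor2 (fun x => f (/ (1 + x)) t) (fun x => df (/ (1 + x)) t) (fun x => ddf (/ (1 + x)) t)).
    intros z Hz. assert (Pz : 0 < z) by (revert Hz; unfold Rmin; destruct Rle_dec; lra).
    split; [apply D; auto|]. split; [apply D2; auto|]. apply BB; [|lra]. pose proof (rho_in z). lra.
  + rewrite (Rabs_pos_eq ((- 2 ^ k) ^ 2)) by apply pow2_ge_0. rewrite Ex. ring.
Qed.

(** The two sides match at y = 0 because the weights sk (-2^k)^n sum to 1. For y < 0 the k-th term
    differs from its value at 0 by at most a multiple of 2^k |y|, and the weights still sum with
    that extra 2^k. *)
Lemma GE_cont_y n f y t : Cinf f -> 0 < t -> continuous (fun y => GE n f y t) y.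
Proof.
intros Hf Ht. destruct (Cinf_dlx f Hf) as [df [Hdf D]].
destruct (Req_dec y 0) as [->|Hy].
2:{ apply (ex_derive_continuous (V:=R_NormedModule)). eexists. apply GE_dy_neq; eauto. }
destruct (Cinf_bound df t t Hdf Ht) as [B [HB BB]].
assert (BB' : forall r, -1 <= r <= 1 -> Rabs (df r t) <= B) by (intros; apply BB; auto; lra).
set (K := B * (1 + SA (S n))). pose proof (SA_pos (S n)).
assert (HK : 0 < K) by (unfold K; nra).
assert (L : forall z, Rabs (GE n f z t - GE n f 0 t) <= K * Rabs z).
{ intros z. unfold GE at 2. destruct (Rle_dec 0 0); [|lra]. replace (/ (1 + 0)) with 1 by field.
  unfold GE. destruct (Rle_dec 0 z) as [Hz|Hz].
  - rewrite (Rabs_pos_eq z) by auto. eapply Rle_trans; [apply (phi_lip f df B); auto|]. apply Rmult_le_compat_r; auto. unfold K. nra.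
  - assert (Hz0 : z < 0) by lra. rewrite (Rabs_left z) by auto.
    assert (E1 : f 1 t = Series (fun k => sk k * (- 2 ^ k) ^ n * f 1 t)) by (rewrite Series_scal_r, sk_sum; ring).
    assert (X1 : ex_series (fun k => sk k * (- 2 ^ k) ^ n * f 1 t)).
    { destruct (Cinf_bound f t t Hf Ht) as [B0 [_ BB0]].
      apply (series_bound (fun k => sk k * (- 2 ^ k) ^ n) (fun k => f 1 t) B0); [apply sk_abs|]. intros; apply BB0; lra. }
    rewrite E1 at 1.
    pose proof (series_comb (fun k => sk k * (- 2 ^ k) ^ n * f (/ (1 + 2 ^ k * - z)) t) (fun k => sk k * (- 2 ^ k) ^ n * f 1 t)
      (fun k => sk k * (- 2 ^ k) ^ n * f 1 t) (fun k => sk k * (- 2 ^ k) ^ S n) 0 (B * - z) (GE_ex n f z t Hf Hz0 Ht) X1 X1 (sk_abs (S n))) as Q.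
    rewrite Rmult_0_l, Rminus_0_r in Q. eapply Rle_trans; [apply Q|].
    + intros k. rewrite Rmult_0_l, Rminus_0_r. pose proof (scaled_pos k z Hz0) as Sp.
      replace (sk k * (- 2 ^ k) ^ n * f (/ (1 + 2 ^ k * - z)) t - sk k * (- 2 ^ k) ^ n * f 1 t) with
        (sk k * (- 2 ^ k) ^ n * (f (/ (1 + 2 ^ k * - z)) t - f 1 t)) by ring.
      replace (sk k * (- 2 ^ k) ^ S n) with (sk k * (- 2 ^ k) ^ n * - 2 ^ k) by (simpl; ring).
      rewrite Rabs_mult, (Rabs_mult _ (- 2 ^ k)), Rabs_Ropp, (Rabs_pos_eq (2 ^ k)) by (apply pow_le; lra).
      replace (B * - z * (Rabs (sk k * (- 2 ^ k) ^ n) * 2 ^ k)) with (Rabs (sk k * (- 2 ^ k) ^ n) * (B * (2 ^ k * - z))) by ring.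
      apply Rmult_le_compat_l; [apply Rabs_pos|]. apply (phi_lip f df B); auto; lra.
    + fold (SA (S n)). unfold K. nra. }
apply continuous_eps. intros eps He. exists (eps / K). split; [apply Rdiv_lt_0_compat; auto|].
intros z Hz. rewrite Rminus_0_r in Hz. eapply Rle_lt_trans; [apply L|].
apply Rlt_le_trans with (K * (eps / K)); [apply Rmult_lt_compat_l; auto|right; field; lra].
Qed.

(** Each derivative multiplies the k-th term by -2^k, so all derivatives stay in the family [GE] and
    match at y = 0 by the same moment identities. *)
Lemma GE_dy n f df y t : Cinf f -> Cinf df -> dlx f df -> 0 < t -> is_derive (fun y => GE n f y t) y (GE (S n) df y t).
Proof.
intros Hf Hdf D Ht. destruct (Req_dec y 0) as [->|Hy]; [|apply GE_dy_neq; auto].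
apply (derive_glue (fun y => GE n f y t) (fun y => GE (S n) df y t) 0 1); [lra| | |].
- intros; apply GE_cont_y; auto.
- intros; apply GE_dy_neq; auto.
- apply GE_cont_y; auto.
Qed.

Lemma GE_cont n f y t : Cinf f -> 0 < t -> continuous (fun p : R * R => GE n f (fst p) (snd p)) (y, t).
Proof.
intros Hf Ht. destruct (Cinf_dt f Hf) as [ft [D Hft]].
destruct (Cinf_bound ft (t / 2) (2 * t) Hft ltac:(lra)) as [B [HB BB]].
set (K := B * (1 + SA n)). pose proof (SA_pos n). assert (HK : 0 < K) by (unfold K; nra).
apply filterlim_locally. intros eps.
destruct (proj1 (continuous_eps _ _) (GE_cont_y n f y t Hf Ht) (eps / 2)) as [d1 [Hd1 Q1]]; [pose proof (cond_pos eps); lra|].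
set (d := Rmin d1 (Rmin (t / 2) (eps / (2 * K)))).
assert (Hd : 0 < d /\ d <= d1 /\ d <= t / 2 /\ d <= eps / (2 * K)).
{ assert (0 < eps / (2 * K)) by (apply Rdiv_lt_0_compat; [apply eps|lra]). unfold d, Rmin; repeat destruct Rle_dec; lra. }
exists (mkposreal d (proj1 Hd)). intros [y' t'] [A1 A2]. simpl in A1, A2.
change (Rabs (y' - y) < d) in A1. change (Rabs (t' - t) < d) in A2.
change (Rabs (GE n f y' t' - GE n f y t) < eps).
specialize (Q1 y' ltac:(lra)). assert (A2' := A2). apply Rabs_lt_between in A2'.
destruct (MVT_abs (GE n f y') (GE n ft y') t t') as [c [Hc E]].
{ intros x Hx. apply GE_dt; auto. revert Hx; unfold Rmin; destruct Rle_dec; lra. }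
assert (Hc' : t / 2 <= c <= 2 * t) by (revert Hc; unfold Rmin, Rmax; destruct Rle_dec; lra).
assert (Bc : Rabs (GE n ft y' c) <= K) by (apply GE_bound; auto; try lra; intros; apply BB; lra).
assert (Q2 : Rabs (GE n f y' t' - GE n f y' t) <= eps / 2).
{ rewrite E, Rabs_mult. replace (eps / 2) with (K * (eps / (2 * K))) by (field; lra). apply Rmult_le_compat; try apply Rabs_pos; lra. }
apply Rabs_lt_between in Q1. apply Rabs_le_between in Q2. apply Rabs_lt_between. lra.
Qed.

(** The values s = 1 and s = -1 give the two half-planes r > 0 and r < 0 in the coordinate y = 1/|r|
    - 1. *)
Lemma GE_Sm k s : s <> 0 -> forall n f, Cinf f -> Sm (fun r t => 0 < s * r /\ 0 < t) k (fun r t => GE n f (/ (s * r) - 1) t).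
Proof.
intros Hs. set (U := fun r t => 0 < s * r /\ 0 < t).
assert (NZ : forall r t, U r t -> s * r <> 0) by (intros r t [H _]; lra).
assert (C : forall n f, Cinf f -> forall r t, U r t -> continuous (fun p : R * R => GE n f (/ (s * fst p) - 1) (snd p)) (r, t)).
{ intros n f Hf r t [Hr Ht]. 
  apply (continuous_comp_2 (fun p : R * R => / (s * fst p) - 1) (fun p => snd p) (fun y t => GE n f y t)); [|ct|apply GE_cont; auto].
  apply cR_minus; [|ct]. apply cR_inv; [ct|]. simpl. lra. }
induction k as [|k IH]; intros n f Hf; (split; [apply C; auto|]); auto.
destruct (Cinf_dlx f Hf) as [df [Hdf D]]. destruct (Cinf_dt f Hf) as [ft [Dt Hft]].
exists (fun r t => GE (S n) df (/ (s * r) - 1) t * ((- s) * ((/ (s * r)) ^ 2))), (fun r t => GE n ft (/ (s * r) - 1) t).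
split; [|split; [|split; [|apply IH; auto]]].
- intros r t [Hr Ht]. apply (is_derive_comp_R (fun y => GE n f y t) (fun r => / (s * r) - 1)); [apply GE_dy; auto|].
  auto_derive; [lra|]. field. split; auto. intros ->. lra.
- intros r t [Hr Ht]. apply GE_dt; auto.
- apply Sm_mult; [apply IH; auto|]. apply Sm_mult; [apply Sm_const|]. apply Sm_pow. apply Sm_inv; auto.
  apply Sm_mult; [apply Sm_const|apply Sm_x].
Qed.

Lemma Cls_Sm k : forall f, Cls k k f -> Sm (fun r t => -1 < r < 1 /\ 0 < t) k f.
Proof.
induction k as [|k IH]; intros f H; pose proof H as H0; rewrite Cls_eq in H; destruct H as [C [Ht Hr]];
  (split; [intros r t [A B]; apply ccont_pt; auto|]); auto.
destruct Ht as [ft [Dt Hft]]. destruct Hr as [fr [Dr Hfr]]. exists fr, ft. split; [|split; [|split]].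
- intros r t [A B]. apply Dr; auto.
- intros r t [A B]. apply Dt; auto. lra.
- apply IH. apply (Cls_mono k (S k)); auto.
- apply IH. apply (Cls_mono (S k) k); auto.
Qed.

(* The representative [r f(|r|)] of phi = r u, continued past |r| = 1. *)
Lemma odd_extension f : Cinf f -> (forall r t, f (- r) t = f r t) -> exists g, smooth2_on (fun _ t => 0 < t) g /\
  forall r t, 0 <= r <= 1 -> 0 < t -> g r t = r * f r t.
Proof.
intros Hf Ev. set (g := fun r t => r * GE 0 f (/ Rabs r - 1) t).
assert (G1 : forall r t, -1 <= r <= 1 -> g r t = r * f r t).
{ intros r t Hr. unfold g. destruct (Req_dec r 0) as [->|Hr0]; [ring|]. f_equal.
  assert (Pr : 0 < Rabs r) by (apply Rabs_pos_lt; auto). assert (Rabs r <= 1) by (apply Rabs_le_between; lra).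
  assert (1 <= / Rabs r) by (rewrite <- Rinv_1; apply Rinv_le_contravar; auto).
  unfold GE. destruct (Rle_dec 0 (/ Rabs r - 1)); [|lra].
  replace (/ (1 + (/ Rabs r - 1))) with (Rabs r) by (field; lra).
  unfold Rabs. destruct Rcase_abs; auto. }
exists g. split; [|intros; apply G1; lra].
assert (Op : forall s, open2 (fun r t => 0 < s * r /\ 0 < t)).
{ intros s r t [A B]. set (d := Rmin (s * r / (Rabs s + 1)) t).
  assert (Ps : 0 < Rabs s + 1) by (pose proof (Rabs_pos s); lra).
  assert (Hd : 0 < d /\ d <= s * r / (Rabs s + 1) /\ d <= t).
  { assert (0 < s * r / (Rabs s + 1)) by (apply Rdiv_lt_0_compat; auto). unfold d, Rmin; destruct Rle_dec; lra. }
  exists d. split; [tauto|]. intros r' t' H1 H2. split; [|apply Rabs_lt_between in H2; lra].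
  assert (Rabs (s * (r' - r)) < s * r).
  { rewrite Rabs_mult. apply Rle_lt_trans with (Rabs s * d); [apply Rmult_le_compat_l; [apply Rabs_pos|lra]|].
    apply Rlt_le_trans with ((Rabs s + 1) * d); [nra|].
    apply Rle_trans with ((Rabs s + 1) * (s * r / (Rabs s + 1))); [apply Rmult_le_compat_l; lra|right; field; lra]. }
  apply Rabs_lt_between in H. lra. }
assert (Op1 : open2 (fun r t => -1 < r < 1 /\ 0 < t)).
{ intros r t [A B]. set (d := Rmin (Rmin (r + 1) (1 - r)) t).
  assert (Hd : 0 < d /\ d <= r + 1 /\ d <= 1 - r /\ d <= t) by (unfold d, Rmin; repeat destruct Rle_dec; lra).
  exists d. split; [tauto|]. intros r' t' H1 H2. apply Rabs_lt_between in H1. apply Rabs_lt_between in H2. lra. }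
assert (Side : forall s, (s = 1 \/ s = -1) -> smooth2_on (fun r t => 0 < s * r /\ 0 < t) g).
{ intros s Hs. assert (Hs0 : s <> 0) by (destruct Hs; lra). apply Sm_smooth2_on; auto. intros k.
  apply Sm_ext with (fun r t => r * GE 0 f (/ (s * r) - 1) t); auto.
  - intros r t [A B]. unfold g. replace (Rabs r) with (s * r); auto. destruct Hs; subst s; unfold Rabs; destruct Rcase_abs; lra.
  - apply Sm_mult; [apply Sm_x|apply GE_Sm; auto]. }
assert (Mid : smooth2_on (fun r t => -1 < r < 1 /\ 0 < t) g).
{ apply Sm_smooth2_on; auto. intros k. apply Sm_ext with (fun r t => r * f r t); auto.
  - intros r t [A B]. symmetry. apply G1. lra.
  - apply Sm_mult; [apply Sm_x|apply Cls_Sm; auto]. }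
(* Three overlapping open sets: on r > 0 and r < 0 the extension formula is smooth; near the axis,
   where its coordinate 1/|r| - 1 degenerates, the original even function is used. *)
intros l r t Ht. destruct (Rtotal_order r 0) as [H|[->|H]].
- apply (Side (-1)); [auto|lra].
- apply Mid. lra.
- apply (Side 1); [auto|lra].
Qed.

(** * Existence *)

Definition half : R -> R -> Prop := fun _ t => 0 < t.

Lemma half_open : open2 half.
Proof. intros r t Ht. exists t. split; auto. intros r' t' _ H. apply Rabs_lt_between in H. unfold half in *. lra. Qed.

Lemma half_clamp f t1 : (forall r t, 0 < t -> continuous (fun p : R * R => f (fst p) (snd p)) (r, t)) -> 0 < t1 -> cont2 (fun r t => f r (Rmax t1 t)).
Proof.
intros C Ht1 p. apply (continuous_comp_2 (fun q : R * R => fst q) (fun q => Rmax t1 (snd q)) f); [ct|ct|].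
apply C. apply Rlt_le_trans with t1; auto. apply Rmax_l.
Qed.

Lemma TT_ex_half n f r t : (forall r t, 0 < t -> continuous (fun p : R * R => f (fst p) (snd p)) (r, t)) -> 0 < t ->
  ex_RInt (fun s => s ^ n * f (r * s) t) 0 1.
Proof.
intros C Ht. pose proof (half_clamp f t C Ht) as C2. assert (Et : Rmax t t = t) by (apply Rmax_left; lra).
apply cont1_RInt. intros s. apply cR_mult; [ct|]. rewrite <- Et.
apply (cont2_at (fun r0 t0 => f r0 (Rmax t t0)) (fun s => r * s) (fun _ => t) s C2); ct.
Qed.

Lemma TT_cont_half n f : (forall r t, 0 < t -> continuous (fun p : R * R => f (fst p) (snd p)) (r, t)) ->
  forall r t, 0 < t -> continuous (fun p : R * R => TT n f (fst p) (snd p)) (r, t).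
Proof.
intros C r t Ht. assert (Ht2 : 0 < t / 2) by lra. pose proof (half_clamp f (t / 2) C Ht2) as C2.
assert (C3 : cont3 (fun r t' s => s ^ n * f (r * s) (Rmax (t / 2) t'))).
{ intros p. apply cR_mult; [ct|].
  apply (cont2_at (fun r0 t0 => f r0 (Rmax (t / 2) t0)) (fun q : R * R * R => fst (fst q) * snd q) (fun q => snd (fst q)) p C2); ct. }
apply (continuous_ext_loc _ (fun p : R * R => RInt (fun s => s ^ n * f (fst p * s) (Rmax (t / 2) (snd p))) 0 1)); [|apply (RInt_cont2 _ C3)].
exists (mkposreal (t / 2) Ht2). intros [a b] [_ B]. change (Rabs (b - t) < t / 2) in B. apply Rabs_lt_between in B.
unfold TT, fst, snd. rewrite Rmax_right by lra. auto.
Qed.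

(** Averaging on the whole half-plane t > 0; it makes the antiderivative defining the pressure Q
    smooth. *)
Lemma Sm_TT k : forall n f, Sm half k f -> Sm half k (TT n f).
Proof.
induction k as [|k IH]; intros n f Hf;
  assert (C0 : forall r t, 0 < t -> continuous (fun p : R * R => f (fst p) (snd p)) (r, t)) by (intros r t Ht; apply (Sm_cont half _ _ _ _ Hf); auto);
  (split; [intros r t Ht; apply TT_cont_half; auto|]); auto.
destruct Hf as [_ [fx [fy [Dx [Dy [Hx Hy]]]]]].
assert (Cx : forall r t, 0 < t -> continuous (fun p : R * R => fx (fst p) (snd p)) (r, t)) by (intros r t Ht; apply (Sm_cont half _ _ _ _ Hx); auto).
assert (Cy : forall r t, 0 < t -> continuous (fun p : R * R => fy (fst p) (snd p)) (r, t)) by (intros r t Ht; apply (Sm_cont half _ _ _ _ Hy); auto).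
exists (TT (S n) fx), (TT n fy). split; [|split; [|split; apply IH; auto]]; intros r t Ht; unfold half in *.
- apply (is_derive_RInt_unit (fun r s => s ^ n * f (r * s) t) (fun r s => s ^ S n * fx (r * s) t) r 1); try lra.
  + intros y s _ _. replace (s ^ S n * fx (y * s) t) with (s ^ n * (fx (y * s) t * s)) by (simpl; ring).
      apply (is_derive_scal (fun y => f (y * s) t)). apply (is_derive_comp_R (fun q => f q t) (fun y => y * s)); [apply Dx; auto|].
      auto_derive; auto; ring.
  + intros s _. apply continuity_2d_pt_filterlim.
      change (continuous (fun p : R * R => cl (snd p) ^ S n * fx (fst p * cl (snd p)) t) (r, s)).
      apply cR_mult; [ct|].
      apply (continuous_comp_2 (fun p : R * R => fst p * cl (snd p)) (fun _ => t) fx); [ct|ct|apply Cx; auto].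
  + intros y _. apply TT_ex_half; auto.
- apply (is_derive_RInt_unit (fun t s => s ^ n * f (r * s) t) (fun t s => s ^ n * fy (r * s) t) t t); auto.
  + intros y s Hy1 _. apply Rabs_lt_between in Hy1. apply is_derive_scal. apply Dy; lra.
  + intros s _. apply continuity_2d_pt_filterlim.
      change (continuous (fun p : R * R => cl (snd p) ^ n * fy (r * cl (snd p)) (fst p)) (t, s)).
      apply cR_mult; [ct|].
      apply (continuous_comp_2 (fun p : R * R => r * cl (snd p)) (fun p => fst p) fy); [ct|ct|apply Cy; auto].
  + intros y Hy1. apply Rabs_lt_between in Hy1. apply TT_ex_half; auto; lra.
Qed.

Lemma TT_antiderivative f : (forall k, Sm half k f) -> forall r t, 0 < t -> is_derive (fun r => r * TT 0 f r t) r (f r t).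
Proof.
intros Hf r t Ht.
assert (C1 : cont1 (fun s => f s t)).
{ intros s. apply (continuous_comp_2 (fun s => s) (fun _ => t) f); [ct|ct|]. apply (Sm_cont half _ _ _ _ (Hf O)); auto. }
apply is_derive_ext with (fun r => RInt (fun s => f s t) 0 r); [|apply (RInt_derive (fun s => f s t)); auto].
intros q. rewrite (RInt_scale _ q C1). unfold TT. Rsimp. f_equal. apply RInt_ext. intros. simpl. Rsimp. ring.
Qed.

(** Hadamard's lemma: u0(r) is the average of g' over [0,r]. *)
Lemma smooth_quotient phi0 : smooth_01 phi0 -> phi0 0 = 0 -> exists u0, cont1 u0 /\ forall r, 0 <= r <= 1 -> phi0 r = r * u0 r.
Proof.
intros [g [Dg E]] P0.
assert (C : cont1 (Derive g)).
{ intros x. apply (ex_derive_continuous (V:=R_NormedModule)). apply (Dg 2%nat x). }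
assert (D : forall x, is_derive g x (Derive g x)) by (intros x; apply Derive_correct, (Dg 1%nat x)).
assert (g0 : g 0 = 0) by (rewrite <- E by lra; auto).
exists (fun r => RInt (fun s => Derive g (r * s)) 0 1). split.
- apply (cont2_sec_r (fun r t => RInt (fun s => Derive g (r * s)) 0 1) 0).
  apply (RInt_cont2 (fun r t s => Derive g (r * s))). intros p. apply (cont1_at (Derive g)); auto. ct.
- intros r Hr. rewrite E by auto. rewrite <- (RInt_scale (Derive g) r C).
  assert (I : is_RInt (Derive g) 0 r (g r - g 0)) by (apply (is_RInt_derive g); auto).
  rewrite (is_RInt_unique _ _ _ _ I). rewrite g0. Rsimp. ring.
Qed.

Lemma smooth_pos_of_Sm f : (forall k, Sm half k f) -> smooth_pos f.
Proof. intros H. exists f. split; [apply (Sm_smooth2_on half half_open); auto|auto]. Qed.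

Lemma cont_closed_of_cont2 f : cont2 f -> cont_closed f.
Proof.
intros C x t Hx Ht P HP. pose proof (C (x, t) P HP) as L. unfold filtermap in *.
revert L. unfold within. apply filter_imp. auto.
Qed.

Lemma dx_eq f x t l : is_derive (fun a => f a t) x l -> dx f x t = l.
Proof. apply is_derive_unique. Qed.

Lemma dy_eq f x t l : is_derive (f x) t l -> dy f x t = l.
Proof. apply is_derive_unique. Qed.

Lemma existence mu phi0 : smooth_01 phi0 -> phi0 0 = 0 -> (forall r, 0 <= r <= 1 -> Rabs (phi0 r) <= PI) ->
  exists v w phi Q Rp, is_solution mu phi0 v w phi Q Rp.
Proof.
intros Hs H0 Hb. destruct (smooth_quotient phi0 Hs H0) as [u0 [C0 E0]].
destruct (bounded_solution u0 C0) as [u [ut [ur [urr [Cu [I0 [I1 [Dt [Dx Reg]]]]]]]]].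
{ intros r Hr. rewrite <- E0; auto. }
assert (Hf : Cinf (even_ext u)) by (intros m k; apply (even_ext_Cls u ut ur urr Dt Dx Reg)).
destruct (odd_extension (even_ext u) Hf) as [g [Sg Eg]].
{ intros r t. unfold even_ext. rewrite Rabs_Ropp. auto. }
set (phi := fun r t => r * u r t).
assert (Egp : forall r t, 0 <= r <= 1 -> 0 < t -> phi r t = g r t).
{ intros r t Hr Ht. rewrite Eg by auto. unfold phi, even_ext. rewrite Rabs_pos_eq by lra. auto. }
assert (Px : forall r t, 0 < r < 1 -> 0 < t -> is_derive (fun a => phi a t) r (u r t + r * ur r t)).
{ intros r t Hr Ht. destruct (Dx r t Hr Ht) as [D1 _]. unfold phi. auto_derive; [repeat split; eexists; eauto|]. der D1. ring. }
assert (Pxx : forall r t, 0 < r < 1 -> 0 < t -> is_derive (fun a => dx phi a t) r (2 * ur r t + r * urr r t)).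
{ intros r t Hr Ht. destruct (Dx r t Hr Ht) as [D1 [D2 _]]. apply is_derive_ext_loc with (fun a => u a t + a * ur a t).
  - apply near_interior; auto. intros q Hq. symmetry. apply dx_eq, Px; auto.
  - auto_derive; [repeat split; eexists; eauto|]. der D1. der D2. ring. }
assert (Pt : forall r t, 0 < r < 1 -> 0 < t -> is_derive (phi r) t (r * ut r t)).
{ intros r t Hr Ht. apply is_derive_scal, Dt; auto; lra. }
assert (Pde : forall r t, 0 < r < 1 -> 0 < t -> dy phi r t + r * dx phi r t = dx (dx phi) r t + dx phi r t / r - sin (2 * phi r t) / (2 * r ^ 2)).
{ intros r t Hr Ht. rewrite (dx_eq _ _ _ _ (Px r t Hr Ht)), (dy_eq _ _ _ _ (Pt r t Hr Ht)), (dx_eq (dx phi) _ _ _ (Pxx r t Hr Ht)).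
  destruct (Dx r t Hr Ht) as [_ [_ E]]. rewrite E, Gn_sin by lra. unfold phi. field. lra. }
assert (Sgk : forall k, Sm half k g) by (apply smooth2_on_Sm; exact Sg).
assert (Sgx : forall k, Sm half k (dx g)) by (intros k; apply Sm_dx; auto using half_open).
assert (Sgt : forall k, Sm half k (dy g)) by (intros k; apply Sm_dy; auto using half_open).
assert (Gx : forall r t, 0 < r < 1 -> 0 < t -> dx g r t = dx phi r t).
{ intros r t Hr Ht. unfold dx. apply Derive_ext_loc. apply near_interior; auto. intros q Hq. symmetry. apply Egp; auto; lra. }
assert (Gt : forall r t, 0 < r < 1 -> 0 < t -> dy g r t = dy phi r t).
{ intros r t Hr Ht. unfold dy. apply Derive_ext_loc. apply near_pos; auto. intros q Hq. symmetry. apply Egp; auto; lra. }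
(* By the equation for phi the right side of the first equation is -(phi_t + r phi_r) phi_r, free of
   1/r and 1/r^2. Written with the smooth extension g it is smooth on the half-plane; v = r then
   leaves Q_r = -r - q. *)
set (q := fun r t => (dy g r t + r * dx g r t) * dx g r t).
assert (Sq : forall k, Sm half k q).
{ intros k. unfold q. apply Sm_mult; auto. apply Sm_plus; auto. apply Sm_mult; auto. apply Sm_x. }
set (Q := fun r t => - / 2 * r ^ 2 + -1 * (r * TT 0 q r t)).
exists (fun r _ : R => r), (fun z _ : R => -2 * z), phi, Q, (fun z _ : R => -2 * z ^ 2).
assert (Qx : forall r t, 0 < t -> dx Q r t = - r - q r t).
{ intros r t Ht. apply dx_eq. pose proof (TT_antiderivative q Sq r t Ht) as D. unfold Q.
  replace (- r - q r t) with (- r + -1 * q r t) by ring.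
  apply (is_derive_plus (V:=R_NormedModule) (fun r => - / 2 * r ^ 2) (fun r => -1 * (r * TT 0 q r t))).
  - auto_derive; auto. field.
  - apply (is_derive_scal (fun r => r * TT 0 q r t)); auto. }
unfold is_solution.
refine (conj _ (conj _ (conj _ (conj _ (conj _ (conj _ (conj _ (conj _ (conj _ (conj _ (conj _ (conj _ (conj _ (conj _ _)))))))))))))).
- apply smooth_pos_of_Sm. apply Sm_x.
- apply smooth_pos_of_Sm. intros k. apply Sm_mult; [apply Sm_const|apply Sm_x].
- exists g. split; auto.
- apply smooth_pos_of_Sm. intros k. unfold Q. apply Sm_plus.
  + apply Sm_mult; [apply Sm_const|apply Sm_pow, Sm_x].
  + apply Sm_mult; [apply Sm_const|]. apply Sm_mult; [apply Sm_x|apply Sm_TT; auto].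
- apply smooth_pos_of_Sm. intros k. apply Sm_mult; [apply Sm_const|apply Sm_pow, Sm_x].
- apply cont_closed_of_cont2. intros p. apply c_fst.
- apply cont_closed_of_cont2. intros p. apply cR_mult; [ct|apply c_fst].
- apply cont_closed_of_cont2. intros p. unfold phi. apply cR_mult; [apply c_fst|apply Cu].
- intros r t Hr Ht. rewrite <- Pde, Qx by auto. unfold q. rewrite Gx, Gt by auto.
  rewrite (dy_eq (fun r _ : R => r) r t 0), (dx_eq (dx (fun r _ : R => r)) r t 0), (dx_eq (fun r _ : R => r) r t 1).
  + field. lra.
  + apply (is_derive_id (K:=R_AbsRing)).
  + apply is_derive_ext with (fun _ => 1); [|apply (is_derive_const (V:=R_NormedModule))].
    intros a. symmetry. apply dx_eq. apply (is_derive_id (K:=R_AbsRing)).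
  + apply (is_derive_const (V:=R_NormedModule)).
- assert (Dw : forall z t, dx (fun z _ : R => -2 * z) z t = -2) by (intros; apply dx_eq; auto_derive; auto; ring).
  intros z t Hz Ht. rewrite (dy_eq _ z t 0), (dx_eq (dx _) z t 0), Dw, (dx_eq (fun z _ : R => -2 * z ^ 2) z t (-4 * z)).
  + ring.
  + auto_derive; auto. ring.
  + apply is_derive_ext with (fun _ => -2); [|apply (is_derive_const (V:=R_NormedModule))]. intros a. symmetry. apply Dw.
  + apply (is_derive_const (V:=R_NormedModule)).
- intros r z t Hr Hz Ht. rewrite (dx_eq (fun r' _ : R => r' * r') r t (2 * r)), (dx_eq (fun z _ : R => -2 * z) z t (-2)).
  + field. lra.
  + auto_derive; auto. ring.
  + auto_derive; auto. ring.
- intros r t Hr Ht. apply Pde; auto.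
- intros r Hr. split; auto. unfold phi. rewrite I0, E0; auto.
- intros z Hz. ring.
- intros t Ht. split; [auto|]. split; [auto|]. split; [ring|]. split; [ring|]. unfold phi. split; [ring|].
  rewrite I1 by auto. rewrite (E0 1) by lra. auto.
Qed.

(** * Uniqueness *)

Lemma smooth_pos_interior f x t : smooth_pos f -> 0 < x < 1 -> 0 < t ->
  is_derive (fun a => f a t) x (dx f x t) /\ is_derive (fun a => dx f a t) x (dx (dx f) x t) /\ is_derive (f x) t (dy f x t).
Proof.
intros [g [Sg E]] Hx Ht.
assert (E1 : forall a s, 0 < a < 1 -> 0 < s -> locally a (fun q => g q s = f q s)).
{ intros a s Ha Hs. apply near_interior; auto. intros q Hq. symmetry. apply E; auto; lra. }
assert (E2 : forall a s, 0 < a < 1 -> 0 < s -> dx g a s = dx f a s) by (intros a s Ha Hs; apply Derive_ext_loc, E1; auto).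
split; [|split]; apply Derive_correct.
- apply ex_derive_ext_loc with (fun a => g a t); auto. apply (Sg nil x t Ht).
- apply ex_derive_ext_loc with (fun a => dx g a t); [|apply (Sg (true :: nil) x t Ht)].
  apply near_interior; auto.
- apply ex_derive_ext_loc with (g x); [|apply (Sg nil x t Ht)].
  apply near_pos; auto. intros s Hs. symmetry. apply E; auto; lra.
Qed.

(* Continuity up to x = 0, 1 turns the interior identity [f_x = h'] into one on the closed interval. *)
Lemma smooth_pos_antiderivative f (h h' : R -> R) t : smooth_pos f -> 0 < t -> (forall x, is_derive h x (h' x)) ->
  (forall x, 0 < x < 1 -> dx f x t = h' x) -> forall x x', 0 <= x <= 1 -> 0 <= x' <= 1 -> f x t - h x = f x' t - h x'.
Proof.
intros Sf Ht Dh Df. pose proof Sf as [g [Sg E]].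
assert (Dg : forall x, is_derive (fun a => g a t) x (dx g x t)) by (intros x; apply Derive_correct, (Sg nil x t Ht)).
assert (Eg : forall x, 0 < x < 1 -> dx g x t = h' x).
{ intros x Hx. rewrite <- Df by auto. apply Derive_ext_loc. apply near_interior; auto. intros q Hq. symmetry. apply E; auto; lra. }
intros x x' Hx Hx'. rewrite !E by auto.
assert (Dd : forall z, is_derive (fun a => g a t - h a) z (dx g z t - h' z)) by (intros z; apply (is_derive_minus (V:=R_NormedModule) (fun a => g a t) h); auto).
destruct (MVT_gen (fun a => g a t - h a) x x' (fun _ => 0)) as [c [_ Ec]].
- intros z Hz. assert (Ez : dx g z t - h' z = 0); [rewrite Eg; [ring|]|rewrite <- Ez; apply Dd].
  revert Hz. unfold Rmin, Rmax. destruct Rle_dec; lra.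
- intros z _. apply continuity_pt_filterlim. apply (ex_derive_continuous (V:=R_NormedModule) (fun a => g a t - h a)). exists (dx g z t - h' z). apply Dd.
- lra.
Qed.

Lemma cont_closed_clamp f : cont_closed f -> cont2 (fun x t => f (cl x) (tp t)).
Proof.
intros C [x t] P HP. pose proof (C (cl x) (tp t) (cl_in x) (tp_pos t) P HP) as L. unfold filtermap, within in L.
assert (M : filterlim (fun p : R * R => (cl (fst p), tp (snd p))) (locally (x, t)) (locally (cl x, tp t))).
{ apply (continuous_comp_2 (fun p : R * R => cl (fst p)) (fun p => tp (snd p)) (fun a b => (a, b)) (x, t)).
  - apply (c_cl (fun p : R * R => fst p)), c_fst.
  - apply (c_tp (fun p : R * R => snd p)), c_snd.
  - apply (continuous_ext (fun p : R * R => p)); [intros [a b]; reflexivity|apply continuous_id]. }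
specialize (M _ L). revert M. unfold filtermap. apply filter_imp. intros [a b] H. apply H. split; [apply cl_in|apply tp_pos].
Qed.

(** The equation for phi after v = r has been inserted. *)
Definition phi_flow (a : R -> R -> R) := exists ax axx at_ : R -> R -> R, forall r t, 0 < r < 1 -> 0 < t ->
  is_derive (fun q => a q t) r (ax r t) /\ is_derive (fun q => ax q t) r (axx r t) /\ is_derive (a r) t (at_ r t) /\
  at_ r t + r * ax r t = axx r t + ax r t / r - sin (2 * a r t) / (2 * r ^ 2).

Lemma sin_lip a b : b <= a -> sin b - sin a <= a - b.
Proof.
intros H. destruct (MVT_abs sin cos a b) as [c [_ E]]; [intros; apply is_derive_Reals, derivable_pt_lim_sin|].
rewrite E. pose proof (COS_bound c). nra.
Qed.

(* Near the axis both values are below pi/4, where the singular term is monotone; away from it that term is Lipschitz. *)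
Lemma phi_flow_le a b : cont2 a -> cont2 b -> phi_flow a -> phi_flow b ->
  (forall r, 0 <= r <= 1 -> a r 0 = b r 0) -> (forall t, 0 <= t -> a 0 t = 0 /\ b 0 t = 0 /\ a 1 t = b 1 t) ->
  forall r t, 0 <= r <= 1 -> 0 <= t -> a r t <= b r t.
Proof.
intros Ca Cb [ax [axx [at_ Fa]]] [bx [bxx [bt Fb]]] I B r0 T Hr0 HT.
pose proof PI_RGT_0 as Pp.
(* Both functions vanish on the axis, so within rho of it they stay below PI/4 in absolute value,
   and their doubles lie where the sine increases. *)
destruct (cont2_unif a 0 1 0 T (PI / 4) Ca ltac:(lra)) as [d1 [Hd1 U1]].
destruct (cont2_unif b 0 1 0 T (PI / 4) Cb ltac:(lra)) as [d2 [Hd2 U2]].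
set (rho := Rmin d1 d2). assert (Hrho : 0 < rho /\ rho <= d1 /\ rho <= d2) by (unfold rho, Rmin; destruct Rle_dec; lra).
(* For r >= rho the term sin(2 phi)/(2 r^2) is Lipschitz in phi with constant 1/rho^2; the extra 1
   makes the inequality at the maximum strict. *)
set (K := 1 + / rho ^ 2). assert (Pr : 0 < / rho ^ 2) by (apply Rinv_0_lt_compat, pow_lt; lra).
set (Z := fun r t => exp (- K * t) * (a r t - b r t)).
assert (CZ : cont2 Z).
{ intros p. unfold Z. apply cR_mult; [apply cR_exp, cR_mult; [ct|apply c_snd]|]. apply cR_minus; [apply Ca|apply Cb]. }
destruct (cont2_max Z 0 1 0 T ltac:(lra) HT CZ) as [x [y [Hx [Hy M]]]].
assert (Ee : forall s, 0 < exp (- K * s)) by (intros; apply exp_pos).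
destruct (Rle_lt_dec (a x y - b x y) 0) as [Hle|Hgt].
{ specialize (M r0 T Hr0 ltac:(lra)). unfold Z in M. pose proof (Ee y). pose proof (Ee T). nra. }
exfalso.
assert (Hx0 : x <> 0) by (intros ->; destruct (B y ltac:(lra)) as [B1 [B2 _]]; lra).
assert (Hx1 : x <> 1) by (intros ->; destruct (B y ltac:(lra)) as [_ [_ B3]]; lra).
assert (Hy0 : y <> 0) by (intros ->; rewrite (I x) in Hgt by auto; lra).
assert (Hxi : 0 < x < 1) by lra. assert (Hyi : 0 < y) by lra.
destruct (Fa x y Hxi Hyi) as [_ [A2 [A3 Ea]]]. destruct (Fb x y Hxi Hyi) as [_ [B2 [B3 Eb]]].
set (d := Rmin x (1 - x)). assert (Hd : 0 < d /\ d <= x /\ d <= 1 - x) by (unfold d, Rmin; destruct Rle_dec; lra).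
pose proof (Ee y) as Ey.
destruct (is_derive_max_int (fun q => Z q y) (fun q => exp (- K * y) * (ax q y - bx q y)) x (exp (- K * y) * (axx x y - bxx x y)) d) as [M1 M2]; [tauto| | | |].
- intros q Hq. apply Rabs_lt_between in Hq. assert (Hq1 : 0 < q < 1) by lra.
  apply (is_derive_scal (fun q => a q y - b q y)). apply (is_derive_minus (V:=R_NormedModule) (fun q => a q y) (fun q => b q y)).
  + apply (Fa q y Hq1 Hyi).
  + apply (Fb q y Hq1 Hyi).
- apply (is_derive_scal (fun q => ax q y - bx q y)). apply (is_derive_minus (V:=R_NormedModule) (fun q => ax q y) (fun q => bx q y)); auto.
- intros q Hq. apply Rabs_lt_between in Hq. apply M; lra.
- assert (M3 : 0 <= exp (- K * y) * (at_ x y - bt x y) - K * exp (- K * y) * (a x y - b x y)).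
  { apply (is_derive_max_left (Z x) y _ y Hyi).
    - unfold Z. auto_derive; [repeat split; eexists; eauto|]. der A3. der B3. ring.
    - intros s Hs. apply M; lra. }
  assert (X1 : ax x y = bx x y) by (apply Rmult_integral in M1; lra).
  assert (X2 : axx x y <= bxx x y) by (apply Rnot_lt_le; intros X; assert (0 < exp (- K * y) * (axx x y - bxx x y)) by (apply Rmult_lt_0_compat; lra); lra).
  assert (X3 : K * (a x y - b x y) <= at_ x y - bt x y).
  { apply Rnot_lt_le. intros X. assert (0 < exp (- K * y) * (K * (a x y - b x y) - (at_ x y - bt x y))) by (apply Rmult_lt_0_compat; lra). lra. }
  assert (Px : 0 < / (2 * x ^ 2)) by (apply Rinv_0_lt_compat; pose proof (pow_lt x 2 ltac:(lra)); lra).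
  assert (X4 : at_ x y - bt x y <= (sin (2 * b x y) - sin (2 * a x y)) * / (2 * x ^ 2)) by (rewrite X1 in Ea; unfold Rdiv in *; lra).
  assert (KD : 0 < K * (a x y - b x y)) by (apply Rmult_lt_0_compat; unfold K; lra).
  destruct (Rlt_le_dec x rho) as [Hlt|Hge].
  + assert (Ux : Rabs (x - 0) < d1 /\ Rabs (x - 0) < d2) by (rewrite Rminus_0_r, Rabs_pos_eq; lra).
    specialize (U1 0 y x y ltac:(lra) Hy Hx Hy ltac:(tauto) ltac:(rewrite Rminus_diag, Rabs_R0; auto)).
    specialize (U2 0 y x y ltac:(lra) Hy Hx Hy ltac:(tauto) ltac:(rewrite Rminus_diag, Rabs_R0; auto)).
    destruct (B y ltac:(lra)) as [B1 [B2' _]]. rewrite B1, Rminus_0_r in U1. rewrite B2', Rminus_0_r in U2.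
    apply Rabs_lt_between in U1. apply Rabs_lt_between in U2.
    assert (Si : sin (2 * b x y) < sin (2 * a x y)) by (apply sin_increasing_1; lra).
    assert ((sin (2 * b x y) - sin (2 * a x y)) * / (2 * x ^ 2) < 0) by nra. lra.
  + pose proof (sin_lip (2 * a x y) (2 * b x y) ltac:(lra)) as L.
    assert (Xr : / x ^ 2 <= / rho ^ 2) by (apply Rinv_le_contravar; [apply pow_lt; lra|apply pow_incr; lra]).
    assert (X5 : (sin (2 * b x y) - sin (2 * a x y)) * / (2 * x ^ 2) <= (2 * a x y - 2 * b x y) * / (2 * x ^ 2)) by (apply Rmult_le_compat_r; lra).
    replace ((2 * a x y - 2 * b x y) * / (2 * x ^ 2)) with (/ x ^ 2 * (a x y - b x y)) in X5 by (field; lra).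
    assert (X6 : / x ^ 2 * (a x y - b x y) <= / rho ^ 2 * (a x y - b x y)) by (apply Rmult_le_compat_r; lra).
    unfold K in X3. lra.
Qed.

Section Solution.
Variables (mu : R) (phi0 : R -> R) (v w phi Q Rp : R -> R -> R).
Hypothesis H : is_solution mu phi0 v w phi Q Rp.

(** Fixing r = 1/2 makes w_z independent of z, and the two boundary values of w give -2. Then r v -
    r^2 is constant in r and vanishes at r = 0. *)
Lemma solution_stretch t : 0 < t -> (forall z, 0 <= z <= 1 -> w z t = -2 * z) /\ (forall r, 0 <= r <= 1 -> v r t = r).
Proof.
destruct H as [Sv [Sw [_ [_ [_ [_ [_ [_ [_ [_ [Div [_ [_ [_ BC]]]]]]]]]]]]]]. intros Ht.
destruct (BC t ltac:(lra)) as [V0 [_ [W0 [W1 _]]]].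
set (c := dx w (/ 2) t).
assert (Wc : forall z, 0 < z < 1 -> dx w z t = c).
{ intros z Hz. pose proof (Div (/ 2) z t ltac:(lra) Hz Ht) as E1. pose proof (Div (/ 2) (/ 2) t ltac:(lra) ltac:(lra) Ht) as E2. unfold c. lra. }
assert (Wz : forall z z', 0 <= z <= 1 -> 0 <= z' <= 1 -> w z t - c * z = w z' t - c * z').
{ apply (smooth_pos_antiderivative w (fun z => c * z) (fun _ => c)); auto. intros; auto_derive; auto; ring. }
assert (Ec : c = -2) by (pose proof (Wz 0 1 ltac:(lra) ltac:(lra)); lra).
split.
- intros z Hz. pose proof (Wz 0 z ltac:(lra) Hz). rewrite Ec in *. lra.
- assert (Srv : smooth_pos (fun r t => r * v r t)).
  { destruct Sv as [g [Sg E]]. exists (fun r t => r * g r t). split; [|intros; rewrite E; auto].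
    apply (Sm_smooth2_on half half_open). intros k. apply Sm_mult; [apply Sm_x|apply smooth2_on_Sm; exact Sg]. }
  assert (Rv : forall r, 0 <= r <= 1 -> 0 * v 0 t - 0 ^ 2 = r * v r t - r ^ 2).
  { intros r Hr. apply (smooth_pos_antiderivative (fun r t => r * v r t) (fun r => r ^ 2) (fun r => 2 * r)); auto; [|intros x Hx|lra].
    - intros; auto_derive; auto; ring.
    - pose proof (Div x (/ 2) t Hx ltac:(lra) Ht) as E. rewrite Wc, Ec in E by lra.
      apply (Rmult_eq_reg_l (/ x)); [|apply Rgt_not_eq, Rinv_0_lt_compat; lra]. replace (/ x * (2 * x)) with 2 by (field; lra). lra. }
  intros r Hr. destruct (Req_dec r 0) as [->|Hr0]; auto. specialize (Rv r Hr).
  apply (Rmult_eq_reg_l r); auto. simpl in Rv. lra.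
Qed.

Lemma solution_phi_flow : phi_flow (fun r t => phi (cl r) (tp t)).
Proof.
destruct H as [_ [_ [Sp [_ [_ [_ [_ [_ [_ [_ [_ [Pe _]]]]]]]]]]]].
exists (dx phi), (dx (dx phi)), (dy phi). intros r t Hr Ht.
destruct (smooth_pos_interior phi r t Sp Hr Ht) as [D1 [D2 D3]].
assert (Et : tp t = t) by (apply tp_id; lra). assert (Er : cl r = r) by (apply cl_id; lra). rewrite Et, Er.
split; [|split; [|split]]; auto.
- apply is_derive_ext_loc with (fun q => phi q t); auto. apply near_interior; auto. intros q Hq. rewrite cl_id; auto; lra.
- apply is_derive_ext_loc with (phi r); auto. apply near_pos; auto. intros q Hq. rewrite tp_id; auto; lra.
- pose proof (Pe r t Hr Ht) as E. rewrite (proj2 (solution_stretch t Ht) r) in E by lra. auto.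
Qed.
End Solution.

Lemma solution_phi_le mu phi0 v1 w1 phi1 Q1 R1 v2 w2 phi2 Q2 R2 :
  is_solution mu phi0 v1 w1 phi1 Q1 R1 -> is_solution mu phi0 v2 w2 phi2 Q2 R2 ->
  forall r t, 0 <= r <= 1 -> 0 <= t -> phi1 r t <= phi2 r t.
Proof.
intros H1 H2 r t Hr Ht. pose proof (solution_phi_flow _ _ _ _ _ _ _ H1) as F1. pose proof (solution_phi_flow _ _ _ _ _ _ _ H2) as F2.
destruct H1 as [_ [_ [_ [_ [_ [_ [_ [C1 [_ [_ [_ [_ [I1 [_ B1]]]]]]]]]]]]]].
destruct H2 as [_ [_ [_ [_ [_ [_ [_ [C2 [_ [_ [_ [_ [I2 [_ B2]]]]]]]]]]]]]].
rewrite <- (cl_id r Hr), <- (tp_id t Ht).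
apply (phi_flow_le (fun r t => phi1 (cl r) (tp t)) (fun r t => phi2 (cl r) (tp t))); auto using cont_closed_clamp.
- intros q Hq. rewrite cl_id, tp_id by lra. destruct (I1 q Hq), (I2 q Hq). lra.
- intros s Hs. rewrite !cl_id, tp_id by lra. destruct (B1 s Hs) as [_ [_ [_ [_ [X1 X2]]]]], (B2 s Hs) as [_ [_ [_ [_ [Y1 Y2]]]]].
  repeat split; auto. lra.
Qed.

Lemma dx_ext_interior f g r t : (forall q, 0 < q < 1 -> f q t = g q t) -> 0 < r < 1 -> dx f r t = dx g r t.
Proof. intros E Hr. apply Derive_ext_loc, near_interior; auto. Qed.

Lemma dy_ext_pos f g r t : (forall s, 0 < s -> f r s = g r s) -> 0 < t -> dy f r t = dy g r t.
Proof. intros E Ht. apply Derive_ext_loc, near_pos; auto. Qed.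

Lemma smooth_pos_diff_const f g t : smooth_pos f -> smooth_pos g -> 0 < t -> (forall x, 0 < x < 1 -> dx f x t = dx g x t) ->
  forall x x', 0 <= x <= 1 -> 0 <= x' <= 1 -> f x t - g x t = f x' t - g x' t.
Proof.
intros Sf [G [SG EG]] Ht E x x' Hx Hx'. rewrite !EG by auto.
apply (smooth_pos_antiderivative f (fun x => G x t) (fun x => dx G x t)); auto.
- intros z. apply Derive_correct, (SG nil z t Ht).
- intros z Hz. rewrite E by auto. apply dx_ext_interior; auto. intros q Hq. apply EG; auto; lra.
Qed.

Theorem theorem2p5 (mu : R) (phi0 : R -> R)
  (Hmu : 0 < mu) (Hsmooth : smooth_01 phi0) (H0 : phi0 0 = 0)
  (Hbound : forall r, 0 <= r <= 1 -> Rabs (phi0 r) <= PI) :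
  (exists v w phi Q Rp : R -> R -> R, is_solution mu phi0 v w phi Q Rp) /\
  (forall v1 w1 phi1 Q1 R1 v2 w2 phi2 Q2 R2 : R -> R -> R,
     is_solution mu phi0 v1 w1 phi1 Q1 R1 ->
     is_solution mu phi0 v2 w2 phi2 Q2 R2 ->
     (forall r t, 0 <= r <= 1 -> 0 <= t ->
        v1 r t = v2 r t /\ phi1 r t = phi2 r t) /\
     (forall z t, 0 <= z <= 1 -> 0 <= t -> w1 z t = w2 z t) /\
     (forall r r' t, 0 <= r <= 1 -> 0 <= r' <= 1 -> 0 < t ->
        Q1 r t - Q2 r t = Q1 r' t - Q2 r' t) /\
     (forall z z' t, 0 <= z <= 1 -> 0 <= z' <= 1 -> 0 < t ->
        R1 z t - R2 z t = R1 z' t - R2 z' t)).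
Proof.
split; [apply existence; auto|]. intros v1 w1 phi1 Q1 R1 v2 w2 phi2 Q2 R2 S1 S2.
assert (Ev : forall r t, 0 <= r <= 1 -> 0 < t -> v1 r t = v2 r t).
{ intros r t Hr Ht. rewrite (proj2 (solution_stretch _ _ _ _ _ _ _ S1 t Ht) r Hr), (proj2 (solution_stretch _ _ _ _ _ _ _ S2 t Ht) r Hr). auto. }
assert (Ew : forall z t, 0 <= z <= 1 -> 0 < t -> w1 z t = w2 z t).
{ intros z t Hz Ht. rewrite (proj1 (solution_stretch _ _ _ _ _ _ _ S1 t Ht) z Hz), (proj1 (solution_stretch _ _ _ _ _ _ _ S2 t Ht) z Hz). auto. }
assert (Ep : forall r t, 0 <= r <= 1 -> 0 <= t -> phi1 r t = phi2 r t).
{ intros r t Hr Ht. apply Rle_antisym.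
  - apply (solution_phi_le _ _ _ _ _ _ _ _ _ _ _ _ S1 S2); auto.
  - apply (solution_phi_le _ _ _ _ _ _ _ _ _ _ _ _ S2 S1); auto. }
destruct S1 as [_ [_ [_ [SQ1 [SR1 [_ [_ [_ [Mv1 [Mw1 [_ [_ [I1 [J1 _]]]]]]]]]]]]]].
destruct S2 as [_ [_ [_ [SQ2 [SR2 [_ [_ [_ [Mv2 [Mw2 [_ [_ [I2 [J2 _]]]]]]]]]]]]]].
split; [|split; [|split]].
- intros r t Hr Ht. split; [|apply Ep; auto]. destruct (Req_dec t 0) as [->|Ht0]; [|apply Ev; auto; lra].
  destruct (I1 r Hr), (I2 r Hr). lra.
- intros z t Hz Ht. destruct (Req_dec t 0) as [->|Ht0]; [|apply Ew; auto; lra]. rewrite J1, J2; auto.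
(* With v and phi equal, subtracting the two equations leaves Q1_r = Q2_r; a pressure is determined
   only up to a function of t. *)
- intros r r' t Hr Hr' Ht. apply (smooth_pos_diff_const Q1 Q2); auto. intros x Hx.
  assert (X1 : forall q, 0 < q < 1 -> dx v1 q t = dx v2 q t) by (intros q Hq; apply dx_ext_interior; auto; intros; apply Ev; auto; lra).
  assert (X2 : forall q, 0 < q < 1 -> dx phi1 q t = dx phi2 q t) by (intros q Hq; apply dx_ext_interior; auto; intros; apply Ep; lra).
  pose proof (Mv1 x t Hx Ht) as E1. pose proof (Mv2 x t Hx Ht) as E2.
  rewrite (dx_ext_interior (dx v1) (dx v2)), X1, (dx_ext_interior (dx phi1) (dx phi2)), X2, (dy_ext_pos v1 v2), Ev, Ep in E1 by (auto; intros; try apply Ev; auto; lra).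
  lra.
- intros z z' t Hz Hz' Ht. apply (smooth_pos_diff_const R1 R2); auto. intros x Hx.
  assert (X1 : forall q, 0 < q < 1 -> dx w1 q t = dx w2 q t) by (intros q Hq; apply dx_ext_interior; auto; intros; apply Ew; auto; lra).
  pose proof (Mw1 x t Hx Ht) as E1. pose proof (Mw2 x t Hx Ht) as E2.
  rewrite (dx_ext_interior (dx w1) (dx w2)), X1, (dy_ext_pos w1 w2), Ew in E1 by (auto; intros; try apply Ew; auto; lra).
  lra.
Qed.
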